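(* Let $\alpha'\in\mathbb{R}\setminus\{0\}$ and $\kappa>0$. For $\phi_0\in\mathbb{R}$ consider the $SU(2)^2$-invariant local solution of the IIB system on the deformed conifold $T^\ast S^3$, smooth in a neighbourhood of the zero-section and with parameters $(\alpha',\kappa)$, for which the dilaton $\phi$ takes the value $\phi_0$ on the zero-section (described in the context). Set $$\phi_0(\alpha',\kappa)=\tfrac34\log\left(\tfrac92|\alpha'|\right)-\tfrac12\log\left(3\sqrt2\,\kappa\right).$$ (i) If $\phi_0>\phi_0(\alpha',\kappa)$, the solution is complete and asymptotically conical, i.e. at infinity it approaches $(\omega_{\mathrm C},\Omega_{\mathrm C},e^{\phi_\infty})$ for some $\phi_\infty\in\mathbb{R}$. (ii) For $\phi_0>\phi_0(\alpha',\kappa)$, the asymptotic value $\phi_\infty$ of the dilaton is increasing in $\phi_0$. (iii) The solution corresponding to $\phi_0=\phi_0(\alpha',\kappa)$ is the CV--MN solution on the deformed conifold: $$u_\ast=\tfrac92|\alpha'|s,\qquad e^{2\phi_\ast}=\frac{(\frac92|\alpha'|)^{3/2}}{3\sqrt2\,\kappa}\,\frac{\sqrt{9s^2\sinh^2(3s)-(3s\cosh(3s)-\sinh(3s))^2}}{\sinh^2(3s)},\qquad s>0.$$ (iv) If $\phi_0<\phi_0(\alpha',\kappa)$, the solution is incomplete.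
   Context: IIB system. An $SU(3)$-structure on a 6-manifold is a pair $(\omega,\Omega)$ of a real non-degenerate 2-form and a locally decomposable complex 3-form with $\omega\wedge\Omega=0$, $2\omega^3=3\,\mathrm{Re}\,\Omega\wedge\mathrm{Im}\,\Omega$, such that $g=\omega(\cdot,J\cdot)$ is positive definite, where $J$ is the almost complex structure for which a complex 1-form $\alpha$ is of type $(1,0)$ iff $\alpha\wedge\Omega=0$. For a $k$-form $\beta$ set $J\beta=(-1)^k\beta(J\cdot,\dots,J\cdot)$, and $d^c\omega=J\,d\omega$. A triple $(\omega,\Omega,\phi)$ solves the IIB system if $d(e^{-2\phi}\Omega)=0$, $d(e^{-2\phi}\omega^2)=0$, $dd^c\omega=0$. The function $\phi$ is called the dilaton. Homogeneous forms. Let $\eta_1,\eta_2,\eta_3$ and $\eta_1',\eta_2',\eta_3'$ be bases of left-invariant 1-forms on the two factors of $SU(2)^2$ with $d\eta_i=2\eta_j\wedge\eta_k$, $d\eta_i'=2\eta_j'\wedge\eta_k'$ for $(ijk)$ cyclic permutations of $(123)$, and $\Sigma=SU(2)^2/\triangle U(1)$, with $U(1)\subset SU(2)$ generated by the vector field dual to the first basis element. The following descend to invariant forms on $\Sigma$: $\eta^{se}=\frac23(\eta_1-\eta_1')$, $\omega_1^{se}=\frac23(\eta_2\wedge\eta_3-\eta_2'\wedge\eta_3')$, $\omega_0^{se}=\frac23(\eta_2\wedge\eta_3+\eta_2'\wedge\eta_3')$, $\omega_2^{se}=-\frac23(\eta_2\wedge\eta_2'+\eta_3\wedge\eta_3')$,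 $\omega_3^{se}=\frac23(\eta_2\wedge\eta_3'+\eta_2'\wedge\eta_3)$. The complement of the zero-section $SU(2)^2/\triangle SU(2)\simeq S^3$ in $T^\ast S^3\simeq SU(2)^2\times_{\triangle SU(2)}\mathfrak{su}(2)$ is $(0,\infty)_s\times\Sigma$, with $s=0$ corresponding to the zero-section. Solutions. Put $V=\kappa\sinh 3s$ and $u_0=\frac32\alpha'\,\frac{3s\cosh(3s)-\sinh(3s)}{\sinh(3s)}$. A pair of functions $(u,\phi)$ of $s$ with $u>0$, $\partial_su>0$, $u^2-u_0^2>0$ satisfying $$\partial_su=\frac{2V^2e^{4\phi}}{u^2-u_0^2},\qquad \partial_s\phi=-\frac{u_0\,\partial_su_0}{u^2-u_0^2}$$ defines the invariant solution of the IIB system $$\omega=\tfrac12\partial_su\,ds\wedge\eta^{se}+u\,\omega_1^{se}+u_0(\nu_3\omega_0^{se}+\nu_0\omega_3^{se}),\quad \Omega=e^{2\phi}(ds+i\eta^{se})\wedge\big(V\omega_2^{se}+iV(\nu_0\omega_0^{se}+\nu_3\omega_3^{se})\big),$$ with $\nu_0=-1/\sinh 3s$, $\nu_3=\coth 3s$. For each $\phi_0\in\mathbb{R}$ there is a unique such $(u,\phi)$ on a small interval $(0,\epsilon)$ with $u=sX(s)$, $\phi=\phi_0+s^2Y(s)$, $X,Y$ smooth up to $s=0$, $X(0)=(18\kappa^2)^{1/3}e^{\frac43\phi_0}$; it defines a solution extending smoothly over the zero-section. This is the family in the theorem. The solution is called complete if it extends to $s\in(0,\infty)$ with complete metric on $T^\ast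 S^3$, and incomplete if its maximal extension is an incomplete metric. Cone. On $\mathrm C=(0,\infty)_r\times\Sigma$: $\omega_{\mathrm C}=r\,dr\wedge\eta^{se}+r^2\omega_1^{se}$, $\Omega_{\mathrm C}=(dr+ir\eta^{se})\wedge r^2(\omega_2^{se}+i\omega_3^{se})$. ''Approaches $(\omega_{\mathrm C},\Omega_{\mathrm C},e^{\phi_\infty})$'' means: after a change of variable $r=r(s)$ near infinity, $|\omega-\omega_{\mathrm C}|$, $|\Omega-\Omega_{\mathrm C}|$ (norms of the cone metric) and $|\phi-\phi_\infty|$ tend to $0$ as $r\to\infty$. *)

(* Defs.v *)
From HB Require Import structures.
From mathcomp Require Import all_boot all_order all_algebra.
From mathcomp Require Import complex.
From mathcomp Require Import all_classical all_reals all_analysis.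

Set Implicit Arguments.
Unset Strict Implicit.
Unset Printing Implicit Defensive.

Import Order.TTheory GRing.Theory Num.Theory.
Import numFieldNormedType.Exports.

Local Open Scope classical_set_scope.
Local Open Scope ring_scope.
Local Open Scope complex_scope.

(* * Invariant forms on (0,oo) x Sigma

   A tangent vector of (0,oo) x SU(2)^2 is given by its seven coordinates in
   the left-invariant frame dual to (ds, eta_1, eta_2, eta_3, eta'_1, eta'_2,
   eta'_3).  Tensors on (0,oo) x Sigma are identified with their pull-backs
   to (0,oo) x SU(2)^2, i.e. with the basic ones: the direction [fibre_dir] of
   the circle U(1) lies in their kernel. *)

Section Forms.
Variable R : realType.

Definition form (k : nat) : Type := ('I_k -> 'rV[R]_7) -> R[i].

Definition covector (a : 'I_7 -> R[i]) : form 1 :=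
  fun v => \sum_(j < 7) a j * (v ord0 ord0 j)%:C.

Definition coframe (n : nat) : form 1 := fun v => (v ord0 ord0 (inord n))%:C.

(* Exterior product of a 1-form and a k-form, normalised so that
   (a /\ b)(v, w) = a(v) b(w) - a(w) b(v) for 1-forms. *)
Definition wedge (k : nat) (a : form 1) (b : form k) : form k.+1 :=
  fun v => \sum_(j < k.+1)
    (-1) ^+ j * a (fun=> v j) * b (fun l => v (lift j l)).

Definition pair_vec (v w : 'rV[R]_7) : 'I_2 -> 'rV[R]_7 :=
  fun j => if j == ord0 then v else w.

Definition ds : form 1 := coframe 0.
Definition eta1 : form 1 := coframe 1.
Definition eta2 : form 1 := coframe 2.
Definition eta3 : form 1 := coframe 3.
Definition eta1' : form 1 := coframe 4.
Definition eta2' : form 1 := coframe 5.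
Definition eta3' : form 1 := coframe 6.

Definition fibre_dir : 'rV[R]_7 :=
  delta_mx ord0 (inord 1) + delta_mx ord0 (inord 4).

Definition eta_se : form 1 := fun v => (2 / 3) * (eta1 v - eta1' v).
Definition omega1_se : form 2 :=
  fun v => (2 / 3) * (wedge eta2 eta3 v - wedge eta2' eta3' v).
Definition omega0_se : form 2 :=
  fun v => (2 / 3) * (wedge eta2 eta3 v + wedge eta2' eta3' v).
Definition omega2_se : form 2 :=
  fun v => - (2 / 3) * (wedge eta2 eta2' v + wedge eta3 eta3' v).
Definition omega3_se : form 2 :=
  fun v => (2 / 3) * (wedge eta2 eta3' v + wedge eta2' eta3 v).

(* * The metric of an SU(3)-structure *)

(* [J] acts on row vectors by [v *m J].  It is a lift to R^7 of an almost
   complex structure on the quotient of R^7 by [fibre_dir]; this quotient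
   structure is determined by Om, the lift only up to multiples of
   [fibre_dir], which are invisible to basic forms. *)
Definition is_acs (Om : form 3) (J : 'M[R]_7) : Prop :=
  [/\ fibre_dir *m J = 0,
      forall v : 'rV[R]_7, exists c : R, v *m J *m J = - v + c *: fibre_dir
    & forall a : 'I_7 -> R[i],
        (forall v : 'rV[R]_7,
           covector a (fun=> v *m J) = 'i%C * covector a (fun=> v)) <->
        (forall v, wedge (covector a) Om v = 0)].

Definition acs (Om : form 3) : 'M[R]_7 := xget 0 [set J | is_acs Om J].

Definition su3_metric (om : form 2) (Om : form 3) (v w : 'rV[R]_7) : R :=
  complex.Re (om (pair_vec v (w *m acs Om))).

(* Norm of a basic k-form with respect to a basic metric [g], nondegenerate
   on the quotient by [fibre_dir]: the rows of the chosen matrix project to a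
   g-orthonormal basis of this six-dimensional quotient. *)
Definition orthonormal_frame (g : 'rV[R]_7 -> 'rV[R]_7 -> R) : 'M[R]_(6, 7) :=
  xget 0 [set f : 'M[R]_(6, 7) |
          forall i j, g (row i f) (row j f) = (i == j)%:R].

Definition form_norm (g : 'rV[R]_7 -> 'rV[R]_7 -> R) (k : nat) (b : form k)
    : R :=
  let f := orthonormal_frame g in
  Num.sqrt ((k`!%:R)^-1 * \sum_(I : {ffun 'I_k -> 'I_6})
    (complex.Re (b (fun l => row (I l) f)) ^+ 2 +
     complex.Im (b (fun l => row (I l) f)) ^+ 2)).

End Forms.

(* * The family of invariant solutions *)

Section Solutions.
Variable R : realType.

Definition sinh (x : R) : R := (expR x - expR (- x)) / 2.
Definition cosh (x : R) : R := (expR x + expR (- x)) / 2.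

Definition V (kappa s : R) : R := kappa * sinh (3 * s).
Definition u0 (alpha s : R) : R :=
  3 / 2 * alpha * ((3 * s * cosh (3 * s) - sinh (3 * s)) / sinh (3 * s)).
Definition nu0 (s : R) : R := - (sinh (3 * s))^-1.
Definition nu3 (s : R) : R := cosh (3 * s) / sinh (3 * s).

Definition omega (alpha : R) (u : R -> R) (s : R) : form R 2 := fun v =>
  (2^-1 * derive1 u s)%:C * wedge (@ds R) (@eta_se R) v
  + (u s)%:C * omega1_se v
  + (u0 alpha s)%:C * ((nu3 s)%:C * omega0_se v + (nu0 s)%:C * omega3_se v).

Definition Omega (kappa : R) (phi : R -> R) (s : R) : form R 3 := fun v =>
  (expR (2 * phi s))%:C *
  wedge (fun x => ds x + 'i%C * eta_se x)
        (fun x => (V kappa s)%:C * omega2_se x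
           + 'i%C * (V kappa s)%:C *
             ((nu0 s)%:C * omega0_se x + (nu3 s)%:C * omega3_se x)) v.

Definition metric (alpha kappa : R) (u phi : R -> R) (s : R) :
    'rV[R]_7 -> 'rV[R]_7 -> R :=
  su3_metric (omega alpha u s) (Omega kappa phi s).

Definition solves (alpha kappa : R) (T : \bar R) (u phi : R -> R) : Prop :=
  forall s : R, 0 < s -> (s%:E < T)%E ->
  [/\ 0 < u s, 0 < derive1 u s, 0 < u s ^+ 2 - u0 alpha s ^+ 2,
      is_derive s 1 u
        (2 * V kappa s ^+ 2 * expR (4 * phi s) / (u s ^+ 2 - u0 alpha s ^+ 2))
    & is_derive s 1 phi
        (- (u0 alpha s * derive1 (u0 alpha) s) / (u s ^+ 2 - u0 alpha s ^+ 2))].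

Definition smooth_on (A : set R) (f : R -> R) : Prop :=
  forall n x, A x -> derivable (derive1n n f) x 1.

(* Smoothness up to the end point s = 0 is expressed by smooth extension to
   a two-sided neighbourhood (equivalent by Borel's lemma). *)
Definition smooth_at_zero_section (kappa phi0 : R) (u phi : R -> R) : Prop :=
  exists2 e : R, 0 < e & exists X Y : R -> R,
  [/\ smooth_on `]- e, e[ X, smooth_on `]- e, e[ Y,
      X 0 = (18 * kappa ^+ 2) `^ (3^-1) * expR (4 / 3 * phi0)
    & forall s : R, 0 < s < e -> u s = s * X s /\ phi s = phi0 + s ^+ 2 * Y s].

(* The solution on 0 < s < T with dilaton phi0 on the zero-section.  Only the
   values of u and phi on (0, T) are relevant. *)
Definition zs_solution (alpha kappa phi0 : R) (T : \bar R) (u phi : R -> R)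
    : Prop :=
  [/\ (0 < T)%E, solves alpha kappa T u phi
    & smooth_at_zero_section kappa phi0 u phi].

Definition extends (T : \bar R) (u phi : R -> R)
    (T' : \bar R) (u' phi' : R -> R) : Prop :=
  (T <= T')%E /\
  forall s : R, 0 < s -> (s%:E < T)%E -> u' s = u s /\ phi' s = phi s.

Definition maximal_extension (alpha kappa : R)
    (T : \bar R) (u phi : R -> R) (T' : \bar R) (u' phi' : R -> R) : Prop :=
  [/\ extends T u phi T' u' phi', solves alpha kappa T' u' phi'
    & forall T'' u'' phi'', extends T' u' phi' T'' u'' phi'' ->
        solves alpha kappa T'' u'' phi'' -> T'' = T'].

End Solutions.

(* * The deformed conifold

   T^*S^3 = SU(2)^2 x_{SU(2)} su(2) is identified with S^3 x su(2), contained
   in R^4 x R^3, by [p, q, v] |-> (p q^-1, Ad_q v), where SU(2) is the group of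
   unit quaternions and su(2) the space of imaginary quaternions.

   The left-invariant 1-forms with d eta_i = 2 eta_j /\ eta_k are dual to the
   basis (-i, -j, -k) of su(2), since duality requires [e_j, e_k] = -2 e_i.
   This basis is used throughout to identify su(2) with R^3. *)

Section Conifold.
Variable R : realType.

Definition qmul (p q : 'rV[R]_4) : 'rV[R]_4 :=
  let a (n : nat) := p ord0 (inord n) in
  let b (n : nat) := q ord0 (inord n) in
  \row_(j < 4) nth 0
    [:: a 0%N * b 0%N - a 1%N * b 1%N - a 2%N * b 2%N - a 3%N * b 3%N;
        a 0%N * b 1%N + a 1%N * b 0%N + a 2%N * b 3%N - a 3%N * b 2%N;
        a 0%N * b 2%N - a 1%N * b 3%N + a 2%N * b 0%N + a 3%N * b 1%N;
        a 0%N * b 3%N + a 1%N * b 2%N - a 2%N * b 1%N + a 3%N * b 0%N] j.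

Definition qconj (q : 'rV[R]_(1 + 3)) : 'rV[R]_(1 + 3) :=
  row_mx (lsubmx q) (- rsubmx q).

Definition su2 (a : 'rV[R]_3) : 'rV[R]_(1 + 3) := row_mx 0 (- a).

Definition Ad (q : 'rV[R]_4) (a : 'rV[R]_3) : 'rV[R]_3 :=
  - rsubmx (qmul (qmul q (su2 a)) (qconj q) : 'rV[R]_(1 + 3)).

Definition sqnorm (n : nat) (x : 'rV[R]_n) : R := \sum_(j < n) x ord0 j ^+ 2.

(* The part s < T of T^*S^3, zero-section included. *)
Definition conifold (T : \bar R) : set 'rV[R]_(4 + 3) :=
  [set m | sqnorm (lsubmx m) = 1 /\
           ((Num.sqrt (sqnorm (rsubmx m)))%:E < T)%E].

Definition tangent (m v : 'rV[R]_(4 + 3)) : Prop :=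
  \sum_(j < 4) lsubmx m ord0 j * lsubmx v ord0 j = 0.

(* The projection (0, oo) x SU(2)^2 -> T^*S^3, (s, p, q) |-> [p, q, s e_1],
   and its differential; X has coordinates (ds, eta, eta')(X). *)
Definition polar (s : R) (p q : 'rV[R]_4) : 'rV[R]_(4 + 3) :=
  row_mx (qmul p (qconj q)) (Ad q (s *: delta_mx ord0 ord0)).

Definition dpolar (s : R) (p q : 'rV[R]_4) (X : 'rV[R]_(1 + (3 + 3))) :
    'rV[R]_(4 + 3) :=
  derive1 (fun t : R => polar (s + t * X ord0 ord0)
                      (p + t *: qmul p (su2 (lsubmx (rsubmx X))))
                      (q + t *: qmul q (su2 (rsubmx (rsubmx X))))) 0.

Definition bilin (n : nat) (A : 'M[R]_n) (v w : 'rV[R]_n) : R :=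
  (v *m A *m w^T) ord0 ord0.

(* Only the values of G m on vectors tangent at m are relevant. *)
Definition riemannian (T : \bar R) (G : 'rV[R]_(4 + 3) -> 'M[R]_(4 + 3))
    : Prop :=
  {within conifold T, continuous G} /\
  forall m, conifold T m ->
    (G m)^T = G m /\
    forall v, tangent m v -> v != 0 -> 0 < bilin (G m) v v.

(* G is the metric on the part s < T of T^*S^3 defined by (u, phi); it is
   determined by continuity on the zero-section. *)
Definition conifold_metric (alpha kappa : R) (T : \bar R) (u phi : R -> R)
    (G : 'rV[R]_(4 + 3) -> 'M[R]_(4 + 3)) : Prop :=
  riemannian T G /\
  forall (s : R) (p q : 'rV[R]_4), 0 < s -> (s%:E < T)%E ->
    sqnorm p = 1 -> sqnorm q = 1 ->
    forall X Y : 'rV[R]_7,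
      bilin (G (polar s p q)) (dpolar s p q X) (dpolar s p q Y)
      = metric alpha kappa u phi s X Y.

(* C^1 curves with possibly vanishing velocity; these give the same distance
   as piecewise C^1 curves, by reparametrisation at the corners. *)
Definition curve_between (T : \bar R) (x y : 'rV[R]_(4 + 3))
    (c : R -> 'rV[R]_(4 + 3)) : Prop :=
  [/\ forall t, derivable c t 1, continuous (derive1 c), c 0 = x, c 1 = y
    & forall t, 0 <= t <= 1 -> conifold T (c t)].

Definition curve_length (G : 'rV[R]_(4 + 3) -> 'M[R]_(4 + 3))
    (c : R -> 'rV[R]_(4 + 3)) : \bar R :=
  (\int[lebesgue_measure]_(t in `[0%R, 1%R])
     (Num.sqrt (bilin (G (c t)) (derive1 c t) (derive1 c t)))%:E)%E.

Definition riemannian_dist (T : \bar R) (G : 'rV[R]_(4 + 3) -> 'M[R]_(4 + 3))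
    (x y : 'rV[R]_(4 + 3)) : \bar R :=
  ereal_inf [set curve_length G c | c in curve_between T x y].

Definition metrically_complete (T : \bar R)
    (G : 'rV[R]_(4 + 3) -> 'M[R]_(4 + 3)) : Prop :=
  forall x : nat -> 'rV[R]_(4 + 3), (forall n, conifold T (x n)) ->
    (forall e : R, 0 < e -> exists N, forall m n, (N <= m)%N -> (N <= n)%N ->
       (riemannian_dist T G (x m) (x n) < e%:E)%E) ->
    exists2 l, conifold T l &
      forall e : R, 0 < e -> exists N, forall n, (N <= n)%N ->
        (riemannian_dist T G (x n) l < e%:E)%E.

Definition complete_solution (alpha kappa : R) (u phi : R -> R) : Prop :=
  exists2 G, conifold_metric alpha kappa +oo u phi G &
    metrically_complete +oo G.

Definition incomplete_solution (alpha kappa : R) (T : \bar R)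
    (u phi : R -> R) : Prop :=
  exists T' u' phi', maximal_extension alpha kappa T u phi T' u' phi' /\
    exists2 G, conifold_metric alpha kappa T' u' phi' G &
      ~ metrically_complete T' G.

End Conifold.

(* * Asymptotics *)

Section Cone.
Variable R : realType.

(* The pull-backs of the conical forms under r = r(s), so that dr = r'(s) ds. *)
Definition omega_cone (r : R -> R) (s : R) : form R 2 := fun v =>
  (r s * derive1 r s)%:C * wedge (@ds R) (@eta_se R) v
  + (r s ^+ 2)%:C * omega1_se v.

Definition Omega_cone (r : R -> R) (s : R) : form R 3 :=
  wedge (fun x => (derive1 r s)%:C * ds x + 'i%C * (r s)%:C * eta_se x)
        (fun x => (r s ^+ 2)%:C * (omega2_se x + 'i%C * omega3_se x)).

Definition cone_metric (r : R -> R) (s : R) : 'rV[R]_7 -> 'rV[R]_7 -> R :=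
  su3_metric (omega_cone r s) (Omega_cone r s).

Definition asymptotically_conical (alpha kappa : R) (u phi : R -> R)
    (phi_infty : R) : Prop :=
  exists (r : R -> R) (s0 : R),
  [/\ smooth_on `]s0, +oo[ r,
      forall s : R, s0 < s -> 0 < r s /\ 0 < derive1 r s,
      r s @[s --> +oo] --> +oo
    & [/\ form_norm (cone_metric r s)
            (fun v => omega alpha u s v - omega_cone r s v)
            @[s --> +oo] --> (0 : R),
          form_norm (cone_metric r s)
            (fun v => Omega kappa phi s v - Omega_cone r s v)
            @[s --> +oo] --> (0 : R)
        & phi s @[s --> +oo] --> phi_infty]].

Definition critical_dilaton (alpha kappa : R) : R :=
  3 / 4 * ln (9 / 2 * `|alpha|) - 2^-1 * ln (3 * Num.sqrt 2 * kappa).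

Definition u_star (alpha s : R) : R := 9 / 2 * `|alpha| * s.

Definition exp_2phi_star (alpha kappa s : R) : R :=
  (9 / 2 * `|alpha|) `^ (3 / 2) / (3 * Num.sqrt 2 * kappa) *
  (Num.sqrt (9 * s ^+ 2 * sinh (3 * s) ^+ 2
             - (3 * s * cosh (3 * s) - sinh (3 * s)) ^+ 2)
   / sinh (3 * s) ^+ 2).

End Cone.

(* Main.v *)
Require Import Defs.
From HB Require Import structures.
From mathcomp Require Import all_boot all_order all_algebra.
From mathcomp Require Import complex.
From mathcomp Require Import all_classical all_reals all_analysis.
From mathcomp Require Import ring lra.

Set Implicit Arguments.
Unset Strict Implicit.
Unset Printing Implicit Defensive.

Import Order.TTheory GRing.Theory Num.Theory.
Import numFieldNormedType.Exports.

Local Open Scope classical_set_scope.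
Local Open Scope ring_scope.

(** * Real analysis *)

(** Everything is governed by the rays u = l s. Near the zero-section u is asymptotic to l0 s with
    l0^3 = 18 kappa^2 e^(4 phi0), and [critical_dilaton] is the value for which l0 equals c =
    [crit_slope] ([zs_slope_critical]). By [coth_identity] the ray u = c s is an exact solution,
    with dilaton [phi_star]; since the singular initial value problem at s = 0 has at most one
    solution ([solution_unique]), it is the solution of (iii). For the other slopes, u - l s and
    [ray_gap] are coupled in such a way that neither can be the first to vanish. Hence a solution
    with l0 > c stays above the rays of slope l with c <= l < l0 ([ray_lt]), and one with l0 < c
    stays below those with l0 < l <= c ([lt_ray]).

    If l0 < c, a ray of slope l < c eventually lies below c (s - 1/3), hence below |u0|, which
    contradicts u^2 > u0^2; so the maximal interval is bounded ([subcritical_bounded]). On it u is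
    increasing and bounded, so a radial curve, whose speed is the square root of u'/2, has finite
    length although it leaves every compact set. This is (iv).

    If l0 > c, then u^2 - u0^2 is at least a fixed multiple of u^2. A truncated, globally Lipschitz
    system is solved by Picard iteration ([picard_global]), and the ray estimate shows that the
    truncation is never felt, so the solution lives on (0, oo) ([supercritical_global]). An
    inequality for (u^3)' gives exponential growth of u ([u_exp_growth]), so that the derivative of
    the decreasing dilaton is integrable and the dilaton converges ([dilaton_cvg]). The function u^3
    e^(-6s) obeys a relaxation equation, whence u is asymptotic to r^2 for r = rho e^s
    ([u_scale_cvg]); with the explicit formulas for the structures this gives the conical
    asymptotics ([supercritical_conical]). The system is cooperative, so the difference of two
    dilatons stays above a positive constant ([solution_mono]), which is (ii).

    For completeness the metric is written on S^3 x R^3 with five radial coefficients ([gform]),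
    extended to the zero-section by their limits. The transverse 2 by 2 block has determinant (u^2 -
    u0^2) / (9 s^2) ([prof_det]), which yields positivity, and for l0 > c a uniform lower bound by
    the Euclidean metric ([profile_min_lower_all]). Cauchy sequences are then Euclidean Cauchy, and
    their limits are reached along short chords ([conifold_mx_complete]). *)

Section PointwiseDerivation.
Context {R : realType}.
Implicit Types (f g : R -> R) (x a b : R).

Lemma der_id x : is_derive x 1 (fun y : R => y) 1.
Proof. exact: is_derive_id. Qed.

Lemma der_cst c x : is_derive x 1 (fun=> c) (0 : R).
Proof. exact: is_derive_cst. Qed.

Lemma der_add f g a b x : is_derive x 1 f a -> is_derive x 1 g b ->
  is_derive x 1 (fun y => f y + g y) (a + b).
Proof. by move=> ? ?; apply: is_deriveD. Qed.

Lemma der_opp f a x : is_derive x 1 f a -> is_derive x 1 (fun y => - f y) (- a).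
Proof. by move=> ?; apply: is_deriveN. Qed.

Lemma der_mul f g a b x : is_derive x 1 f a -> is_derive x 1 g b ->
  is_derive x 1 (fun y => f y * g y) (f x * b + g x * a).
Proof. by move=> ? ?; exact: is_deriveM. Qed.

Lemma der_exp f a x n : is_derive x 1 f a ->
  is_derive x 1 (fun y => f y ^+ n) (n%:R * f x ^+ n.-1 * a).
Proof.
move=> D; have -> : (fun y => f y ^+ n) = f ^+ n.
  by apply/funext => y; rewrite exprfctE.
exact: is_deriveX.
Qed.

Lemma der_inv f a x : f x != 0 -> is_derive x 1 f a ->
  is_derive x 1 (fun y => (f y)^-1) (- (f x) ^- 2 * a).
Proof. by move=> ? ?; apply: is_deriveV. Qed.

Lemma der_expR f a x : is_derive x 1 f a ->
  is_derive x 1 (fun y => expR (f y)) (expR (f x) * a).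
Proof. by move=> ?; exact: (is_derive1_comp (is_derive_expR _)). Qed.

Lemma der_ln f a x : 0 < f x -> is_derive x 1 f a ->
  is_derive x 1 (fun y => ln (f y)) ((f x)^-1 * a).
Proof. by move=> ? ?; apply: (is_derive1_comp (is_derive1_ln _)). Qed.

Lemma der_cont f a x : is_derive x 1 f a -> {for x, continuous f}.
Proof. by move=> [df _]; apply/differentiable_continuous/derivable1_diffP. Qed.

Lemma der_near f g a x : {near x, f =1 g} -> is_derive x 1 f a ->
  is_derive x 1 g a.
Proof. by move=> fg; apply: near_eq_is_derive => //; exact: oner_neq0. Qed.

Lemma derivable_der f x : derivable f x 1 -> is_derive x 1 f (derive1 f x).
Proof. by move=> df; rewrite derive1E; apply: DeriveDef. Qed.

Lemma derive1_der f a x : is_derive x 1 f a -> derive1 f x = a.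
Proof. by move=> df; rewrite derive1E; exact: derive_val. Qed.

Lemma der_eq f b x : (exists a, is_derive x 1 f a /\ a = b) ->
  is_derive x 1 f b.
Proof. by move=> [a [? <-]]. Qed.

(** For each increment the difference quotient of the glued function is one of the two given
    quotients, and these have the same limit. *)
Lemma der_glue f g a d : is_derive a 1 f d -> is_derive a 1 g d -> f a = g a ->
  is_derive a 1 (fun s => if s < a then f s else g s) d.
Proof.
have quot (k : R -> R) : is_derive a 1 k d ->
    h^-1 *: (k (h *: 1 + a) - k a) @[h --> 0^'] --> d.
  by move=> [dk <-]; exact: dk.
move=> /quot qf /quot qg fg; set w := fun s => _.
have qw : h^-1 *: (w (h *: 1 + a) - w a) @[h --> 0^'] --> d.
  apply/cvgrPdist_lt => e e0.
  move/cvgrPdist_lt: qf => /(_ e e0) qf; move/cvgrPdist_lt: qg => /(_ e e0) qg.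
  near=> h; rewrite {2}/w ltxx /w; case: ifP => _; last by near: h.
  by rewrite -fg; near: h.
apply: DeriveDef; first by apply/cvg_ex; exists d.
exact: cvg_lim qw.
Unshelve. all: by end_near. Qed.

End PointwiseDerivation.

(** A hook for [der], redefined once the rules for [sinh] and [cosh] are available; [pos_special]
    plays the same part for [pos]. *)
Ltac der_special F := fail.

(* [notypeclasses] because type class resolution would otherwise discharge the
   premises with scaled, hence less readable, derivatives. *)
Ltac der := lazymatch goal with |- is_derive ?x _ ?F0 _ =>
  let T := type of x in
  let F := eval cbv beta in (fun y : T => F0 y) in
  lazymatch F with
  | fun _ => ?c => exact: der_cst
  | fun y => y => exact: der_id
  | fun y => GRing.add (@?f y) (@?g y) => notypeclasses refine (der_add _ _); der
  | fun y => GRing.opp (@?f y) => notypeclasses refine (der_opp _); der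
  | fun y => GRing.mul (@?f y) (@?g y) => notypeclasses refine (der_mul _ _); der
  | fun y => GRing.exp (@?f y) ?n => notypeclasses refine (der_exp _ _); der
  | fun y => GRing.inv (@?f y) => notypeclasses refine (der_inv _ _); [| der]
  | fun y => expR (@?f y) => notypeclasses refine (der_expR _); der
  | fun y => ln (@?f y) => notypeclasses refine (der_ln _ _); [| der]
  | _ => first [der_special F | eassumption | idtac]
  end end.

Tactic Notation "derE" tactic3(tac) := apply: der_eq; eexists; split; [der | cbv beta; tac].

Ltac pos_special := fail.

Ltac pos := lazymatch goal with
  | |- is_true (_ < GRing.mul _ _) => apply: mulr_gt0; pos
  | |- is_true (_ < GRing.exp _ _) => apply: exprn_gt0; pos
  | |- is_true (_ < GRing.inv _) => rewrite invr_gt0; pos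
  | |- is_true (_ < _ + _) => first [assumption | lra | apply: addr_gt0; pos]
  | |- is_true (_ < GRing.natmul _ _) => by rewrite ltr0n
  | |- is_true (_ <= GRing.natmul _ _) => exact: ler0n
  | |- is_true (_ < expR _) => exact: expR_gt0
  | |- is_true (_ <= GRing.mul _ _) => apply: mulr_ge0; pos
  | |- is_true (_ <= GRing.exp _ 2) => exact: sqr_ge0
  | |- is_true (_ <= GRing.exp _ _) => apply: exprn_ge0; pos
  | |- is_true (_ <= GRing.inv _) => rewrite invr_ge0; pos
  | |- is_true (_ <= _ + _) => first [assumption | lra | apply: addr_ge0; pos]
  | |- is_true (_ <= expR _) => exact: expR_ge0
  | |- is_true (_ <= `|_|) => exact: normr_ge0
  | |- _ => first [assumption | done | pos_special | lra | apply: ltW; assumption | idtac]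
  end.

(** * Monotonicity, Gronwall inequalities and antiderivatives *)

Section Calculus.
Context {R : realType}.
Implicit Types (f g df : R -> R) (x a b : R).

Lemma deriv_ge0_le f df a b : a <= b ->
  (forall x, a <= x <= b -> is_derive x 1 f (df x)) ->
  (forall x, a < x < b -> 0 <= df x) -> f a <= f b.
Proof.
rewrite le_eqVlt => /predU1P[->//|ab] Hd H0.
have [] := @MVT R f df a b ab.
- by move=> x; rewrite in_itv/= => /andP[ax xb]; apply: Hd; rewrite !ltW.
- apply: derivable_within_continuous => x; rewrite in_itv/= => xab.
  by case: (Hd x xab).
- move=> c; rewrite in_itv/= => cab e.
  by rewrite -subr_ge0 e mulr_ge0 ?H0// subr_ge0 ltW.
Qed.

Lemma deriv_le0_ge f df a b : a <= b ->
  (forall x, a <= x <= b -> is_derive x 1 f (df x)) ->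
  (forall x, a < x < b -> df x <= 0) -> f b <= f a.
Proof.
move=> ab Hd H0; rewrite -lerN2.
apply: (@deriv_ge0_le (fun y => - f y) (fun y => - df y)) => // x xab.
  by apply: der_opp; exact: Hd.
by rewrite oppr_ge0 H0.
Qed.

Lemma deriv_le_sub f df g dg a b : a <= b ->
  (forall x, a <= x <= b -> is_derive x 1 f (df x)) ->
  (forall x, a <= x <= b -> is_derive x 1 g (dg x)) ->
  (forall x, a < x < b -> df x <= dg x) -> f b - f a <= g b - g a.
Proof.
move=> ab Hf Hg H; rewrite -subr_ge0.
have -> : g b - g a - (f b - f a) = (g b - f b) - (g a - f a) by ring.
rewrite subr_ge0.
apply: (@deriv_ge0_le (fun y => g y - f y) (fun y => dg y - df y)) => // x xab.
  by apply: der_add; [exact: Hg | apply: der_opp; exact: Hf].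
by rewrite subr_ge0 H.
Qed.

Lemma deriv_gt0_lt f df a b : a < b ->
  (forall x, a <= x <= b -> is_derive x 1 f (df x)) ->
  (forall x, a < x < b -> 0 < df x) -> f a < f b.
Proof.
move=> ab Hd H0.
have [] := @MVT R f df a b ab.
- by move=> x; rewrite in_itv/= => /andP[ax xb]; apply: Hd; rewrite !ltW.
- apply: derivable_within_continuous => x; rewrite in_itv/= => xab.
  by case: (Hd x xab).
- move=> c; rewrite in_itv/= => cab e.
  by rewrite -subr_gt0 e mulr_gt0 ?H0// subr_gt0.
Qed.

Lemma gronwall_ge f df a b K : a <= b ->
  (forall x, a <= x <= b -> is_derive x 1 f (df x)) ->
  (forall x, a < x < b -> - K * f x <= df x) ->
  f a * expR (K * a) <= f b * expR (K * b).
Proof.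
move=> ab Hd H.
apply: (@deriv_ge0_le (fun x => f x * expR (K * x))
  (fun x => (df x + K * f x) * expR (K * x)) a b ab) => x xab.
  have D := Hd x xab.
  derE ring.
by rewrite mulr_ge0 ?expR_ge0//; have := H _ xab; lra.
Qed.

Lemma gronwall_le f df a b K : a <= b ->
  (forall x, a <= x <= b -> is_derive x 1 f (df x)) ->
  (forall x, a < x < b -> df x <= K * f x) ->
  f b <= f a * expR (K * (b - a)).
Proof.
move=> ab Hd H.
have : - f a * expR (- K * a) <= - f b * expR (- K * b).
  apply: (@gronwall_ge (fun x => - f x) (fun x => - df x)) => // x xab.
    by apply: der_opp; exact: Hd.
  by rewrite opprK mulrN lerN2 H.
rewrite !mulNr lerN2 -(ler_pM2r (expR_gt0 (K * b))) -!mulrA -!expRD.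
by rewrite addNr expR0 mulr1 mulrBr [- _ + _]addrC.
Qed.

Lemma segment_bounded f a b : a <= b ->
  (forall x, a <= x <= b -> {for x, continuous f}) ->
  exists2 K, 0 <= K & forall x, a <= x <= b -> `|f x| <= K.
Proof.
move=> ab cf.
have [|c _ Hc] := @EVT_max R (fun x => `|f x|) a b ab.
  apply: continuous_in_subspaceT => x; rewrite inE/= in_itv/= => xab.
  by apply: continuous_comp; [exact: cf | exact: norm_continuous].
by exists `|f c| => // x xab; apply: Hc; rewrite in_itv.
Qed.

Lemma segment_lower_bound f a b : a <= b ->
  (forall x, a <= x <= b -> {for x, continuous f}) ->
  (forall x, a <= x <= b -> 0 < f x) ->
  exists2 m, 0 < m & forall x, a <= x <= b -> m <= f x.
Proof.
move=> ab cf f0.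
have [|c cab Hc] := @EVT_min R f a b ab.
  apply: continuous_in_subspaceT => x; rewrite inE/= in_itv/= => xab.
  exact: cf.
exists (f c); first by apply: f0; move: cab; rewrite in_itv.
by move=> x xab; apply: Hc; rewrite in_itv.
Qed.

Lemma cont_pos_near f x : {for x, continuous f} -> 0 < f x ->
  exists2 e, 0 < e & forall y, `|y - x| < e -> 0 < f y.
Proof.
move=> cf f0.
have : \forall y \near x, 0 < f y by exact: (cvgr_gt _ cf _ f0).
move=> /nbhs_ballP[e /= e0 He]; exists e => // y yx; apply: He.
by rewrite /ball/= distrC.
Qed.

(* The two inequalities are only assumed as long as both functions are
   positive: neither can be the first to vanish. *)
Lemma coupled_gt0 (d D dd dD : R -> R) a b K : a <= b ->
  (forall x, a <= x <= b -> is_derive x 1 d (dd x)) ->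
  (forall x, a <= x <= b -> is_derive x 1 D (dD x)) ->
  0 < d a -> 0 < D a ->
  (forall x, a <= x <= b -> 0 < d x -> 0 < D x ->
     - K * d x <= dd x /\ - K * D x <= dD x) ->
  0 < d b /\ 0 < D b.
Proof.
move=> ab Hd HD da Da H.
(* The times up to which both functions have stayed positive; [t] is their supremum. *)
pose A := [set x | a <= x <= b /\ forall y, a <= y <= x -> 0 < d y /\ 0 < D y].
have Aa : A a.
  by split; [rewrite lexx | move=> y; rewrite -eq_le => /eqP<-].
have ubA : ubound A b by move=> x [/andP[]].
have sA : has_sup A by split; [exists a | exists b].
set t := sup A.
have at_ : a <= t by apply: sup_upper_bound.
have tb : t <= b by apply: sup_le_ub => //; exists a.
have below y : a <= y < t -> 0 < d y /\ 0 < D y.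
  move=> /andP[ay yt].
  have [z [_ Hz] yz] := @sup_adherent R A (t - y) ltac:(by rewrite subr_gt0) sA.
  by apply: Hz; rewrite ay ltW//; move: yz; rewrite -/t; lra.
have dt : 0 < d t.
  (* Before [t] both functions are positive, so the differential inequality is available and
     Gronwall carries positivity to [t] itself. *)
  have h : d a * expR (K * a) <= d t * expR (K * t).
    apply: (@gronwall_ge d dd) => // x xat; first by apply: Hd; lra.
    have [|p q] := below x; first by lra.
    by case: (H x _ p q) => //; lra.
  rewrite -(pmulr_lgt0 _ (expR_gt0 (K * t))).
  by apply: lt_le_trans h; rewrite mulr_gt0// expR_gt0.
have Dt : 0 < D t.
  have h : D a * expR (K * a) <= D t * expR (K * t).
    apply: (@gronwall_ge D dD) => // x xat; first by apply: HD; lra.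
    have [|p q] := below x; first by lra.
    by case: (H x _ p q) => //; lra.
  rewrite -(pmulr_lgt0 _ (expR_gt0 (K * t))).
  by apply: lt_le_trans h; rewrite mulr_gt0// expR_gt0.
have [tb'|tb'] := ltP t b; last first.
  by have -> : b = t by apply/eqP; rewrite eq_le tb tb'.
exfalso.
have tab : a <= t <= b by rewrite at_ tb.
(* If [t < b], continuity keeps both functions positive a little beyond [t], against the choice of
   [t]. *)
have [e1 e10 H1] := cont_pos_near (der_cont (Hd t tab)) dt.
have [e2 e20 H2] := cont_pos_near (der_cont (HD t tab)) Dt.
pose e := Num.min (Num.min e1 e2) (b - t).
have e0 : 0 < e by rewrite !lt_min e10 e20 subr_gt0.
have [l1 l2 l3] : [/\ e <= e1, e <= e2 & e <= b - t].
  by rewrite /e; split; rewrite !ge_min lexx ?orbT.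
have : A (t + e / 2).
  split; first by lra.
  move=> y /andP[ay yte].
  have [yt|yt] := ltP y t; first by apply: below; rewrite ay.
  have n : `|y - t| < e by rewrite ger0_norm; lra.
  by split; [apply: H1 | apply: H2]; apply: lt_le_trans n _.
by move=> /(sup_upper_bound sA); rewrite -/t; lra.
Qed.

Lemma antiderivative f a : continuous f ->
  exists2 F : R -> R, F a = 0 & forall x, a <= x -> is_derive x 1 F (f x).
Proof.
move=> cf.
(* Starting the integral at [a - 1] makes [a] an interior point, so that the derivative there is
   two-sided. *)
pose G x := (\int[lebesgue_measure]_(t in `[a - 1, x]) f t)%R.
have HG x : a <= x -> is_derive x 1 G (f x).
  move=> ax.
  have [||||dG eG] := @continuous_FTC1_closed R f (a - 1) x (x + 1).
  - by lra.
  - apply: continuous_compact_integrable; first exact: segment_compact.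
    by apply: continuous_subspaceT => y; exact: cf.
  - by lra.
  - exact: cf.
  - by rewrite -eG; exact: derivable_der.
exists (fun x => G x - G a); first by rewrite subrr.
move=> x ax; have D := HG x ax.
derE (by rewrite addr0).
Qed.

End Calculus.

(** * Global solutions of Lipschitz systems by Picard iteration *)

Section Picard.
Context {R : realType}.

Lemma le_pow2_eq0 (x C : R) : (forall n, `|x| <= C / 2 ^+ n) -> x = 0.
Proof.
move=> H; apply/eqP; rewrite -normr_eq0; apply/eqP/le_anti.
rewrite normr_ge0 andbT leNgt; apply/negP => x0.
have := H (Num.truncn (C / `|x|)).+1.
set n := (Num.truncn (C / `|x|)).+1; rewrite ler_pdivlMr ?exprn_gt0//; apply/negP; rewrite -ltNge.
have : C / `|x| < 2 ^+ n.
  apply: (lt_le_trans (truncnS_gt _)); rewrite -natrX ler_nat.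
  by apply: ltnW; apply: ltn_expl.
by rewrite ltr_pdivrMr// mulrC.
Qed.

(** With e_n = 2 C / 2^n one has e_n - e_(n+1) = C / 2^n, so the intervals of radius e_n around u_n
    are nested; the limit is the supremum of their left ends. *)
Lemma geometric_cauchy (u : nat -> R) (C : R) :
  (forall n, `|u n.+1 - u n| <= C / 2 ^+ n) ->
  exists2 l, u n @[n --> \oo] --> l & forall n, `|u n - l| <= 2 * C / 2 ^+ n.
Proof.
move=> H.
pose e n : R := 2 * C / 2 ^+ n.
have eS n : e n - e n.+1 = C / 2 ^+ n by rewrite /e exprS; field.
have e0 n : 0 <= e n.
  have := le_trans (normr_ge0 _) (H n); rewrite /e -mulrA.
  by move=> ?; rewrite mulr_ge0.
have incr m n : (m <= n)%N -> u m - e m <= u n - e n.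
  elim: n => [|n IH]; first by rewrite leqn0 => /eqP->.
  rewrite leq_eqVlt => /predU1P[->//|/IH h]; apply: (le_trans h).
  by move: (H n) (eS n); rewrite ler_norml => /andP[]; lra.
have decr m n : (m <= n)%N -> u n + e n <= u m + e m.
  elim: n => [|n IH]; first by rewrite leqn0 => /eqP->.
  rewrite leq_eqVlt => /predU1P[->//|/IH h]; apply: le_trans h.
  by move: (H n) (eS n); rewrite ler_norml => /andP[]; lra.
have vw m n : u m - e m <= u n + e n.
  have h1 := incr m (maxn m n) (leq_maxl _ _).
  have h2 := decr n (maxn m n) (leq_maxr _ _).
  by have := e0 (maxn m n); lra.
pose A := range (fun n => u n - e n).
have sA : has_sup A.
  split; first by exists (u 0%N - e 0%N), 0%N.
  by exists (u 0%N + e 0%N) => _ [n _ <-].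
have bnd n : `|u n - sup A| <= e n.
  have h1 : u n - e n <= sup A by apply: sup_upper_bound => //; exists n.
  have h2 : sup A <= u n + e n.
    by apply: sup_le_ub; [case: sA | move=> _ [m _ <-]; exact: vw].
  by rewrite ler_norml; apply/andP; split; lra.
exists (sup A) => //.
apply/cvgrPdist_lt => d d0.
have He : (e n) @[n --> \oo] --> (0 : R).
  rewrite -(mulr0 (2 * C)); apply: cvgM; first exact: cvg_cst.
  rewrite (_ : (fun n => _) = (fun n => 1 * 2^-1 ^+ n)).
    by apply: cvg_geometric; rewrite ger0_norm ?invf_lt1 ?ltr1n.
  by apply/funext => n; rewrite mul1r exprVn.
move/cvgrPdist_lt: He => /(_ d d0).
apply: filterS => n; rewrite sub0r normrN ger0_norm//.
by rewrite distrC; apply: le_lt_trans.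
Qed.

Lemma local_uniform_limit_continuous (f_ : nat -> R -> R) (f : R -> R) :
  (forall n, continuous (f_ n)) ->
  (forall x, exists2 b, x < b & exists C, forall n y, y <= b ->
     `|f_ n y - f y| <= C / 2 ^+ n) ->
  continuous f.
Proof.
move=> cf H x; have [b xb [C HC]] := H x.
apply/cvgrPdist_lt => e e0.
have [n Hn] : exists n, C / 2 ^+ n < e / 3.
  apply: contrapT => /forallNP h.
  have : e / 3 = 0.
    apply: (@le_pow2_eq0 _ C) => n; rewrite ger0_norm; last by lra.
    by rewrite leNgt; apply/negP/h.
  by lra.
move/cvgrPdist_lt: (cf n x) => /(_ (e / 3)).
rewrite divr_gt0//= => /(_ isT) h1.
have h2 : \forall y \near x, y < b by exact: (cvgr_lt x cvg_id _ xb).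
near=> y.
have yb : y < b by near: y.
have d1 : `|f_ n x - f_ n y| < e / 3 by near: y.
have a1 := HC n x (ltW xb); have a2 := HC n y (ltW yb).
move: d1 a1 a2 Hn; rewrite !ltr_norml !ler_norml.
move=> /andP[? ?] /andP[? ?] /andP[? ?] ?; apply/andP; split; lra.
Unshelve. all: by end_near. Qed.

Lemma max_continuous (a : R) : continuous (fun s => Num.max s a).
Proof. by move=> s; apply: continuous_max => //; exact: cst_continuous. Qed.

Definition primitive (a : R) (h : R -> R) : R -> R :=
  xget (fun=> 0) [set H | H a = 0 /\ forall x, a <= x -> is_derive x 1 H (h x)].

Lemma primitiveP a h : continuous h -> primitive a h a = 0 /\
  forall x, a <= x -> is_derive x 1 (primitive a h) (h x).
Proof.
move=> ch; rewrite /primitive; case: xgetP => [H _ //|/= H].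
by have [G G0 GP] := antiderivative a ch; case: (H G).
Qed.

Lemma primitive_continuous a h : continuous h ->
  continuous (fun s => primitive a h (Num.max s a)).
Proof.
move=> /(primitiveP a)[_ H] s.
apply: (@continuous_comp _ _ _ (fun s => Num.max s a) (primitive a h)).
  exact: max_continuous.
by apply: der_cont; apply: H; rewrite le_max lexx orbT.
Qed.

Variables (F : bool -> R -> R -> R -> R) (a : R) (y0 : bool -> R).
Hypothesis Fcont : forall i f g, continuous f -> continuous g ->
  continuous (fun s => F i s (f s) (g s)).
Hypothesis Flip : forall b, exists2 L, 0 < L &
  forall i s x y x' y', a <= s <= b ->
    `|F i s x y - F i s x' y'| <= L * (`|x - x'| + `|y - y'|).

Let rhs (y : bool -> R -> R) i s := F i s (y true s) (y false s).
(** The Picard map. Freezing the argument at [a] makes every iterate continuous on the whole line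
    and constant to the left of [a]. *)
Let step (y : bool -> R -> R) i s :=
  y0 i + primitive a (rhs y i) (Num.max s a).
Let dist (y z : bool -> R -> R) s :=
  `|y true s - z true s| + `|y false s - z false s|.
Let cont (y : bool -> R -> R) := forall i, continuous (y i).

Let rhs_cont y : cont y -> forall i, continuous (rhs y i).
Proof. by move=> cy i; apply: Fcont; exact: cy. Qed.

Let step_cont y : cont y -> cont (step y).
Proof.
move=> cy i s.
have h := @primitive_continuous a (rhs y i) (@rhs_cont _ cy i) s.
exact: (cvgD (cvg_cst (y0 i)) h).
Qed.

(* With the weight [expR (4 L (s - a))] the Picard map halves distances. *)
Let step_contract b L y z D : 0 < L ->
  (forall i s x y x' y', a <= s <= b ->
    `|F i s x y - F i s x' y'| <= L * (`|x - x'| + `|y - y'|)) ->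
  cont y -> cont z ->
  (forall s, a <= s <= b -> dist y z s <= D * expR (4 * L * (s - a))) ->
  forall s, a <= s <= b ->
    dist (step y) (step z) s <= D / 2 * expR (4 * L * (s - a)).
Proof.
move=> L0 HL cy cz H s /andP[as_ sb].
have D0 : 0 <= D.
  have /H : a <= a <= b by rewrite lexx (le_trans as_ sb).
  rewrite subrr mulr0 expR0 mulr1; apply: le_trans.
  by rewrite addr_ge0.
(* Each of the two components contributes a quarter: the weight is chosen such that D/4 times it is
   a primitive of L D times it. *)
suff main i : `|step y i s - step z i s| <= D / 4 * expR (4 * L * (s - a)).
  by have := main true; have := main false; rewrite /dist; lra.
rewrite /step opprD addrACA subrr add0r max_l//.
have dE (x : R) : is_derive x 1 (fun x => D / 4 * expR (4 * L * (x - a)))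
    (L * (D * expR (4 * L * (x - a)))).
  by derE field.
have bnd x : a < x < s ->
    `|rhs y i x - rhs z i x| <= L * (D * expR (4 * L * (x - a))).
  move=> xs; have xb : a <= x <= b by lra.
  by apply: (le_trans (HL _ _ _ _ _ _ xb)); rewrite ler_pM2l// H.
have E0 : 0 <= D / 4 * expR (4 * L * (a - a)).
  by rewrite mulr_ge0 ?expR_ge0 ?divr_ge0.
have main w z' : cont w -> cont z' ->
    (forall x, a < x < s -> rhs w i x - rhs z' i x <= L * (D * expR (4 * L * (x - a)))) ->
    primitive a (rhs w i) s - primitive a (rhs z' i) s <=
      D / 4 * expR (4 * L * (s - a)).
  move=> cw cz' Hw.
  have [pw dw] := primitiveP a (@rhs_cont _ cw i).
  have [pz dz] := primitiveP a (@rhs_cont _ cz' i).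
  have dwz (x : R) : a <= x <= s -> is_derive x 1
      (fun x => primitive a (rhs w i) x - primitive a (rhs z' i) x)
      (rhs w i x - rhs z' i x).
    move=> /andP[ax _]; have D1 := dw x ax; have D2 := dz x ax.
    by derE by [].
  have := deriv_le_sub as_ dwz (fun x _ => dE x) Hw.
  by rewrite pw pz subrr subr0; lra.
rewrite ler_norml; apply/andP; split.
  rewrite lerNl opprB; apply: main => // x /bnd.
  by rewrite ler_norml => /andP[]; lra.
by apply: main => // x /bnd; rewrite ler_norml => /andP[]; lra.
Qed.

Let y_ n : bool -> R -> R := iter n step (fun i _ => y0 i).

Let y_cont n : cont (y_ n).
Proof.
elim: n => [|n IH]; first by move=> i; exact: cst_continuous.
exact: step_cont.
Qed.

Let y_max n i s : y_ n i (Num.max s a) = y_ n i s.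
Proof. by case: n => [//|n]; rewrite /= /step -maxA maxxx. Qed.

Let y_dist b : a <= b -> exists2 L, 0 < L & exists2 D, 0 <= D &
  (forall i s x y x' y', a <= s <= b ->
    `|F i s x y - F i s x' y'| <= L * (`|x - x'| + `|y - y'|)) /\
  forall n s, a <= s <= b ->
    dist (y_ n.+1) (y_ n) s <= D / 2 ^+ n * expR (4 * L * (s - a)).
Proof.
move=> ab; have [L L0 HL] := Flip b; exists L => //.
have [D D0 HD] : exists2 D, 0 <= D & forall s, a <= s <= b ->
    `|dist (y_ 1) (y_ 0) s| <= D.
  apply: segment_bounded => // s _.
  have h i : {for s, continuous (fun s => `|y_ 1 i s - y_ 0 i s|)}.
    apply: (@continuous_comp _ _ _ (fun s => y_ 1 i s - y_ 0 i s)).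
      by apply: continuousB; apply: y_cont.
    exact: norm_continuous.
  by apply: continuousD; apply: h.
exists D => //; split => //; elim=> [|n IH] s sab.
  rewrite expr0 divr1; apply: (le_trans (le_trans (ler_norm _) (HD s sab))).
  rewrite ler_peMr// -expR0 ler_expR mulr_ge0 ?subr_ge0//; last by lra.
  by rewrite mulr_ge0 ?(ltW L0).
have := step_contract L0 HL (@y_cont n.+1) (@y_cont n) IH sab.
by rewrite -[step (y_ n.+1)]/(y_ n.+2) -[step (y_ n)]/(y_ n.+1) exprSr invfM mulrA.
Qed.

Let y_oo i s : R := lim (y_ n i s @[n --> \oo]).

Let y_ooP b : a <= b -> exists C, forall n i s, s <= b ->
  `|y_ n i s - y_oo i s| <= C / 2 ^+ n.
Proof.
move=> ab; have [L L0 [D D0 [_ H]]] := y_dist ab.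
exists (2 * (D * expR (4 * L * (b - a)))) => n i s sb.
have [|l cl Hl] := @geometric_cauchy (fun n => y_ n i s) (D * expR (4 * L * (b - a))).
  move=> m; rewrite -y_max -[X in _ - X]y_max; set t := Num.max s a.
  have tab : a <= t <= b by rewrite /t le_max lexx orbT/= ge_max sb ab.
  apply: (@le_trans _ _ (dist (y_ m.+1) (y_ m) t)).
    by rewrite /dist; case: i; rewrite (lerDl, lerDr).
  apply: (le_trans (H m t tab)).
  rewrite mulrAC ler_pM2r ?invr_gt0 ?exprn_gt0//.
  apply: ler_wpM2l => //; rewrite ler_expR ler_wpM2l ?mulr_ge0 ?(ltW L0)//.
  by case/andP: tab; lra.
by rewrite /y_oo (cvg_lim _ cl).
Qed.

Let y_oo_cont : cont y_oo.
Proof.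
move=> i; apply: (@local_uniform_limit_continuous (fun n => y_ n i)).
  by move=> n; exact: y_cont.
move=> x; exists (Num.max x a + 1).
  by rewrite ltr_pwDr// le_max lexx.
have [|C HC] := @y_ooP (Num.max x a + 1).
  by rewrite ler_wpDr// le_max lexx orbT.
by exists C => n y yb; exact: HC.
Qed.

Let y_oo_fix i s : a <= s -> y_oo i s = step y_oo i s.
Proof.
move=> as_; have [C HC] := y_ooP as_.
have [L L0 HL] := Flip s.
apply/eqP; rewrite -subr_eq0; apply/eqP.
(* Both sides are close to the iterate of index n + 1: the limit by convergence, its Picard image by
   contraction. *)
apply: (@le_pow2_eq0 _ (C + C * expR (4 * L * (s - a)))) => n.
have C0 : 0 <= C.
  by have := HC 0%N i s (lexx s); rewrite expr0 divr1; exact: le_trans.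
have := @step_contract s L (y_ n) y_oo (2 * (C / 2 ^+ n)) L0 HL (@y_cont n) (@y_oo_cont).
have K t : a <= t <= s ->
    dist (y_ n) y_oo t <= 2 * (C / 2 ^+ n) * expR (4 * L * (t - a)).
  move=> /andP[at_ ts]; apply: (@le_trans _ _ (2 * (C / 2 ^+ n))).
    by rewrite /dist; have := HC n true t ts; have := HC n false t ts; lra.
  rewrite ler_peMr ?mulr_ge0 ?divr_ge0 ?exprn_ge0// -expR0 ler_expR.
  by rewrite !mulr_ge0 ?subr_ge0 ?(ltW L0).
move=> /(_ K s); rewrite as_ lexx => /(_ isT) h.
have h1 : `|step (y_ n) i s - step y_oo i s| <= C / 2 ^+ n * expR (4 * L * (s - a)).
  apply: le_trans (le_trans h _); first by rewrite /dist; case: i; rewrite (lerDl, lerDr).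
  by rewrite le_eqVlt; apply/orP; left; apply/eqP; field; rewrite expf_neq0.
have h2 := HC n.+1 i s (lexx s).
have h3 : C / 2 ^+ n.+1 <= C / 2 ^+ n.
  rewrite ler_wpM2l// lef_pV2 ?posrE ?exprn_gt0// ler_eXn2l//.
  by rewrite ltr1n.
rewrite -[y_ n.+1 i s]/(step (y_ n) i s) in h2.
have -> : (C + C * expR (4 * L * (s - a))) / 2 ^+ n =
  C / 2 ^+ n + C / 2 ^+ n * expR (4 * L * (s - a)).
  by field; rewrite expf_neq0.
move: h1 h2; rewrite !ler_norml => /andP[? ?] /andP[? ?].
by apply/andP; split; lra.
Qed.

(** The Lipschitz constant may depend on the segment: on each one a weight adapted to its own
    constant gives the contraction, and the iterates do not depend on the segment. *)
Theorem picard_global : exists2 y : bool -> R -> R, (forall i, y i a = y0 i) &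
  forall i s, a <= s -> is_derive s 1 (y i) (F i s (y true s) (y false s)).
Proof.
(* The limit [y_oo] is frozen to the left of [a], hence need not be differentiable there. This
   function agrees with it from [a] on and has a two-sided derivative at [a]. *)
pose y i t := y0 i + primitive a (rhs y_oo i) t.
have yE i s : a <= s -> y i s = y_oo i s.
  by move=> as_; rewrite y_oo_fix// /step max_l.
exists y => i.
  by rewrite /y (primitiveP a (@rhs_cont _ (@y_oo_cont) i)).1 addr0.
move=> s as_; have [_ H] := primitiveP a (@rhs_cont _ (@y_oo_cont) i).
rewrite !yE//; have D := H s as_.
by rewrite /y; derE (by rewrite add0r).
Qed.

End Picard.

(** * Hyperbolic functions and the function [u0] *)

Section Hyperbolic.
Context {R : realType}.
Implicit Types (f : R -> R) (x : R).

Lemma der_sinh f a x : is_derive x 1 f a ->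
  is_derive x 1 (fun y => sinh (f y)) (cosh (f x) * a).
Proof. by move=> D; rewrite /sinh /cosh; derE lra. Qed.

Lemma der_cosh f a x : is_derive x 1 f a ->
  is_derive x 1 (fun y => cosh (f y)) (sinh (f x) * a).
Proof. by move=> D; rewrite /sinh /cosh; derE lra. Qed.

Lemma cosh_sqr x : cosh x ^+ 2 = 1 + sinh x ^+ 2.
Proof.
have := expRxMexpNx_1 x; rewrite /cosh /sinh.
by set p := expR x; set q := expR (- x) => e; nra.
Qed.

Lemma cosh_sub_sinh x : cosh x - sinh x = expR (- x).
Proof. by rewrite /cosh /sinh; lra. Qed.

Lemma cosh_add_sinh x : cosh x + sinh x = expR x.
Proof. by rewrite /cosh /sinh; lra. Qed.

Lemma cosh_gt0 x : 0 < cosh x.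
Proof. by rewrite /cosh divr_gt0// addr_gt0// expR_gt0. Qed.

Lemma sinh0 : sinh 0 = 0 :> R.
Proof. by rewrite /sinh oppr0 subrr mul0r. Qed.

Lemma cosh0 : cosh 0 = 1 :> R.
Proof. by rewrite /cosh oppr0 expR0; lra. Qed.

Lemma sinh_gt0 x : 0 < x -> 0 < sinh x.
Proof. by move=> x0; rewrite /sinh divr_gt0// subr_gt0 ltr_expR; lra. Qed.

Lemma sinh_lt_cosh x : sinh x < cosh x.
Proof. by rewrite -subr_gt0 cosh_sub_sinh expR_gt0. Qed.

Lemma cosh_ge1 x : 1 <= cosh x.
Proof.
have := cosh_sqr x; have := cosh_gt0 x; have := sqr_ge0 (sinh x); nra.
Qed.

End Hyperbolic.

Ltac der_special F ::= lazymatch F with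
  | fun y => sinh (@?f y) => notypeclasses refine (der_sinh _); der
  | fun y => cosh (@?f y) => notypeclasses refine (der_cosh _); der
  end.

Ltac pos_special ::= lazymatch goal with
  | |- is_true (_ < cosh _) => exact: cosh_gt0
  | |- is_true (_ < sinh _) => apply: sinh_gt0; pos
  | |- is_true (_ <= cosh _) => apply: ltW; exact: cosh_gt0
  | |- is_true (_ <= sinh _) => apply: ltW; apply: sinh_gt0; pos
  end.

(** * Bounds for [u0] and its derivative *)

Section Langevin.
Context {R : realType}.
Implicit Types (x s alpha kappa : R).

(** This is x coth x - 1, that is x times the classical Langevin function; [dlangevin] is its
    derivative for x > 0. *)
Definition langevin x : R := (x * cosh x - sinh x) / sinh x.
Definition dlangevin x : R := cosh x / sinh x - x / sinh x ^+ 2.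

(** Most bounds of this section compare two functions that agree at 0 through the sign of the
    derivative of their difference. *)
Let from0 (g dg : R -> R) x : g 0 = 0 -> 0 < x ->
  (forall y : R, is_derive y 1 g (dg y)) -> (forall y, 0 < y -> 0 < dg y) -> 0 < g x.
Proof.
move=> g0 x0 D H; rewrite -g0; apply: (@deriv_gt0_lt _ g dg) => // y.
by move=> /andP[/H].
Qed.

Lemma xcosh_gt_sinh x : 0 < x -> sinh x < x * cosh x.
Proof.
move=> x0; rewrite -subr_gt0.
apply: (@from0 (fun x => x * cosh x - sinh x) (fun x => x * sinh x)) => //.
- by rewrite sinh0 mul0r subrr.
- by move=> y; derE ring.
- by move=> y y0; rewrite mulr_gt0 ?sinh_gt0.
Qed.

Lemma langevin_gt0 x : 0 < x -> 0 < langevin x.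
Proof.
by move=> x0; rewrite divr_gt0 ?sinh_gt0// subr_gt0 xcosh_gt_sinh.
Qed.

Lemma langevin_lt x : 0 < x -> langevin x < x.
Proof.
move=> x0; rewrite /langevin ltr_pdivrMr ?sinh_gt0// -subr_gt0.
apply: (@from0 (fun x => x * sinh x - (x * cosh x - sinh x))
  (fun x => sinh x + x * (cosh x - sinh x))) => //.
- by rewrite sinh0 !mul0r !subrr.
- by move=> y; derE ring.
- by move=> y y0; rewrite addr_gt0 ?sinh_gt0// mulr_gt0// subr_gt0 sinh_lt_cosh.
Qed.

Lemma langevin_gt x : 0 < x -> x - 1 < langevin x.
Proof.
move=> x0; have sx := sinh_gt0 x0.
rewrite /langevin ltr_pdivlMr// mulrBl mul1r ltrD2r ltr_pM2l//.
exact: sinh_lt_cosh.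
Qed.

Lemma langevin_le_sqr x : 0 < x -> langevin x <= x ^+ 2.
Proof.
move=> x0; rewrite /langevin ler_pdivrMr ?sinh_gt0// -subr_ge0 ltW//.
apply: (@from0 (fun x => x ^+ 2 * sinh x - (x * cosh x - sinh x))
  (fun x => x * sinh x + x ^+ 2 * cosh x)) => //.
- by rewrite sinh0 expr0n/= !mul0r !subrr.
- by move=> y; derE ring.
- move=> y y0; rewrite addr_gt0// mulr_gt0// ?sinh_gt0 ?cosh_gt0//.
  by rewrite exprn_gt0.
Qed.

Lemma der_langevin x : 0 < x -> is_derive x 1 langevin (dlangevin x).
Proof.
move=> x0; have sx : sinh x != 0 by rewrite gt_eqF ?sinh_gt0.
rewrite /langevin /dlangevin; apply: der_eq; eexists; split; [der|]; first exact: sx.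
have e := cosh_sqr x; cbv beta; apply/eqP; rewrite -subr_eq0.
move: e sx; set S := sinh x; set C := cosh x => e sx.
rewrite [X in X == 0](_ : _ = x * (1 + S ^+ 2 - C ^+ 2) / S ^+ 2); last by field.
by rewrite e; apply/eqP; ring.
Qed.

Lemma dlangevin_gt0 x : 0 < x -> 0 < dlangevin x.
Proof.
move=> x0; have sx := sinh_gt0 x0.
have -> : dlangevin x = (sinh x * cosh x - x) / sinh x ^+ 2.
  by rewrite /dlangevin; field; rewrite gt_eqF.
rewrite divr_gt0 ?exprn_gt0//.
apply: (@from0 (fun x => sinh x * cosh x - x) (fun x => 2 * sinh x ^+ 2)) => //.
- by rewrite sinh0 mul0r subrr.
- by move=> y; derE (have := cosh_sqr y; nra).
- by move=> y y0; rewrite mulr_gt0// exprn_gt0// sinh_gt0.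
Qed.

Lemma dlangevin_lt1 x : 0 < x -> dlangevin x < 1.
Proof.
move=> x0; have sx := sinh_gt0 x0.
have -> : dlangevin x = (sinh x * cosh x - x) / sinh x ^+ 2.
  by rewrite /dlangevin; field; rewrite gt_eqF.
rewrite ltr_pdivrMr ?exprn_gt0// mul1r -subr_gt0.
apply: (@from0 (fun x => sinh x ^+ 2 - (sinh x * cosh x - x))
  (fun x => 2 * sinh x * (cosh x - sinh x))) => //.
- by rewrite sinh0 mul0r expr0n !subrr.
- by move=> y; derE (have := cosh_sqr y; nra).
- by move=> y y0; rewrite mulr_gt0 ?subr_gt0 ?sinh_lt_cosh// mulr_gt0 ?sinh_gt0.
Qed.

Lemma dlangevin_le x : 0 < x -> dlangevin x <= x.
Proof.
move=> x0; have sx := sinh_gt0 x0.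
have -> : dlangevin x = (sinh x * cosh x - x) / sinh x ^+ 2.
  by rewrite /dlangevin; field; rewrite gt_eqF.
rewrite ler_pdivrMr ?exprn_gt0// -subr_ge0 ltW//.
apply: (@from0 (fun x => x * sinh x ^+ 2 - (sinh x * cosh x - x))
  (fun x => sinh x * (x * cosh x - sinh x + x * cosh x))) => //.
- by rewrite sinh0 !mul0r !subrr.
- by move=> y; derE (have := cosh_sqr y; nra).
- move=> y y0; apply: mulr_gt0; first exact: sinh_gt0.
  apply: addr_gt0; first by rewrite subr_gt0 xcosh_gt_sinh.
  by apply: mulr_gt0 => //; exact: cosh_gt0.
Qed.

(** The slope of [u_star], and also of the asymptote c (s - 1/3) of |u0|. *)
Definition crit_slope alpha : R := 9 / 2 * `|alpha|.
Definition du0 alpha s : R := 9 / 2 * alpha * dlangevin (3 * s).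

Lemma crit_slope_gt0 alpha : alpha != 0 -> 0 < crit_slope alpha.
Proof. by move=> a0; rewrite /crit_slope mulr_gt0 ?normr_gt0//; lra. Qed.

Lemma crit_slope_sqr alpha : crit_slope alpha ^+ 2 = 81 / 4 * alpha ^+ 2.
Proof. by rewrite /crit_slope exprMn real_normK ?num_real//; field. Qed.

Lemma u0E alpha s : u0 alpha s = 3 / 2 * alpha * langevin (3 * s).
Proof. by []. Qed.

Lemma der_u0 alpha s : 0 < s -> is_derive s 1 (u0 alpha) (du0 alpha s).
Proof.
move=> s0; have s3 : 0 < 3 * s by lra.
have L : is_derive s 1 (fun y => langevin (3 * y)) (dlangevin (3 * s) * 3).
  have D3 : is_derive s 1 (fun y : R => 3 * y) 3 by derE ring.
  exact: (is_derive1_comp (der_langevin s3) D3).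
rewrite (_ : u0 alpha = fun y => 3 / 2 * alpha * langevin (3 * y)) //.
apply: der_eq; eexists; split.
  by notypeclasses refine (der_mul _ _); [exact: der_cst | exact: L].
by cbv beta; rewrite /du0; field.
Qed.

Lemma derive1_u0 alpha s : 0 < s -> derive1 (u0 alpha) s = du0 alpha s.
Proof. by move=> s0; apply: derive1_der; exact: der_u0. Qed.

Lemma u0_sqr alpha s :
  u0 alpha s ^+ 2 = crit_slope alpha ^+ 2 / 9 * langevin (3 * s) ^+ 2.
Proof. by rewrite u0E crit_slope_sqr; field. Qed.

Lemma u0_du0 alpha s : u0 alpha s * du0 alpha s =
  crit_slope alpha ^+ 2 / 3 * (langevin (3 * s) * dlangevin (3 * s)).
Proof. by rewrite u0E /du0 crit_slope_sqr; field. Qed.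

Lemma u0_sqr_lt alpha s : alpha != 0 -> 0 < s ->
  u0 alpha s ^+ 2 < crit_slope alpha ^+ 2 * s ^+ 2.
Proof.
move=> a0 s0; have s3 : 0 < 3 * s by lra.
have c0 : 0 < crit_slope alpha ^+ 2 by rewrite exprn_gt0 ?crit_slope_gt0.
rewrite u0_sqr -mulrA ltr_pM2l//.
by have := langevin_lt s3; have := langevin_gt0 s3; nra.
Qed.

Lemma u0_sqr_gt alpha s : alpha != 0 -> 3^-1 < s ->
  crit_slope alpha ^+ 2 * (s - 3^-1) ^+ 2 < u0 alpha s ^+ 2.
Proof.
move=> a0 s0; have s3 : 0 < 3 * s by lra.
have c0 : 0 < crit_slope alpha ^+ 2 by rewrite exprn_gt0 ?crit_slope_gt0.
rewrite u0_sqr -mulrA ltr_pM2l//.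
by have := langevin_gt s3; have := langevin_gt0 s3; nra.
Qed.

Lemma u0_du0_gt0 alpha s : alpha != 0 -> 0 < s -> 0 < u0 alpha s * du0 alpha s.
Proof.
move=> a0 s0; have s3 : 0 < 3 * s by lra.
rewrite u0_du0; apply: mulr_gt0.
  by rewrite divr_gt0 ?exprn_gt0 ?crit_slope_gt0.
by apply: mulr_gt0; [exact: langevin_gt0 | exact: dlangevin_gt0].
Qed.

Lemma u0_du0_le alpha s : alpha != 0 -> 0 < s ->
  u0 alpha s * du0 alpha s <= crit_slope alpha ^+ 2 * s.
Proof.
move=> a0 s0; have s3 : 0 < 3 * s by lra.
have c0 : 0 < crit_slope alpha ^+ 2 by rewrite exprn_gt0 ?crit_slope_gt0.
rewrite u0_du0 -mulrA ler_pM2l//.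
have := langevin_lt s3; have := langevin_gt0 s3.
by have := dlangevin_lt1 s3; have := dlangevin_gt0 s3; nra.
Qed.

Lemma u0_du0_le_cube alpha s : alpha != 0 -> 0 < s ->
  u0 alpha s * du0 alpha s <= 9 * crit_slope alpha ^+ 2 * s ^+ 3.
Proof.
move=> a0 s0; have s3 : 0 < 3 * s by lra.
have c0 : 0 < crit_slope alpha ^+ 2 by rewrite exprn_gt0 ?crit_slope_gt0.
have -> : 9 * crit_slope alpha ^+ 2 * s ^+ 3 =
  crit_slope alpha ^+ 2 / 3 * ((3 * s) ^+ 2 * (3 * s)) by field.
rewrite u0_du0 ler_pM2l ?divr_gt0//.
by rewrite ler_pM ?langevin_le_sqr ?dlangevin_le// ltW ?langevin_gt0 ?dlangevin_gt0.
Qed.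

Lemma u0_sqr_le_fourth alpha s : alpha != 0 -> 0 < s ->
  u0 alpha s ^+ 2 <= 9 * crit_slope alpha ^+ 2 * s ^+ 4.
Proof.
move=> a0 s0; have s3 : 0 < 3 * s by lra.
have c0 : 0 < crit_slope alpha ^+ 2 by rewrite exprn_gt0 ?crit_slope_gt0.
have -> : 9 * crit_slope alpha ^+ 2 * s ^+ 4 =
  crit_slope alpha ^+ 2 / 9 * ((3 * s) ^+ 2) ^+ 2 by field.
rewrite u0_sqr ler_pM2l ?divr_gt0// ler_sqr ?nnegrE ?sqr_ge0//.
  exact: langevin_le_sqr.
exact/ltW/langevin_gt0.
Qed.

Lemma V_gt0 kappa s : 0 < kappa -> 0 < s -> 0 < V kappa s.
Proof. by move=> k0 s0; rewrite /V mulr_gt0// sinh_gt0//; lra. Qed.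

Lemma der_V kappa s : is_derive s 1 (V kappa) (3 * kappa * cosh (3 * s)).
Proof. by rewrite /V; derE ring. Qed.

(* The logarithmic derivative of [V] is that of [sqrt (c^2 s^2 - u0^2)] times
   a factor that makes the ray of slope [c] an exact solution. *)
Lemma coth_identity alpha s : 0 < s ->
  3 * cosh (3 * s) / sinh (3 * s) *
    (crit_slope alpha ^+ 2 * s ^+ 2 - u0 alpha s ^+ 2)
  = crit_slope alpha ^+ 2 * s + u0 alpha s * du0 alpha s.
Proof.
move=> s0; have : sinh (3 * s) != 0 by rewrite gt_eqF// sinh_gt0//; lra.
rewrite u0_sqr u0_du0 /langevin /dlangevin.
have := cosh_sqr (3 * s); set S := sinh _; set C := cosh _ => e S0.
apply/eqP; rewrite -subr_eq0.
have -> : forall c : R, 3 * C / S * (c * s ^+ 2 - c / 9 * ((3 * s * C - S) / S) ^+ 2)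
   - (c * s + c / 3 * ((3 * s * C - S) / S * (C / S - 3 * s / S ^+ 2)))
   = c * s * (C ^+ 2 - 1 - S ^+ 2) * (S - 3 * s * C) / S ^+ 3 by move=> c; field.
by rewrite e; apply/eqP; ring.
Qed.

End Langevin.

(** * Comparison with rays *)

Section System.
Context {R : realType}.
Implicit Types (alpha kappa s x p l : R) (u phi : R -> R) (T : \bar R).

Definition rhs_u alpha kappa s x p : R :=
  2 * V kappa s ^+ 2 * expR (4 * p) / (x ^+ 2 - u0 alpha s ^+ 2).
Definition rhs_phi alpha s x : R :=
  - (u0 alpha s * du0 alpha s) / (x ^+ 2 - u0 alpha s ^+ 2).

Lemma rhs_u_gt0 alpha kappa s x p : 0 < kappa -> 0 < s ->
  u0 alpha s ^+ 2 < x ^+ 2 -> 0 < rhs_u alpha kappa s x p.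
Proof.
move=> k0 s0 h; rewrite divr_gt0 ?subr_gt0//.
by have V0 := V_gt0 k0 s0; pos.
Qed.

Lemma solvesP alpha kappa T u phi : 0 < kappa ->
  solves alpha kappa T u phi <->
  forall s, 0 < s -> (s%:E < T)%E ->
  [/\ 0 < u s, u0 alpha s ^+ 2 < u s ^+ 2,
      is_derive s 1 u (rhs_u alpha kappa s (u s) (phi s))
    & is_derive s 1 phi (rhs_phi alpha s (u s))].
Proof.
move=> k0; split=> H s s0 sT; have := H s s0 sT.
  move=> [us _ as_ du dphi]; split=> //; first by rewrite -subr_gt0.
  by rewrite /rhs_phi -derive1_u0.
move=> [us as_ du dphi]; split=> //.
- by rewrite (derive1_der du) rhs_u_gt0.
- by rewrite subr_gt0.
- by rewrite derive1_u0.
Qed.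

Definition zs_slope kappa p0 : R :=
  (18 * kappa ^+ 2) `^ (3^-1) * expR (4 / 3 * p0).

Lemma zs_slope_gt0 kappa p0 : 0 < kappa -> 0 < zs_slope kappa p0.
Proof.
by move=> k0; rewrite mulr_gt0 ?expR_gt0// powR_gt0// mulr_gt0 ?exprn_gt0.
Qed.

Lemma zs_slope_cube kappa p0 : 0 < kappa ->
  zs_slope kappa p0 ^+ 3 = 18 * kappa ^+ 2 * expR (4 * p0).
Proof.
move=> k0; rewrite exprMn -expRM_natl; congr (_ * expR _); last by field.
have h : 0 <= 18 * kappa ^+ 2 by rewrite mulr_ge0 ?sqr_ge0.
by rewrite -[LHS]powR_mulrn ?powR_ge0// -powRrM mulVf ?powRr1//.
Qed.

Lemma zs_slope_lt kappa p q : 0 < kappa ->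
  (zs_slope kappa p < zs_slope kappa q) = (p < q).
Proof.
move=> k0; rewrite ltr_pM2l ?powR_gt0 ?mulr_gt0 ?exprn_gt0// ltr_expR.
by rewrite ltr_pM2l.
Qed.

(** This is where the constant in [critical_dilaton] comes from: it solves 18 kappa^2 e^(4 phi) =
    c^3. *)
Lemma zs_slope_critical alpha kappa : alpha != 0 -> 0 < kappa ->
  zs_slope kappa (critical_dilaton alpha kappa) = crit_slope alpha.
Proof.
move=> a0 k0; have c0 := crit_slope_gt0 a0.
apply/eqP; rewrite -(@eqrXn2 _ 3)// ?ltW ?zs_slope_gt0// zs_slope_cube//.
have -> : 4 * critical_dilaton alpha kappa =
    3%:R * ln (crit_slope alpha) - 2%:R * ln (3 * Num.sqrt 2 * kappa).
  by rewrite /critical_dilaton /crit_slope; field.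
have r0 : 0 < Num.sqrt 2 :> R by rewrite sqrtr_gt0.
rewrite expRD expRN !expRM_natl !lnK ?posrE// ?mulr_gt0//.
rewrite !exprMn sqr_sqrtr//; apply/eqP; field.
by rewrite gt_eqF.
Qed.

(** The first-order data at the zero-section, which suffice for the comparison with rays and for
    uniqueness. Unlike smoothness they are immediate to check for the limit of an explicit
    formula. *)
Definition zero_data l p0 u phi : Prop :=
  forall e : R, 0 < e -> exists2 d : R, 0 < d & forall s, 0 < s < d ->
    `|u s / s - l| < e /\ `|phi s - p0| < e.

Lemma zs_zero_data alpha kappa p0 T u phi :
  zs_solution alpha kappa p0 T u phi ->
  zero_data (zs_slope kappa p0) p0 u phi.
Proof.
move=> [_ _ [e e0 [X [Y [sX sY X0 H]]]]] r r0.
have cX : {for 0, continuous X}.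
  apply/differentiable_continuous/derivable1_diffP.
  by apply: (sX 0%N); rewrite /= in_itv/= e0 oppr_lt0 e0.
have cY : {for 0, continuous (fun s => s ^+ 2 * Y s)}.
  have d : is_derive (0:R) 1 Y (derive1 Y 0).
    apply: derivable_der.
    by apply: (sY 0%N); rewrite /= in_itv/= e0 oppr_lt0 e0.
  by eapply der_cont; der.
move/cvgrPdist_lt: cX => /(_ r r0)/nbhs_ballP[d1 /= d10 H1].
move/cvgrPdist_lt: cY => /(_ r r0)/nbhs_ballP[d2 /= d20 H2].
exists (Num.min e (Num.min d1 d2)); first by rewrite !lt_min e0 d10 d20.
move=> s; rewrite !lt_min => /andP[s0 /and3P[se sd1 sd2]].
have [|-> ->] := H s; first by rewrite s0 se.
split.
  rewrite mulrAC mulfV ?gt_eqF// mul1r -[zs_slope _ _]X0 distrC; apply: H1.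
  by rewrite /ball/= sub0r normrN gtr0_norm.
have := H2 s; rewrite /ball/= sub0r normrN gtr0_norm// expr0n/= mul0r sub0r normrN.
by rewrite addrAC subrr add0r; exact.
Qed.

Lemma zero_data_unique l1 l2 p1 p2 u phi : zero_data l1 p1 u phi ->
  zero_data l2 p2 u phi -> l1 = l2 /\ p1 = p2.
Proof.
move=> H1 H2.
have K e : 0 < e -> `|l1 - l2| < e /\ `|p1 - p2| < e.
  move=> e0; have e2 : 0 < e / 2 by lra.
  have [d1 d10 h1] := H1 _ e2; have [d2 d20 h2] := H2 _ e2.
  pose s := Num.min d1 d2 / 2.
  have m0 : 0 < Num.min d1 d2 by rewrite lt_min d10 d20.
  have [m1 m2] : Num.min d1 d2 <= d1 /\ Num.min d1 d2 <= d2.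
    by rewrite !ge_min !lexx orbT.
  have [|a1 b1] := h1 s; first by rewrite /s; lra.
  have [|a2 b2] := h2 s; first by rewrite /s; lra.
  move: a1 b1 a2 b2; rewrite !ltr_norml.
  by move=> /andP[? ?] /andP[? ?] /andP[? ?] /andP[? ?]; split; apply/andP; split; lra.
split; apply/eqP; rewrite -subr_eq0 -normr_eq0; apply/negPn/negP;
  rewrite -normr_gt0 normr_id => h; have [h1 h2] := K _ h.
  by rewrite ltxx in h1.
by rewrite ltxx in h2.
Qed.

Lemma sinh_ge_id x : 0 < x -> x <= sinh x.
Proof.
move=> x0; have : 0 - 0 <= sinh x - x :> R.
  have -> : 0 - 0 = sinh 0 - 0 :> R by rewrite sinh0.
  apply: (@deriv_ge0_le _ (fun x => sinh x - x) (fun x => cosh x - 1)).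
  - exact: ltW.
  - by move=> y _; derE ring.
  - by move=> y _; rewrite subr_ge0 cosh_ge1.
by lra.
Qed.

Lemma V_ge kappa s : 0 < kappa -> 0 < s -> 3 * kappa * s <= V kappa s.
Proof.
move=> k0 s0; rewrite /V (_ : 3 * kappa * s = kappa * (3 * s)); last by ring.
rewrite ler_pM2l//.
by apply: sinh_ge_id; lra.
Qed.

Lemma V_le kappa s : 0 < kappa -> 0 < s ->
  V kappa s <= 3 * kappa * s * cosh (3 * s).
Proof.
move=> k0 s0; rewrite /V.
rewrite (_ : _ * cosh _ = kappa * (3 * s * cosh (3 * s))); last by ring.
rewrite ler_pM2l//.
by apply/ltW/xcosh_gt_sinh; lra.
Qed.

(** Eliminates q = coth(3s) by [coth_identity]: the defect of the ray of slope l as a solution has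
    the sign of l^2 - c^2. Throughout, x is s, k is u0 u0', m is u0^2. *)
Let ray_rate (c l x k m q : R) : 0 < x -> 0 <= k -> 0 <= m ->
  m < c ^+ 2 * x ^+ 2 -> 3 * q * (c ^+ 2 * x ^+ 2 - m) = c ^+ 2 * x + k ->
  (3 * q * (l ^+ 2 * x ^+ 2 - m) - (l ^+ 2 * x + k)) * (c ^+ 2 * x ^+ 2 - m) =
  (l ^+ 2 - c ^+ 2) * (x * m + k * x ^+ 2).
Proof. by move=> x0 k0 m0 mc Hq; rewrite mulrBl mulrAC Hq; ring. Qed.

(** Here y is u and w is 2 V^2 e^(4 phi). After collecting terms, each derivative is a multiple of
    its own function, bounded below through K, plus terms that are nonnegative while both u - l s
    and the gap are positive and l >= c. *)
Let ray_gap_ge (c l x k m q y w K : R) : 0 < c -> c <= l -> 0 < x -> 0 < k ->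
  0 <= m -> m < c ^+ 2 * x ^+ 2 -> m < y ^+ 2 -> 0 < y ->
  3 * q * (c ^+ 2 * x ^+ 2 - m) = c ^+ 2 * x + k ->
  l * (y + l * x) / (y ^+ 2 - m) <= K -> 4 * k / (y ^+ 2 - m) <= K ->
  0 < y - l * x -> 0 < w - l * (l ^+ 2 * x ^+ 2 - m) -> 0 <= q ->
  - K * (y - l * x) <= w / (y ^+ 2 - m) - l /\
  - K * (w - l * (l ^+ 2 * x ^+ 2 - m)) <=
    w * (6 * q + 4 * (- k / (y ^+ 2 - m))) - l * (2 * l ^+ 2 * x - 2 * k).
Proof.
move=> c0 cl x0 k0 m0 mc my y0 Hq HK1 HK2 dx Dx q0.
have l0 : 0 < l by lra.
have mc' : 0 < c ^+ 2 * x ^+ 2 - m by rewrite subr_gt0.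
have A0 : 0 < y ^+ 2 - m by rewrite subr_gt0.
have i0 : 0 < (y ^+ 2 - m)^-1 by rewrite invr_gt0.
have iA : (y ^+ 2 - m)^-1 * (y ^+ 2 - m) = 1 by rewrite mulVf ?gt_eqF.
have Al : l ^+ 2 * x ^+ 2 - m <= y ^+ 2 - m.
  rewrite lerD2r -exprMn ler_sqr ?nnegrE; [by lra | by pos | exact: ltW].
have qray : 0 <= 3 * q * (l ^+ 2 * x ^+ 2 - m) - (l ^+ 2 * x + k).
  rewrite -(pmulr_lge0 _ mc') (@ray_rate c l x k m q x0 (ltW k0) m0 mc Hq).
  apply: mulr_ge0; last by pos.
  by rewrite subr_ge0 ler_sqr ?nnegrE; lra.
move: (_^-1) i0 iA HK1 HK2 => i i0 iA HK1 HK2; split.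
  have -> : w * i - l = (w - l * (l ^+ 2 * x ^+ 2 - m)) * i
     - (l * (y + l * x) * i) * (y - l * x) + l * (i * (y ^+ 2 - m) - 1) by ring.
  rewrite iA subrr mulr0 addr0.
  have := mulr_gt0 Dx i0; have := ler_pM2r dx (l * (y + l * x) * i) K.
  by rewrite HK1 mulNr; lra.
have -> : w * (6 * q + 4 * (- k * i)) - l * (2 * l ^+ 2 * x - 2 * k) =
  (w - l * (l ^+ 2 * x ^+ 2 - m)) * (6 * q - 4 * k * i)
  + 2 * l * (3 * q * (l ^+ 2 * x ^+ 2 - m) - (l ^+ 2 * x + k))
  + 4 * l * k * i * ((y ^+ 2 - m) - (l ^+ 2 * x ^+ 2 - m))
  + 4 * l * k * (1 - i * (y ^+ 2 - m)) by ring.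
rewrite iA subrr mulr0 addr0.
have t3 : 0 <= 4 * l * k * i * ((y ^+ 2 - m) - (l ^+ 2 * x ^+ 2 - m)).
  by apply: mulr_ge0; [pos | rewrite subr_ge0].
have t2 : 0 <= 2 * l * (3 * q * (l ^+ 2 * x ^+ 2 - m) - (l ^+ 2 * x + k)) by pos.
have t1 : - K * (w - l * (l ^+ 2 * x ^+ 2 - m)) <=
    (w - l * (l ^+ 2 * x ^+ 2 - m)) * (6 * q - 4 * k * i).
  by rewrite mulrC ler_pM2l//; lra.
by lra.
Qed.

Let ray_gap_le (c l x k m q y w K : R) : 0 < l -> l <= c -> 0 < x -> 0 < k ->
  0 <= m -> m < c ^+ 2 * x ^+ 2 -> m < y ^+ 2 -> 0 < y ->
  3 * q * (c ^+ 2 * x ^+ 2 - m) = c ^+ 2 * x + k ->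
  l * (y + l * x) / (y ^+ 2 - m) <= K -> 4 * k / (y ^+ 2 - m) <= K ->
  0 < l * x - y -> 0 < l * (l ^+ 2 * x ^+ 2 - m) - w -> 0 <= q ->
  - K * (l * x - y) <= l - w / (y ^+ 2 - m) /\
  - K * (l * (l ^+ 2 * x ^+ 2 - m) - w) <=
    - (w * (6 * q + 4 * (- k / (y ^+ 2 - m))) - l * (2 * l ^+ 2 * x - 2 * k)).
Proof.
move=> l0 lc x0 k0 m0 mc my y0 Hq HK1 HK2 dx Dx q0.
have mc' : 0 < c ^+ 2 * x ^+ 2 - m by rewrite subr_gt0.
have A0 : 0 < y ^+ 2 - m by rewrite subr_gt0.
have i0 : 0 < (y ^+ 2 - m)^-1 by rewrite invr_gt0.
have iA : (y ^+ 2 - m)^-1 * (y ^+ 2 - m) = 1 by rewrite mulVf ?gt_eqF.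
have Al : y ^+ 2 - m <= l ^+ 2 * x ^+ 2 - m.
  by rewrite lerD2r -exprMn ler_sqr ?nnegrE; [lra | exact: ltW | pos].
have qray : 3 * q * (l ^+ 2 * x ^+ 2 - m) - (l ^+ 2 * x + k) <= 0.
  rewrite -(pmulr_lle0 _ mc') (@ray_rate c l x k m q x0 (ltW k0) m0 mc Hq).
  apply: mulr_le0_ge0; last by pos.
  by rewrite subr_le0 ler_sqr ?nnegrE; lra.
move: (_^-1) i0 iA HK1 HK2 => i i0 iA HK1 HK2; split.
  have -> : l - w * i = (l * (l ^+ 2 * x ^+ 2 - m) - w) * i
     - (l * (y + l * x) * i) * (l * x - y) + l * (1 - i * (y ^+ 2 - m)) by ring.
  rewrite iA subrr mulr0 addr0.
  have := mulr_gt0 Dx i0; have := ler_pM2r dx (l * (y + l * x) * i) K.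
  by rewrite HK1 mulNr; lra.
have -> : - (w * (6 * q + 4 * (- k * i)) - l * (2 * l ^+ 2 * x - 2 * k)) =
  (l * (l ^+ 2 * x ^+ 2 - m) - w) * (6 * q - 4 * k * i)
  + 2 * l * ((l ^+ 2 * x + k) - 3 * q * (l ^+ 2 * x ^+ 2 - m))
  + 4 * l * k * i * ((l ^+ 2 * x ^+ 2 - m) - (y ^+ 2 - m))
  + 4 * l * k * (i * (y ^+ 2 - m) - 1) by ring.
rewrite iA subrr mulr0 addr0.
have t3 : 0 <= 4 * l * k * i * ((l ^+ 2 * x ^+ 2 - m) - (y ^+ 2 - m)).
  by apply: mulr_ge0; [pos | rewrite subr_ge0].
have t2 : 0 <= 2 * l * ((l ^+ 2 * x + k) - 3 * q * (l ^+ 2 * x ^+ 2 - m)).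
  by apply: mulr_ge0; [pos | lra].
have t1 : - K * (l * (l ^+ 2 * x ^+ 2 - m) - w) <=
    (l * (l ^+ 2 * x ^+ 2 - m) - w) * (6 * q - 4 * k * i).
  by rewrite mulrC ler_pM2l//; lra.
by lra.
Qed.

(* [u - l s] and [ray_gap l] vanish identically on a solution with [u = l s];
   they have the advantage over [phi] of being defined also where the ray
   leaves the region [u0^2 < u^2]. *)
Definition ray_gap alpha kappa l phi s : R :=
  2 * V kappa s ^+ 2 * expR (4 * phi s)
  - l * (l ^+ 2 * s ^+ 2 - u0 alpha s ^+ 2).

Let dgap alpha kappa l phi s x : R := 2 * V kappa s ^+ 2 * expR (4 * phi s) *
    (6 * (cosh (3 * s) / sinh (3 * s)) + 4 * x)
  - l * (2 * l ^+ 2 * s - 2 * (u0 alpha s * du0 alpha s)).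

Let der_gap alpha kappa l phi s x : 0 < s -> is_derive s 1 phi x ->
  is_derive s 1 (ray_gap alpha kappa l phi) (dgap alpha kappa l phi s x).
Proof.
move=> s0 dphi; have d2 := der_u0 alpha s0; have dV := der_V kappa s.
have S0 : sinh (3 * s) != 0 by rewrite gt_eqF// sinh_gt0//; lra.
rewrite /ray_gap /dgap; derE idtac; rewrite /V.
by move: (u0 _ _) (du0 _ _) => y z; field.
Qed.

(** The equations are demanded only where u lies above the ray. This lets the lemma apply both to
    true solutions and to the truncated system, which coincides with the true one there once the
    dilaton truncation is known to be inactive. *)
Lemma ray_persist alpha kappa l u phi du dphi b1 b2 : alpha != 0 ->
  crit_slope alpha <= l -> 0 < b1 -> b1 <= b2 ->
  (forall s, b1 <= s <= b2 -> is_derive s 1 u (du s)) ->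
  (forall s, b1 <= s <= b2 -> is_derive s 1 phi (dphi s)) ->
  (forall s, b1 <= s <= b2 -> l * s < u s ->
    du s = rhs_u alpha kappa s (u s) (phi s) /\ dphi s = rhs_phi alpha s (u s)) ->
  l * b1 < u b1 -> 0 < ray_gap alpha kappa l phi b1 ->
  l * b2 < u b2 /\ 0 < ray_gap alpha kappa l phi b2.
Proof.
move=> a0 cl b10 b12 Du Dphi H ub1 gb1.
have c0 := crit_slope_gt0 a0; have l0 : 0 < l by lra.
have pos s : b1 <= s <= b2 -> 0 < s by move=> /andP[? _]; lra.
have mc s : b1 <= s <= b2 -> 0 < crit_slope alpha ^+ 2 * s ^+ 2 - u0 alpha s ^+ 2.
  by move=> /pos s0; rewrite subr_gt0 u0_sqr_lt.
(* The coefficients are bounded with the denominator of the critical ray, positive for all s > 0;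
   above the ray of slope l >= c the true denominator is larger. *)
have [K1 K10 H1] : exists2 K, 0 <= K & forall s, b1 <= s <= b2 ->
    `|l * (u s + l * s) / (crit_slope alpha ^+ 2 * s ^+ 2 - u0 alpha s ^+ 2)| <= K.
  apply: segment_bounded => // s sb; have s0 := pos s sb.
  have d1 := Du s sb; have d2 := der_u0 alpha s0.
  by eapply der_cont; der; rewrite gt_eqF// mc.
have [K2 K20 H2] : exists2 K, 0 <= K & forall s, b1 <= s <= b2 ->
    `|(crit_slope alpha ^+ 2 * s ^+ 2 - u0 alpha s ^+ 2)^-1| <= K.
  apply: segment_bounded => // s sb; have s0 := pos s sb.
  have d2 := der_u0 alpha s0.
  by eapply der_cont; der; rewrite gt_eqF// mc.
pose K3 := 4 * (crit_slope alpha ^+ 2 * b2) * K2.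
suff [] : 0 < u b2 - l * b2 /\ 0 < ray_gap alpha kappa l phi b2.
  by rewrite subr_gt0.
apply: (@coupled_gt0 R (fun x => u x - l * x) (ray_gap alpha kappa l phi)
  (fun x => du x - l) (fun x => dgap alpha kappa l phi x (dphi x))
  b1 b2 (Num.max K1 K3) b12).
- move=> x xb; have d1 := Du x xb; derE ring.
- by move=> x xb; apply: der_gap; [exact: pos | exact: Dphi].
- by rewrite subr_gt0.
- by [].
- move=> x xb dx; have x0 := pos x xb.
  have lx : l * x < u x by rewrite -subr_gt0.
  have [-> ->] := H x xb lx.
  have mc' := mc x xb; have m0 : 0 <= u0 alpha x ^+ 2 := sqr_ge0 _.
  have ux : 0 < u x by apply: lt_trans lx; rewrite mulr_gt0.
  have cx : crit_slope alpha * x <= u x.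
    by apply: le_trans (ltW lx); rewrite ler_pM2r.
  have Al : crit_slope alpha ^+ 2 * x ^+ 2 - u0 alpha x ^+ 2 <=
      u x ^+ 2 - u0 alpha x ^+ 2.
    by rewrite lerD2r -exprMn ler_sqr ?nnegrE ?(ltW ux)// mulr_ge0 ?ltW.
  have iA : (u x ^+ 2 - u0 alpha x ^+ 2)^-1 <=
      (crit_slope alpha ^+ 2 * x ^+ 2 - u0 alpha x ^+ 2)^-1.
    by rewrite lef_pV2 ?posrE//; apply: lt_le_trans Al.
  have i0 : 0 <= (u x ^+ 2 - u0 alpha x ^+ 2)^-1.
    by rewrite invr_ge0; apply: le_trans Al; exact: ltW.
  move=> Dx; rewrite /rhs_u /dgap /rhs_phi.
  apply: (@ray_gap_ge (crit_slope alpha)) => //.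
  - exact: u0_du0_gt0.
  - exact: u0_sqr_lt.
  - by rewrite -subr_gt0; apply: lt_le_trans Al.
  - by rewrite -coth_identity// mulrA.
  - rewrite le_max; apply/orP; left; apply: le_trans (le_trans (ler_norm _) (H1 x xb)).
    apply: ler_wpM2l => //; apply: mulr_ge0; first exact: ltW.
    by apply: addr_ge0; [exact: ltW | apply: mulr_ge0; exact: ltW].
  - rewrite le_max; apply/orP; right; apply: ler_pM => //.
      by apply: mulr_ge0 => //; exact/ltW/u0_du0_gt0.
      rewrite ler_pM2l//; apply: (le_trans (u0_du0_le a0 x0)).
      by rewrite ler_pM2l ?exprn_gt0//; case/andP: xb.
    by apply: (le_trans iA); exact: le_trans (ler_norm _) (H2 x xb).
  - by apply: mulr_ge0; [exact/ltW/cosh_gt0 | rewrite invr_ge0; apply/ltW/sinh_gt0; lra].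
Qed.

Variables (alpha kappa : R) (T : \bar R) (u phi : R -> R) (l0 p0 : R).
Hypotheses (a0 : alpha != 0) (k0 : 0 < kappa).
Hypotheses (sol : solves alpha kappa T u phi) (zd : zero_data l0 p0 u phi).
Hypotheses (l00 : 0 < l0) (l0E : l0 ^+ 3 = 18 * kappa ^+ 2 * expR (4 * p0)).

Let c := crit_slope alpha.

Let solP := (solvesP alpha T u phi k0).1 sol.

Lemma exists_below d s : 0 < d -> 0 < s -> exists2 r : R, 0 < r < d & r <= s.
Proof.
move=> d0 s0; exists (Num.min d s / 2).
  have : 0 < Num.min d s by rewrite lt_min d0.
  have : Num.min d s <= d by rewrite ge_min lexx.
  by move=> ? ?; apply/andP; split; lra.
have : 0 < Num.min d s by rewrite lt_min d0.
have : Num.min d s <= s by rewrite ge_min lexx orbT.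
by lra.
Qed.

Let gap l s := ray_gap alpha kappa l phi s.

Let gap_bound l b1 b2 : 0 < b1 -> b1 <= b2 -> (b2%:E < T)%E ->
  exists K, forall s, b1 <= s <= b2 ->
    l * (u s + l * s) / (u s ^+ 2 - u0 alpha s ^+ 2) <= K /\
    4 * (u0 alpha s * du0 alpha s) / (u s ^+ 2 - u0 alpha s ^+ 2) <= K.
Proof.
move=> b10 b12 b2T.
have inT s : b1 <= s <= b2 -> 0 < s /\ (s%:E < T)%E.
  move=> /andP[h1 h2]; split; first by lra.
  by apply: le_lt_trans b2T; rewrite lee_fin.
have [K1 _ H1] : exists2 K, 0 <= K & forall s, b1 <= s <= b2 ->
    `|l * (u s + l * s) / (u s ^+ 2 - u0 alpha s ^+ 2)| <= K.
  apply: segment_bounded => // s /inT[s0 sT].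
  have [us as_ du _] := solP s0 sT; have d2 := der_u0 alpha s0.
  by eapply der_cont; der; rewrite gt_eqF// subr_gt0.
have [K2 _ H2] : exists2 K, 0 <= K & forall s, b1 <= s <= b2 ->
    `|(u s ^+ 2 - u0 alpha s ^+ 2)^-1| <= K.
  apply: segment_bounded => // s /inT[s0 sT].
  have [us as_ du _] := solP s0 sT; have d2 := der_u0 alpha s0.
  by eapply der_cont; der; rewrite gt_eqF// subr_gt0.
exists (Num.max K1 (4 * (crit_slope alpha ^+ 2 * b2) * K2)) => s sb.
have [s0 sT] := inT s sb; split.
  by rewrite le_max (le_trans (ler_norm _) (H1 s sb)).
rewrite le_max; apply/orP; right.
have [us as_ _ _] := solP s0 sT.
have i0 : 0 < (u s ^+ 2 - u0 alpha s ^+ 2)^-1 by rewrite invr_gt0 subr_gt0.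
have h2 : (u s ^+ 2 - u0 alpha s ^+ 2)^-1 <= K2 := le_trans (ler_norm _) (H2 s sb).
rewrite ler_pM ?(ltW i0)//; first by rewrite mulr_ge0 ?ltW ?u0_du0_gt0.
rewrite ler_pM2l//; apply: (le_trans (u0_du0_le a0 s0)).
by rewrite ler_pM2l ?exprn_gt0 ?crit_slope_gt0//; case/andP: sb.
Qed.

(** Close to s = 0 both u - l s and the gap are positive, because u/s tends to l0 > l and V >= 3
    kappa s; [ray_persist] propagates this. *)
Lemma ray_lt l s : c <= l -> l < l0 -> 0 < s -> (s%:E < T)%E ->
  l * s < u s /\ 0 < ray_gap alpha kappa l phi s.
Proof.
move=> cl ll0 s0 sT.
have c0 : 0 < c := crit_slope_gt0 a0.
have lp : 0 < l by lra.
(* Chosen with 4 e = 3 ln(l0 / l), so that phi > p0 - e gives l0^3 e^(4 (phi - p0)) > l^3. *)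
pose e := - (3 / 4 * ln (l / l0)).
have e0 : 0 < e.
  rewrite oppr_gt0 pmulr_rlt0; last by lra.
  by rewrite ln_lt0// divr_gt0//= ltr_pdivrMr// mul1r.
have m0 : 0 < Num.min e (l0 - l) by rewrite lt_min e0 subr_gt0.
have [d d0 Hd] := zd m0.
have [r rd rs] := exists_below d0 s0; have r0 : 0 < r by case/andP: rd.
have [] := Hd r rd; rewrite !lt_min => /andP[_ h1] /andP[h2 _].
have rT : (r%:E < T)%E by apply: le_lt_trans sT; rewrite lee_fin.
have inT x : r <= x <= s -> 0 < x /\ (x%:E < T)%E.
  move=> /andP[h3 h4]; split; first by lra.
  by apply: le_lt_trans sT; rewrite lee_fin.
apply: (@ray_persist alpha kappa l u phi
  (fun x => rhs_u alpha kappa x (u x) (phi x)) (fun x => rhs_phi alpha x (u x)) r) => //.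
- by move=> x /inT[x0 xT]; case: (solP x0 xT).
- by move=> x /inT[x0 xT]; case: (solP x0 xT).
- move: h1; rewrite ltr_norml => /andP[h1 _].
  have : l < u r / r by lra.
  by rewrite ltr_pdivlMr.
- have q0 : 0 <= u0 alpha r ^+ 2 := sqr_ge0 _.
  have : l ^+ 3 * r ^+ 2 < 2 * V kappa r ^+ 2 * expR (4 * phi r); last first.
    have q1 := mulr_ge0 (ltW lp) q0; move=> h; rewrite /ray_gap subr_gt0.
    rewrite (_ : l * _ = l ^+ 3 * r ^+ 2 - l * u0 alpha r ^+ 2); last by ring.
    by lra.
  apply: (@lt_le_trans _ _ (18 * kappa ^+ 2 * r ^+ 2 * expR (4 * phi r))).
    have -> : 18 * kappa ^+ 2 * r ^+ 2 * expR (4 * phi r) =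
      l0 ^+ 3 * expR (4 * (phi r - p0)) * r ^+ 2.
      by rewrite l0E mulrBr expRD expRN; field; rewrite gt_eqF// expR_gt0.
    rewrite ltr_pM2r ?exprn_gt0// -ltr_pdivrMl ?exprn_gt0//.
    have -> : (l0 ^+ 3)^-1 * l ^+ 3 = expR (3%:R * ln (l / l0)).
      rewrite expRM_natl lnK ?posrE ?divr_gt0// exprMn exprVn mulrC//.
    by rewrite ltr_expR; move: h2; rewrite ltr_norml /e => /andP[]; lra.
  rewrite ler_pM2r ?expR_gt0//.
  have := V_ge k0 r0; have : 0 < 3 * kappa * r by rewrite !mulr_gt0.
  by move=> h3 h4; nra.
Qed.

Lemma lt_ray l s : l0 < l -> l <= c -> 0 < s -> (s%:E < T)%E -> u s < l * s.
Proof.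
move=> ll0 lc s0 sT.
have c0 : 0 < c := crit_slope_gt0 a0.
have lp : 0 < l := lt_trans l00 ll0.
(* Half of the available room: 4 e = (3/2) ln(l / l0) leaves a factor (l / l0)^(3/2) to absorb
   cosh^2, from the upper bound of V, and the term with u0^2. *)
pose e := 3 / 8 * ln (l / l0).
have e0 : 0 < e.
  apply: mulr_gt0; first by lra.
  by apply: ln_gt0; rewrite ltr_pdivlMr ?mul1r.
have m0 : 0 < Num.min e (l - l0) by rewrite lt_min e0 subr_gt0.
have [d d0 Hd] := zd m0.
(* Up to a factor x^2, a lower bound for minus the gap near 0, obtained from V <= 3 kappa x cosh(3x)
   and u0^2 <= 9 c^2 x^4. *)
pose q x := l * (l ^+ 2 - 9 * c ^+ 2 * x ^+ 2)
  - l0 ^+ 3 * expR (4 * e) * cosh (3 * x) ^+ 2.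
have [d' d'0 Hd'] : exists2 d' : R, 0 < d' & forall y, `|y - 0| < d' -> 0 < q y.
  apply: cont_pos_near; first by rewrite /q; eapply der_cont; der.
  rewrite /q !mulr0 expr0n/= !mulr0 cosh0 expr1n mulr1 subr0 -exprS.
  rewrite subr_gt0 mulrC -ltr_pdivlMr ?exprn_gt0//.
  have -> : l ^+ 3 / l0 ^+ 3 = expR (3%:R * ln (l / l0)).
    by rewrite expRM_natl lnK ?posrE ?divr_gt0// expr_div_n.
  by rewrite ltr_expR; move: e0; rewrite /e; lra.
have dd0 : 0 < Num.min d d' by rewrite lt_min d0 d'0.
have [r] := exists_below dd0 s0; rewrite lt_min => /and3P[r0 rd rd'] rs.
have /Hd' qr : `|r - 0| < d' by rewrite subr0 gtr0_norm.
have [] := Hd r; first by rewrite r0.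
rewrite !lt_min => /andP[_ h1] /andP[h2 _].
have rT : (r%:E < T)%E by apply: le_lt_trans sT; rewrite lee_fin.
have [K HK] := @gap_bound l r s r0 rs sT.
have inT x : r <= x <= s -> 0 < x /\ (x%:E < T)%E.
  move=> /andP[h3 h4]; split; first by lra.
  by apply: le_lt_trans sT; rewrite lee_fin.
suff [] : 0 < l * s - u s /\ 0 < - gap l s by rewrite subr_gt0.
apply: (@coupled_gt0 R (fun x => l * x - u x) (fun x => - gap l x)
  (fun x => l - rhs_u alpha kappa x (u x) (phi x)) (fun x => - dgap alpha kappa l phi x (rhs_phi alpha x (u x))) r s K rs).
- move=> x /inT[x0 xT]; have [_ _ du _] := solP x0 xT.
  derE (move: (rhs_u _ _ _ _ _) => y; ring).
- move=> x /inT[x0 xT]; have [_ _ _ dp] := solP x0 xT.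
  by have D := der_gap alpha kappa l x0 dp; derE by [].
- move: h1; rewrite ltr_norml => /andP[_ h1].
  have : u r / r < l by lra.
  by rewrite ltr_pdivrMr// subr_gt0.
- rewrite /gap /ray_gap opprB subr_gt0.
  apply: (@le_lt_trans _ _ (l0 ^+ 3 * expR (4 * e) * cosh (3 * r) ^+ 2 * r ^+ 2)).
    apply: (@le_trans _ _ (18 * kappa ^+ 2 * expR (4 * phi r) * cosh (3 * r) ^+ 2 * r ^+ 2)).
      have V1 := V_le k0 r0; have V2 := V_gt0 k0 r0.
      have -> : 18 * kappa ^+ 2 * expR (4 * phi r) * cosh (3 * r) ^+ 2 * r ^+ 2 =
        2 * (3 * kappa * r * cosh (3 * r)) ^+ 2 * expR (4 * phi r) by ring.
      rewrite ler_pM2r ?expR_gt0// ler_pM2l// ler_sqr ?nnegrE//; first exact: ltW.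
      by pos.
    rewrite ler_pM2r ?exprn_gt0// ler_pM2r ?exprn_gt0 ?cosh_gt0// l0E.
    rewrite -[_ * expR (4 * e)]mulrA -expRD.
    rewrite ler_pM2l; last by pos.
    by rewrite ler_expR; move: h2; rewrite ltr_norml => /andP[]; lra.
  have := u0_sqr_le_fourth a0 r0; rewrite -/c => u4.
  apply: (@lt_le_trans _ _ (l * (l ^+ 2 - 9 * c ^+ 2 * r ^+ 2) * r ^+ 2)).
    by rewrite ltr_pM2r ?exprn_gt0// -subr_gt0.
  rewrite -mulrA ler_pM2l// mulrBl lerD2l lerN2; apply: (le_trans u4).
  by rewrite le_eqVlt; apply/orP; left; apply/eqP; ring.
- move=> x xrs; have [x0 xT] := inT x xrs; have [ux ax du dp] := solP x0 xT.
  have [K1 K2] := HK x xrs.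
  move=> dx; rewrite /rhs_u /dgap /gap /ray_gap /rhs_phi opprB => Dx.
  apply: (@ray_gap_le c) => //; first exact: u0_du0_gt0.
  - exact: sqr_ge0.
  - exact: u0_sqr_lt.
  - by rewrite -coth_identity// mulrA.
  - by pos.
Qed.

(** Take l strictly between l0 and c. Then u < l s, whereas u > |u0| > c (s - 1/3) for s > 1/3,
    which is impossible where the two lines meet. *)
Lemma subcritical_bounded : l0 < c -> exists B : R, (T <= B%:E)%E.
Proof.
move=> lc; pose l := (l0 + c) / 2; have c0 : 0 < c := crit_slope_gt0 a0.
have [l1 l2] : l0 < l /\ l < c by rewrite /l; split; lra.
have lp : 0 < l := lt_trans l00 l1.
(* The abscissa at which c (s - 1/3) = l s. *)
exists (c / (3 * (c - l))); rewrite leNgt; apply/negP => BT.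
have B0 : 3^-1 < c / (3 * (c - l)).
  rewrite ltr_pdivlMr; last by lra.
  by rewrite (_ : 3^-1 * (3 * (c - l)) = c - l); [lra | field].
have B1 : 0 < c / (3 * (c - l)) by apply: lt_trans B0.
have [uB aB _ _] := solP B1 BT.
have h1 := lt_ray l1 (ltW l2) B1 BT.
have h2 := u0_sqr_gt a0 B0.
set B := c / (3 * (c - l)) in B0 B1 uB aB h1 h2.
have BE : c * (B - 3^-1) = l * B by rewrite /B; field; rewrite subr_eq0 gt_eqF.
move: h2; rewrite -/c -exprMn BE; nra.
Qed.

End System.

(** * Uniqueness and the critical solution *)

Section Uniqueness.
Context {R : realType}.
Implicit Types (alpha kappa s x p l : R) (u phi : R -> R) (T : \bar R).

Lemma solves_le alpha kappa T T' u phi : (T <= T')%E ->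
  solves alpha kappa T' u phi -> solves alpha kappa T u phi.
Proof. by move=> TT' H s s0 sT; apply: H => //; apply: lt_le_trans TT'. Qed.

Lemma ereal_exists_below d T : 0 < d -> (0 < T)%E ->
  exists2 r : R, 0 < r < d & (r%:E < T)%E.
Proof.
case: T => [t||]// d0; rewrite ?lte_fin => t0.
  have [r rd rt] := exists_below d0 t0.
  by exists (r / 2); [lra | rewrite lte_fin; lra].
by exists (d / 2); [lra | rewrite ltry].
Qed.

Lemma zero_data_extends l p T u phi T' u' phi' : (0 < T)%E ->
  extends T u phi T' u' phi' -> zero_data l p u phi -> zero_data l p u' phi'.
Proof.
move=> T0 [_ H] zd e e0; have [d d0 Hd] := zd e e0.
have [r /andP[r0 rd] rT] := ereal_exists_below d0 T0.
exists r => // s /andP[s0 sr]; have [|-> ->] := H s s0.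
  by apply: lt_trans rT; rewrite lte_fin.
by apply: Hd; lra.
Qed.

Lemma expR_lipschitz M x y : x <= M -> y <= M ->
  `|expR x - expR y| <= expR M * `|x - y|.
Proof.
wlog yx : x y / y <= x.
  move=> H xM yM; have [|/ltW xy] := leP y x; first by move=> ?; exact: H.
  by rewrite distrC [`|x - y|]distrC; exact: H.
move=> xM yM; rewrite !ger0_norm ?subr_ge0 ?ler_expR//.
apply: (@le_trans _ _ (expR x * (x - y))).
  have -> : expR y = expR x * expR (y - x) by rewrite -expRD; congr expR; ring.
  have := expR_ge1Dx (y - x); have := expR_gt0 x; nra.
by rewrite ler_wpM2r ?subr_ge0// ler_expR.
Qed.

Section TwoSolutions.
Variables (alpha kappa : R) (T : \bar R) (u1 phi1 u2 phi2 : R -> R).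
Hypotheses (a0 : alpha != 0) (k0 : 0 < kappa).
Hypotheses (sol1 : solves alpha kappa T u1 phi1).
Hypotheses (sol2 : solves alpha kappa T u2 phi2).

Let s1 := (solvesP alpha T u1 phi1 k0).1 sol1.
Let s2 := (solvesP alpha T u2 phi2 k0).1 sol2.
Let A1 s := u1 s ^+ 2 - u0 alpha s ^+ 2.
Let A2 s := u2 s ^+ 2 - u0 alpha s ^+ 2.

Let inT r s x : 0 < r -> (s%:E < T)%E -> r <= x <= s -> 0 < x /\ (x%:E < T)%E.
Proof.
move=> r0 sT /andP[h3 h4]; split; first by lra.
by apply: le_lt_trans sT; rewrite lee_fin.
Qed.

Let k1 s := (u0 alpha s * du0 alpha s) * (u1 s + u2 s) / (A1 s * A2 s).
Let k2 M s := 8 * V kappa s ^+ 2 * expR (4 * M) / A1 s.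

Let dD s : 0 < s -> (s%:E < T)%E ->
  rhs_phi alpha s (u2 s) - rhs_phi alpha s (u1 s) = k1 s * (u2 s - u1 s).
Proof.
move=> s0 sT; have [_ a1 _ _] := s1 s0 sT; have [_ a2 _ _] := s2 s0 sT.
rewrite /rhs_phi /k1 /A1 /A2; field.
by rewrite !gt_eqF// subr_gt0.
Qed.

Let du_le s M : 0 < s -> (s%:E < T)%E -> phi1 s <= M -> phi2 s <= M ->
  (rhs_u alpha kappa s (u2 s) (phi2 s) - rhs_u alpha kappa s (u1 s) (phi1 s))
    * (u2 s - u1 s) <= k2 M s * (`|phi2 s - phi1 s| * `|u2 s - u1 s|).
Proof.
move=> s0 sT M1 M2; have [p1 a1 _ _] := s1 s0 sT; have [p2 a2 _ _] := s2 s0 sT.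
have B1 : 0 < A1 s by rewrite subr_gt0.
have B2 : 0 < A2 s by rewrite subr_gt0.
have -> : (rhs_u alpha kappa s (u2 s) (phi2 s) - rhs_u alpha kappa s (u1 s) (phi1 s))
    * (u2 s - u1 s) =
  2 * V kappa s ^+ 2 / A1 s * ((expR (4 * phi2 s) - expR (4 * phi1 s)) * (u2 s - u1 s))
  - 2 * V kappa s ^+ 2 * expR (4 * phi2 s) * (u1 s + u2 s) / (A1 s * A2 s)
    * (u2 s - u1 s) ^+ 2.
  by rewrite /rhs_u -/(A1 s) -/(A2 s); rewrite /A1 /A2 in B1 B2 *; field; rewrite !gt_eqF.
rewrite lerBlDr ler_wpDr//.
  by apply: mulr_ge0; pos.
have -> : k2 M s * (`|phi2 s - phi1 s| * `|u2 s - u1 s|) =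
  2 * V kappa s ^+ 2 / A1 s * (expR (4 * M) * (4 * `|phi2 s - phi1 s|) * `|u2 s - u1 s|).
  by rewrite /k2; ring.
apply: ler_wpM2l; first by pos.
apply: (le_trans (ler_norm _)); rewrite normrM ler_wpM2r//.
apply: (le_trans (@expR_lipschitz (4 * M) _ _ _ _)); [lra|lra|].
rewrite ler_pM2l ?expR_gt0// (_ : 4 * phi2 s - 4 * phi1 s = 4 * (phi2 s - phi1 s)).
  by rewrite normrM ger0_norm.
by ring.
Qed.

Let E s := (u2 s - u1 s) ^+ 2 + (phi2 s - phi1 s) ^+ 2.

Let E_gronwall M K r s : 0 < r -> r <= s -> (s%:E < T)%E ->
  (forall x, r <= x <= s -> phi1 x <= M /\ phi2 x <= M) ->
  (forall x, r <= x <= s -> k1 x + k2 M x <= K) ->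
  E s <= E r * expR (K * (s - r)).
Proof.
move=> r0 rs sT HM HK.
apply: (@gronwall_le R E (fun x =>
   2 * (u2 x - u1 x) * (rhs_u alpha kappa x (u2 x) (phi2 x) - rhs_u alpha kappa x (u1 x) (phi1 x))
   + 2 * (phi2 x - phi1 x) * (rhs_phi alpha x (u2 x) - rhs_phi alpha x (u1 x)))) => //.
  move=> x /(inT r0 sT)[x0 xT].
  have [_ _ d1 e1] := s1 x0 xT; have [_ _ d2 e2] := s2 x0 xT.
  by rewrite /E; derE ring.
move=> x /andP[rx xs]; have xrs : r <= x <= s by rewrite !ltW.
have [x0 xT] := inT r0 sT xrs; have [M1 M2] := HM x xrs.
rewrite (dD x0 xT); have h := du_le x0 xT M1 M2.
have [p1 a1 _ _] := s1 x0 xT; have [p2 a2 _ _] := s2 x0 xT.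
have B1 : 0 < A1 x by rewrite subr_gt0.
have B2 : 0 < A2 x by rewrite subr_gt0.
have q0 := u0_du0_gt0 a0 x0.
have k10 : 0 <= k1 x by rewrite /k1; apply: mulr_ge0; [apply: mulr_ge0; lra | pos].
have k20 : 0 <= k2 M x by rewrite /k2; pos.
have := HK x xrs; rewrite /E.
move: (rhs_u _ _ _ _ _ - rhs_u _ _ _ _ _) h => e.
move: (u2 x - u1 x) (phi2 x - phi1 x) (k1 x) (k2 M x) k10 k20 => d D q1 q2 q10 q20 h hK.
apply: (@le_trans _ _ ((q1 + q2) * (d ^+ 2 + D ^+ 2))); last first.
  by rewrite ler_wpM2r// addr_ge0 ?sqr_ge0.
have nd : `|D| * `|d| <= (d ^+ 2 + D ^+ 2) / 2.
  rewrite -[d ^+ 2]real_normK ?num_real// -[D ^+ 2]real_normK ?num_real//.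
  by have := sqr_ge0 (`|D| - `|d|); nra.
have nd' : D * d <= `|D| * `|d| by rewrite -normrM ler_norm.
have := ler_wpM2l q10 nd; have := ler_wpM2l q20 nd; have := ler_wpM2l q10 nd'.
by nra.
Qed.

Let E_eq0 s : E s = 0 -> u1 s = u2 s /\ phi1 s = phi2 s.
Proof.
move=> /eqP; rewrite paddr_eq0 ?sqr_ge0// !sqrf_eq0 !subr_eq0.
by move=> /andP[/eqP-> /eqP->].
Qed.

Lemma solution_unique_from r s : 0 < r -> r <= s -> (s%:E < T)%E ->
  u1 r = u2 r -> phi1 r = phi2 r -> u1 s = u2 s /\ phi1 s = phi2 s.
Proof.
move=> r0 rs sT eu ephi; apply: E_eq0.
have bnd (f : R -> R) : (forall x, r <= x <= s -> 0 < x -> (x%:E < T)%E ->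
    {for x, continuous f}) -> exists M, forall x, r <= x <= s -> f x <= M.
  move=> cf; have [K _ HK] := @segment_bounded R f r s rs
    (fun x xrs => cf x xrs (inT r0 sT xrs).1 (inT r0 sT xrs).2).
  by exists K => x /HK; exact: le_trans (ler_norm _).
have [M1 HM1] : exists M, forall x, r <= x <= s -> phi1 x <= M.
  by apply: bnd => x _ x0 xT; have [_ _ _ d] := s1 x0 xT; exact: der_cont d.
have [M2 HM2] : exists M, forall x, r <= x <= s -> phi2 x <= M.
  by apply: bnd => x _ x0 xT; have [_ _ _ d] := s2 x0 xT; exact: der_cont d.
pose M := Num.max M1 M2.
have [K HK] : exists K, forall x, r <= x <= s -> k1 x + k2 M x <= K.
  apply: bnd => x _ x0 xT; have [_ a1 d1 _] := s1 x0 xT.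
  have [_ a2 d2 _] := s2 x0 xT; have d3 := der_u0 alpha x0.
  have [y d4] : exists y, is_derive x 1 (du0 alpha) y.
    rewrite /du0 /dlangevin; eexists; der.
    - by rewrite gt_eqF// sinh_gt0//; lra.
    - by rewrite expf_neq0// gt_eqF// sinh_gt0//; lra.
  have d5 := der_V kappa x.
  rewrite /k1 /k2 /A1 /A2; eapply der_cont; der.
  - by rewrite mulf_neq0// gt_eqF// subr_gt0.
  - by rewrite gt_eqF// subr_gt0.
have := @E_gronwall M K r s r0 rs sT.
have -> : E r = 0 by rewrite /E eu ephi !subrr expr0n addr0.
rewrite mul0r => h; apply/le_anti; rewrite h//.
  by rewrite addr_ge0 ?sqr_ge0.
by move=> x xrs; rewrite !le_max HM1// HM2// orbT.
Qed.

Section SameZeroData.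
Variables (l0 p0 : R).
Hypotheses (l00 : 0 < l0).
Hypotheses (zd1 : zero_data l0 p0 u1 phi1) (zd2 : zero_data l0 p0 u2 phi2).

(** As s tends to 0, u0 u0' is O(s^3), V is O(s), and both gaps u^2 - u0^2 exceed l0^2 s^2 / 8.
    Hence [k1] and [k2] stay bounded and Gronwall survives the singularity. *)
Let near_zero : exists2 e : R, 0 < e & forall x, 0 < x < e -> (x%:E < T)%E ->
  [/\ phi1 x <= p0 + 1, phi2 x <= p0 + 1 &
    k1 x + k2 (p0 + 1) x <= 12 ^+ 3 * crit_slope alpha ^+ 2 / l0 ^+ 3 +
      24 ^+ 2 * kappa ^+ 2 * expR 3 ^+ 2 * expR (4 * (p0 + 1)) / l0 ^+ 2].
Proof.
have c0 := crit_slope_gt0 a0; set c := crit_slope alpha in c0 *.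
have lp : 0 < l0 := l00.
have m0 : 0 < Num.min 1 (l0 / 2) by rewrite lt_min; apply/andP; split; lra.
have [e1 e10 H1] := zd1 m0; have [e2 e20 H2] := zd2 m0.
pose e3 := l0 / (9 * c).
have e30 : 0 < e3 by rewrite divr_gt0//; lra.
exists (Num.min (Num.min e1 e2) (Num.min e3 1)).
  by rewrite !lt_min e10 e20 e30 ltr01.
move=> x; rewrite !lt_min => /andP[x0 /andP[/andP[xe1 xe2] /andP[xe3 x1]]] xT.
have [] := H1 x; first by rewrite x0.
rewrite !lt_min => /andP[_ a1] /andP[b1 _].
have [] := H2 x; first by rewrite x0.
rewrite !lt_min => /andP[_ a2] /andP[b2 _].
have [p1 q1 _ _] := s1 x0 xT; have [p2 q2 _ _] := s2 x0 xT.
have um (v : R) : `|v / x - l0| < l0 / 2 -> l0 / 2 * x <= v /\ v <= 3 / 2 * l0 * x.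
  rewrite ltr_norml => /andP[h1 h2]; split.
    by rewrite -ler_pdivlMr//; lra.
  by rewrite -ler_pdivrMr//; lra.
have [m1 M1] := um _ a1; have [m2 M2] := um _ a2.
have c4 := u0_sqr_le_fourth a0 x0; rewrite -/c in c4.
have cx : 9 * c * x <= l0 by move: xe3; rewrite ltr_pdivlMr; lra.
have c5 : u0 alpha x ^+ 2 <= l0 ^+ 2 / 8 * x ^+ 2.
  apply: (le_trans c4); have -> : 9 * c ^+ 2 * x ^+ 4 = (9 * c * x) ^+ 2 / 9 * x ^+ 2 by field.
  rewrite ler_pM2r ?exprn_gt0//.
  have : (9 * c * x) ^+ 2 <= l0 ^+ 2.
    by rewrite ler_sqr ?nnegrE ?(ltW lp)//; pos.
  by have := sqr_ge0 l0; lra.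
have Al (v : R) : l0 / 2 * x <= v -> l0 ^+ 2 / 8 * x ^+ 2 <= v ^+ 2 - u0 alpha x ^+ 2.
  move=> h; have w0 : 0 <= l0 / 2 * x by pos.
  have : (l0 / 2 * x) ^+ 2 <= v ^+ 2.
    by rewrite ler_sqr ?nnegrE//; apply: le_trans h.
  by move: c5; rewrite !exprMn; lra.
have A1l := Al _ m1; have A2l := Al _ m2.
have q0 : 0 < l0 ^+ 2 / 8 * x ^+ 2 by pos.
have kk := u0_du0_le_cube a0 x0; have kp := u0_du0_gt0 a0 x0; rewrite -/c in kk.
split.
- by move: b1; rewrite ltr_norml => /andP[]; lra.
- by move: b2; rewrite ltr_norml => /andP[]; lra.
have i1 : (A1 x)^-1 <= (l0 ^+ 2 / 8 * x ^+ 2)^-1.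
  by rewrite lef_pV2 ?posrE// subr_gt0.
have i2 : (A2 x)^-1 <= (l0 ^+ 2 / 8 * x ^+ 2)^-1.
  by rewrite lef_pV2 ?posrE// subr_gt0.
have j1 : 0 <= (A1 x)^-1 by rewrite invr_ge0 subr_ge0 ltW.
have j2 : 0 <= (A2 x)^-1 by rewrite invr_ge0 subr_ge0 ltW.
apply: lerD.
  rewrite /k1 invfM.
  have -> : 12 ^+ 3 * c ^+ 2 / l0 ^+ 3 =
     (9 * c ^+ 2 * x ^+ 3) * (3 * l0 * x) * ((l0 ^+ 2 / 8 * x ^+ 2)^-1 * (l0 ^+ 2 / 8 * x ^+ 2)^-1).
    by field; rewrite !gt_eqF.
  apply: ler_pM.
  - by apply: mulr_ge0; [exact: ltW | apply: addr_ge0; exact: ltW].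
  - exact: mulr_ge0.
  - have -> : 3 * l0 * x = 3 / 2 * l0 * x + 3 / 2 * l0 * x by field.
    apply: ler_pM => //; [exact: ltW | | exact: lerD].
    by apply: addr_ge0; exact: ltW.
  - exact: ler_pM.
rewrite /k2.
have -> : 24 ^+ 2 * kappa ^+ 2 * expR 3 ^+ 2 * expR (4 * (p0 + 1)) / l0 ^+ 2 =
  8 * (3 * kappa * x * expR 3) ^+ 2 * expR (4 * (p0 + 1)) * (l0 ^+ 2 / 8 * x ^+ 2)^-1.
  by field; rewrite !gt_eqF.
apply: ler_pM => //; first by pos.
rewrite ler_pM2r ?expR_gt0// ler_pM2l// ler_sqr ?nnegrE; last 2 first.
- exact/ltW/V_gt0.
- by pos.
apply: (le_trans (V_le k0 x0)); rewrite ler_pM2l; last by pos.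
apply: (@le_trans _ _ (expR (3 * x))); last by rewrite ler_expR; lra.
by rewrite -cosh_add_sinh lerDl; pos.
Qed.

(** The squared distance [E] tends to 0 at the zero-section and grows at most exponentially from
    there, so it vanishes. *)
Lemma solution_unique s : 0 < s -> (s%:E < T)%E ->
  u1 s = u2 s /\ phi1 s = phi2 s.
Proof.
move=> s0 sT; have [e e0 He] := near_zero.
have [r /andP[r0 re] rs] := exists_below e0 s0.
have rT : (r%:E < T)%E by apply: le_lt_trans sT; rewrite lee_fin.
suff [eu ephi] : u1 r = u2 r /\ phi1 r = phi2 r.
  exact: (solution_unique_from r0 rs sT eu ephi).
apply: E_eq0.
pose K := 12 ^+ 3 * crit_slope alpha ^+ 2 / l0 ^+ 3 +
  24 ^+ 2 * kappa ^+ 2 * expR 3 ^+ 2 * expR (4 * (p0 + 1)) / l0 ^+ 2.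
rewrite -/K in He.
have K0 : 0 <= K.
  have c0 := crit_slope_gt0 a0; have lp : 0 < l0 := l00.
  by rewrite /K; apply: addr_ge0; pos.
apply/eqP/negPn/negP => E0.
have Er : 0 < E r by rewrite lt_neqAle eq_sym E0/= addr_ge0 ?sqr_ge0.
(* Since E q <= 8 d at a point q close to 0, this choice makes Gronwall yield E r <= E r / 2, a
   contradiction. *)
pose d := Num.min 1 (E r * expR (- (K * r)) / 16).
have d0 : 0 < d by rewrite lt_min ltr01 /=; pos.
have [d1 d10 H1] := zd1 d0; have [d2 d20 H2] := zd2 d0.
have dd : 0 < Num.min (Num.min d1 d2) 1 by rewrite !lt_min d10 d20 ltr01.
have [q] := exists_below dd r0; rewrite !lt_min => /andP[q0 /andP[/andP[qd1 qd2] q1]] qr.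
have [|a1 b1] := H1 q; first by rewrite q0.
have [|a2 b2] := H2 q; first by rewrite q0.
have inr x : q <= x <= r -> 0 < x < e /\ (x%:E < T)%E.
  move=> /andP[qx xr]; split; first by lra.
  by apply: le_lt_trans rT; rewrite lee_fin.
have : E r <= E q * expR (K * (r - q)).
  apply: (@E_gronwall (p0 + 1)) => // x /inr[xe xT].
    by have [] := He x xe xT.
  by have [] := He x xe xT.
apply/negP; rewrite -ltNge.
have dle : d <= 1 by rewrite /d ge_min lexx.
have dle' : d <= E r * expR (- (K * r)) / 16 by rewrite /d ge_min lexx orbT.
have Eq : E q <= 8 * d.
  have hu : `|u2 q - u1 q| <= 2 * d.
    have -> : u2 q - u1 q = ((u2 q / q - l0) - (u1 q / q - l0)) * q.
      by field; rewrite gt_eqF.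
    rewrite normrM (gtr0_norm q0); have := ler_normB (u2 q / q - l0) (u1 q / q - l0).
    by move=> h; have := normr_ge0 ((u2 q / q - l0) - (u1 q / q - l0)); nra.
  have hp : `|phi2 q - phi1 q| <= 2 * d.
    have -> : phi2 q - phi1 q = (phi2 q - p0) - (phi1 q - p0) by ring.
    by have := ler_normB (phi2 q - p0) (phi1 q - p0); lra.
  rewrite /E -[(u2 q - _) ^+ 2]real_normK ?num_real// -[(phi2 q - _) ^+ 2]real_normK ?num_real//.
  by have := normr_ge0 (u2 q - u1 q); have := normr_ge0 (phi2 q - phi1 q); nra.
have h : expR (K * (r - q)) <= expR (K * r).
  by rewrite ler_expR ler_wpM2l//; lra.
apply: (@le_lt_trans _ _ (8 * d * expR (K * r))).
  by apply: ler_pM; rewrite ?addr_ge0 ?sqr_ge0 ?expR_ge0.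
have : d * expR (K * r) <= E r / 16.
  have -> : E r / 16 = E r * expR (- (K * r)) / 16 * expR (K * r).
    by rewrite expRN; field; rewrite gt_eqF ?expR_gt0.
  by rewrite ler_pM2r ?expR_gt0.
by lra.
Qed.

End SameZeroData.

(* The system is cooperative: each right-hand side is increasing in the other
   unknown. *)
Lemma solution_mono l1 p1 l2 p2 : l1 < l2 -> p1 < p2 -> (0 < T)%E ->
  zero_data l1 p1 u1 phi1 -> zero_data l2 p2 u2 phi2 ->
  exists2 d : R, 0 < d & exists r : R, forall s, r <= s -> (s%:E < T)%E ->
    d <= phi2 s - phi1 s.
Proof.
move=> l12 p12 T0 zd1 zd2.
pose e := Num.min ((l2 - l1) / 2) ((p2 - p1) / 2).
have e0 : 0 < e by rewrite lt_min; apply/andP; split; lra.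
have [el ep] : e <= (l2 - l1) / 2 /\ e <= (p2 - p1) / 2 by rewrite /e !ge_min !lexx orbT.
have [d1 d10 H1] := zd1 _ e0; have [d2 d20 H2] := zd2 _ e0.
have dd : 0 < Num.min d1 d2 by rewrite lt_min d10 d20.
have [r] := ereal_exists_below dd T0; rewrite lt_min => /and3P[r0 rd1 rd2] rT.
have [|] := H1 r; first by rewrite r0.
rewrite !ltr_norml => /andP[_ a1] /andP[_ b1].
have [|] := H2 r; first by rewrite r0.
rewrite !ltr_norml => /andP[a2 _] /andP[b2 _].
have ur : 0 < u2 r - u1 r.
  have ir : 0 < r^-1 by rewrite invr_gt0.
  by rewrite subr_gt0 -(ltr_pM2r ir); lra.
have pr : 0 < phi2 r - phi1 r by lra.
(* While u2 > u1 the difference of the dilatons is nondecreasing, so its value at [r] is a lower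
   bound from there on. *)
exists (phi2 r - phi1 r) => //; exists r.
have dU x : 0 < x -> (x%:E < T)%E -> is_derive x 1 (fun x => u2 x - u1 x)
    (rhs_u alpha kappa x (u2 x) (phi2 x) - rhs_u alpha kappa x (u1 x) (phi1 x)).
  move=> x0 xT; have [_ _ e1 _] := s1 x0 xT.
  by have [_ _ e2 _] := s2 x0 xT; derE ring.
have dP x : 0 < x -> (x%:E < T)%E -> is_derive x 1 (fun x => phi2 x - phi1 x)
    (rhs_phi alpha x (u2 x) - rhs_phi alpha x (u1 x)).
  move=> x0 xT; have [_ _ _ e1] := s1 x0 xT.
  by have [_ _ _ e2] := s2 x0 xT; derE ring.
have k1_ge0 x : 0 < x -> (x%:E < T)%E -> 0 <= k1 x.
  move=> x0 xT; have kp := u0_du0_gt0 a0 x0.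
  have [v1 q1 _ _] := s1 x0 xT; have [v2 q2 _ _] := s2 x0 xT.
  rewrite /k1; apply: mulr_ge0; last by rewrite invr_ge0 mulr_ge0 ?subr_ge0 ?ltW.
  by apply: mulr_ge0; lra.
have main s : r <= s -> (s%:E < T)%E -> 0 < u2 s - u1 s.
  move=> rs sT.
  have [K K0 HK] : exists2 K, 0 <= K & forall x, r <= x <= s ->
      `|2 * V kappa x ^+ 2 * expR (4 * phi1 x) * (u1 x + u2 x) / (A1 x * A2 x)| <= K.
    apply: segment_bounded => // x /(inT r0 sT)[x0 xT].
    have [_ q1 e1 f1] := s1 x0 xT; have [_ q2 e2 f2] := s2 x0 xT.
    have d3 := der_u0 alpha x0; have d5 := der_V kappa x.
    rewrite /A1 /A2; eapply der_cont; der.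
    by rewrite mulf_neq0// gt_eqF// subr_gt0.
  suff [] : 0 < u2 s - u1 s /\ 0 < phi2 s - phi1 s by [].
  apply: (@coupled_gt0 R (fun x => u2 x - u1 x) (fun x => phi2 x - phi1 x)
    (fun x => rhs_u alpha kappa x (u2 x) (phi2 x) - rhs_u alpha kappa x (u1 x) (phi1 x))
    (fun x => rhs_phi alpha x (u2 x) - rhs_phi alpha x (u1 x)) r s K) => //.
  - by move=> x /(inT r0 sT)[x0 xT]; exact: dU.
  - by move=> x /(inT r0 sT)[x0 xT]; exact: dP.
  move=> x xrs dx Dx; have [x0 xT] := inT r0 sT xrs.
  have [v1 q1 _ _] := s1 x0 xT; have [v2 q2 _ _] := s2 x0 xT.
  have B1 : 0 < A1 x by rewrite subr_gt0.
  have B2 : 0 < A2 x by rewrite subr_gt0.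
  split; last first.
    rewrite (dD x0 xT).
    apply: (@le_trans _ _ 0); first by rewrite mulNr oppr_le0; apply: mulr_ge0 => //; exact: ltW.
    by apply: mulr_ge0; [exact: k1_ge0 | exact: ltW].
  have := le_trans (ler_norm _) (HK x xrs).
  have -> : rhs_u alpha kappa x (u2 x) (phi2 x) - rhs_u alpha kappa x (u1 x) (phi1 x) =
    2 * V kappa x ^+ 2 / A2 x * (expR (4 * phi2 x) - expR (4 * phi1 x))
    - 2 * V kappa x ^+ 2 * expR (4 * phi1 x) * (u1 x + u2 x) / (A1 x * A2 x) * (u2 x - u1 x).
    by rewrite /rhs_u; rewrite /A1 /A2 in B1 B2 *; field; rewrite !gt_eqF.
  move: (_ / (A1 x * A2 x)) => k kK.
  have : 0 <= 2 * V kappa x ^+ 2 / A2 x * (expR (4 * phi2 x) - expR (4 * phi1 x)).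
    apply: mulr_ge0; first by pos.
    by rewrite subr_ge0 ler_expR; lra.
  have := ler_wpM2r (ltW dx) kK; rewrite mulNr; lra.
move=> s rs sT.
apply: (@deriv_ge0_le R (fun x => phi2 x - phi1 x)
  (fun x => rhs_phi alpha x (u2 x) - rhs_phi alpha x (u1 x))) => //.
  by move=> x /(inT r0 sT)[x0 xT]; exact: dP.
move=> x /andP[rx xs]; have xrs : r <= x <= s by rewrite !ltW.
have [x0 xT] := inT r0 sT xrs; rewrite (dD x0 xT).
apply: mulr_ge0; first exact: k1_ge0.
by apply/ltW/main => //; exact: ltW.
Qed.

End TwoSolutions.

End Uniqueness.

(** * The explicit solution along the critical ray *)

Section Critical.
Context {R : realType}.
Variables (alpha kappa : R).
Hypotheses (a0 : alpha != 0) (k0 : 0 < kappa).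

Let c := crit_slope alpha.
Let c0 : 0 < c. Proof. exact: crit_slope_gt0. Qed.

(** The dilaton obtained by setting u = c s and solving u' = c for e^(4 phi). *)
Definition phi_star (s : R) : R :=
  (ln c + ln (c ^+ 2 * s ^+ 2 - u0 alpha s ^+ 2) - ln 2 - 2 * ln (V kappa s)) / 4.

Let as_gt0 s : 0 < s -> 0 < c ^+ 2 * s ^+ 2 - u0 alpha s ^+ 2.
Proof. by move=> s0; rewrite subr_gt0 u0_sqr_lt. Qed.

Lemma expR_phi_star s : 0 < s -> expR (4 * phi_star s) =
  c * (c ^+ 2 * s ^+ 2 - u0 alpha s ^+ 2) / (2 * V kappa s ^+ 2).
Proof.
move=> s0; have A0 := as_gt0 s0; have V0 := V_gt0 k0 s0.
have -> : 4 * phi_star s =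
  ln c + ln (c ^+ 2 * s ^+ 2 - u0 alpha s ^+ 2) - ln 2 - 2%:R * ln (V kappa s).
  by rewrite /phi_star; field.
rewrite !expRD !expRN expRM_natl !lnK ?posrE//; field.
by rewrite gt_eqF.
Qed.

(** The equation for u holds by the choice of [phi_star]. The one for the dilaton is its logarithmic
    derivative, in which the logarithmic derivative of V is given by [coth_identity]. *)
Lemma solves_star : solves alpha kappa +oo%E (u_star alpha) phi_star.
Proof.
apply/(solvesP _ _ _ _ k0) => s s0 _; have A0 := as_gt0 s0; have V0 := V_gt0 k0 s0.
have S0 : 0 < sinh (3 * s) by apply: sinh_gt0; lra.
have uE : u_star alpha s = c * s by [].
split.
- by rewrite uE mulr_gt0.
- by rewrite uE (_ : (c * s) ^+ 2 = c ^+ 2 * s ^+ 2); [exact: u0_sqr_lt | ring].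
- have -> : rhs_u alpha kappa s (u_star alpha s) (phi_star s) = c.
    rewrite /rhs_u uE expR_phi_star// (_ : (c * s) ^+ 2 = c ^+ 2 * s ^+ 2); [field | ring].
    by rewrite (_ : (c * s) ^+ 2 = c ^+ 2 * s ^+ 2) ?gt_eqF//; ring.
  by rewrite /u_star -/(crit_slope alpha) -/c; derE ring.
have d1 := der_u0 alpha s0; have d2 := der_V kappa s.
rewrite /phi_star; derE idtac; rewrite ?A0 ?V0 //.
have := coth_identity alpha s0; rewrite -/c /rhs_phi uE (_ : (c * s) ^+ 2 = c ^+ 2 * s ^+ 2) /V; last by ring.
move: (u0 alpha s) (du0 alpha s) A0 => m m' A0 H.
have A0' : c ^+ 2 * s ^+ 2 - m ^+ 2 != 0 by rewrite gt_eqF.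
set w := cosh (3 * s) / sinh (3 * s) in H.
have E : (kappa * sinh (3 * s))^-1 * (3 * kappa * cosh (3 * s)) = 3 * w.
  by rewrite /w; field; rewrite !gt_eqF.
have Hw : 3 * w = (c ^+ 2 * s + m * m') / (c ^+ 2 * s ^+ 2 - m ^+ 2).
  by apply: (mulIf A0'); rewrite divfK// -H /w mulrA.
rewrite E Hw /=; field.
by have A1 := A0'; rewrite -exprMn in A1; rewrite ?A0' ?A1.
Qed.

(** e^(4 phi_star) is squeezed around e^(4 p) = c^3 / (18 kappa^2) by 3 kappa s <= V <= 3 kappa s
    cosh(3s) and 0 <= u0^2 <= 9 c^2 s^4. *)
Lemma zero_data_star :
  zero_data c (critical_dilaton alpha kappa) (u_star alpha) phi_star.
Proof.
move=> e e0; set p := critical_dilaton alpha kappa.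
have pE : expR (4 * p) = c ^+ 3 / (18 * kappa ^+ 2).
  have := zs_slope_cube p k0; rewrite zs_slope_critical// -/c => ->.
  by field; rewrite gt_eqF.
pose q s : R := e - ln (cosh (3 * s) ^+ 2 / (1 - 9 * s ^+ 2)).
have [E9 E3] : 1 - 9 * 0 ^+ 2 = 1 :> R /\ 3 * 0 = 0 :> R by split; ring.
have cq : {for 0, continuous q}.
  rewrite /q; eapply der_cont; der; cbv beta; rewrite ?E3 ?E9 ?cosh0 ?expr1n ?divr1 ?oner_neq0 ?ltr01//.
have q0 : 0 < q 0.
  by rewrite /q E3 E9 cosh0 expr1n divr1 ln1 subr0.
have [d d0 Hd] := cont_pos_near cq q0.
exists (Num.min d 9^-1); first by rewrite lt_min d0 invr_gt0 ltr0n.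
move=> s; rewrite lt_min => /and3P[s0 sd s9].
have uE : u_star alpha s = c * s by [].
split; first by rewrite uE mulfK ?gt_eqF// subrr normr0.
have A0 := as_gt0 s0; have V0 := V_gt0 k0 s0; have C0 := cosh_gt0 (3 * s).
have s2 : 0 < 1 - 9 * s ^+ 2 by nra.
have V1 := V_ge k0 s0; have V2 := V_le k0 s0.
have u4 := u0_sqr_le_fourth a0 s0; rewrite -/c in u4.
have m0 := sqr_ge0 (u0 alpha s).
have up : phi_star s <= p.
  suff : 4 * phi_star s <= 4 * p by lra.
  rewrite -ler_expR expR_phi_star// pE ler_pdivrMr; last by pos.
  have -> : c ^+ 3 / (18 * kappa ^+ 2) * (2 * V kappa s ^+ 2) =
    c ^+ 3 / (9 * kappa ^+ 2) * V kappa s ^+ 2 by field; rewrite gt_eqF.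
  apply: (@le_trans _ _ (c ^+ 3 / (9 * kappa ^+ 2) * (3 * kappa * s) ^+ 2)).
    have -> : c ^+ 3 / (9 * kappa ^+ 2) * (3 * kappa * s) ^+ 2 =
      c * (c ^+ 2 * s ^+ 2) by field; rewrite gt_eqF.
    by rewrite ler_pM2l//; lra.
  rewrite ler_pM2l; last by pos.
  by rewrite ler_sqr ?nnegrE//; [pos | exact: ltW].
have lo : p - ln (cosh (3 * s) ^+ 2 / (1 - 9 * s ^+ 2)) / 4 <= phi_star s.
  suff : 4 * p - ln (cosh (3 * s) ^+ 2 / (1 - 9 * s ^+ 2)) <= 4 * phi_star s by lra.
  rewrite -ler_expR expR_phi_star// expRD expRN lnK; last first.
    by rewrite posrE divr_gt0 ?exprn_gt0.
  rewrite pE ler_pdivlMr; last by pos.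
  have -> : c ^+ 3 / (18 * kappa ^+ 2) / (cosh (3 * s) ^+ 2 / (1 - 9 * s ^+ 2)) *
      (2 * V kappa s ^+ 2) =
    c ^+ 3 * (1 - 9 * s ^+ 2) / (9 * kappa ^+ 2 * cosh (3 * s) ^+ 2) * V kappa s ^+ 2.
    by field; rewrite !gt_eqF.
  apply: (@le_trans _ _ (c ^+ 3 * (1 - 9 * s ^+ 2) / (9 * kappa ^+ 2 * cosh (3 * s) ^+ 2) *
     (3 * kappa * s * cosh (3 * s)) ^+ 2)).
    rewrite ler_pM2l; last by pos.
    by rewrite ler_sqr ?nnegrE//; [exact: ltW | pos].
  have -> : c ^+ 3 * (1 - 9 * s ^+ 2) / (9 * kappa ^+ 2 * cosh (3 * s) ^+ 2) *
     (3 * kappa * s * cosh (3 * s)) ^+ 2 = c * (c ^+ 2 * s ^+ 2 - 9 * c ^+ 2 * s ^+ 4).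
    by field; rewrite !gt_eqF.
  by rewrite ler_pM2l//; lra.
have : 0 < q s by apply: Hd; rewrite subr0 gtr0_norm.
by rewrite /q ltr_norml => h; apply/andP; split; lra.
Qed.

(** Both sides are nonnegative and their squares agree: the radicand is 9 sinh^2 / c^2 times c^2 s^2
    - u0^2. *)
Lemma expR_2phi_star s : 0 < s -> expR (2 * phi_star s) = exp_2phi_star alpha kappa s.
Proof.
move=> s0; have A0 := as_gt0 s0; have S0 : 0 < sinh (3 * s) by apply: sinh_gt0; lra.
have r2 : 0 < Num.sqrt 2 :> R by rewrite sqrtr_gt0.
have L1 := langevin_lt (_ : 0 < 3 * s); have L0 := langevin_gt0 (_ : 0 < 3 * s).
have s3 : 0 < 3 * s by lra.
set D := 9 * s ^+ 2 * sinh (3 * s) ^+ 2 - (3 * s * cosh (3 * s) - sinh (3 * s)) ^+ 2.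
have DE : D = (9 / c ^+ 2) * sinh (3 * s) ^+ 2 * (c ^+ 2 * s ^+ 2 - u0 alpha s ^+ 2).
  by rewrite u0_sqr -/c /D /langevin; field; rewrite !gt_eqF.
have D0 : 0 <= D by rewrite DE; apply: mulr_ge0; [pos | exact: ltW].
have e0 : 0 <= exp_2phi_star alpha kappa s.
  rewrite /exp_2phi_star -/D; apply: mulr_ge0; last by rewrite divr_ge0 ?sqrtr_ge0 ?sqr_ge0.
  by rewrite divr_ge0 ?powR_ge0//; apply: mulr_ge0; [apply: mulr_ge0; [lra | exact: ltW] | exact: ltW].
apply: (@pexpIrn _ 2); rewrite ?nnegrE ?expR_ge0//.
rewrite -expRM_natl (_ : 2%:R * (2 * phi_star s) = 4 * phi_star s); last by ring.
rewrite expR_phi_star// /exp_2phi_star -/D -/(crit_slope alpha) -/c.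
have sq (p r y S : R) : r != 0 -> S != 0 -> (p / (3 * r * kappa) * (y / S ^+ 2)) ^+ 2 =
    p ^+ 2 * y ^+ 2 / (9 * r ^+ 2 * kappa ^+ 2 * S ^+ 4).
  by move=> rn Sn; field; rewrite rn Sn gt_eqF.
rewrite sq ?gt_eqF// (sqr_sqrtr D0) (sqr_sqrtr (ler0n R 2)).
have -> : (c `^ (3 / 2)) ^+ 2 = c ^+ 3.
  rewrite -[LHS]powR_mulrn ?powR_ge0// -powRrM (_ : 3 / 2 * 2%:R = 3%:R); last by field.
  by rewrite powR_mulrn// ltW.
rewrite DE /V; move: (u0 _ _) (sinh _) S0 => m S S0.
field.
by rewrite !gt_eqF.
Qed.

Theorem critical_solution T u phi :
  zs_solution alpha kappa (critical_dilaton alpha kappa) T u phi ->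
  exists u' phi' : R -> R,
    [/\ extends T u phi +oo%E u' phi', solves alpha kappa +oo%E u' phi'
      & forall s : R, 0 < s -> u' s = u_star alpha s /\
          expR (2 * phi' s) = exp_2phi_star alpha kappa s].
Proof.
move=> zs; have [T0 sol _] := zs; have zd := zs_zero_data zs.
rewrite zs_slope_critical// in zd.
exists (u_star alpha), phi_star; split; last by move=> s s0; rewrite expR_2phi_star.
  split; first by rewrite leey.
  move=> s s0 sT.
  have sol' := solves_le (leey T) solves_star.
  by have [] := solution_unique a0 k0 sol' sol c0 zero_data_star zd s0 sT.
exact: solves_star.
Qed.

End Critical.

(** * Maximal extensions and global existence *)

Section Extension.
Context {R : realType}.
Variables (alpha kappa : R).
Hypotheses (a0 : alpha != 0) (k0 : 0 < kappa).

Lemma extends_refl (T : \bar R) u phi : extends T u phi T u phi.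
Proof. by split. Qed.

Lemma extends_trans (T1 T2 T3 : \bar R) u1 p1 u2 p2 u3 p3 :
  extends T1 u1 p1 T2 u2 p2 -> extends T2 u2 p2 T3 u3 p3 ->
  extends T1 u1 p1 T3 u3 p3.
Proof.
move=> [T12 e12] [T23 e23]; split; first exact: le_trans T23.
move=> s s0 sT; have [<- <-] := e12 s s0 sT; apply: e23 => //.
exact: lt_le_trans T12.
Qed.

Lemma solves_near (T : \bar R) u phi u' phi' s : 0 < s -> (s%:E < T)%E ->
  solves alpha kappa T u phi ->
  (forall x, 0 < x -> (x%:E < T)%E -> u' x = u x /\ phi' x = phi x) ->
  [/\ 0 < u' s, u0 alpha s ^+ 2 < u' s ^+ 2,
      is_derive s 1 u' (rhs_u alpha kappa s (u' s) (phi' s))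
    & is_derive s 1 phi' (rhs_phi alpha s (u' s))].
Proof.
move=> s0 sT /(solvesP _ _ _ _ k0) sol e.
have [us as_ du dp] := sol s s0 sT; have [-> ->] := e s s0 sT.
have [d d0 Hd] : exists2 d : R, 0 < d & forall x, `|s - x| < d -> 0 < x /\ (x%:E < T)%E.
  have [r rs rT] : exists2 r : R, s < r & (r%:E <= T)%E.
    case: T sT {sol e} => [t||]//; first by rewrite lte_fin => st; exists t.
    by exists (s + 1); [rewrite ltrDl | rewrite leey].
  have m0 : 0 < Num.min s (r - s) by rewrite lt_min s0 subr_gt0.
  exists (Num.min s (r - s)) => // x; rewrite lt_min !ltr_norml.
  move=> /andP[/andP[h1 h2] /andP[h3 h4]]; split; first by lra.
  by apply: lt_le_trans rT; rewrite lte_fin; lra.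
split=> //.
- apply: der_near du; apply/nbhs_ballP; exists d => //= x /Hd[x0 xT].
  by have [] := e x x0 xT.
- apply: der_near dp; apply/nbhs_ballP; exists d => //= x /Hd[x0 xT].
  by have [] := e x x0 xT.
Qed.

(** Any two extensions agree where both are defined, because extensions keep the data at the
    zero-section and these determine the solution. So all extensions glue to one on the supremum of
    their intervals. *)
Theorem maximal_extension_exists (l0 p0 : R) (T : \bar R) u phi : 0 < l0 ->
  (0 < T)%E -> solves alpha kappa T u phi -> zero_data l0 p0 u phi ->
  exists T' u' phi', maximal_extension alpha kappa T u phi T' u' phi'.
Proof.
move=> l00 T0 sol zd.
pose ext (T' : \bar R) u' phi' :=
  extends T u phi T' u' phi' /\ solves alpha kappa T' u' phi'.
pose val (s : R) (p : (R -> R) * (R -> R)) :=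
  exists2 T', (s%:E < T')%E & ext T' p.1 p.2.
(* Some extension reaching beyond [s]; the default is taken only where no extension arrives. *)
pose w (s : R) := xget (u, phi) [set p | val s p].
have agree T1 u1 p1 T2 u2 p2 s : ext T1 u1 p1 -> ext T2 u2 p2 -> 0 < s ->
    (s%:E < T1)%E -> (s%:E < T2)%E -> u1 s = u2 s /\ p1 s = p2 s.
  move=> [e1 s1] [e2 s2] s0 sT1 sT2.
  have z1 := zero_data_extends T0 e1 zd; have z2 := zero_data_extends T0 e2 zd.
  have m1 : (Order.min T1 T2 <= T1)%E by rewrite ge_min lexx.
  have m2 : (Order.min T1 T2 <= T2)%E by rewrite ge_min lexx orbT.
  apply: (solution_unique a0 k0 (solves_le m1 s1) (solves_le m2 s2) l00 z1 z2 s0).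
  by rewrite lt_min sT1 sT2.
pose T' := ereal_sup [set t | exists u' phi', ext t u' phi'].
pose u' s := (w s).1 s; pose phi' s := (w s).2 s.
have T'ub t v q : ext t v q -> (t <= T')%E.
  by move=> h; apply: ereal_sup_ubound; exists v, q.
have wE t v q s : ext t v q -> 0 < s -> (s%:E < t)%E -> u' s = v s /\ phi' s = q s.
  move=> h s0 st; rewrite /u' /phi' /w; case: xgetP => [p _ [t' st' h']|H].
    exact: (agree _ _ _ _ _ _ _ h' h).
  by exfalso; apply: (H (v, q)); exists t.
have extT : ext T u phi by split; [exact: extends_refl | exact: sol].
have solT' : solves alpha kappa T' u' phi'.
  apply/(solvesP _ _ _ _ k0) => s s0 sT'.
  have [t [v [q h]] st] := ereal_sup_gt sT'.
  by apply: (solves_near s0 st h.2) => x x0 xt; exact: (wE _ _ _ _ h).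
have eT' : extends T u phi T' u' phi'.
  by split; [exact: T'ub extT | move=> s s0 sT; exact: (wE _ _ _ _ extT)].
exists T', u', phi'; split => // T'' u'' phi'' e'' s''.
apply/le_anti; rewrite (T'ub _ u'' phi'') ?e''.1//.
by split => //; exact: extends_trans e''.
Qed.

(** * Global existence above the critical slope *)

Section Supercritical.
Variables (l0 p0 : R) (T : \bar R) (u phi : R -> R).
Hypotheses (T0 : (0 < T)%E) (sol : solves alpha kappa T u phi).
Hypotheses (zd : zero_data l0 p0 u phi).
Hypotheses (l0E : l0 ^+ 3 = 18 * kappa ^+ 2 * expR (4 * p0)).
Hypothesis (cl : crit_slope alpha < l0).

Let c := crit_slope alpha.
Let c0 : 0 < c. Proof. exact: crit_slope_gt0. Qed.
Let l := (c + l0) / 2.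
Let lc : c < l. Proof. by have := cl; rewrite /l /c; lra. Qed.
Let ll0 : l < l0. Proof. by have := cl; rewrite /l /c; lra. Qed.
Let l_gt0 : 0 < l. Proof. exact: lt_trans lc. Qed.
Let l00 : 0 < l0. Proof. exact: lt_trans ll0. Qed.

Section Start.
Variable a : R.
Hypotheses (a_gt0 : 0 < a) (aT : (a%:E < T)%E).

(* The truncations [max x (l s)] and [min p (phi a)] make the right-hand sides
   globally Lipschitz; [ray_persist] shows that they are never active. *)
Let t s := Num.max s a.
Let q (s x : R) := (Num.max x (l * t s) ^+ 2 - u0 alpha (t s) ^+ 2)^-1.
Let F (i : bool) (s x p : R) : R := if i
  then 2 * V kappa (t s) ^+ 2 * expR (4 * Num.min p (phi a)) * q s x
  else - (u0 alpha (t s) * du0 alpha (t s)) * q s x.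

Let t_gt0 s : 0 < t s. Proof. by rewrite lt_max a_gt0 orbT. Qed.

Let q_bounds s x : (l ^+ 2 - c ^+ 2) / l ^+ 2 * Num.max x (l * t s) ^+ 2 <=
  Num.max x (l * t s) ^+ 2 - u0 alpha (t s) ^+ 2.
Proof.
set X := Num.max _ _; have lX : l * t s <= X by rewrite le_max lexx orbT.
have := u0_sqr_lt a0 (t_gt0 s); rewrite -/c => m.
have h : c ^+ 2 * t s ^+ 2 <= c ^+ 2 / l ^+ 2 * X ^+ 2.
  have -> : c ^+ 2 * t s ^+ 2 = c ^+ 2 / l ^+ 2 * (l * t s) ^+ 2.
    by field; rewrite gt_eqF.
  rewrite ler_pM2l; last by pos.
  have w0 : 0 <= l * t s by apply: mulr_ge0; exact: ltW.
  by rewrite ler_sqr ?nnegrE//; apply: le_trans lX.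
have -> : (l ^+ 2 - c ^+ 2) / l ^+ 2 * X ^+ 2 = X ^+ 2 - c ^+ 2 / l ^+ 2 * X ^+ 2.
  by field; rewrite gt_eqF.
by lra.
Qed.

Let mu := (l ^+ 2 - c ^+ 2) / l ^+ 2.
Let mu_gt0 : 0 < mu.
Proof.
apply: divr_gt0; last by pos.
by rewrite subr_gt0 ltr_sqr ?nnegrE ?(ltW c0) ?(ltW l_gt0).
Qed.

Let q_gt0 s x : 0 < Num.max x (l * t s) ^+ 2 - u0 alpha (t s) ^+ 2.
Proof.
apply: lt_le_trans (q_bounds s x); rewrite -/mu mulr_gt0// exprn_gt0//.
by rewrite lt_max (mulr_gt0 l_gt0 (t_gt0 s)) orbT.
Qed.

Let q_le s x : 0 <= q s x <= (mu * (l * a) ^+ 2)^-1.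
Proof.
rewrite invr_ge0 (ltW (q_gt0 s x))/= lef_pV2 ?posrE//; last first.
  by pos.
apply: le_trans (q_bounds s x); rewrite -/mu ler_pM2l//.
have h1 : l * a <= Num.max x (l * t s).
  by rewrite le_max ler_pM2l// le_max lexx !orbT.
have h0 : 0 <= l * a by apply/ltW/mulr_gt0.
by rewrite ler_sqr ?nnegrE//; exact: le_trans h1.
Qed.

Let q_lip s x y : `|q s x - q s y| <= 2 / (mu ^+ 2 * (l * a) ^+ 3) * `|x - y|.
Proof.
pose X := Num.max x (l * t s); pose Y := Num.max y (l * t s).
have X0 : 0 < X by rewrite lt_max (mulr_gt0 l_gt0 (t_gt0 s)) orbT.
have Y0 : 0 < Y by rewrite lt_max (mulr_gt0 l_gt0 (t_gt0 s)) orbT.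
have la0 : 0 < l * a by rewrite mulr_gt0.
have la (z : R) : l * a <= Num.max z (l * t s) by rewrite le_max ler_pM2l// le_max lexx !orbT.
have XY : `|X - Y| <= `|x - y|.
  have := ler_norm (x - y); have := ler_norm (y - x); rewrite distrC => h1 h2.
  by rewrite /X /Y !maxEle ler_norml; case: ifPn; case: ifPn => *; apply/andP; split; lra.
have qX := q_gt0 s x; have qY := q_gt0 s y.
have -> : q s x - q s y = (Y - X) * ((X + Y) * (q s x * q s y)).
  by rewrite /q; rewrite -/X -/Y in qX qY *; field; rewrite !gt_eqF.
have bX : q s x <= (mu * X ^+ 2)^-1.
  by rewrite lef_pV2 ?posrE//; [exact: q_bounds | pos].
have bY : q s y <= (mu * Y ^+ 2)^-1.
  by rewrite lef_pV2 ?posrE//; [exact: q_bounds | pos].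
have qx0 : 0 <= q s x by case/andP: (q_le s x).
have qy0 : 0 <= q s y by case/andP: (q_le s y).
have P0 : 0 <= (X + Y) * (q s x * q s y).
  by apply: mulr_ge0; [apply: addr_ge0; exact: ltW | exact: mulr_ge0].
rewrite normrM (ger0_norm P0) distrC mulrC.
apply: ler_pM => //.
apply: (@le_trans _ _ ((X + Y) * ((mu * X ^+ 2)^-1 * (mu * Y ^+ 2)^-1))).
  by rewrite ler_pM2l ?addr_gt0//; exact: ler_pM.
have -> : (X + Y) * ((mu * X ^+ 2)^-1 * (mu * Y ^+ 2)^-1) =
  (mu ^+ 2)^-1 * (X^-1 * (Y^-1) ^+ 2 + Y^-1 * (X^-1) ^+ 2).
  by field; rewrite !gt_eqF.
have -> : 2 / (mu ^+ 2 * (l * a) ^+ 3) = (mu ^+ 2)^-1 * ((l * a)^-1 * ((l * a)^-1) ^+ 2 + (l * a)^-1 * ((l * a)^-1) ^+ 2).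
  by field; rewrite !gt_eqF.
rewrite ler_pM2l ?invr_gt0 ?exprn_gt0//.
have iX : X^-1 <= (l * a)^-1 by rewrite lef_pV2 ?posrE//; exact: la.
have iY : Y^-1 <= (l * a)^-1 by rewrite lef_pV2 ?posrE//; exact: la.
have iX0 : 0 <= X^-1 by rewrite invr_ge0 ltW.
have iY0 : 0 <= Y^-1 by rewrite invr_ge0 ltW.
have ila : 0 <= (l * a)^-1 by rewrite invr_ge0 ltW.
by apply: lerD; apply: ler_pM => //; rewrite ?sqr_ge0 ?ler_sqr ?nnegrE.
Qed.

Let F_lip b : exists2 L, 0 < L &
  forall i s x y x' y', a <= s <= b ->
    `|F i s x y - F i s x' y'| <= L * (`|x - x'| + `|y - y'|).
Proof.
have [ab|ba] := leP a b; last by exists 1 => // i s x y x' y' /andP[? ?]; lra.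
have [N N0 HN] : exists2 N, 0 <= N & forall s, a <= s <= b ->
    `|2 * V kappa s ^+ 2| <= N.
  apply: segment_bounded => // s _; have d := der_V kappa s.
  by eapply der_cont; der.
pose Q := 2 / (mu ^+ 2 * (l * a) ^+ 3); pose B := (mu * (l * a) ^+ 2)^-1.
have Q0 : 0 < Q by rewrite /Q; pos.
have B0 : 0 < B by rewrite /B; pos.
pose e := expR (4 * phi a); have e0 : 0 < e := expR_gt0 _.
pose L := 1 + N * (4 * e * B + e * Q) + c ^+ 2 * b * Q.
have b0 : 0 < b by exact: lt_le_trans ab.
have L1 : 0 <= N * (4 * e * B + e * Q).
  by apply: mulr_ge0 => //; apply: addr_ge0; pos.
have L2 : 0 <= c ^+ 2 * b * Q.
  by pos.
exists L; first by rewrite /L; lra.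
move=> i s x y x' y' sab; have ts : t s = s by rewrite /t max_l//; case/andP: sab.
have qlip := q_lip s x x'; rewrite -/Q in qlip.
have nx := normr_ge0 (x - x'); have ny := normr_ge0 (y - y').
have /andP[q0 qB] := q_le s x; rewrite -/B in qB.
apply: (@le_trans _ _ ((N * (4 * e * B + e * Q) + c ^+ 2 * b * Q) * (`|x - x'| + `|y - y'|))); last first.
  by rewrite ler_wpM2r ?addr_ge0// /L; lra.
case: i; rewrite /F ts.
  set w := 2 * V kappa s ^+ 2.
  have wN : `|w| <= N by exact: HN.
  set m := Num.min y (phi a); set m' := Num.min y' (phi a).
  have ma : m <= phi a by rewrite ge_min lexx orbT.
  have m'a : m' <= phi a by rewrite ge_min lexx orbT.
  have mm : `|m - m'| <= `|y - y'|.
    have := ler_norm (y - y'); have := ler_norm (y' - y); rewrite distrC => h1 h2.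
    by rewrite /m /m' !minEle ler_norml; case: ifPn; case: ifPn => *; apply/andP; split; lra.
  have -> : w * expR (4 * m) * q s x - w * expR (4 * m') * q s x' =
    w * ((expR (4 * m) - expR (4 * m')) * q s x + expR (4 * m') * (q s x - q s x')) by ring.
  rewrite normrM.
  have h1 : `|expR (4 * m) - expR (4 * m')| <= 4 * e * `|y - y'|.
    apply: (le_trans (@expR_lipschitz _ (4 * phi a) _ _ _ _)); [lra|lra|].
    rewrite -/e -mulrBr normrM ger0_norm// mulrA [e * 4]mulrC.
    by rewrite ler_pM2l// mulr_gt0.
  have h2 : expR (4 * m') <= e by rewrite ler_expR; lra.
  have h3 : `|(expR (4 * m) - expR (4 * m')) * q s x + expR (4 * m') * (q s x - q s x')|
    <= 4 * e * `|y - y'| * B + e * (Q * `|x - x'|).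
    apply: (le_trans (ler_normD _ _)); rewrite !normrM (ger0_norm q0).
    rewrite (ger0_norm (expR_ge0 _)); apply: lerD; apply: ler_pM => //.
  apply: (@le_trans _ _ (N * (4 * e * `|y - y'| * B + e * (Q * `|x - x'|)))).
    exact: ler_pM.
  rewrite [leRHS](_ : _ = N * ((4 * e * B + e * Q) * (`|x - x'| + `|y - y'|)) +
    c ^+ 2 * b * Q * (`|x - x'| + `|y - y'|)); last by ring.
  apply: ler_wpDr; first by rewrite mulr_ge0// addr_ge0.
  rewrite ler_wpM2l// -subr_ge0.
  have -> : (4 * e * B + e * Q) * (`|x - x'| + `|y - y'|) -
    (4 * e * `|y - y'| * B + e * (Q * `|x - x'|)) = 4 * e * B * `|x - x'| + e * Q * `|y - y'| by ring.
  by apply: addr_ge0; pos.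
rewrite -mulrBr normrM normrN.
have s0 : 0 < s by case/andP: sab => h _; exact: lt_le_trans h.
rewrite (gtr0_norm (u0_du0_gt0 a0 s0)) mulrDl.
apply: ler_wpDl; first by rewrite mulr_ge0// addr_ge0.
rewrite -[c ^+ 2 * b * Q * _]mulrA; apply: ler_pM => //.
- exact/ltW/u0_du0_gt0.
- apply: (le_trans (u0_du0_le a0 s0)); rewrite ler_pM2l ?exprn_gt0//.
  by case/andP: sab.
- by apply: (le_trans qlip); rewrite ler_pM2l// lerDl.
Qed.

Let cont_comp (f g : R -> R) s : {for s, continuous g} ->
  {for g s, continuous f} -> {for s, continuous (fun x => f (g x))}.
Proof. by move=> cg cf; exact: continuous_comp. Qed.

Let F_cont i f g : continuous f -> continuous g ->
  continuous (fun s => F i s (f s) (g s)).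
Proof.
move=> cf cg s.
have ct : {for s, continuous t} by exact: max_continuous.
have t0 := t_gt0 s.
have cu0 : {for s, continuous (fun s => u0 alpha (t s))}.
  by apply: (cont_comp ct); exact: der_cont (der_u0 alpha t0).
have cdu0 : {for s, continuous (fun s => du0 alpha (t s))}.
  apply: (cont_comp ct); rewrite /du0 /dlangevin; eapply der_cont; der.
  - by rewrite gt_eqF// sinh_gt0//; lra.
  - by rewrite expf_neq0// gt_eqF// sinh_gt0//; lra.
have cV : {for s, continuous (fun s => V kappa (t s))}.
  by apply: (cont_comp ct); exact: der_cont (der_V kappa _).
have sqr (h : R -> R) : {for s, continuous h} -> {for s, continuous (fun x => h x ^+ 2)}.
  by move=> ch; apply: (@cont_comp (fun y => y ^+ 2)) => //; exact: exprn_continuous.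
have cM : {for s, continuous (fun s => Num.max (f s) (l * t s))}.
  apply: continuous_max; first exact: cf.
  by apply: cvgM => //; exact: cvg_cst.
have cq : {for s, continuous (fun s => q s (f s))}.
  apply: cvgV; first by rewrite gt_eqF// q_gt0.
  by apply: cvgB; exact: sqr.
have cm : {for s, continuous (fun s => Num.min (g s) (phi a))}.
  by apply: continuous_min; [exact: cg | exact: cvg_cst].
have ce : {for s, continuous (fun s => expR (4 * Num.min (g s) (phi a)))}.
  apply: (@cont_comp expR); last exact: continuous_expR.
  by apply: cvgM => //; exact: cvg_cst.
rewrite /F; case: i.
  by apply: cvgM => //; apply: cvgM => //; apply: cvgM; [exact: cvg_cst | exact: sqr].
by apply: cvgM => //; apply: cvgN; exact: cvgM.
Qed.

Lemma supercritical_from : exists u' phi' : R -> R,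
  [/\ u' a = u a, phi' a = phi a & forall s, a <= s ->
    [/\ 0 < u' s, u0 alpha s ^+ 2 < u' s ^+ 2,
      is_derive s 1 u' (rhs_u alpha kappa s (u' s) (phi' s))
    & is_derive s 1 phi' (rhs_phi alpha s (u' s))]].
Proof.
have [y ya dy] := picard_global (fun i : bool => if i then u a else phi a) F_cont F_lip.
have tE s : a <= s -> t s = s by move=> h; rewrite /t max_l.
(* The dilaton component decreases, so its truncation at [phi a] is inactive. *)
have mono s : a <= s -> y false s <= phi a.
  move=> as_; rewrite -(ya false); apply: (@deriv_le0_ge R _ _ a s as_).
    by move=> x /andP[ax _]; exact: dy.
  move=> x /andP[ax _]; rewrite /F /= (tE x (ltW ax)) mulNr oppr_le0.
  apply: mulr_ge0; last by case/andP: (q_le x (y true x)).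
  by apply/ltW/u0_du0_gt0 => //; exact: lt_trans ax.
have FE s : a <= s -> l * s < y true s ->
    F true s (y true s) (y false s) = rhs_u alpha kappa s (y true s) (y false s) /\
    F false s (y true s) (y false s) = rhs_phi alpha s (y true s).
  move=> as_ ls; rewrite /F /q tE// max_l ?(ltW ls)// min_l ?mono//.
have [ua ga] := ray_lt a0 k0 sol zd l00 l0E (ltW lc) ll0 a_gt0 aT.
(* The first component starts above the ray and obeys the true system as long as it is above it, so
   it never reaches the truncation. *)
have ray s : a <= s -> l * s < y true s.
  move=> as_; have [] := @ray_persist _ alpha kappa l (y true) (y false)
    (fun x => F true x (y true x) (y false x)) (fun x => F false x (y true x) (y false x))
    a s a0 (ltW lc) a_gt0 as_ => //.
  - by move=> x /andP[ax _]; exact: dy.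
  - by move=> x /andP[ax _]; exact: dy.
  - by move=> x /andP[ax _]; exact: FE.
  - by rewrite ya.
  - by move: ga; rewrite /ray_gap ya.
exists (y true), (y false); split; [exact: ya | exact: ya|] => s as_.
have s0 : 0 < s by exact: lt_le_trans as_.
have ls := ray s as_; have [F1 F2] := FE s as_ ls.
split.
- by apply: lt_trans ls; rewrite mulr_gt0.
- apply: (lt_le_trans (u0_sqr_lt a0 s0)); rewrite -exprMn.
  have h : c * s <= y true s by apply: le_trans (ltW ls); rewrite ler_pM2r// ltW.
  have w0 : 0 <= c * s by apply: mulr_ge0; exact: ltW.
  by rewrite ler_sqr ?nnegrE//; apply: le_trans h.
- by rewrite -F1; exact: dy.
- by rewrite -F2; exact: dy.
Qed.

End Start.

(** The solution is restarted at an interior point [a] and glued there. Uniqueness from the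
    zero-section then shows that the result agrees with the given solution on all of (0, T), and not
    merely up to [a]. *)
Theorem supercritical_global : exists u' phi' : R -> R,
  extends T u phi +oo%E u' phi' /\ solves alpha kappa +oo%E u' phi'.
Proof.
have [a /andP[a_gt0 _] aT] := ereal_exists_below ltr01 T0.
have [v [psi [va psia H]]] := supercritical_from a_gt0 aT.
pose u' s := if s < a then u s else v s.
pose phi' s := if s < a then phi s else psi s.
have sol' : solves alpha kappa +oo%E u' phi'.
  apply/(solvesP _ _ _ _ k0) => s s0 _; have [sa|] := ltP s a.
    have aT' : (a%:E <= T)%E by exact: ltW.
    apply: (solves_near s0 _ (solves_le aT' sol)); first by rewrite lte_fin.
    by move=> x x0; rewrite lte_fin /u' /phi' => ->.
  rewrite le_eqVlt => /predU1P[<-|as_].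
    have [_ _ du dphi] := (solvesP _ _ _ _ k0).1 sol a a_gt0 aT.
    have [v0 av dv dpsi] := H a (lexx a).
    rewrite /u' /phi' !ltxx; split=> //; apply: der_glue => //.
    - by rewrite va psia.
    - by rewrite va.
  have [v0 av dv dpsi] := H s (ltW as_).
  have nr : \forall x \near s, a < x by exact: (cvgr_gt s cvg_id _ as_).
  have [us ps] : u' s = v s /\ phi' s = psi s by rewrite /u' /phi' ltNge (ltW as_).
  rewrite us ps; split=> //.
  - by apply: der_near dv; apply: filterS nr => x ax; rewrite /u' ltNge (ltW ax).
  - by apply: der_near dpsi; apply: filterS nr => x ax; rewrite /phi' ltNge (ltW ax).
have ea : extends a%:E u phi +oo%E u' phi'.
  split; first by rewrite leey.
  by move=> s s0; rewrite lte_fin /u' /phi' => ->.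
have zd' := zero_data_extends (_ : (0 < a%:E)%E) ea zd.
exists u', phi'; split => //; split; first by rewrite leey.
move=> s s0 sT; have solT := solves_le (leey T) sol'.
by have [] := solution_unique a0 k0 solT sol l00 (zd' a_gt0) zd s0 sT.
Qed.

End Supercritical.

End Extension.

(** * Asymptotics of supercritical solutions *)

Section Limits.
Context {R : realType}.

Lemma cvg_pinfty_le (f g : R -> R) (N : R) : (forall s, N <= s -> `|f s| <= g s) ->
  g s @[s --> +oo] --> 0 -> f s @[s --> +oo] --> 0.
Proof.
move=> H /cvgrPdist_lt cg; apply/cvgrPdist_lt => e e0.
have := cg e e0; rewrite /=; apply: filterS2 (nbhs_pinfty_ge (num_real N)).
move=> s Ns; rewrite !sub0r !normrN => h.
by apply: le_lt_trans (H s Ns) (le_lt_trans (ler_norm _) h).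
Qed.

Lemma expRN_le (s : R) : 0 < s -> expR (- s) <= s^-1.
Proof.
move=> s0; rewrite expRN lef_pV2 ?posrE ?expR_gt0//.
by apply: le_trans (expR_ge1Dx s); rewrite lerDr.
Qed.

Lemma expRN_cvg0 (k : R) : 0 < k -> expR (- (k * s)) @[s --> +oo] --> (0 : R).
Proof.
move=> k0; apply/cvgrPdist_lt => e e0; near=> s.
have s0 : 0 < s by near: s; exact: nbhs_pinfty_gt.
rewrite sub0r normrN ger0_norm ?expR_ge0//.
apply: (le_lt_trans (expRN_le (mulr_gt0 k0 s0))).
rewrite invf_plt ?posrE ?mulr_gt0// -ltr_pdivrMl//.
by near: s; apply: nbhs_pinfty_gt; exact: num_real.
Unshelve. all: by end_near. Qed.

Lemma nonincreasing_cvg_pinfty (f : R -> R) (N m : R) :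
  (forall x y, N <= x -> x <= y -> f y <= f x) -> (forall x, N <= x -> m <= f x) ->
  exists L : R, f s @[s --> +oo] --> L.
Proof.
move=> mono lb; pose A := [set f x | x in [set x | N <= x]].
have iA : has_inf A.
  split; first by exists (f N), N => /=.
  by exists m => _ [x Nx <-]; exact: lb.
exists (inf A); apply/cvgrPdist_lt => e e0.
have [_ [x Nx <-] fx] := inf_adherent e0 iA.
near=> s.
have xs : x <= s by near: s; apply: nbhs_pinfty_ge; exact: num_real.
have h1 : inf A <= f s.
  by apply: ge_inf; [case: iA | exists s => //=; exact: le_trans xs].
have h2 := mono x s Nx xs.
by rewrite ltr_norml; apply/andP; split; lra.
Unshelve. all: by end_near. Qed.

(** Once h is within e/2 of its limit H, Gronwall makes the excess of |g - H| over e/2 decay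
    exponentially. *)
Lemma linear_ode_cvg (g h : R -> R) (k N H : R) : 0 < k ->
  (forall s, N <= s -> is_derive s 1 g (k * (h s - g s))) ->
  h s @[s --> +oo] --> H -> g s @[s --> +oo] --> H.
Proof.
move=> k0 dg /cvgrPdist_lt ch; apply/cvgrPdist_lt => e e0.
have e2 : 0 < e / 2 by lra.
have [M [_ HM]] := ch _ e2.
pose B := Num.max N (M + 1).
have BN : N <= B by rewrite le_max lexx.
have hB s : B <= s -> `|H - h s| < e / 2.
  by move=> Bs; apply: HM; apply: lt_le_trans Bs; rewrite lt_max ltrDl ltr01 orbT.
have K : \forall s \near +oo, (`|g B - H| + e / 2) * expR (- (k * (s - B))) < e / 2.
  have c0 : (`|g B - H| + e / 2) * expR (k * B) * expR (- (k * s)) @[s --> +oo] --> (0 : R).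
    rewrite -[X in _ --> X](mulr0 ((`|g B - H| + e / 2) * expR (k * B))).
    by apply: cvgM; [exact: cvg_cst | exact: expRN_cvg0].
  move/cvgrPdist_lt: c0 => /(_ _ e2); apply: filterS => s.
  rewrite sub0r normrN; apply: le_lt_trans.
  rewrite -mulrA -expRD (_ : k * B + - (k * s) = - (k * (s - B))); last by ring.
  exact: ler_norm.
near=> s.
have Bs : B <= s by near: s; apply: nbhs_pinfty_ge; exact: num_real.
have Ks : (`|g B - H| + e / 2) * expR (- (k * (s - B))) < e / 2 by near: s; exact: K.
have xB x : B <= x <= s -> N <= x by move=> /andP[Bx _]; exact: le_trans Bx.
have up : g s - H - e / 2 <= (g B - H - e / 2) * expR (- k * (s - B)).
  apply: (@gronwall_le R (fun x => g x - H - e / 2) (fun x => k * (h x - g x))) => //.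
    by move=> x /xB Nx; have D := dg x Nx; derE ring.
  move=> x /andP[Bx xs]; have := hB x (ltW Bx); rewrite ltr_norml => /andP[h1 h2].
  by rewrite mulNr -mulrN ler_pM2l//; lra.
have dn : H - g s - e / 2 <= (H - g B - e / 2) * expR (- k * (s - B)).
  apply: (@gronwall_le R (fun x => H - g x - e / 2) (fun x => - (k * (h x - g x)))) => //.
    by move=> x /xB Nx; have D := dg x Nx; derE ring.
  move=> x /andP[Bx xs]; have := hB x (ltW Bx); rewrite ltr_norml => /andP[h1 h2].
  by rewrite mulNr -!mulrN ler_pM2l//; lra.
move: up dn Ks; rewrite mulNr; have := expR_ge0 (- (k * (s - B))).
move: (expR _) => E E0 up dn Ks.
have n1 := ler_norm (g B - H); have n2 := ler_norm (H - g B); rewrite distrC in n2.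
have w1 : (g B - H - e / 2) * E <= (`|g B - H| + e / 2) * E by rewrite ler_wpM2r//; lra.
have w2 : (H - g B - e / 2) * E <= (`|g B - H| + e / 2) * E by rewrite ler_wpM2r//; lra.
by rewrite ltr_norml; apply/andP; split; lra.
Unshelve. all: by end_near. Qed.

Lemma sqr_le_expR (s : R) : 0 <= s -> s ^+ 2 <= 4 * expR s.
Proof.
move=> s0; have h : s / 2 <= expR (s / 2).
  by apply: le_trans (expR_ge1Dx _); rewrite lerDr.
have -> : expR s = expR (s / 2) ^+ 2 by rewrite -expRM_natl; congr expR; field.
by have := expR_gt0 (s / 2); nra.
Qed.

Lemma sinh3E (s : R) : sinh (3 * s) = expR (3 * s) * (1 - expR (- (6 * s))) / 2.
Proof.
rewrite /sinh mulrBr mulr1 -expRD (_ : 3 * s + - (6 * s) = - (3 * s)) //; ring.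
Qed.

Lemma cosh3E (s : R) : cosh (3 * s) = expR (3 * s) * (1 + expR (- (6 * s))) / 2.
Proof.
rewrite /cosh mulrDr mulr1 -expRD (_ : 3 * s + - (6 * s) = - (3 * s)) //; ring.
Qed.

Lemma sinh3_scaled_cvg : sinh (3 * s) * expR (- (3 * s)) @[s --> +oo] --> (2^-1 : R).
Proof.
rewrite (_ : (fun s : R => _) = fun s => (1 - expR (- (6 * s))) / 2).
  rewrite -[X in _ --> X]mul1r -[X in X * _](subr0 1).
  by apply: cvgM; [apply: cvgB; [exact: cvg_cst | exact: expRN_cvg0] | exact: cvg_cst].
apply/funext => s; rewrite sinh3E (expRN (3 * s)); field.
by rewrite gt_eqF// expR_gt0.
Qed.

Lemma nu3_cvg : @nu3 R s @[s --> +oo] --> (1 : R).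
Proof.
have h : (fun s : R => (1 + expR (- (6 * s))) / (1 - expR (- (6 * s)))) =1 @nu3 R.
  move=> s; rewrite /nu3 cosh3E sinh3E.
  have [->|n0] := eqVneq (1 - expR (- (6 * s))) 0; first by rewrite mulr0 mul0r invr0 !mulr0.
  by field; rewrite n0 gt_eqF// expR_gt0.
rewrite -(funext h) -[X in _ --> X](divr1 1) -[X in X / _](addr0 1) -[X in _ / X](subr0 1).
apply: cvgM; first by apply: cvgD; [exact: cvg_cst | exact: expRN_cvg0].
by apply: cvgV; [rewrite subr0 oner_neq0 | apply: cvgB; [exact: cvg_cst | exact: expRN_cvg0]].
Qed.

Lemma sinh3_ge (s : R) : 1 <= s -> expR (3 * s) / 4 <= sinh (3 * s).
Proof.
move=> s1; rewrite sinh3E; have := expR_gt0 (3 * s).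
have : expR (- (6 * s)) <= 1 / 2.
  have s6 : 0 < 6 * s by lra.
  by apply: (le_trans (expRN_le s6)); rewrite -div1r ler_pdivrMr//; lra.
by move: (expR _) (expR _) => x y; nra.
Qed.

Lemma nu0_cvg : @nu0 R s @[s --> +oo] --> (0 : R).
Proof.
apply: (@cvg_pinfty_le _ (fun s => 4 * expR (- (3 * s))) 1).
  move=> s s1; have S0 : 0 < sinh (3 * s) by apply: sinh_gt0; lra.
  rewrite /nu0 normrN gtr0_norm ?invr_gt0//.
  have := sinh3_ge s1; rewrite expRN => h.
  have -> : 4 * (expR (3 * s))^-1 = (expR (3 * s) / 4)^-1.
    by field; rewrite gt_eqF// expR_gt0.
  by rewrite lef_pV2 ?posrE// divr_gt0// expR_gt0.
rewrite -[X in _ --> X](mulr0 4); apply: cvgM; first exact: cvg_cst.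
exact: expRN_cvg0.
Qed.

End Limits.

(** * Growth of [u] and convergence of the dilaton *)

Section SupercriticalAsymptotics.
Context {R : realType}.
Variables (alpha kappa l0 p0 : R) (u phi : R -> R).
Hypotheses (a0 : alpha != 0) (k0 : 0 < kappa).
Hypotheses (sol : solves alpha kappa +oo%E u phi) (zd : zero_data l0 p0 u phi).
Hypotheses (l0E : l0 ^+ 3 = 18 * kappa ^+ 2 * expR (4 * p0)).
Hypothesis (cl : crit_slope alpha < l0).

Let c := crit_slope alpha.
Let c0 : 0 < c. Proof. exact: crit_slope_gt0. Qed.
Let l := (c + l0) / 2.
Let lc : c < l. Proof. by have := cl; rewrite /l /c; lra. Qed.
Let ll0 : l < l0. Proof. by have := cl; rewrite /l /c; lra. Qed.
Let l_gt0 : 0 < l. Proof. exact: lt_trans lc. Qed.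
Let l00 : 0 < l0. Proof. exact: lt_trans ll0. Qed.

Let solP s : 0 < s ->
  [/\ 0 < u s, u0 alpha s ^+ 2 < u s ^+ 2,
      is_derive s 1 u (rhs_u alpha kappa s (u s) (phi s))
    & is_derive s 1 phi (rhs_phi alpha s (u s))].
Proof. by move=> s0; apply: (solvesP _ _ _ _ k0).1 sol s s0 (ltry _). Qed.

Let u_ge s : 0 < s -> l * s < u s.
Proof. by move=> s0; have [] := ray_lt a0 k0 sol zd l00 l0E (ltW lc) ll0 s0 (ltry _). Qed.

Let mu := (l ^+ 2 - c ^+ 2) / l ^+ 2.
Let mu_gt0 : 0 < mu.
Proof.
apply: divr_gt0; last by pos.
by rewrite subr_gt0 ltr_sqr ?nnegrE ?(ltW c0) ?(ltW l_gt0).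
Qed.

Lemma gap_ge : exists2 m : R, 0 < m & forall s, 0 < s ->
  m * u s ^+ 2 <= u s ^+ 2 - u0 alpha s ^+ 2.
Proof.
exists mu => // s s0; have := u0_sqr_lt a0 s0; rewrite -/c => m.
have h : c ^+ 2 * s ^+ 2 <= c ^+ 2 / l ^+ 2 * u s ^+ 2.
  have -> : c ^+ 2 * s ^+ 2 = c ^+ 2 / l ^+ 2 * (l * s) ^+ 2.
    by field; rewrite gt_eqF.
  rewrite ler_pM2l; last by pos.
  have w0 : 0 <= l * s by apply: mulr_ge0; exact: ltW.
  have w1 : l * s <= u s by apply/ltW/u_ge.
  by rewrite ler_sqr ?nnegrE//; exact: le_trans w1.
have -> : mu * u s ^+ 2 = u s ^+ 2 - c ^+ 2 / l ^+ 2 * u s ^+ 2.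
  by rewrite /mu; field; rewrite gt_eqF.
by lra.
Qed.

Lemma dilaton_nonincreasing x y : 0 < x -> x <= y -> phi y <= phi x.
Proof.
move=> x0 xy; apply: (@deriv_le0_ge R phi (fun s => rhs_phi alpha s (u s)) x y xy).
  by move=> s /andP[xs _]; have [] := solP (lt_le_trans x0 xs).
move=> s /andP[xs _]; have s0 := lt_trans x0 xs.
have [_ h _ _] := solP s0; rewrite /rhs_phi mulNr oppr_le0.
by apply: mulr_ge0; [exact/ltW/u0_du0_gt0 | rewrite invr_ge0 subr_ge0 ltW].
Qed.

Let dphi_ge s : 0 < s -> - (c ^+ 2 / mu * (s / u s ^+ 2)) <= rhs_phi alpha s (u s).
Proof.
move=> s0; have [us h _ _] := solP s0.
have [m m0 _] := gap_ge.
have mg : mu * u s ^+ 2 <= u s ^+ 2 - u0 alpha s ^+ 2.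
  have := u0_sqr_lt a0 s0; rewrite -/c => m1.
  have h1 : c ^+ 2 * s ^+ 2 <= c ^+ 2 / l ^+ 2 * u s ^+ 2.
    have -> : c ^+ 2 * s ^+ 2 = c ^+ 2 / l ^+ 2 * (l * s) ^+ 2.
      by field; rewrite gt_eqF.
    rewrite ler_pM2l; last by pos.
    have w0 : 0 <= l * s by apply: mulr_ge0; exact: ltW.
    have w1 : l * s <= u s by apply/ltW/u_ge.
    by rewrite ler_sqr ?nnegrE//; exact: le_trans w1.
  have -> : mu * u s ^+ 2 = u s ^+ 2 - c ^+ 2 / l ^+ 2 * u s ^+ 2.
    by rewrite /mu; field; rewrite gt_eqF.
  by lra.
rewrite /rhs_phi mulNr lerN2.
have -> : c ^+ 2 / mu * (s / u s ^+ 2) = c ^+ 2 * s * (mu * u s ^+ 2)^-1.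
  by field; rewrite !gt_eqF.
apply: ler_pM.
- exact/ltW/u0_du0_gt0.
- by rewrite invr_ge0 subr_ge0 ltW.
- exact: u0_du0_le.
- have p1 : 0 < mu * u s ^+ 2 by pos.
  by rewrite lef_pV2 ?posrE//; exact: lt_le_trans mg.
Qed.

(** A bootstrap. The linear bound u >= l s gives phi' >= - K / s, hence phi' >= - 1/4 for large s,
    so e^(4 phi) decays no faster than e^(-s). Then (u^3)' >= 6 V^2 e^(4 phi) is at least of order
    e^(5s), more than enough for u^3 >= m e^(3s). *)
Lemma u_exp_growth : exists C s1 : R, [/\ 0 < C, 1 <= s1 &
  forall s, s1 <= s -> C * expR s <= u s].
Proof.
pose K := c ^+ 2 / mu / l ^+ 2.
have K0 : 0 < K by rewrite /K; pos.
pose s1 := Num.max 1 (4 * K).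
have s11 : 1 <= s1 by rewrite le_max lexx.
have s1K : 4 * K <= s1 by rewrite le_max lexx orbT.
have s10 : 0 < s1 by lra.
have dphi4 s : s1 <= s -> - 4^-1 <= rhs_phi alpha s (u s).
  move=> ss; have s0 : 0 < s by lra.
  apply: le_trans (dphi_ge s0); rewrite lerN2.
  have -> : c ^+ 2 / mu * (s / u s ^+ 2) = K * ((l * s) ^+ 2 / u s ^+ 2) / s.
    have [us _ _ _] := solP s0.
    by rewrite /K; field; rewrite !gt_eqF.
  rewrite ler_pdivrMr//; apply: (@le_trans _ _ K); last by lra.
  rewrite -[leRHS]mulr1 ler_pM2l// ler_pdivrMr ?exprn_gt0//; last by case: (solP s0).
  have w0 : 0 <= l * s by apply: mulr_ge0; exact: ltW.
  have w1 : l * s <= u s by apply/ltW/u_ge.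
  by rewrite mul1r ler_sqr ?nnegrE//; exact: le_trans w1.
have phi_ge s : s1 <= s -> phi s1 - (s - s1) / 4 <= phi s.
  move=> ss; have := @deriv_le_sub R (fun x => - (x / 4)) (fun=> - 4^-1) phi
    (fun s => rhs_phi alpha s (u s)) s1 s ss.
  have d1 x : s1 <= x <= s -> is_derive x 1 (fun x : R => - (x / 4)) (- 4^-1).
    by move=> _; derE ring.
  have d2 x : s1 <= x <= s -> is_derive x 1 phi (rhs_phi alpha x (u x)).
    by move=> /andP[sx _]; have [] := solP (lt_le_trans s10 sx).
  move=> /(_ d1 d2) h; have := h (fun x xs => dphi4 x (ltW (proj1 (andP xs)))).
  by lra.
pose K1 := 6 / 16 * kappa ^+ 2 * expR (4 * phi s1 + s1).
have K10 : 0 < K1 by rewrite /K1; pos.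
(* The first entry makes the derivative of m e^(3s) at most K1 e^(3s), the second gives the
   comparison at [s1]. *)
pose m := Num.min (K1 / 3) (u s1 ^+ 3 / expR (3 * s1)).
have [us1 _ _ _] := solP s10.
have m0 : 0 < m.
  rewrite lt_min; apply/andP; split; first by pos.
  by apply: divr_gt0; [exact: exprn_gt0 | exact: expR_gt0].
have mK : 3 * m <= K1.
  have : m <= K1 / 3 by rewrite /m ge_min lexx.
  by lra.
have mu1 : m * expR (3 * s1) <= u s1 ^+ 3.
  by rewrite -ler_pdivlMr ?expR_gt0// /m ge_min lexx orbT.
exists (expR (ln m / 3)), s1; split => // [|s ss]; first exact: expR_gt0.
have s0 : 0 < s by lra.
have [us _ _ _] := solP s0.
rewrite -(@ler_pXn2r _ 3) ?nnegrE ?(ltW us) ?mulr_ge0 ?expR_ge0//.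
rewrite exprMn -!expRM_natl (_ : 3%:R * (ln m / 3) = ln m); last by field.
rewrite lnK ?posrE//.
suff : u s1 ^+ 3 - m * expR (3 * s1) <= u s ^+ 3 - m * expR (3 * s) by lra.
apply: (@deriv_ge0_le R (fun x => u x ^+ 3 - m * expR (3 * x))
  (fun x => 3 * u x ^+ 2 * rhs_u alpha kappa x (u x) (phi x) - 3 * m * expR (3 * x)) s1 s ss).
  move=> x /andP[sx _]; have [_ _ du _] := solP (lt_le_trans s10 sx).
  by derE ring.
move=> x /andP[sx _]; have x0 : 0 < x by lra.
have [ux ax _ _] := solP x0; rewrite subr_ge0.
have A0 : 0 < u x ^+ 2 - u0 alpha x ^+ 2 by rewrite subr_gt0.
apply: (@le_trans _ _ (6 * V kappa x ^+ 2 * expR (4 * phi x))); last first.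
  have -> : 3 * u x ^+ 2 * rhs_u alpha kappa x (u x) (phi x) =
    6 * V kappa x ^+ 2 * expR (4 * phi x) * (u x ^+ 2 / (u x ^+ 2 - u0 alpha x ^+ 2)).
    by rewrite /rhs_u; field; rewrite gt_eqF.
  rewrite -[leLHS]mulr1; apply: ler_wpM2l; first by pos.
  by rewrite ler_pdivlMr// mul1r lerBlDr lerDl sqr_ge0.
have x1 : 1 <= x by lra.
have S1 := sinh3_ge x1.
have V1 : (kappa * (expR (3 * x) / 4)) ^+ 2 <= V kappa x ^+ 2.
  rewrite ler_sqr ?nnegrE.
  - by rewrite /V ler_pM2l.
  - by pos.
  - exact/ltW/V_gt0.
apply: (@le_trans _ _ (6 * (kappa * (expR (3 * x) / 4)) ^+ 2 * expR (4 * phi s1 + s1 - x))); last first.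
  apply: ler_pM; [by pos | exact: expR_ge0 | by rewrite ler_pM2l|].
  by rewrite ler_expR; have := phi_ge x (ltW sx); lra.
have -> : 6 * (kappa * (expR (3 * x) / 4)) ^+ 2 * expR (4 * phi s1 + s1 - x) =
  K1 * (expR (3 * x) * (expR (3 * x) * expR (- x))).
  by rewrite /K1 expRD; field.
have e1 : 1 <= expR (3 * x) * expR (- x).
  by rewrite -expRD -[leLHS]expR0 ler_expR; lra.
apply: (@le_trans _ _ (K1 * expR (3 * x))); first by rewrite ler_pM2r ?expR_gt0.
by rewrite ler_pM2l// ler_peMr ?expR_ge0.
Qed.

(** The dilaton decreases, and its derivative is at least - (c^2 / mu) s / u^2, which by the
    exponential growth of u is bounded below by - K e^(-s). *)
Lemma dilaton_cvg : exists L : R, phi s @[s --> +oo] --> L.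
Proof.
have [C [s1 [C0 s11 HC]]] := u_exp_growth.
have s10 : 0 < s1 by lra.
pose K := c ^+ 2 / mu / C ^+ 2.
have K0 : 0 < K by rewrite /K; pos.
apply: (@nonincreasing_cvg_pinfty R phi s1 (phi s1 - K)).
  by move=> x y sx xy; apply: dilaton_nonincreasing => //; exact: lt_le_trans sx.
move=> s ss.
have : phi s1 - K * expR (- s1) <= phi s - K * expR (- s).
  apply: (@deriv_ge0_le R (fun x => phi x - K * expR (- x))
    (fun x => rhs_phi alpha x (u x) + K * expR (- x)) s1 s ss).
    move=> x /andP[sx _]; have [_ _ _ d] := solP (lt_le_trans s10 sx).
    by derE ring.
  move=> x /andP[sx _]; have x0 : 0 < x by lra.
  have := dphi_ge x0; suff : c ^+ 2 / mu * (x / u x ^+ 2) <= K * expR (- x) by lra.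
  have [ux _ _ _] := solP x0.
  have uC := HC x (ltW sx).
  have -> : K * expR (- x) = c ^+ 2 / mu * (expR x / (C * expR x) ^+ 2).
    by rewrite /K expRN; field; rewrite !gt_eqF ?expR_gt0.
  rewrite ler_pM2l; last by pos.
  have CE : 0 < C * expR x by rewrite mulr_gt0 ?expR_gt0.
  apply: ler_pM; [exact: ltW | by pos | |].
    by apply: le_trans (expR_ge1Dx x); rewrite lerDr.
  rewrite lef_pV2 ?posrE ?exprn_gt0// ler_sqr ?nnegrE//; exact: ltW.
have e1 : expR (- s1) <= 1 by rewrite -expR0 ler_expR; lra.
have := ler_pM2l K0 (expR (- s1)) 1; rewrite e1 mulr1.
by have := mulr_ge0 (ltW K0) (expR_ge0 (- s)); lra.
Qed.

Lemma u0_div_u_cvg : u0 alpha s ^+ 2 / u s ^+ 2 @[s --> +oo] --> (0 : R).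
Proof.
have [C [s1 [C0 s11 HC]]] := u_exp_growth.
apply: (@cvg_pinfty_le _ _ (fun s => 4 * c ^+ 2 / C ^+ 2 * expR (- (1 * s))) s1).
  move=> s ss; have s0 : 0 < s by lra.
  have [us _ _ _] := solP s0.
  rewrite ger0_norm; last by pos.
  have -> : 4 * c ^+ 2 / C ^+ 2 * expR (- (1 * s)) =
    (c ^+ 2 * (4 * expR s)) / (C * expR s) ^+ 2.
    by rewrite mul1r expRN; field; rewrite !gt_eqF ?expR_gt0.
  have CE : 0 < C * expR s by rewrite mulr_gt0 ?expR_gt0.
  apply: ler_pM; [exact: sqr_ge0 | by pos | |].
    apply: (le_trans (ltW (u0_sqr_lt a0 s0))); rewrite ler_pM2l ?exprn_gt0//.
    exact/sqr_le_expR/ltW.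
  rewrite lef_pV2 ?posrE ?exprn_gt0// ler_sqr ?nnegrE; [exact: HC | exact: ltW | exact: ltW].
rewrite -[X in _ --> X](mulr0 (4 * c ^+ 2 / C ^+ 2)).
by apply: cvgM; [exact: cvg_cst | exact: expRN_cvg0].
Qed.

Section Scale.
Variable L : R.
Hypothesis phiL : phi s @[s --> +oo] --> L.

(* The cone radius is asymptotically [rho e^s], where rho is such that
   [e^{2 phi} V ~ (rho e^s)^3]. *)
Let rho := expR ((ln (kappa / 2) + 2 * L) / 3).
Definition cone_radius s := rho * expR s.

Let rho_gt0 : 0 < rho. Proof. exact: expR_gt0. Qed.

Let rho3 : rho ^+ 3 = kappa / 2 * expR (2 * L).
Proof.
rewrite /rho -expRM_natl (_ : 3%:R * _ = ln (kappa / 2) + 2 * L); last by field.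
by rewrite expRD lnK// posrE divr_gt0.
Qed.

Lemma cone_radius_gt0 (s : R) : 0 < cone_radius s.
Proof. by rewrite mulr_gt0 ?expR_gt0. Qed.

Lemma der_cone_radius (s : R) : is_derive s 1 cone_radius (cone_radius s).
Proof. by rewrite /cone_radius; derE ring. Qed.

Lemma cone_radius_smooth (A : set R) : smooth_on A cone_radius.
Proof.
have h n : derive1n n cone_radius = cone_radius.
  elim: n => [//|n IH]; rewrite derive1nS IH; apply/funext => s.
  exact: derive1_der (der_cone_radius s).
by move=> n s _; rewrite h; case: (der_cone_radius s).
Qed.

Lemma cone_radius_cvg : cone_radius s @[s --> +oo] --> +oo.
Proof.
apply/cvgryPge => A; near=> s.
have sA : A / rho <= s by near: s; apply: nbhs_pinfty_ge; exact: num_real.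
rewrite /cone_radius -ler_pdivrMl//; apply: le_trans (_ : s <= _).
  by rewrite mulrC.
by apply: le_trans (expR_ge1Dx s); rewrite lerDr.
Unshelve. all: by end_near. Qed.

Let expR_phi_cvg (k : R) : expR (k * phi s) @[s --> +oo] --> expR (k * L).
Proof.
apply: (@cvg_comp _ _ _ (fun s => k * phi s) expR _ (nbhs (k * L))).
  by apply: cvgM; [exact: cvg_cst | exact: phiL].
exact: continuous_expR.
Qed.

Lemma Omega_scale_cvg :
  expR (2 * phi s) * V kappa s / cone_radius s ^+ 3 @[s --> +oo] --> (1 : R).
Proof.
have r1 : rho ^+ 3 != 0 by rewrite expf_neq0// gt_eqF.
rewrite (_ : (fun s => _) = fun s => kappa / rho ^+ 3 * expR (2 * phi s) *
    (sinh (3 * s) * expR (- (3 * s)))); last first.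
  apply/funext => s; rewrite /cone_radius /V expRN (expRM_natl 3 s); field.
  by rewrite gt_eqF ?expR_gt0// gt_eqF.
rewrite [X in _ --> X](_ : 1 = kappa / rho ^+ 3 * expR (2 * L) * 2^-1).
  apply: cvgM; last exact: sinh3_scaled_cvg.
  by apply: cvgM; [exact: cvg_cst | exact: expR_phi_cvg].
rewrite rho3; field.
by rewrite !gt_eqF ?expR_gt0.
Qed.

Let gap_div_u_cvg : (u s ^+ 2 - u0 alpha s ^+ 2) / u s ^+ 2 @[s --> +oo] --> (1 : R).
Proof.
have h : 1 - u0 alpha s ^+ 2 / u s ^+ 2 @[s --> +oo] --> (1 - 0 : R).
  by apply: cvgB; [exact: cvg_cst | exact: u0_div_u_cvg].
rewrite subr0 in h; apply: cvg_trans h; apply: near_eq_cvg; near=> s.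
have s0 : 0 < s by near: s; exact: nbhs_pinfty_gt.
have [us _ _ _] := solP s0.
by field; rewrite gt_eqF.
Unshelve. all: by end_near. Qed.

(** With g = u^3 e^(-6s), the equation for u becomes g' = 6 (h - g). *)
Let h s := (V kappa s * expR (- (3 * s))) ^+ 2 * expR (4 * phi s) *
  ((u s ^+ 2 - u0 alpha s ^+ 2) / u s ^+ 2)^-1.

Let h_cvg : h s @[s --> +oo] --> rho ^+ 6.
Proof.
have -> : rho ^+ 6 = (kappa * 2^-1) ^+ 2 * expR (4 * L) * 1^-1.
  have -> : rho ^+ 6 = (rho ^+ 3) ^+ 2 by ring.
  rewrite rho3 exprMn -expRM_natl invr1 mulr1; congr (_ * expR _); ring.
apply: cvgM; last by apply: cvgV; [exact: oner_neq0 | exact: gap_div_u_cvg].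
apply: cvgM; last exact: expR_phi_cvg.
have hv : V kappa s * expR (- (3 * s)) @[s --> +oo] --> kappa * 2^-1.
  rewrite (_ : (fun s => _) = fun s => kappa * (sinh (3 * s) * expR (- (3 * s)))).
    by apply: cvgM; [exact: cvg_cst | exact: sinh3_scaled_cvg].
  by apply/funext => s; rewrite /V mulrA.
by rewrite (_ : (fun s => _) = fun s => V kappa s * expR (- (3 * s)) * (V kappa s * expR (- (3 * s)))) //;
  exact: cvgM.
Qed.

Let g_cvg : u s ^+ 3 * expR (- (6 * s)) @[s --> +oo] --> rho ^+ 6.
Proof.
apply: (@linear_ode_cvg _ _ h 6 1); [by lra | | exact: h_cvg].
move=> s s1; have s0 : 0 < s by lra.
have [us as_ du _] := solP s0.
have A0 : 0 < u s ^+ 2 - u0 alpha s ^+ 2 by rewrite subr_gt0.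
derE idtac.
have e6 : expR (- (3 * s)) ^+ 2 = expR (- (6 * s)).
  by rewrite -expRM_natl; congr expR; ring.
rewrite /h /rhs_u (_ : (V kappa s * expR (- (3 * s))) ^+ 2 = V kappa s ^+ 2 * expR (- (3 * s)) ^+ 2); last by ring.
by rewrite e6 /=; field; rewrite !gt_eqF.
Qed.

Lemma u_scale_cvg : u s / cone_radius s ^+ 2 @[s --> +oo] --> (1 : R).
Proof.
have c1 : (u s / cone_radius s ^+ 2) ^+ 3 @[s --> +oo] --> (1 : R).
  rewrite (_ : (fun s => _) = fun s => (rho ^+ 6)^-1 * (u s ^+ 3 * expR (- (6 * s)))).
    rewrite [X in _ --> X](_ : 1 = (rho ^+ 6)^-1 * rho ^+ 6).
      by apply: cvgM; [exact: cvg_cst | exact: g_cvg].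
    by rewrite mulVf// expf_neq0// gt_eqF.
  apply/funext => s; rewrite /cone_radius expRN (_ : expR (6 * s) = expR s ^+ 6).
    by field; rewrite !gt_eqF ?expR_gt0.
  by rewrite -expRM_natl.
move/cvgrPdist_lt: c1 => c1; apply/cvgrPdist_lt => e e0.
near=> s.
have s0 : 0 < s by near: s; exact: nbhs_pinfty_gt.
have c2 : `|1 - (u s / cone_radius s ^+ 2) ^+ 3| < e by near: s; exact: c1.
have [us _ _ _] := solP s0.
have x0 : 0 < u s / cone_radius s ^+ 2 by have r0 := cone_radius_gt0 s; pos.
(* Convergence of the cube suffices: |1 - x| <= |1 - x^3| for positive x. *)
apply: le_lt_trans c2; move: (u s / _) x0 => x x0.
have -> : 1 - x ^+ 3 = (1 - x) * (1 + x + x ^+ 2) by ring.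
rewrite normrM ler_peMr// ger0_norm; last by pos.
by have := sqr_ge0 x; lra.
Unshelve. all: by end_near. Qed.

Lemma du_scale_cvg : derive1 u s / (2 * cone_radius s ^+ 2) @[s --> +oo] --> (1 : R).
Proof.
have c1 : (rho ^+ 6)^-1 * h s * ((u s / cone_radius s ^+ 2)^-1) ^+ 2 @[s --> +oo] --> (1 : R).
  rewrite [X in _ --> X](_ : 1 = (rho ^+ 6)^-1 * rho ^+ 6 * (1^-1 * 1^-1)); last first.
    by rewrite mulVf ?expf_neq0 ?gt_eqF// invr1 !mulr1.
  apply: cvgM; first by apply: cvgM; [exact: cvg_cst | exact: h_cvg].
  by apply: cvgM; (apply: cvgV; [exact: oner_neq0 | exact: u_scale_cvg]).
apply: cvg_trans c1; apply: near_eq_cvg; near=> s.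
have s0 : 0 < s by near: s; exact: nbhs_pinfty_gt.
have [us as_ du _] := solP s0.
have A0 : 0 < u s ^+ 2 - u0 alpha s ^+ 2 by rewrite subr_gt0.
rewrite (derive1_der du) /h /rhs_u /cone_radius expRN.
rewrite (_ : expR (3 * s) = expR s ^+ 3); last by rewrite -expRM_natl.
by field; rewrite !gt_eqF ?expR_gt0.
Unshelve. all: by end_near. Qed.

Lemma u0_scale_cvg : u0 alpha s / cone_radius s ^+ 2 @[s --> +oo] --> (0 : R).
Proof.
apply: (@cvg_pinfty_le _ _ (fun s => c / rho ^+ 2 * expR (- (1 * s))) 1).
  move=> s s1; have s0 : 0 < s by lra.
  have r0 := cone_radius_gt0 s.
  have m0 := u0_sqr_lt a0 s0; rewrite -/c in m0.
  have n : `|u0 alpha s| <= c * s.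
    have w0 : 0 <= c * s by apply: mulr_ge0; exact: ltW.
    have e : (c * s) ^+ 2 = c ^+ 2 * s ^+ 2 by ring.
    by rewrite -ler_sqr ?nnegrE// real_normK ?num_real// e; exact: ltW.
  rewrite normrM (gtr0_norm (_ : 0 < (cone_radius s ^+ 2)^-1)); last by pos.
  have -> : c / rho ^+ 2 * expR (- (1 * s)) = c * expR s / cone_radius s ^+ 2.
    by rewrite /cone_radius mul1r expRN; field; rewrite !gt_eqF ?expR_gt0.
  rewrite ler_pM2r; last by pos.
  apply: (le_trans n); rewrite ler_pM2l//.
  by apply: le_trans (expR_ge1Dx s); rewrite lerDr.
rewrite -[X in _ --> X](mulr0 (c / rho ^+ 2)).
by apply: cvgM; [exact: cvg_cst | exact: expRN_cvg0].
Qed.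

End Scale.

End SupercriticalAsymptotics.

(** * Explicit form of the invariant metrics *)

Section Evaluation.
Local Open Scope complex_scope.
Context {R : realType}.
Implicit Types (v w : 'rV[R]_7).
Local Notation C := R[i].

Definition co (k : nat) v : R := v ord0 (inord k).

Lemma sum_inord (M : nmodType) n (F : 'I_n.+1 -> M) :
  \sum_(i < n.+1) F i = \sum_(0 <= k < n.+1) F (inord k).
Proof. by rewrite big_mkord; apply: eq_bigr => i _; rewrite inord_val. Qed.

Lemma sum7 (M : nmodType) (F : 'I_7 -> M) : \sum_(i < 7) F i =
  F (inord 0) + F (inord 1) + F (inord 2) + F (inord 3) + F (inord 4)
  + F (inord 5) + F (inord 6).
Proof. by rewrite sum_inord !big_nat_recr//= big_geq// add0r. Qed.

Lemma form1_ext (a : Defs.form R 1) (f : 'I_1 -> 'rV[R]_7) : a f = a (fun=> f ord0).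
Proof. by congr a; apply/funext => i; rewrite ord1. Qed.

Definition tri v1 v2 v3 : 'I_3 -> 'rV[R]_7 := fun j => nth v1 [:: v1; v2; v3] j.

Lemma wedge1E (a b : Defs.form R 1) (v : 'I_2 -> 'rV[R]_7) : wedge a b v =
  a (fun=> v ord0) * b (fun=> v (inord 1)) - a (fun=> v (inord 1)) * b (fun=> v ord0).
Proof.
rewrite /wedge sum_inord !big_nat_recr//= big_geq// add0r.
rewrite !inordK// expr0 expr1 mul1r mulN1r mulNr.
congr (a _ * b _ - a _ * b _); apply/funext => i; congr v; apply: val_inj;
  by rewrite /= ?inordK// ord1.
Qed.

Lemma wedge2E (a : Defs.form R 1) (b : Defs.form R 2) (v : 'I_3 -> 'rV[R]_7) : wedge a b v =
  a (fun=> v (inord 0)) * b (pair_vec (v (inord 1)) (v (inord 2)))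
  - a (fun=> v (inord 1)) * b (pair_vec (v (inord 0)) (v (inord 2)))
  + a (fun=> v (inord 2)) * b (pair_vec (v (inord 0)) (v (inord 1))).
Proof.
rewrite /wedge sum_inord !big_nat_recr//= big_geq// add0r.
rewrite !inordK// expr0 expr1 mul1r mulN1r mulNr sqrrN expr1n mul1r.
congr (a _ * b _ - a _ * b _ + a _ * b _); apply/funext => i; rewrite /pair_vec;
  case: ifP => h; congr v; apply: val_inj; rewrite /= !inordK//;
  by case: i h => -[|[|]].
Qed.

Lemma wedge3E (a : Defs.form R 1) (b : Defs.form R 3) (v : 'I_4 -> 'rV[R]_7) : wedge a b v =
  a (fun=> v (inord 0)) * b (tri (v (inord 1)) (v (inord 2)) (v (inord 3)))
  - a (fun=> v (inord 1)) * b (tri (v (inord 0)) (v (inord 2)) (v (inord 3)))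
  + a (fun=> v (inord 2)) * b (tri (v (inord 0)) (v (inord 1)) (v (inord 3)))
  - a (fun=> v (inord 3)) * b (tri (v (inord 0)) (v (inord 1)) (v (inord 2))).
Proof.
rewrite /wedge sum_inord !big_nat_recr//= big_geq// add0r.
rewrite !inordK// expr0 expr1 mul1r mulN1r mulNr sqrrN expr1n mul1r exprS sqrrN expr1n mulr1 mulN1r mulNr.
congr (a _ * b _ - a _ * b _ + a _ * b _ - a _ * b _); apply/funext => i; rewrite /tri;
  case: i => -[|[|[|]]]//= h; congr v; apply: val_inj; by rewrite /= !inordK.
Qed.

Lemma pair_vec0 v w : pair_vec v w ord0 = v. Proof. by []. Qed.

Lemma pair_vec1 v w : pair_vec v w (inord 1) = w.
Proof. by rewrite /pair_vec -val_eqE /= inordK. Qed.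

Lemma tri0 u v w : tri u v w (inord 0) = u. Proof. by rewrite /tri inordK. Qed.
Lemma tri1 u v w : tri u v w (inord 1) = v. Proof. by rewrite /tri inordK. Qed.
Lemma tri2 u v w : tri u v w (inord 2) = w. Proof. by rewrite /tri inordK. Qed.

Lemma coframe2E m n v w : wedge (@coframe R m) (@coframe R n) (pair_vec v w) =
  (co m v * co n w - co m w * co n v)%:C.
Proof.
by rewrite wedge1E pair_vec0 pair_vec1 /coframe -!rmorphM -rmorphB.
Qed.

Let two_thirds : (2 / 3 : C) = (2 / 3 : R)%:C.
Proof. by rewrite fmorph_div !rmorph_nat. Qed.

Lemma eta_seE v : eta_se (fun=> v) = (2 / 3 * (co 1 v - co 4 v))%:C.
Proof. by rewrite /eta_se /eta1 /eta1' /coframe two_thirds -rmorphB -rmorphM. Qed.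

Lemma ds_eta_seE v w : wedge (@ds R) (@eta_se R) (pair_vec v w) =
  (2 / 3 * (co 0 v * (co 1 w - co 4 w) - co 0 w * (co 1 v - co 4 v)))%:C.
Proof.
rewrite wedge1E pair_vec0 pair_vec1 !eta_seE /ds /coframe -!rmorphM -rmorphB.
by congr (_%:C); rewrite /co; ring.
Qed.

Lemma omega1E v w : omega1_se (pair_vec v w) =
  (2 / 3 * ((co 2 v * co 3 w - co 2 w * co 3 v) - (co 5 v * co 6 w - co 5 w * co 6 v)))%:C.
Proof. by rewrite /omega1_se /eta2 /eta3 /eta2' /eta3' !coframe2E two_thirds -rmorphB -rmorphM. Qed.

Lemma omega0E v w : omega0_se (pair_vec v w) =
  (2 / 3 * ((co 2 v * co 3 w - co 2 w * co 3 v) + (co 5 v * co 6 w - co 5 w * co 6 v)))%:C.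
Proof. by rewrite /omega0_se /eta2 /eta3 /eta2' /eta3' !coframe2E two_thirds -rmorphD -rmorphM. Qed.

Lemma omega2E v w : omega2_se (pair_vec v w) =
  (- (2 / 3) * ((co 2 v * co 5 w - co 2 w * co 5 v) + (co 3 v * co 6 w - co 3 w * co 6 v)))%:C.
Proof.
rewrite /omega2_se /eta2 /eta3 /eta2' /eta3' !coframe2E two_thirds.
by rewrite -rmorphN -rmorphD -rmorphM.
Qed.

Lemma omega3E v w : omega3_se (pair_vec v w) =
  (2 / 3 * ((co 2 v * co 6 w - co 2 w * co 6 v) + (co 5 v * co 3 w - co 5 w * co 3 v)))%:C.
Proof. by rewrite /omega3_se /eta2 /eta3 /eta2' /eta3' !coframe2E two_thirds -rmorphD -rmorphM. Qed.

End Evaluation.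

Lemma complex_ext (R : realType) (x y : R[i]) :
  complex.Re x = complex.Re y -> complex.Im x = complex.Im y -> x = y.
Proof. by case: x y => [a b] [c d] /= -> ->. Qed.

(** * The almost complex structure determined by the 3-form *)

Section Structure.
Local Open Scope complex_scope.
Context {R : realType}.
Implicit Types (v w : 'rV[R]_7).
Local Notation C := R[i].
Local Notation "x %:RC" := ((x)%:C : C) (at level 2, format "x %:RC").

Variables (K rho sigma n0 n3 : R).
Hypotheses (K0 : K != 0) (rho0 : 0 < rho) (sigma0 : 0 < sigma).
Hypothesis (nE : n3 ^+ 2 - n0 ^+ 2 = 1).

(* The common shape of [Omega] and [Omega_cone]. *)
Definition gOmega : Defs.form R 3 := fun t =>
  K%:C * wedge (fun x => rho%:C * ds x + 'i%C * sigma%:C * eta_se x)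
    (fun x => omega2_se x + 'i%C * (n0%:C * omega0_se x + n3%:C * omega3_se x)) t.

(** A coframe of (1,0)-forms: [gOmega] is a multiple of the product of [theta0], [theta1] and
    [theta2], whose value on three vectors is [det3]. *)
Definition theta0 v : C := Complex (rho * co 0 v) (sigma * (2 / 3 * (co 1 v - co 4 v))).
Definition theta1 v : C := Complex (co 2 v) (n3 * co 3 v + n0 * co 6 v).
Definition theta2 v : C := Complex (- co 5 v) (n0 * co 3 v + n3 * co 6 v).

Definition det3 (u v w : 'rV[R]_7) : C :=
  theta0 u * (theta1 v * theta2 w - theta1 w * theta2 v)
  - theta0 v * (theta1 u * theta2 w - theta1 w * theta2 u)
  + theta0 w * (theta1 u * theta2 v - theta1 v * theta2 u).

(** The relation n3^2 - n0^2 = 1 is what makes this 2-form decomposable. *)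
Let Theta2 v w : omega2_se (pair_vec v w) +
    'i%C * (n0%:C * omega0_se (pair_vec v w) + n3%:C * omega3_se (pair_vec v w)) =
  (2 / 3)%:RC * (theta1 v * theta2 w - theta1 w * theta2 v).
Proof.
rewrite omega2E omega0E omega3E /theta1 /theta2; apply: complex_ext; rewrite /=.
  apply/eqP; rewrite -subr_eq0; apply/eqP.
  transitivity (2 / 3 * (co 3 v * co 6 w - co 3 w * co 6 v) * (n3 ^+ 2 - n0 ^+ 2 - 1)); last first.
    by rewrite nE subrr mulr0.
  by field.
by field.
Qed.

Lemma gOmegaE (v : 'I_3 -> 'rV[R]_7) : gOmega v =
  (2 / 3 * K)%:RC * det3 (v (inord 0)) (v (inord 1)) (v (inord 2)).
Proof.
have t0 w : rho%:C * ds (fun=> w) + 'i%C * sigma%:C * eta_se (fun=> w) = theta0 w.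
  by rewrite eta_seE /ds /coframe -/(co _ _) /theta0; apply: complex_ext => /=; ring.
rewrite /gOmega wedge2E !Theta2 !t0 /det3 rmorphM.
by move: ((2 / 3)%:RC) => z; ring.
Qed.

Definition theta0_coef : 'I_7 -> C := fun j => nth 0 [:: rho%:C;
  Complex 0 (2 / 3 * sigma); 0; 0; Complex 0 (- (2 / 3 * sigma)); 0; 0] j.
Definition theta1_coef : 'I_7 -> C := fun j => nth 0 [:: 0; 0; 1;
  Complex 0 n3; 0; 0; Complex 0 n0] j.
Definition theta2_coef : 'I_7 -> C := fun j => nth 0 [:: 0; 0; 0;
  Complex 0 n0; 0; -1; Complex 0 n3] j.

Lemma covectorE (a : 'I_7 -> C) v : covector a (fun=> v) =
  a (inord 0) * (co 0 v)%:C + a (inord 1) * (co 1 v)%:C + a (inord 2) * (co 2 v)%:C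
  + a (inord 3) * (co 3 v)%:C + a (inord 4) * (co 4 v)%:C + a (inord 5) * (co 5 v)%:C
  + a (inord 6) * (co 6 v)%:C.
Proof. by rewrite /covector sum7. Qed.

Lemma covector_theta0 v : covector theta0_coef (fun=> v) = theta0 v.
Proof.
rewrite covectorE /theta0_coef !inordK//= /theta0; apply: complex_ext => /=; ring.
Qed.

Lemma covector_theta1 v : covector theta1_coef (fun=> v) = theta1 v.
Proof.
rewrite covectorE /theta1_coef !inordK//= /theta1; apply: complex_ext => /=; ring.
Qed.

Lemma covector_theta2 v : covector theta2_coef (fun=> v) = theta2 v.
Proof.
rewrite covectorE /theta2_coef !inordK//= /theta2; apply: complex_ext => /=; ring.
Qed.

Definition is_comb (a : 'I_7 -> C) := exists c : C * C * C, forall v,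
  covector a (fun=> v) = c.1.1 * theta0 v + c.1.2 * theta1 v + c.2 * theta2 v.

Lemma wedge_gOmega a (v : 'I_4 -> 'rV[R]_7) : wedge (covector a) gOmega v =
  (2 / 3 * K)%:RC *
  (covector a (fun=> v (inord 0)) * det3 (v (inord 1)) (v (inord 2)) (v (inord 3))
  - covector a (fun=> v (inord 1)) * det3 (v (inord 0)) (v (inord 2)) (v (inord 3))
  + covector a (fun=> v (inord 2)) * det3 (v (inord 0)) (v (inord 1)) (v (inord 3))
  - covector a (fun=> v (inord 3)) * det3 (v (inord 0)) (v (inord 1)) (v (inord 2))).
Proof. by rewrite wedge3E !gOmegaE !tri0 !tri1 !tri2; move: (_%:RC) => z; ring. Qed.

Lemma comb_wedge a : is_comb a -> forall t, wedge (covector a) gOmega t = 0.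
Proof.
by move=> [[[c0 c1] c2] H] v; rewrite wedge_gOmega !H /det3 /=; ring.
Qed.

Definition unit_vec k : 'rV[R]_7 := delta_mx ord0 (inord k).

Lemma co_unit j k : (j < 7)%N -> (k < 7)%N -> co j (unit_vec k) = (j == k)%:R.
Proof. by move=> j7 k7; rewrite /co mxE eqxx/= -val_eqE /= !inordK. Qed.

(** Evaluating the 4-form on v and on the basis vectors 0, 2, 5, where the three forms take the
    diagonal values rho, 1, -1, solves for a(v) and gives the coefficients. *)
Lemma wedge_comb a : (forall t, wedge (covector a) gOmega t = 0) -> is_comb a.
Proof.
move=> H; pose e0 := unit_vec 0; pose e2 := unit_vec 2; pose e5 := unit_vec 5.
exists (rho^-1%:C * covector a (fun=> e0), covector a (fun=> e2), - covector a (fun=> e5)) => v.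
pose q (j : 'I_4) : 'rV[R]_7 := nth v [:: v; e0; e2; e5] j.
have := H q; rewrite wedge_gOmega /q !inordK//=.
have t00 : theta0 e0 = rho%:C by rewrite /theta0 !co_unit//=; apply: complex_ext => /=; ring.
have t01 : theta1 e0 = 0 by rewrite /theta1 !co_unit//=; apply: complex_ext => /=; ring.
have t02 : theta2 e0 = 0 by rewrite /theta2 !co_unit//=; apply: complex_ext => /=; ring.
have t20 : theta0 e2 = 0 by rewrite /theta0 !co_unit//=; apply: complex_ext => /=; ring.
have t21 : theta1 e2 = 1 by rewrite /theta1 !co_unit//=; apply: complex_ext => /=; ring.
have t22 : theta2 e2 = 0 by rewrite /theta2 !co_unit//=; apply: complex_ext => /=; ring.
have t50 : theta0 e5 = 0 by rewrite /theta0 !co_unit//=; apply: complex_ext => /=; ring.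
have t51 : theta1 e5 = 0 by rewrite /theta1 !co_unit//=; apply: complex_ext => /=; ring.
have t52 : theta2 e5 = -1 by rewrite /theta2 !co_unit//=; apply: complex_ext => /=; ring.
rewrite /det3 t00 t01 t02 t20 t21 t22 t50 t51 t52.
have k0 : (2 / 3 * K)%:RC != 0.
  by rewrite fmorph_eq0 mulf_neq0// divr_eq0 !pnatr_eq0.
move/eqP; rewrite mulf_eq0 (negPf k0)/= => /eqP; set e := (X in X = 0) => h.
have r0 : rho%:RC != 0 by rewrite fmorph_eq0 gt_eqF.
rewrite fmorphV; apply/eqP; rewrite -subr_eq0; apply/eqP.
transitivity (- (rho%:RC)^-1 * e); last by rewrite h mulr0.
by rewrite /e; field.
Qed.

Definition acs_rows : seq (seq R) :=
  [:: [:: 0; 3 / 4 * (rho / sigma); 0; 0; - (3 / 4 * (rho / sigma)); 0; 0];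
      [:: - (2 / 3 * (sigma / rho)); 0; 0; 0; 0; 0; 0];
      [:: 0; 0; 0; n3; 0; 0; - n0];
      [:: 0; 0; - n3; 0; 0; n0; 0];
      [:: 2 / 3 * (sigma / rho); 0; 0; 0; 0; 0; 0];
      [:: 0; 0; 0; n0; 0; 0; - n3];
      [:: 0; 0; - n0; 0; 0; n3; 0]].

Definition acs_mx : 'M[R]_7 := \matrix_(i < 7, j < 7) nth 0 (nth [::] acs_rows i) j.

Lemma acs_mxE v k : (k < 7)%N -> co k (v *m acs_mx) =
  co 0 v * nth 0 (nth [::] acs_rows 0) k + co 1 v * nth 0 (nth [::] acs_rows 1) k
  + co 2 v * nth 0 (nth [::] acs_rows 2) k + co 3 v * nth 0 (nth [::] acs_rows 3) k
  + co 4 v * nth 0 (nth [::] acs_rows 4) k + co 5 v * nth 0 (nth [::] acs_rows 5) k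
  + co 6 v * nth 0 (nth [::] acs_rows 6) k.
Proof. by move=> k7; rewrite /co mxE sum7 !mxE !inordK. Qed.

Lemma row7P v w : (forall k, (k < 7)%N -> co k v = co k w) -> v = w.
Proof.
move=> H; apply/rowP => j; have := H j (ltn_ord j).
by rewrite /co inord_val.
Qed.

Lemma co_add k v w : co k (v + w) = co k v + co k w. Proof. by rewrite /co mxE. Qed.
Lemma co_scale k (c : R) v : co k (c *: v) = c * co k v. Proof. by rewrite /co mxE. Qed.
Lemma co_opp k v : co k (- v) = - co k v. Proof. by rewrite /co mxE. Qed.

Lemma co_fibre k : (k < 7)%N -> co k (@fibre_dir R) = ((k == 1%N) || (k == 4%N))%:R.
Proof.
move=> k7; rewrite /fibre_dir -/(unit_vec 1) -/(unit_vec 4) co_add !co_unit//.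
by case: k k7 => [|[|[|[|[|[|[|]]]]]]]//= _; rewrite ?addr0 ?add0r.
Qed.

Definition theta_type (J : 'M[R]_7) := forall v,
  [/\ theta0 (v *m J) = 'i%C * theta0 v, theta1 (v *m J) = 'i%C * theta1 v
    & theta2 (v *m J) = 'i%C * theta2 v].

Lemma acs_mx_type : theta_type acs_mx.
Proof.
move=> v; rewrite /theta0 /theta1 /theta2 !acs_mxE//=; split; apply: complex_ext => /=.
- by field; rewrite !gt_eqF.
- by field; rewrite !gt_eqF.
- by ring.
- transitivity ((n3 ^+ 2 - n0 ^+ 2) * co 2 v); last by rewrite nE; ring.
  by ring.
- by ring.
- transitivity (- (n3 ^+ 2 - n0 ^+ 2) * co 5 v); last by rewrite nE; ring.
  by ring.
Qed.

Lemma is_acs_acs_mx : is_acs gOmega acs_mx.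
Proof.
split.
- apply: row7P => k k7; rewrite acs_mxE// !co_fibre//= /co mxE.
  by case: k k7 => [|[|[|[|[|[|[|]]]]]]]//= _; ring.
- move=> v; exists (2^-1 * (co 1 v + co 4 v)); apply: row7P => k k7.
  rewrite acs_mxE// !acs_mxE// co_add co_opp co_scale co_fibre//.
  case: k k7 => [|[|[|[|[|[|[|]]]]]]]//= _.
  + by field; rewrite !gt_eqF.
  + by field; rewrite !gt_eqF.
  + transitivity (- (n3 ^+ 2 - n0 ^+ 2) * co 2 v); last by rewrite nE; ring.
    by ring.
  + transitivity (- (n3 ^+ 2 - n0 ^+ 2) * co 3 v); last by rewrite nE; ring.
    by ring.
  + by field; rewrite !gt_eqF.
  + transitivity (- (n3 ^+ 2 - n0 ^+ 2) * co 5 v); last by rewrite nE; ring.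
    by ring.
  + transitivity (- (n3 ^+ 2 - n0 ^+ 2) * co 6 v); last by rewrite nE; ring.
    by ring.
- move=> a; split=> [H|/wedge_comb[c H] v]; last first.
    by have [e0 e1 e2] := acs_mx_type v; rewrite !H e0 e1 e2; ring.
  apply: comb_wedge.
  have E k : (k < 7)%N -> covector a (fun=> unit_vec k *m acs_mx) =
      'i%C * covector a (fun=> unit_vec k) by move=> _; exact: H.
  move: (E 0%N isT) (E 1%N isT) (E 2%N isT) (E 3%N isT) (E 4%N isT) (E 5%N isT) (E 6%N isT).
  rewrite !covectorE !acs_mxE// !co_unit//=.
  set A0 := a (inord 0); set A1 := a (inord 1); set A2 := a (inord 2); set A3 := a (inord 3); set A4 := a (inord 4); set A5 := a (inord 5); set A6 := a (inord 6).
  rewrite !(mul0r, mul1r, mulr0, mulr1, addr0, add0r, rmorph0, rmorph1).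
  move=> _ H1 _ H3 H4 _ H6.
  (* Lets the equations a(vJ) = i a(v) on basis vectors express the coefficients 1, 3, 4, 6 of [a]
     through those of index 0, 2, 5. *)
  have iK (x : C) : x = - ('i%C * ('i%C * x)).
    by case: x => p q; apply: complex_ext => /=; ring.
  exists (rho^-1%:C * A0, A2, - A5) => v; rewrite covectorE.
  rewrite -/A0 -/A1 -/A2 -/A3 -/A4 -/A5 -/A6.
  clearbody A0 A1 A2 A3 A4 A5 A6.
  rewrite (iK A1) (iK A3) (iK A4) (iK A6) -H1 -H3 -H4 -H6 /theta0 /theta1 /theta2.
  case: A0 A2 A5 {H1 H3 H4 H6} => [x0 y0] [x2 y2] [x5 y5].
  by apply: complex_ext => /=; field; rewrite !gt_eqF.
Qed.

End Structure.

(** * Explicit metrics and norm estimates against the cone *)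

Section MetricFormula.
Context {R : realType}.
Local Open Scope complex_scope.
Implicit Types (v w : 'rV[R]_7).

Definition gomega (p q q0 q3 : R) : Defs.form R 2 := fun t =>
  p%:C * wedge (@ds R) (@eta_se R) t + q%:C * omega1_se t
  + (q0%:C * omega0_se t + q3%:C * omega3_se t).

Lemma gomegaE p q q0 q3 v w : gomega p q q0 q3 (pair_vec v w) =
  (p * (2 / 3 * (co 0 v * (co 1 w - co 4 w) - co 0 w * (co 1 v - co 4 v)))
  + q * (2 / 3 * ((co 2 v * co 3 w - co 2 w * co 3 v) - (co 5 v * co 6 w - co 5 w * co 6 v)))
  + (q0 * (2 / 3 * ((co 2 v * co 3 w - co 2 w * co 3 v) + (co 5 v * co 6 w - co 5 w * co 6 v)))
  + q3 * (2 / 3 * ((co 2 v * co 6 w - co 2 w * co 6 v) + (co 5 v * co 3 w - co 5 w * co 3 v)))))%:C.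
Proof.
by rewrite /gomega ds_eta_seE omega1E omega0E omega3E -!rmorphM -!rmorphD.
Qed.

Definition gmetric (p q w0 rho sigma n0 n3 : R) v w : R :=
  p * (rho / sigma * (co 0 v * co 0 w)
       + sigma / rho * (4 / 9 * ((co 1 v - co 4 v) * (co 1 w - co 4 w))))
  + 2 / 3 * ((q * n3 + w0) * (co 2 v * co 2 w + co 3 v * co 3 w)
    + (q * n3 - w0) * (co 5 v * co 5 w + co 6 v * co 6 w)
    + q * n0 * (co 2 v * co 5 w + co 5 v * co 2 w + co 3 v * co 6 w + co 6 v * co 3 w)).

(** The structure [acs] is an arbitrary choice, but any admissible one acts on the three (1,0)-forms
    as multiplication by i. This fixes w J up to the fibre direction, to which the 2-form is
    blind. *)
Lemma su3_metricE (K rho sigma n0 n3 p q w0 : R) v w :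
  K != 0 -> 0 < rho -> 0 < sigma -> n3 ^+ 2 - n0 ^+ 2 = 1 ->
  su3_metric (gomega p q (w0 * n3) (w0 * n0)) (gOmega K rho sigma n0 n3) v w =
  gmetric p q w0 rho sigma n0 n3 v w.
Proof.
move=> K0 rho0 sigma0 nE.
rewrite /su3_metric; set J := acs _.
have [_ _ isJ] : is_acs (gOmega K rho sigma n0 n3) J.
  by apply: (xgetPex 0); exists (acs_mx rho sigma n0 n3); exact: is_acs_acs_mx.
have c0 : is_comb rho sigma n0 n3 (theta0_coef rho sigma).
  by exists (1, 0, 0) => x; rewrite covector_theta0 /=; ring.
have c1 : is_comb rho sigma n0 n3 (theta1_coef n0 n3).
  by exists (0, 1, 0) => x; rewrite covector_theta1 /=; ring.
have c2 : is_comb rho sigma n0 n3 (theta2_coef n0 n3).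
  by exists (0, 0, 1) => x; rewrite covector_theta2 /=; ring.
have /(_ w) := (isJ _).2 (comb_wedge K nE c0); rewrite !covector_theta0 => e0.
have /(_ w) := (isJ _).2 (comb_wedge K nE c1); rewrite !covector_theta1 => e1.
have /(_ w) := (isJ _).2 (comb_wedge K nE c2); rewrite !covector_theta2 => e2.
move: e0 e1 e2; rewrite gomegaE /theta0 /theta1 /theta2 /=.
move: (w *m J) => z.
move=> [a1 a2] [b1 b2] [d1 d2].
have x0 : co 0 z = - (sigma / rho * (2 / 3 * (co 1 w - co 4 w))).
  by apply: (mulfI (lt0r_neq0 rho0)); rewrite a1; field; rewrite gt_eqF.
have x14 : co 1 z - co 4 z = 3 / 2 * (rho / sigma * co 0 w).
  apply: (mulfI (lt0r_neq0 sigma0)).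
  have -> : sigma * (co 1 z - co 4 z) = 3 / 2 * (sigma * (2 / 3 * (co 1 z - co 4 z))) by field.
  by rewrite a2; field; rewrite gt_eqF.
have x2 : co 2 z = - (n3 * co 3 w + n0 * co 6 w) by rewrite b1; ring.
have x5 : co 5 z = n0 * co 3 w + n3 * co 6 w by apply: oppr_inj; rewrite d1; ring.
have x3 : co 3 z = n3 * co 2 w + n0 * co 5 w.
  transitivity ((n3 ^+ 2 - n0 ^+ 2) * co 3 z); first by rewrite nE mul1r.
  have -> : (n3 ^+ 2 - n0 ^+ 2) * co 3 z =
    n3 * (n3 * co 3 z + n0 * co 6 z) - n0 * (n0 * co 3 z + n3 * co 6 z) by ring.
  by rewrite b2 d2; ring.
have x6 : co 6 z = - (n0 * co 2 w + n3 * co 5 w).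
  transitivity ((n3 ^+ 2 - n0 ^+ 2) * co 6 z); first by rewrite nE mul1r.
  have -> : (n3 ^+ 2 - n0 ^+ 2) * co 6 z =
    n3 * (n0 * co 3 z + n3 * co 6 z) - n0 * (n3 * co 3 z + n0 * co 6 z) by ring.
  by rewrite b2 d2; ring.
rewrite x0 x14 x2 x3 x5 x6 /gmetric; apply/eqP; rewrite -subr_eq0; apply/eqP.
transitivity (2 / 3 * w0 * (n3 ^+ 2 - n0 ^+ 2 - 1) *
  (co 2 v * co 2 w + co 3 v * co 3 w - co 5 v * co 5 w - co 6 v * co 6 w)); last first.
  by rewrite nE subrr mulr0 mul0r.
by field; rewrite !gt_eqF.
Qed.

Lemma omegaE (alpha : R) u s :
  omega alpha u s = gomega (2^-1 * derive1 u s) (u s) (u0 alpha s * nu3 s) (u0 alpha s * nu0 s).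
Proof.
apply/funext => t; rewrite /omega /gomega.
move: (wedge _ _ t) (omega1_se t) (omega0_se t) (omega3_se t) => [a b] [c d] [e f] [g h].
by apply: complex_ext => /=; ring.
Qed.

Lemma OmegaE (kappa : R) phi s :
  Omega kappa phi s = gOmega (expR (2 * phi s) * V kappa s) 1 1 (nu0 s) (nu3 s).
Proof.
apply/funext => t; rewrite /Omega /gOmega !wedge2E !rmorph1.
move: (V kappa s) (expR _) => W e; rewrite rmorphM.
by move: ('i%C) => i; ring.
Qed.

Lemma omega_coneE r s :
  omega_cone r s = gomega (r s * derive1 r s) (r s ^+ 2) (0 * 1) (0 * 0) :> Defs.form R 2.
Proof.
by apply/funext => t; rewrite /omega_cone /gomega mul0r mulr0 !rmorph0 !mul0r !addr0.
Qed.

Lemma Omega_coneE r s :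
  Omega_cone r s = gOmega (r s ^+ 2) (derive1 r s) (r s) 0 1 :> Defs.form R 3.
Proof.
apply/funext => t; rewrite /Omega_cone /gOmega !wedge2E !rmorph0 !rmorph1.
by move: ('i%C) => i; ring.
Qed.

Lemma nu_sqr s : 0 < s -> nu3 s ^+ 2 - nu0 s ^+ 2 = 1 :> R.
Proof.
move=> s0; have S0 : sinh (3 * s) != 0 by rewrite gt_eqF// sinh_gt0//; lra.
have -> : nu3 s ^+ 2 - nu0 s ^+ 2 = (cosh (3 * s) ^+ 2 - 1) / sinh (3 * s) ^+ 2.
  by rewrite /nu3 /nu0; field.
by rewrite cosh_sqr addrAC subrr add0r divff// expf_neq0.
Qed.

Lemma metricE (alpha kappa : R) u phi s v w : 0 < kappa -> 0 < s ->
  metric alpha kappa u phi s v w =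
  gmetric (2^-1 * derive1 u s) (u s) (u0 alpha s) 1 1 (nu0 s) (nu3 s) v w.
Proof.
move=> k0 s0; rewrite /metric omegaE OmegaE su3_metricE ?nu_sqr//.
by rewrite mulf_neq0 ?gt_eqF ?expR_gt0 ?V_gt0.
Qed.

Lemma cone_metricE (r : R -> R) (s : R) v w : 0 < r s -> derive1 r s = r s ->
  cone_metric r s v w = r s ^+ 2 * (co 0 v * co 0 w
    + 4 / 9 * ((co 1 v - co 4 v) * (co 1 w - co 4 w))
    + 2 / 3 * (co 2 v * co 2 w + co 3 v * co 3 w + co 5 v * co 5 w + co 6 v * co 6 w)).
Proof.
move=> r0 rE; rewrite /cone_metric omega_coneE Omega_coneE su3_metricE ?rE//.
- by rewrite /gmetric; field; rewrite gt_eqF.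
- by rewrite expf_neq0// gt_eqF.
- by rewrite expr1n expr0n subr0.
Qed.

Lemma form_norm_le g k (b : Defs.form R k) (M : R) : 0 <= M ->
  (forall I : {ffun 'I_k -> 'I_6},
    let x := b (fun l => row (I l) (orthonormal_frame g)) in
    `|complex.Re x| <= M /\ `|complex.Im x| <= M) ->
  form_norm g b <= Num.sqrt (2 * 6 ^+ k) * M.
Proof.
move=> M0 H; rewrite /form_norm -[leRHS]ger0_norm ?mulr_ge0 ?sqrtr_ge0//.
rewrite -sqrtr_sqr ler_wsqrtr// exprMn sqr_sqrtr; last by rewrite mulr_ge0 ?exprn_ge0.
set S := \sum_(_ | _) _.
have S0 : 0 <= S by apply: sumr_ge0 => I _; rewrite addr_ge0 ?sqr_ge0.
apply: (@le_trans _ _ S).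
  rewrite ler_piMl// invf_le1 ?ltr0n ?fact_gt0//.
  by rewrite ler1n fact_gt0.
apply: (@le_trans _ _ (\sum_(I : {ffun 'I_k -> 'I_6}) (2 * M ^+ 2))).
  apply: ler_sum => I _; have [h1 h2] := H I.
  have sq (y : R) : `|y| <= M -> y ^+ 2 <= M ^+ 2.
    by move=> h; rewrite -[y ^+ 2]real_normK ?num_real// ler_sqr ?nnegrE.
  by have := sq _ h1; have := sq _ h2; lra.
have card : #|{: {ffun 'I_k -> 'I_6}}| = (6 ^ k)%N by rewrite card_ffun !card_ord.
rewrite sumr_const card -[leLHS]mulr_natr natrX.
by rewrite le_eqVlt; apply/orP; left; apply/eqP; ring.
Qed.

(** A unit vector has each rescaled coordinate bounded by 2 since the cone metric is diagonal, so it
    does not matter which orthonormal frame was chosen; for the default zero matrix the bounds are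
    trivial. *)
Lemma cone_frame_bounds (r : R -> R) (s : R) (i : 'I_6) : 0 < r s -> derive1 r s = r s ->
  let f := row i (orthonormal_frame (cone_metric r s)) in
  [/\ `|r s * co 0 f| <= 2, `|r s * (co 1 f - co 4 f)| <= 2, `|r s * co 2 f| <= 2,
    `|r s * co 3 f| <= 2 & `|r s * co 5 f| <= 2 /\ `|r s * co 6 f| <= 2].
Proof.
move=> r0 rE f.
have : r s ^+ 2 * (co 0 f ^+ 2 + 4 / 9 * (co 1 f - co 4 f) ^+ 2
    + 2 / 3 * (co 2 f ^+ 2 + co 3 f ^+ 2 + co 5 f ^+ 2 + co 6 f ^+ 2)) <= 1.
  rewrite /f /orthonormal_frame; case: xgetP => [F _ /(_ i i)|_].
    by rewrite cone_metricE// eqxx => h; rewrite -[leRHS]h !expr2.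
  have z k : co k (row i (0 : 'M[R]_(6, 7))) = 0 by rewrite /co !mxE.
  by rewrite !z subrr expr0n /= !(mulr0, addr0) ler01.
move: (co 0 f) (co 1 f - co 4 f) (co 2 f) (co 3 f) (co 5 f) (co 6 f) => x0 x1 x2 x3 x5 x6 h.
have sq (y : R) : (r s * y) ^+ 2 <= 2 ^+ 2 -> `|r s * y| <= 2.
  by move=> hy; rewrite -ler_sqr ?nnegrE// real_normK ?num_real.
have P (y : R) : 0 <= (r s * y) ^+ 2 by exact: sqr_ge0.
have {}h : (r s * x0) ^+ 2 + 4 / 9 * (r s * x1) ^+ 2 + 2 / 3 * ((r s * x2) ^+ 2
   + (r s * x3) ^+ 2 + (r s * x5) ^+ 2 + (r s * x6) ^+ 2) <= 1.
  by apply: le_trans h; rewrite le_eqVlt; apply/orP; left; apply/eqP; ring.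
have := P x0; have := P x1; have := P x2; have := P x3; have := P x5; have := P x6.
move: h sq; move=> h sq p6 p5 p3 p2 p1 p0.
by split; [| | | | split]; apply: sq; lra.
Qed.

Let bound_mul (x y a b : R) : `|x| <= a -> `|y| <= b -> `|x * y| <= a * b.
Proof. by move=> h1 h2; rewrite normrM ler_pM. Qed.

Let minor_le (x y z w : R) : `|x| <= 2 -> `|y| <= 2 -> `|z| <= 2 -> `|w| <= 2 ->
  `|x * y - z * w| <= 8.
Proof.
move=> hx hy hz hw; apply: (le_trans (ler_normB _ _)).
by have := bound_mul hx hy; have := bound_mul hz hw; lra.
Qed.


Let pair_row (f : 'M[R]_(6, 7)) (I : {ffun 'I_2 -> 'I_6}) :
  (fun l => row (I l) f) = pair_vec (row (I ord0) f) (row (I (inord 1)) f).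
Proof.
apply/funext => l; rewrite /pair_vec; case: ifPn => [/eqP->//|l0].
congr (row (I _) f); apply: val_inj; rewrite /= inordK//.
by case: l l0 => -[|[|]].
Qed.

(** Rescaling the coordinates by r turns the difference into fixed forms, bounded on frame vectors,
    whose coefficients are the scale-invariant errors on the right. *)
Lemma omega_norm_le (alpha : R) u (r : R -> R) (s : R) : 0 < r s -> derive1 r s = r s ->
  form_norm (cone_metric r s) (fun t => omega alpha u s t - omega_cone r s t) <=
  Num.sqrt (2 * 6 ^+ 2) * (8 * `|derive1 u s / (2 * r s ^+ 2) - 1|
    + 16 * `|u s / r s ^+ 2 - 1| + 16 * (`|u0 alpha s / r s ^+ 2| * (`|nu3 s| + `|nu0 s|))).
Proof.
move=> r0 rE; apply: form_norm_le => [|I].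
  by rewrite !addr_ge0 ?mulr_ge0 ?addr_ge0.
rewrite pair_row; set f := orthonormal_frame _.
have [] := cone_frame_bounds (I ord0) r0 rE; have [] := cone_frame_bounds (I (inord 1)) r0 rE.
rewrite -/f; move: (row (I ord0) f) (row (I (inord 1)) f) => v w q0 q14 q2 q3 [q5 q6] p0 p14 p2 p3 [p5 p6].
rewrite omegaE omega_coneE !gomegaE rE -rmorphB; split; last first.
  rewrite [X in `|X|](_ : _ = 0) ?normr0 ?addr_ge0 ?mulr_ge0 ?addr_ge0//.
have -> : forall x : R, complex.Re x%:C = x by [].
set x := (X in `|X|).
have -> : x = (derive1 u s / (2 * r s ^+ 2) - 1) * (2 / 3 * ((r s * co 0 v) * (r s * (co 1 w - co 4 w)) -
      (r s * co 0 w) * (r s * (co 1 v - co 4 v))))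
  + (u s / r s ^+ 2 - 1) * (2 / 3 * (((r s * co 2 v) * (r s * co 3 w) - (r s * co 2 w) * (r s * co 3 v))
       - ((r s * co 5 v) * (r s * co 6 w) - (r s * co 5 w) * (r s * co 6 v))))
  + (u0 alpha s / r s ^+ 2) * (nu3 s * (2 / 3 * (((r s * co 2 v) * (r s * co 3 w) - (r s * co 2 w) * (r s * co 3 v))
       + ((r s * co 5 v) * (r s * co 6 w) - (r s * co 5 w) * (r s * co 6 v))))
     + nu0 s * (2 / 3 * (((r s * co 2 v) * (r s * co 6 w) - (r s * co 2 w) * (r s * co 6 v))
       + ((r s * co 5 v) * (r s * co 3 w) - (r s * co 5 w) * (r s * co 3 v))))).
  by rewrite /x; field; rewrite gt_eqF.
have m1 := minor_le p0 q14 q0 p14.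
have m2 := minor_le p2 q3 q2 p3; have m3 := minor_le p5 q6 q5 p6.
have m4 := minor_le p2 q6 q2 p6; have m5 := minor_le p5 q3 q5 p3.
have n23 (y : R) : `|2 / 3 * y| = 2 / 3 * `|y| by rewrite normrM ger0_norm//; lra.
have t1 (y : R) : `|y| <= 8 -> `|2 / 3 * y| <= 8.
  by move=> h; rewrite n23; have := normr_ge0 y; lra.
have t2 (y z : R) : `|y| <= 8 -> `|z| <= 8 -> `|2 / 3 * (y - z)| <= 16 /\ `|2 / 3 * (y + z)| <= 16.
  move=> h1 h2; rewrite !n23.
  have e1 := ler_normB y z; have e2 := ler_normD y z; have e3 := normr_ge0 (y - z).
  by have e4 := normr_ge0 (y + z); split; lra.
have [n1 n2] := t2 _ _ m2 m3; have [_ n3] := t2 _ _ m4 m5; have n0 := t1 _ m1.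
apply: (le_trans (ler_normD _ _)); apply: lerD.
  apply: (le_trans (ler_normD _ _)); apply: lerD; rewrite normrM mulrC.
    by rewrite ler_wpM2r.
  by rewrite ler_wpM2r.
rewrite normrM [leRHS]mulrCA ler_wpM2l//; apply: (le_trans (ler_normD _ _)).
rewrite [leRHS]mulrDr; apply: lerD; rewrite normrM mulrC; exact: ler_wpM2r.
Qed.

Let T2 (F : 'rV[R]_7 -> 'rV[R]_7 -> R) (a : 'rV[R]_7 -> R) x y z : R :=
  a x * F y z - a y * F x z + a z * F x y.

Let T2_le F a x y z : `|a x| <= 2 -> `|a y| <= 2 -> `|a z| <= 2 ->
  `|F y z| <= 16 -> `|F x z| <= 16 -> `|F x y| <= 16 -> `|T2 F a x y z| <= 96.
Proof.
move=> ax ay az h1 h2 h3; rewrite /T2.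
apply: (le_trans (ler_normD _ _)); have := ler_normB (a x * F y z) (a y * F x z).
by have := bound_mul ax h1; have := bound_mul ay h2; have := bound_mul az h3; lra.
Qed.

Lemma Omega_norm_le (kappa : R) phi (r : R -> R) (s : R) : 0 < r s -> derive1 r s = r s ->
  form_norm (cone_metric r s) (fun t => Omega kappa phi s t - Omega_cone r s t) <=
  Num.sqrt (2 * 6 ^+ 3) *
    (96 * `|expR (2 * phi s) * V kappa s / r s ^+ 3 - 1|
    + 96 * `|expR (2 * phi s) * V kappa s / r s ^+ 3 * nu0 s|
    + 96 * `|expR (2 * phi s) * V kappa s / r s ^+ 3 * nu3 s - 1|).
Proof.
move=> r0 rE; apply: form_norm_le => [|I].
  by rewrite !addr_ge0 ?mulr_ge0.
set f := orthonormal_frame _.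
have [] := cone_frame_bounds (I (inord 0)) r0 rE; have [] := cone_frame_bounds (I (inord 1)) r0 rE.
have [] := cone_frame_bounds (I (inord 2)) r0 rE.
rewrite -/f OmegaE Omega_coneE /gOmega !wedge2E !eta_seE !omega2E !omega0E !omega3E rE.
rewrite /ds /coframe -!/(co 0 _).
move: (row (I (inord 0)) f) (row (I (inord 1)) f) (row (I (inord 2)) f) => x y z.
move=> z0 z14 z2 z3 [z5 z6] y0 y14 y2 y3 [y5 y6] x0 x14 x2 x3 [x5 x6].
move: (expR _ * V _ _) => e.
pose F2 v w := - (2 / 3) * (((r s * co 2 v) * (r s * co 5 w) - (r s * co 2 w) * (r s * co 5 v))
  + ((r s * co 3 v) * (r s * co 6 w) - (r s * co 3 w) * (r s * co 6 v))).
pose F0 v w := 2 / 3 * (((r s * co 2 v) * (r s * co 3 w) - (r s * co 2 w) * (r s * co 3 v))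
  + ((r s * co 5 v) * (r s * co 6 w) - (r s * co 5 w) * (r s * co 6 v))).
pose F3 v w := 2 / 3 * (((r s * co 2 v) * (r s * co 6 w) - (r s * co 2 w) * (r s * co 6 v))
  + ((r s * co 5 v) * (r s * co 3 w) - (r s * co 5 w) * (r s * co 3 v))).
pose b v := r s * co 0 v.
pose h v := 2 / 3 * (r s * (co 1 v - co 4 v)).
have t2 (p q : R) : `|p| <= 8 -> `|q| <= 8 -> `|2 / 3 * (p + q)| <= 16.
  move=> h1 h2; rewrite normrM ger0_norm; last by lra.
  by have := ler_normD p q; have := normr_ge0 (p + q); lra.
have t2' (p q : R) : `|p| <= 8 -> `|q| <= 8 -> `|- (2 / 3) * (p + q)| <= 16.
  by move=> h1 h2; rewrite mulNr normrN; exact: t2.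
have t1 (p : R) : `|p| <= 2 -> `|2 / 3 * p| <= 2.
  by move=> h1; rewrite normrM ger0_norm; have := normr_ge0 p; lra.
have B2 : `|T2 F2 b x y z| <= 96 /\ `|T2 F2 h x y z| <= 96.
  by split; apply: T2_le; rewrite /b /h /F2; by [| exact: t1 | apply: t2'; exact: minor_le].
have B0 : `|T2 F0 b x y z| <= 96 /\ `|T2 F0 h x y z| <= 96.
  by split; apply: T2_le; rewrite /b /h /F0; by [| exact: t1 | apply: t2; exact: minor_le].
have B3 : `|T2 F3 b x y z| <= 96 /\ `|T2 F3 h x y z| <= 96.
  by split; apply: T2_le; rewrite /b /h /F3; by [| exact: t1 | apply: t2; exact: minor_le].
have tri_le (p q t A B D : R) : `|A| <= 96 -> `|B| <= 96 -> `|D| <= 96 ->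
    `|p * A + q * B + t * D| <= 96 * `|p| + 96 * `|q| + 96 * `|t|.
  move=> hA hB hD; apply: (le_trans (ler_normD _ _)); apply: lerD.
    by apply: (le_trans (ler_normD _ _)); apply: lerD; rewrite normrM mulrC ler_wpM2r.
  by rewrite normrM mulrC ler_wpM2r.
have nz : r s != 0 by rewrite gt_eqF.
split.
  set X := (X in `|X|).
  have -> : X = (e / r s ^+ 3 - 1) * T2 F2 b x y z + (e / r s ^+ 3 * nu0 s) * (- T2 F0 h x y z)
    + (e / r s ^+ 3 * nu3 s - 1) * (- T2 F3 h x y z).
    by rewrite /X /T2 /F2 /F0 /F3 /b /h /=; field.
  by apply: tri_le; rewrite ?normrN; case: B2 B0 B3 => ? ? [? ?] [? ?].
set X := (X in `|X|).
have -> : X = (e / r s ^+ 3 - 1) * T2 F2 h x y z + (e / r s ^+ 3 * nu0 s) * T2 F0 b x y z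
  + (e / r s ^+ 3 * nu3 s - 1) * T2 F3 b x y z.
  by rewrite /X /T2 /F2 /F0 /F3 /b /h /=; field.
by apply: tri_le; case: B2 B0 B3 => ? ? [? ?] [? ?].
Qed.

End MetricFormula.

(** * Convergence to the cone *)

Section Conical.
Context {R : realType}.
Variables (alpha kappa l0 p0 : R) (u phi : R -> R).
Hypotheses (a0 : alpha != 0) (k0 : 0 < kappa).
Hypotheses (sol : solves alpha kappa +oo%E u phi) (zd : zero_data l0 p0 u phi).
Hypotheses (l0E : l0 ^+ 3 = 18 * kappa ^+ 2 * expR (4 * p0)).
Hypothesis (cl : crit_slope alpha < l0).

Let dist0 (f : R -> R) (a : R) : f s @[s --> +oo] --> a ->
  `|f s - a| @[s --> +oo] --> (0 : R).
Proof.
move=> cf; have h : f s - a @[s --> +oo] --> a - a.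
  by apply: cvgB => //; exact: cvg_cst.
by rewrite subrr in h; rewrite -[X in _ --> X](@normr0 R R); exact: cvg_norm.
Qed.

Let norm0 (f : R -> R) : f s @[s --> +oo] --> (0 : R) ->
  `|f s| @[s --> +oo] --> (0 : R).
Proof. by move=> cf; rewrite -[X in _ --> X](@normr0 R R); exact: cvg_norm. Qed.

Theorem supercritical_conical : exists L, asymptotically_conical alpha kappa u phi L.
Proof.
have [L phiL] := dilaton_cvg a0 k0 sol zd l0E cl.
exists L; exists (cone_radius kappa L), 0.
have rE s : derive1 (cone_radius kappa L) s = cone_radius kappa L s.
  exact: derive1_der (der_cone_radius kappa L s).
have r0 s := cone_radius_gt0 kappa L s.
split.
- exact: cone_radius_smooth.
- by move=> s _; rewrite rE.
- exact: cone_radius_cvg.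
have cu := u_scale_cvg a0 k0 sol zd l0E cl phiL.
have cdu := du_scale_cvg a0 k0 sol zd l0E cl phiL.
have cu0 := u0_scale_cvg kappa a0 L.
have cO := Omega_scale_cvg k0 phiL.
split=> //.
- apply: (@cvg_pinfty_le _ _ _ 0).
    move=> s _; rewrite ger0_norm ?sqrtr_ge0//.
    exact: (omega_norm_le _ _ (r0 s) (rE s)).
  rewrite -[X in _ --> X](mulr0 (Num.sqrt (2 * 6 ^+ 2))).
  apply: cvgM; first exact: cvg_cst.
  rewrite [X in _ --> X](_ : 0 = 8 * 0 + 16 * 0 + 16 * (0 * (`|1 : R| + `|0 : R|))); last by ring.
  apply: cvgD; first apply: cvgD.
  + by apply: cvgM; [exact: cvg_cst | exact: dist0].
  + by apply: cvgM; [exact: cvg_cst | exact: dist0].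
  apply: cvgM; first exact: cvg_cst.
  apply: cvgM; first exact: norm0.
  by apply: cvgD; apply: cvg_norm; [exact: nu3_cvg | exact: nu0_cvg].
- apply: (@cvg_pinfty_le _ _ _ 0).
    move=> s _; rewrite ger0_norm ?sqrtr_ge0//.
    exact: (Omega_norm_le _ _ (r0 s) (rE s)).
  rewrite -[X in _ --> X](mulr0 (Num.sqrt (2 * 6 ^+ 3))).
  apply: cvgM; first exact: cvg_cst.
  rewrite [X in _ --> X](_ : 0 = 96 * 0 + 96 * `|1 * 0 : R| + 96 * 0); last by rewrite !mulr0 normr0 !mulr0 !addr0.
  apply: cvgD; first apply: cvgD.
  + by apply: cvgM; [exact: cvg_cst | exact: dist0].
  + apply: cvgM; first exact: cvg_cst.
    by apply: cvg_norm; apply: cvgM => //; exact: nu0_cvg.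
  apply: cvgM; first exact: cvg_cst.
  apply: dist0; rewrite -[X in _ --> X](mulr1 1).
  by apply: cvgM => //; exact: nu3_cvg.
Qed.

End Conical.

(** * The metric on the deformed conifold *)

Section Quaternions.
Context {R : realType}.
Implicit Types (p q : 'rV[R]_4) (a b : 'rV[R]_3).

Definition qc (k : nat) q : R := q ord0 (inord k).
Definition vc (k : nat) a : R := a ord0 (inord k).

Lemma row4P p q : qc 0 p = qc 0 q -> qc 1 p = qc 1 q -> qc 2 p = qc 2 q ->
  qc 3 p = qc 3 q -> p = q.
Proof.
move=> h0 h1 h2 h3; apply/rowP => j; rewrite -(inord_val j).
by case: j => -[|[|[|[|]]]].
Qed.

Lemma row3P a b : vc 0 a = vc 0 b -> vc 1 a = vc 1 b -> vc 2 a = vc 2 b -> a = b.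
Proof.
move=> h0 h1 h2; apply/rowP => j; rewrite -(inord_val j).
by case: j => -[|[|[|]]].
Qed.

Lemma qmulE p q :
  (qc 0 (qmul p q) = qc 0 p * qc 0 q - qc 1 p * qc 1 q - qc 2 p * qc 2 q - qc 3 p * qc 3 q) *
  (qc 1 (qmul p q) = qc 0 p * qc 1 q + qc 1 p * qc 0 q + qc 2 p * qc 3 q - qc 3 p * qc 2 q) *
  (qc 2 (qmul p q) = qc 0 p * qc 2 q - qc 1 p * qc 3 q + qc 2 p * qc 0 q + qc 3 p * qc 1 q) *
  (qc 3 (qmul p q) = qc 0 p * qc 3 q + qc 1 p * qc 2 q - qc 2 p * qc 1 q + qc 3 p * qc 0 q).
Proof. by rewrite /qc /qmul; do !split; rewrite mxE inordK. Qed.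

Let inord_rshift k : (k < 3)%N -> inord k.+1 = rshift 1 (inord k) :> 'I_(1 + 3).
Proof. by move=> k3; apply: val_inj; rewrite /= !inordK. Qed.

Let inord_lshift : inord 0 = lshift 3 ord0 :> 'I_(1 + 3).
Proof. by apply: val_inj; rewrite /= inordK. Qed.

Lemma qconjE q : (qc 0 (qconj q) = qc 0 q) * (qc 1 (qconj q) = - qc 1 q) *
  (qc 2 (qconj q) = - qc 2 q) * (qc 3 (qconj q) = - qc 3 q).
Proof.
do !split; rewrite /qc /qconj ?inord_lshift ?inord_rshift// ?mxE//;
  by rewrite ?(unsplitK (inl _ ord0)) ?(unsplitK (inr _ _)) !mxE.
Qed.

Lemma su2E a : (qc 0 (su2 a) = 0) * (qc 1 (su2 a) = - vc 0 a) *
  (qc 2 (su2 a) = - vc 1 a) * (qc 3 (su2 a) = - vc 2 a).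
Proof.
do !split; rewrite /qc /su2 ?inord_lshift ?inord_rshift// ?mxE//;
  by rewrite ?(unsplitK (inl _ ord0)) ?(unsplitK (inr _ _)) !mxE.
Qed.

Lemma Ad_qc q a : let x := qmul (qmul q (su2 a)) (qconj q) in
  (vc 0 (Ad q a) = - qc 1 x) * (vc 1 (Ad q a) = - qc 2 x) * (vc 2 (Ad q a) = - qc 3 x).
Proof. by rewrite /vc /Ad /qc !inord_rshift// !mxE. Qed.

Lemma AdE q a : let q0 := qc 0 q in let q1 := qc 1 q in let q2 := qc 2 q in
  let q3 := qc 3 q in let x := vc 0 a in let y := vc 1 a in let z := vc 2 a in
  (vc 0 (Ad q a) = (q0 ^+ 2 + q1 ^+ 2 - q2 ^+ 2 - q3 ^+ 2) * x + 2 * (q1 * q2 - q0 * q3) * y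
     + 2 * (q1 * q3 + q0 * q2) * z) *
  (vc 1 (Ad q a) = 2 * (q1 * q2 + q0 * q3) * x + (q0 ^+ 2 - q1 ^+ 2 + q2 ^+ 2 - q3 ^+ 2) * y
     + 2 * (q2 * q3 - q0 * q1) * z) *
  (vc 2 (Ad q a) = 2 * (q1 * q3 - q0 * q2) * x + 2 * (q2 * q3 + q0 * q1) * y
     + (q0 ^+ 2 - q1 ^+ 2 - q2 ^+ 2 + q3 ^+ 2) * z).
Proof. by do !split; rewrite !Ad_qc !qmulE !qconjE !su2E; ring. Qed.

Lemma sqnorm4 q : sqnorm q = qc 0 q ^+ 2 + qc 1 q ^+ 2 + qc 2 q ^+ 2 + qc 3 q ^+ 2.
Proof. by rewrite /sqnorm sum_inord !big_nat_recr//= big_geq// add0r. Qed.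

Lemma sqnorm3 a : sqnorm a = vc 0 a ^+ 2 + vc 1 a ^+ 2 + vc 2 a ^+ 2.
Proof. by rewrite /sqnorm sum_inord !big_nat_recr//= big_geq// add0r. Qed.

Definition dot a b : R := vc 0 a * vc 0 b + vc 1 a * vc 1 b + vc 2 a * vc 2 b.
Definition cross a b : 'rV[R]_3 := \row_j nth 0
  [:: vc 1 a * vc 2 b - vc 2 a * vc 1 b; vc 2 a * vc 0 b - vc 0 a * vc 2 b;
      vc 0 a * vc 1 b - vc 1 a * vc 0 b] j.

Lemma vc_scale k (t : R) a : vc k (t *: a) = t * vc k a. Proof. by rewrite /vc mxE. Qed.

Lemma vc_sub k a b : vc k (a - b) = vc k a - vc k b. Proof. by rewrite /vc !mxE. Qed.

Lemma crossE a b :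
  (vc 0 (cross a b) = vc 1 a * vc 2 b - vc 2 a * vc 1 b) *
  (vc 1 (cross a b) = vc 2 a * vc 0 b - vc 0 a * vc 2 b) *
  (vc 2 (cross a b) = vc 0 a * vc 1 b - vc 1 a * vc 0 b).
Proof. by rewrite /vc !mxE !inordK. Qed.

Lemma dot_Ad q a b : sqnorm q = 1 -> dot (Ad q a) (Ad q b) = dot a b.
Proof.
move=> q1; have -> : dot a b = sqnorm q ^+ 2 * dot a b by rewrite q1 expr1n mul1r.
by rewrite /dot sqnorm4 !AdE; ring.
Qed.

Lemma cross_Ad q a b : sqnorm q = 1 -> cross (Ad q a) (Ad q b) = Ad q (cross a b).
Proof.
move=> q1; have -> : Ad q (cross a b) = sqnorm q *: Ad q (cross a b).
  by rewrite q1 scale1r.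
by apply: row3P; rewrite !vc_scale !(crossE, AdE) sqnorm4; ring.
Qed.

Definition vec3 (x y z : R) : 'rV[R]_3 := \row_j nth 0 [:: x; y; z] j.

Lemma vec3E x y z : (vc 0 (vec3 x y z) = x) * (vc 1 (vec3 x y z) = y) * (vc 2 (vec3 x y z) = z).
Proof. by rewrite /vc !mxE !inordK. Qed.

Lemma e1E s : (vc 0 (s *: delta_mx ord0 ord0 : 'rV[R]_3) = s) *
  (vc 1 (s *: delta_mx ord0 ord0 : 'rV[R]_3) = 0) *
  (vc 2 (s *: delta_mx ord0 ord0 : 'rV[R]_3) = 0).
Proof.
rewrite /vc !mxE -!val_eqE /= !inordK//=.
by rewrite mulr1 !mulr0.
Qed.

Lemma qc_add k p q : qc k (p + q) = qc k p + qc k q. Proof. by rewrite /qc mxE. Qed.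
Lemma qc_scale k (t : R) q : qc k (t *: q) = t * qc k q. Proof. by rewrite /qc mxE. Qed.

Lemma derive1_row n (F : R -> 'rV[R]_n) (t : R) (d : 'rV[R]_n) :
  (forall j, is_derive t 1 (fun x => F x ord0 j) (d ord0 j)) ->
  derivable F t 1 /\ derive1 F t = d.
Proof.
move=> H; have DF : derivable F t 1.
  by apply/derivable_mxP => i j; rewrite ord1; case: (H j).
split=> //; rewrite derive1E derive_mx//; apply/rowP => j; rewrite mxE.
by have D := H j; exact: derive_val.
Qed.

Section DPolar.
Variables (s : R) (p q : 'rV[R]_4) (X : 'rV[R]_7).

Let xi := vec3 (co 1 X) (co 2 X) (co 3 X).
Let xi' := vec3 (co 4 X) (co 5 X) (co 6 X).

(* Both components are expressed in the rotating frame [Ad q]. *)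
Let dp := qmul p (su2 xi).
Let dq := qmul q (su2 xi').
Let tgt : 'rV[R]_(4 + 3) := row_mx (qmul p (qmul (su2 (xi - xi')) (qconj q)))
  (Ad q (vec3 (co 0 X) (- (2 * s * co 6 X)) (2 * s * co 5 X))).

Lemma dpolarE : dpolar s p q X = tgt.
Proof.
have X0 : (X : 'rV[R]_(1 + (3 + 3))) ord0 ord0 = co 0 X.
  by rewrite /co; congr (X _ _); apply: val_inj; rewrite /= inordK.
have X1 : lsubmx (rsubmx (X : 'rV[R]_(1 + (3 + 3)))) = xi.
  by apply: row3P; rewrite /xi !vec3E /vc /co !mxE; congr (X _ _); apply: val_inj; rewrite /= !inordK.
have X2 : rsubmx (rsubmx (X : 'rV[R]_(1 + (3 + 3)))) = xi'.
  by apply: row3P; rewrite /xi' !vec3E /vc /co !mxE; congr (X _ _); apply: val_inj; rewrite /= !inordK.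
rewrite /dpolar X0 X1 X2 -/dp -/dq.
apply: (derive1_row _).2 => j; rewrite /polar /tgt.
case: (splitP (j : 'I_(4 + 3))) => k jk.
  have -> : j = lshift 3 k by apply: val_inj.
  under eq_fun do rewrite row_mxEl; rewrite row_mxEl.
  have E (v : 'rV[R]_4) : v ord0 k = qc k v by rewrite /qc inord_val.
  under eq_fun do rewrite E; rewrite E.
  case: k {jk E} => -[|[|[|[|]]]]//= _; under eq_fun do
    rewrite !(qmulE, qconjE, qc_add, qc_scale); rewrite !(qmulE, qconjE, su2E); derE idtac;
    rewrite !vc_sub; ring.
have -> : j = rshift 4 k by apply: val_inj.
under eq_fun do rewrite row_mxEr; rewrite row_mxEr.
have E (v : 'rV[R]_3) : v ord0 k = vc k v by rewrite /vc inord_val.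
under eq_fun do rewrite E; rewrite E.
case: k {jk E} => -[|[|[|]]]//= _; under eq_fun do
  rewrite !(AdE, e1E, qc_add, qc_scale); rewrite !(AdE, vec3E); derE idtac;
  rewrite ?(qmulE, su2E) /xi' ?vec3E; ring.
Qed.

End DPolar.

End Quaternions.

(** * Invariant bilinear forms on S^3 x R^3 *)

Section RadialForms.
Context {R : realType}.
Notation E7 := 'rV[R]_(4 + 3).
Implicit Types (m v w : E7) (f : R -> R).

Definition nrm m : R := Num.sqrt (sqnorm (rsubmx m)).
Definition nvec m : 'rV[R]_3 := (nrm m)^-1 *: rsubmx m.
(** The sphere component of v translated back to the identity. Its real part vanishes when v is
    tangent, and [zeta] reads its imaginary part in the basis (-i, -j, -k). *)
Definition Wq m v : 'rV[R]_4 := qmul (qconj (lsubmx m)) (lsubmx v).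
Definition zeta m v : 'rV[R]_3 := vec3 (- qc 1 (Wq m v)) (- qc 2 (Wq m v)) (- qc 3 (Wq m v)).

Variables f1 f2 f3 f4 f5 : R -> R.

(* The last term only matters for vectors that are not tangent. *)
Definition gform m v w : R :=
  let s := nrm m in let n := nvec m in
  let z := rsubmx v in let z' := rsubmx w in
  f1 s * dot z z' + f2 s * (dot z n * dot z' n)
  + f3 s * dot (zeta m v) (zeta m w) + f4 s * (dot (zeta m v) n * dot (zeta m w) n)
  + f5 s / 2 * (dot (zeta m v) (cross n z') + dot (zeta m w) (cross n z))
  + qc 0 (Wq m v) * qc 0 (Wq m w).

Definition gmx m : 'M[R]_(4 + 3) :=
  \matrix_(i, j) gform m (delta_mx ord0 i) (delta_mx ord0 j).

Lemma gformC m v w : gform m v w = gform m w v.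
Proof. by rewrite /gform /dot; ring. Qed.

Lemma vc_lin k (a : R) (x y : 'rV[R]_3) : vc k (a *: x + y) = a * vc k x + vc k y.
Proof. by rewrite /vc !mxE. Qed.

Lemma qc_lin k (a : R) (x y : 'rV[R]_4) : qc k (a *: x + y) = a * qc k x + qc k y.
Proof. by rewrite /qc !mxE. Qed.

Lemma gform_lin m (a : R) v v' w : gform m (a *: v + v') w = a * gform m v w + gform m v' w.
Proof.
rewrite /gform /zeta /Wq.
have -> : lsubmx (a *: v + v') = a *: lsubmx v + lsubmx v' by apply/rowP => j; rewrite !mxE.
have -> : rsubmx (a *: v + v') = a *: rsubmx v + rsubmx v' by apply/rowP => j; rewrite !mxE.
by rewrite /dot !(crossE, vec3E, qmulE, vc_lin, qc_lin); ring.
Qed.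

Lemma linear_coord n (g : 'rV[R]_n -> R) (v : 'rV[R]_n) :
  (forall a x y, g (a *: x + y) = a * g x + g y) ->
  g v = \sum_j v ord0 j * g (delta_mx ord0 j).
Proof.
move=> lin; have g0 : g 0 = 0.
  by have := lin 1 0 0; rewrite scale1r addr0; lra.
have gs a x : g (a *: x) = a * g x by rewrite -[a *: x]addr0 lin g0 addr0.
have gD x y : g (x + y) = g x + g y by have := lin 1 x y; rewrite scale1r mul1r.
rewrite {1}[v]row_sum_delta (big_morph g gD g0).
by apply: eq_bigr => j _; rewrite gs.
Qed.

Lemma bilin_gmx m v w : bilin (gmx m) v w = gform m v w.
Proof.
rewrite (linear_coord v (fun a x y => gform_lin m a x y w)).
rewrite /bilin -mulmxA mxE; apply: eq_bigr => i _; congr (_ * _).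
rewrite gformC (@linear_coord _ (gform m ^~ (delta_mx ord0 i)) w); last first.
  by move=> a x y; exact: gform_lin.
rewrite mxE; apply: eq_bigr => j _.
by rewrite mxE mulrC mxE gformC.
Qed.

Lemma gmx_sym m : (gmx m)^T = gmx m.
Proof. by apply/matrixP => i j; rewrite [LHS]mxE [LHS]mxE [RHS]mxE gformC. Qed.

Lemma nrm_polar (s : R) p q : 0 < s -> sqnorm q = 1 -> nrm (polar s p q) = s.
Proof.
move=> s0 q1; rewrite /nrm /polar row_mxKr.
have -> : sqnorm (Ad q (s *: delta_mx ord0 ord0)) = s ^+ 2.
  have e a : sqnorm a = dot a a :> R by rewrite sqnorm3 /dot; ring.
  by rewrite e dot_Ad// /dot !e1E; ring.
by rewrite sqrtr_sqr gtr0_norm.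
Qed.

Lemma Wq_polar s p q X : sqnorm p = 1 -> Wq (polar s p q) (dpolar s p q X) =
  qmul (qmul q (su2 (vec3 (co 1 X - co 4 X) (co 2 X - co 5 X) (co 3 X - co 6 X)))) (qconj q).
Proof.
move=> p1; rewrite dpolarE /Wq /polar !row_mxKl.
have -> : vec3 (co 1 X) (co 2 X) (co 3 X) - vec3 (co 4 X) (co 5 X) (co 6 X) =
    vec3 (co 1 X - co 4 X) (co 2 X - co 5 X) (co 3 X - co 6 X).
  by apply: row3P; rewrite vc_sub !vec3E.
move: (vec3 _ _ _) => a; rewrite -[RHS]scale1r -p1 sqnorm4.
by apply: row4P; rewrite qc_scale !(qmulE, qconjE, su2E); ring.
Qed.

Lemma nvec_polar (s : R) p q : 0 < s -> sqnorm q = 1 ->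
  nvec (polar s p q) = Ad q (vec3 1 0 0).
Proof.
move=> s0 q1; rewrite /nvec nrm_polar// /polar row_mxKr.
by apply: row3P; rewrite vc_scale !AdE !e1E !vec3E; field; rewrite gt_eqF.
Qed.

Lemma zeta_polar s p q X : sqnorm p = 1 -> zeta (polar s p q) (dpolar s p q X) =
  Ad q (vec3 (co 1 X - co 4 X) (co 2 X - co 5 X) (co 3 X - co 6 X)).
Proof.
move=> p1; rewrite /zeta (Wq_polar _ _ _ p1).
by apply: row3P; rewrite vec3E Ad_qc.
Qed.

Lemma qc0_polar s p q X : sqnorm p = 1 -> qc 0 (Wq (polar s p q) (dpolar s p q X)) = 0.
Proof.
move=> p1; rewrite (Wq_polar _ _ _ p1); move: (vec3 _ _ _) => a.
by rewrite !(qmulE, qconjE, su2E); ring.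
Qed.

Lemma gform_frame (s : R) (q : 'rV[R]_4) m v w a b x y : sqnorm q = 1 ->
  nrm m = s -> nvec m = Ad q (vec3 1 0 0) ->
  zeta m v = Ad q a -> zeta m w = Ad q b -> rsubmx v = Ad q x -> rsubmx w = Ad q y ->
  qc 0 (Wq m v) = 0 ->
  gform m v w = let n := vec3 1 0 0 in
    f1 s * dot x y + f2 s * (dot x n * dot y n) + f3 s * dot a b
    + f4 s * (dot a n * dot b n) + f5 s / 2 * (dot a (cross n y) + dot b (cross n x)).
Proof.
move=> q1 sE nE aE bE xE yE w0; rewrite /gform sE nE aE bE xE yE w0.
by rewrite !cross_Ad// !dot_Ad//= mul0r addr0.
Qed.

(** [Ad q] is a rotation, so it drops out of all dot and cross products; one may compute as if n
    were the first basis vector. *)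
Lemma gform_polar (s : R) p q X Y : 0 < s -> sqnorm p = 1 -> sqnorm q = 1 ->
  gform (polar s p q) (dpolar s p q X) (dpolar s p q Y) =
  let a j := (co 1 j - co 4 j) in let b j := (co 2 j - co 5 j) in
  let c j := (co 3 j - co 6 j) in
  f1 s * (co 0 X * co 0 Y + 4 * s ^+ 2 * (co 5 X * co 5 Y + co 6 X * co 6 Y))
  + f2 s * (co 0 X * co 0 Y) + f3 s * (a X * a Y + b X * b Y + c X * c Y)
  + f4 s * (a X * a Y) - s * f5 s * (b X * co 5 Y + c X * co 6 Y + b Y * co 5 X + c Y * co 6 X).
Proof.
move=> s0 p1 q1.
have r Z : rsubmx (dpolar s p q Z) =
    Ad q (vec3 (co 0 Z) (- (2 * s * co 6 Z)) (2 * s * co 5 Z)).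
  by rewrite dpolarE row_mxKr.
rewrite (@gform_frame s q _ _ _ _ _ _ _ q1 (nrm_polar p s0 q1) (nvec_polar p s0 q1)
  (zeta_polar s q X p1) (zeta_polar s q Y p1) (r X) (r Y) (qc0_polar s q X p1)).
by rewrite /dot !(crossE, vec3E) /=; field.
Qed.

End RadialForms.

(** * Continuity across the zero-section *)

Section RadialContinuity.
Context {R : realType}.
Notation E7 := 'rV[R]_(4 + 3).
Implicit Types (m v w : E7) (f : R -> R).

(** Continuity at a point, in a form whose goals the tactic [ctn] can split along the syntax of the
    function. *)
Definition cat (T : topologicalType) (x : T) (g : T -> R) := g y @[y --> x] --> g x.

Lemma cat_cst (T : topologicalType) (x : T) (c : R) : cat x (fun=> c).
Proof. exact: cvg_cst. Qed.

Lemma cat_add (T : topologicalType) (x : T) g h : cat x g -> cat x h ->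
  cat x (fun y => g y + h y).
Proof. by move=> cg ch; exact: cvgD. Qed.

Lemma cat_opp (T : topologicalType) (x : T) g : cat x g -> cat x (fun y => - g y).
Proof. by move=> cg; exact: cvgN. Qed.

Lemma cat_mul (T : topologicalType) (x : T) g h : cat x g -> cat x h ->
  cat x (fun y => g y * h y).
Proof. by move=> cg ch; exact: cvgM. Qed.

Lemma cat_inv (T : topologicalType) (x : T) g : cat x g -> g x != 0 ->
  cat x (fun y => (g y)^-1).
Proof. by move=> cg g0; exact: cvgV. Qed.

Lemma cat_sqr (T : topologicalType) (x : T) g : cat x g -> cat x (fun y => g y ^+ 2).
Proof. by move=> cg; exact: cvgM. Qed.

Lemma cat_eq (T : topologicalType) (x : T) g h : g =1 h -> cat x g -> cat x h.
Proof. by move=> /funext->. Qed.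

Lemma cat_mul_bounded (T : topologicalType) (x : T) (g b : T -> R) : cat x g -> g x = 0 ->
  (forall y, `|b y| <= 1) -> cat x (fun y => g y * b y).
Proof.
rewrite /cat => cg g0 b1; rewrite g0 mul0r; apply/cvgrPdist_lt => e e0.
move: cg; rewrite g0 => /cvgrPdist_lt/(_ e e0).
apply: filterS => y; rewrite !sub0r !normrN; apply: le_lt_trans.
by rewrite normrM ler_piMr.
Qed.

Lemma cvg_matrix (T : topologicalType) (x : T) a b (F : T -> 'M[R]_(a.+1, b.+1)) :
  (forall i j, cat x (fun y => F y i j)) -> F y @[y --> x] --> F x.
Proof.
move=> cF; apply/cvg_ballP => e e0.
have H (ij : 'I_a.+1 * 'I_b.+1) : \forall y \near x,
    ball (F x ij.1 ij.2) e (F y ij.1 ij.2).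
  by have /cvg_ballP/(_ e e0) := cF ij.1 ij.2.
have := @filter_forall _ _ _ _ (nbhs_filter x) H; apply: filterS => y Hy; split=> // i j.
exact: (Hy (i, j)).
Qed.

End RadialContinuity.

Ltac ctn := lazymatch goal with |- cat ?x ?F0 =>
  let T := type of x in
  let F := eval cbv beta in (fun y : T => F0 y) in
  lazymatch F with
  | fun _ => ?c => exact: cat_cst
  | fun y => GRing.add (@?f y) (@?g y) => apply: (@cat_add _ _ x f g); ctn
  | fun y => GRing.opp (@?f y) => apply: (@cat_opp _ _ x f); ctn
  | fun y => GRing.mul (@?f y) (@?g y) => apply: (@cat_mul _ _ x f g); ctn
  | fun y => GRing.exp (@?f y) 2 => apply: (@cat_sqr _ _ x f); ctn
  | _ => first [eassumption | idtac]
  end end.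

Section GformContinuity.
Context {R : realType}.
Notation E7 := 'rV[R]_(4 + 3).
Implicit Types (m v w : E7) (f : R -> R).

Lemma cat_lsub k m : cat m (fun x : E7 => qc k (lsubmx x)).
Proof.
apply: (@cat_eq _ _ _ (fun x : E7 => x ord0 (lshift 3 (inord k)))); last exact: coord_continuous.
by move=> x; rewrite /qc mxE.
Qed.

Lemma cat_rsub k m : cat m (fun x : E7 => vc k (rsubmx x)).
Proof.
apply: (@cat_eq _ _ _ (fun x : E7 => x ord0 (rshift 4 (inord k)))); last exact: coord_continuous.
by move=> x; rewrite /vc mxE.
Qed.

Lemma cat_nrm m : cat m (@nrm R).
Proof.
have c0 := @cat_rsub 0 m; have c1 := @cat_rsub 1 m; have c2 := @cat_rsub 2 m.
have c : cat m (fun x : E7 => sqnorm (rsubmx x)).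
  apply: (@cat_eq _ _ _ (fun x : E7 => vc 0 (rsubmx x) ^+ 2 + vc 1 (rsubmx x) ^+ 2
    + vc 2 (rsubmx x) ^+ 2)); first by move=> x; rewrite sqnorm3.
  by ctn.
apply: (@cvg_comp _ _ _ (fun x : E7 => sqnorm (rsubmx x)) Num.sqrt _ (nbhs (sqnorm (rsubmx m)))) => //.
exact: sqrt_continuous.
Qed.

Lemma nrm_ge0 m : 0 <= nrm m. Proof. exact: sqrtr_ge0. Qed.

Lemma nrm_sqr m : nrm m ^+ 2 = vc 0 (rsubmx m) ^+ 2 + vc 1 (rsubmx m) ^+ 2 + vc 2 (rsubmx m) ^+ 2.
Proof.
rewrite /nrm sqr_sqrtr sqnorm3//.
by rewrite !addr_ge0 ?sqr_ge0.
Qed.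

Lemma nrm_eq0 m : nrm m = 0 -> rsubmx m = 0.
Proof.
move=> n0; have := nrm_sqr m; rewrite n0 expr0n /= => /esym/eqP.
rewrite !paddr_eq0 ?addr_ge0 ?sqr_ge0// !sqrf_eq0 => /andP[/andP[/eqP h0 /eqP h1] /eqP h2].
by apply: row3P; rewrite ?h0 ?h1 ?h2 /vc mxE.
Qed.

Lemma nvec_unit m : nrm m != 0 -> dot (nvec m) (nvec m) = 1.
Proof.
move=> n0; have -> : dot (nvec m) (nvec m) = (vc 0 (rsubmx m) ^+ 2 + vc 1 (rsubmx m) ^+ 2
  + vc 2 (rsubmx m) ^+ 2) / nrm m ^+ 2.
  by rewrite /dot /nvec !vc_scale; field.
by rewrite -nrm_sqr divff// expf_neq0.
Qed.

Lemma vc_nvec_le k m : (k < 3)%N -> `|vc k (nvec m)| <= 1.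
Proof.
move=> k3; have [n0|n0] := eqVneq (nrm m) 0.
  by rewrite /nvec vc_scale n0 invr0 mul0r normr0.
have := nvec_unit n0; rewrite /dot.
have sq (y : R) : y ^+ 2 <= 1 -> `|y| <= 1.
  by move=> h; rewrite -ler_sqr ?nnegrE// real_normK ?num_real// expr1n.
case: k k3 => [|[|[|]]]//= _; move: (vc 0 _) (vc 1 _) (vc 2 _) => x y z h; apply: sq.
- by have := sqr_ge0 y; have := sqr_ge0 z; lra.
- by have := sqr_ge0 x; have := sqr_ge0 z; lra.
- by have := sqr_ge0 x; have := sqr_ge0 y; lra.
Qed.

Lemma cat_radial f m : {for nrm m, continuous f} -> cat m (fun x => f (nrm x)).
Proof. by move=> cf; exact: (@cvg_comp _ _ _ (@nrm R) f _ (nbhs (nrm m)) _ (@cat_nrm m) cf). Qed.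

(* Directions are discontinuous on the zero section, where their
   coefficients have to vanish. *)
Lemma cat_radial_bounded f (b : E7 -> R) m : {for nrm m, continuous f} -> f 0 = 0 ->
  (forall x, `|b x| <= 1) -> (nrm m != 0 -> cat m b) -> cat m (fun x => f (nrm x) * b x).
Proof.
move=> cf f0 b1 cb; have cfn := cat_radial cf.
have [n0|n0] := eqVneq (nrm m) 0; last by apply: cat_mul => //; exact: cb.
by apply: (@cat_mul_bounded _ _ _ (fun x => f (nrm x))) => //=; rewrite n0.
Qed.

Lemma cat_nvec k m : nrm m != 0 -> cat m (fun x => vc k (nvec x)).
Proof.
move=> n0; apply: (@cat_eq _ _ _ (fun x => (nrm x)^-1 * vc k (rsubmx x))).
  by move=> x; rewrite /nvec vc_scale.
apply: cat_mul; last exact: cat_rsub.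
by apply: (@cat_inv _ _ _ (@nrm R)) => //; exact: cat_nrm.
Qed.

Lemma gform_continuous f1 f2 f3 f4 f5 m v w :
  {for nrm m, continuous f1} -> {for nrm m, continuous f2} ->
  {for nrm m, continuous f3} -> {for nrm m, continuous f4} ->
  {for nrm m, continuous f5} -> f2 0 = 0 -> f4 0 = 0 -> f5 0 = 0 ->
  cat m (fun x => gform f1 f2 f3 f4 f5 x v w).
Proof.
move=> h1 h2 h3 h4 h5 f20 f40 f50.
have F1 := cat_radial h1; have F3 := cat_radial h3.
have N1 k : (k < 3)%N -> cat m (fun x => f5 (nrm x) * vc k (nvec x)).
  move=> k3; apply: cat_radial_bounded => // [x|n0]; [exact: vc_nvec_le | exact: cat_nvec].
have N2 f i j : {for nrm m, continuous f} -> f 0 = 0 -> (i < 3)%N -> (j < 3)%N ->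
    cat m (fun x => f (nrm x) * (vc i (nvec x) * vc j (nvec x))).
  move=> cf f0 i3 j3; apply: (@cat_radial_bounded _ (fun x => vc i (nvec x) * vc j (nvec x))) => //.
    by move=> x; rewrite normrM mulr_ile1 ?vc_nvec_le.
  by move=> n0; apply: cat_mul; exact: cat_nvec.
have P k := @cat_lsub k m.
have W k x : (k < 4)%N -> cat m (fun y => qc k (Wq y x)).
  have P0 := P 0%N; have P1 := P 1%N; have P2 := P 2; have P3 := P 3.
  by case: k => [|[|[|[|]]]]// _; (eapply cat_eq;
    [by move=> y; rewrite /Wq qmulE !qconjE; reflexivity | ctn]).
have Z k x : (k < 3)%N -> cat m (fun y => vc k (zeta y x)).
  case: k => [|[|[|]]]// _; (eapply cat_eq;
    [by move=> y; rewrite /zeta vec3E; reflexivity | by apply: cat_opp; exact: W]).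
pose z k := vc k (rsubmx v); pose z' k := vc k (rsubmx w).
(* The products of two direction terms are expanded so that f times two components of n is a single
   factor, which is continuous at the zero-section because f vanishes there. *)
pose D (f : R -> R) (a b : nat -> E7 -> R) (x : E7) :=
  a 0%N x * b 0%N x * (f (nrm x) * (vc 0 (nvec x) * vc 0 (nvec x)))
  + a 0%N x * b 1%N x * (f (nrm x) * (vc 0 (nvec x) * vc 1 (nvec x)))
  + a 0%N x * b 2%N x * (f (nrm x) * (vc 0 (nvec x) * vc 2 (nvec x)))
  + a 1%N x * b 0%N x * (f (nrm x) * (vc 1 (nvec x) * vc 0 (nvec x)))
  + a 1%N x * b 1%N x * (f (nrm x) * (vc 1 (nvec x) * vc 1 (nvec x)))
  + a 1%N x * b 2%N x * (f (nrm x) * (vc 1 (nvec x) * vc 2 (nvec x)))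
  + a 2%N x * b 0%N x * (f (nrm x) * (vc 2 (nvec x) * vc 0 (nvec x)))
  + a 2%N x * b 1%N x * (f (nrm x) * (vc 2 (nvec x) * vc 1 (nvec x)))
  + a 2%N x * b 2%N x * (f (nrm x) * (vc 2 (nvec x) * vc 2 (nvec x))).
have cD f a b : {for nrm m, continuous f} -> f 0 = 0 ->
    (forall k, (k < 3)%N -> cat m (a k)) -> (forall k, (k < 3)%N -> cat m (b k)) ->
    cat m (D f a b).
  by move=> cf f0 ca cb; rewrite /D; do 8 (apply: cat_add;
    last by apply: cat_mul; [apply: cat_mul; [exact: ca | exact: cb] | exact: N2]);
    apply: cat_mul; [apply: cat_mul; [exact: ca | exact: cb] | exact: N2].
pose n1 k x := f5 (nrm x) * vc k (nvec x).
have c0 := N1 0%N isT; have c1 := N1 1%N isT; have c2 := N1 2 isT.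
have a0 := Z 0%N v isT; have a1 := Z 1%N v isT; have a2 := Z 2 v isT.
have b0 := Z 0%N w isT; have b1 := Z 1%N w isT; have b2 := Z 2 w isT.
have w0 := W 0%N v isT; have w1 := W 0%N w isT.
apply: (@cat_eq _ _ _ (fun x => f1 (nrm x) * dot (rsubmx v) (rsubmx w)
   + D f2 (fun k _ => z k) (fun k _ => z' k) x
   + f3 (nrm x) * (vc 0 (zeta x v) * vc 0 (zeta x w) + vc 1 (zeta x v) * vc 1 (zeta x w)
        + vc 2 (zeta x v) * vc 2 (zeta x w))
   + D f4 (fun k x => vc k (zeta x v)) (fun k x => vc k (zeta x w)) x
   + 2^-1 * (vc 0 (zeta x v) * (n1 1%N x * z' 2 - n1 2 x * z' 1%N)
       + vc 1 (zeta x v) * (n1 2 x * z' 0%N - n1 0%N x * z' 2)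
       + vc 2 (zeta x v) * (n1 0%N x * z' 1%N - n1 1%N x * z' 0%N)
     + (vc 0 (zeta x w) * (n1 1%N x * z 2 - n1 2 x * z 1%N)
       + vc 1 (zeta x w) * (n1 2 x * z 0%N - n1 0%N x * z 2)
       + vc 2 (zeta x w) * (n1 0%N x * z 1%N - n1 1%N x * z 0%N)))
   + qc 0 (Wq x v) * qc 0 (Wq x w))).
  by move=> x; rewrite /gform /D /n1 /z /z' /dot !crossE; field.
have D1 : cat m (D f2 (fun k _ => z k) (fun k _ => z' k)).
  by apply: cD => // k _; exact: cat_cst.
have D2 : cat m (D f4 (fun k x => vc k (zeta x v)) (fun k x => vc k (zeta x w))).
  by apply: cD => // k k3; exact: Z.
by ctn.
Qed.

Lemma gmx_continuous f1 f2 f3 f4 f5 m :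
  {for nrm m, continuous f1} -> {for nrm m, continuous f2} ->
  {for nrm m, continuous f3} -> {for nrm m, continuous f4} ->
  {for nrm m, continuous f5} -> f2 0 = 0 -> f4 0 = 0 -> f5 0 = 0 ->
  {for m, continuous (gmx f1 f2 f3 f4 f5)}.
Proof.
move=> h1 h2 h3 h4 h5 f20 f40 f50; apply: cvg_matrix => i j.
apply: (@cat_eq _ _ _ (fun x => gform f1 f2 f3 f4 f5 x (delta_mx ord0 i) (delta_mx ord0 j))).
  by move=> x; rewrite /gmx mxE.
exact: gform_continuous.
Qed.

End GformContinuity.

(** * Comparison with the Euclidean metric *)

Section RadialFormBounds.
Context {R : realType}.
Notation E7 := 'rV[R]_(4 + 3).
Implicit Types (m v w : E7) (a b n z : 'rV[R]_3).

Lemma dot_ge0 a : 0 <= dot a a.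
Proof. by rewrite /dot -!expr2 !addr_ge0 ?sqr_ge0. Qed.

Lemma dot_proj_le n z : dot n n = 1 -> 0 <= dot z z - dot z n ^+ 2.
Proof.
move=> n1; suff -> : dot z z - dot z n ^+ 2 = dot (cross n z) (cross n z) by exact: dot_ge0.
rewrite -[dot z z]mul1r -n1 /dot !crossE; ring.
Qed.

(** The squared triple product is the Gram determinant of n, z, a; for a unit vector n the
    difference of the two sides is the square of z.a - (z.n)(a.n). *)
Lemma triple_product_le n z a : dot n n = 1 ->
  dot a (cross n z) ^+ 2 <= (dot z z - dot z n ^+ 2) * (dot a a - dot a n ^+ 2).
Proof.
move=> n1; have -> : dot a (cross n z) ^+ 2 =
  dot n n * dot z z * dot a a + 2 * dot z n * dot z a * dot a n - dot n n * dot z a ^+ 2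
  - dot z z * dot a n ^+ 2 - dot a a * dot z n ^+ 2.
  by rewrite /dot !crossE; ring.
rewrite n1 -subr_ge0; suff -> : forall x y p q r : R,
  (x - p ^+ 2) * (y - q ^+ 2) - (1 * x * y + 2 * p * r * q - 1 * r ^+ 2 - x * q ^+ 2 - y * p ^+ 2)
  = (r - p * q) ^+ 2 by exact: sqr_ge0.
by move=> *; ring.
Qed.

Lemma nvec_cases m : (nrm m = 0 /\ nvec m = 0) \/ (0 < nrm m /\ dot (nvec m) (nvec m) = 1).
Proof.
have [n0|n0] := eqVneq (nrm m) 0; first by left; rewrite /nvec n0 invr0 scale0r.
by right; rewrite nvec_unit// lt_def n0 nrm_ge0.
Qed.

Definition esq v : R := sqnorm (lsubmx v) + sqnorm (rsubmx v).

(** Left translation by the unit quaternion [lsubmx m] is an isometry of R^4. *)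
Lemma esqE m v : sqnorm (lsubmx m) = 1 -> esq v =
  dot (rsubmx v) (rsubmx v) + dot (zeta m v) (zeta m v) + qc 0 (Wq m v) ^+ 2.
Proof.
move=> m1; rewrite /esq -[sqnorm (lsubmx v)]mul1r -m1 !sqnorm4 sqnorm3.
by rewrite /zeta /Wq /dot !(vec3E, qmulE, qconjE); ring.
Qed.

Lemma quad_ge0 (x y p r t c : R) : 0 <= x -> 0 <= y -> 0 <= p -> 0 <= r ->
  t ^+ 2 <= p * r -> c ^+ 2 <= 4 * x * y -> 0 <= x * p + y * r + c * t.
Proof.
move=> x0 y0 p0 r0 tpr cxy.
have h : (c * t) ^+ 2 <= (x * p + y * r) ^+ 2.
  have h1 : (c * t) ^+ 2 <= (4 * x * y) * (p * r) by rewrite exprMn ler_pM ?sqr_ge0.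
  apply: (le_trans h1); rewrite -subr_ge0.
  by rewrite [leRHS](_ : _ = (x * p - y * r) ^+ 2) ?sqr_ge0//; ring.
have s0 : 0 <= x * p + y * r by rewrite addr_ge0 ?mulr_ge0.
have : `|c * t| <= x * p + y * r by rewrite -ler_sqr ?nnegrE// real_normK ?num_real.
by rewrite ler_norml => /andP[]; lra.
Qed.

Variables f1 f2 f3 f4 f5 : R -> R.

(** After subtracting delta times the Euclidean form, the parts along n have coefficients f1 + f2
    and f3 + f4, and the parts orthogonal to n form a 2 by 2 block with off-diagonal entry f5 / 2.
    These conditions make all of them nonnegative. *)
Definition form_ge (delta s : R) : Prop :=
  [/\ delta <= f1 s, delta <= f3 s, delta <= f1 s + f2 s, delta <= f3 s + f4 s
    & f5 s ^+ 2 <= 4 * (f1 s - delta) * (f3 s - delta)].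

Lemma gform_ge delta m v : sqnorm (lsubmx m) = 1 -> delta <= 1 ->
  form_ge delta (nrm m) -> delta * esq v <= gform f1 f2 f3 f4 f5 m v v.
Proof.
move=> m1 d1 [h1 h3 h12 h34 h5]; rewrite (esqE v m1) /gform.
move: (rsubmx v) (zeta m v) (qc 0 (Wq m v)) => z a w.
have zz := dot_ge0 z; have aa := dot_ge0 a; have ww := sqr_ge0 w.
have W : delta * w ^+ 2 <= w * w by rewrite -expr2 ler_piMl.
have [[n0 ->]|[n0 n1]] := nvec_cases m.
  have -> : dot z 0 = 0 by rewrite /dot /vc !mxE; ring.
  have -> : dot a 0 = 0 by rewrite /dot /vc !mxE; ring.
  have -> : dot a (cross 0 z) = 0 by rewrite /dot !crossE /vc !mxE; ring.
  have : delta * dot z z <= f1 (nrm m) * dot z z by exact: ler_wpM2r.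
  have : delta * dot a a <= f3 (nrm m) * dot a a by exact: ler_wpM2r.
  by rewrite !mulr0 !addr0 !mulrDr; lra.
have := triple_product_le z a n1; have := dot_proj_le z n1; have := dot_proj_le a n1.
move: (dot z z) (dot a a) (dot z (nvec m)) (dot a (nvec m)) (dot a (cross _ _)) zz aa.
move=> Z A p q t Z0 A0 ar zr tr.
have q1 : 0 <= (f1 (nrm m) - delta) * (Z - p ^+ 2) + (f3 (nrm m) - delta) * (A - q ^+ 2)
    + f5 (nrm m) * t 
    by apply: (quad_ge0 _ _ zr ar tr h5); rewrite subr_ge0.
have q2 : 0 <= (f1 (nrm m) + f2 (nrm m) - delta) * p ^+ 2 by rewrite mulr_ge0 ?sqr_ge0 ?subr_ge0.
have q3 : 0 <= (f3 (nrm m) + f4 (nrm m) - delta) * q ^+ 2 by rewrite mulr_ge0 ?sqr_ge0 ?subr_ge0.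
by lra.
Qed.

Lemma gform_le K m v : sqnorm (lsubmx m) = 1 -> 1 <= K ->
  (forall f, f = f1 \/ f = f2 \/ f = f3 \/ f = f4 \/ f = f5 -> `|f (nrm m)| <= K) ->
  gform f1 f2 f3 f4 f5 m v v <= 3 * K * esq v.
Proof.
move=> m1 K1 H.
have H1 := H f1 (or_introl erefl).
have H2 := H f2 (or_intror (or_introl erefl)).
have H3 := H f3 (or_intror (or_intror (or_introl erefl))).
have H4 := H f4 (or_intror (or_intror (or_intror (or_introl erefl)))).
have H5 := H f5 (or_intror (or_intror (or_intror (or_intror erefl)))).
rewrite (esqE v m1) /gform.
move: (rsubmx v) (zeta m v) (qc 0 (Wq m v)) => z a w.
have zz := dot_ge0 z; have aa := dot_ge0 a; have ww := sqr_ge0 w.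
have bd (c x y : R) : `|c| <= K -> `|x| <= y -> c * x <= K * y.
  move=> cK xy; apply: le_trans (ler_norm _) _.
  by rewrite normrM ler_pM.
have [P [A [T [hP hA hT]]]] : exists P A T, [/\ P = dot z (nvec m), A = dot a (nvec m) &
    T = dot a (cross (nvec m) z)] by do 3 eexists.
have [P1 A1 T1] : [/\ P ^+ 2 <= dot z z, A ^+ 2 <= dot a a & `|T| <= dot z z + dot a a].
  rewrite hP hA hT; have [[n0 ->]|[n0 n1]] := nvec_cases m.
    have -> : dot z 0 = 0 by rewrite /dot /vc !mxE; ring.
    have -> : dot a 0 = 0 by rewrite /dot /vc !mxE; ring.
    have -> : dot a (cross 0 z) = 0 by rewrite /dot !crossE /vc !mxE; ring.
    by rewrite !expr0n normr0; split=> //; exact: addr_ge0.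
  have := triple_product_le z a n1; have := dot_proj_le z n1; have := dot_proj_le a n1.
  move: (dot z z) (dot a a) (dot z (nvec m)) (dot a (nvec m)) (dot a (cross _ _)) zz aa.
  move=> Z B p q t Z0 B0 ar zr tr.
  have p0 := sqr_ge0 p; have q0 := sqr_ge0 q; split; [lra|lra|].
  have ZB : 0 <= Z + B by lra.
  rewrite -ler_sqr ?nnegrE// real_normK ?num_real//; apply: (le_trans tr).
  have : (Z - p ^+ 2) * (B - q ^+ 2) <= Z * B by apply: ler_pM; lra.
  by have := sqr_ge0 Z; have := sqr_ge0 B; have := mulr_ge0 Z0 B0; nra.
rewrite -hP -hA -hT -!expr2.
have a1 : f1 (nrm m) * dot z z <= K * dot z z by apply: bd => //; rewrite ger0_norm.
have a2 : f2 (nrm m) * P ^+ 2 <= K * dot z z by apply: bd => //; rewrite ger0_norm ?sqr_ge0.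
have a3 : f3 (nrm m) * dot a a <= K * dot a a by apply: bd => //; rewrite ger0_norm.
have a4 : f4 (nrm m) * A ^+ 2 <= K * dot a a by apply: bd => //; rewrite ger0_norm ?sqr_ge0.
have a5 : f5 (nrm m) * T <= K * (dot z z + dot a a) by apply: bd.
have a6 : w ^+ 2 <= K * w ^+ 2 by rewrite ler_peMl.
have a7 : 0 <= K * w ^+ 2 by rewrite mulr_ge0//; lra.
have -> : f5 (nrm m) / 2 * (T + T) = f5 (nrm m) * T by field.
have key (x1 x2 x3 x4 x5 y Z B k : R) : x1 <= k * Z -> x2 <= k * Z -> x3 <= k * B ->
  x4 <= k * B -> x5 <= k * (Z + B) -> y <= k * y -> 0 <= k * y ->
  x1 + x2 + x3 + x4 + x5 + y <= 3 * k * (Z + B + y) by lra.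
exact: key.
Qed.

End RadialFormBounds.

(** * Extension of radial functions to the zero-section *)

Section RightLimits.
Context {R : realType}.
Implicit Types (f g : R -> R) (l : R).

Lemma cvg_at_right0P f l : f s @[s --> 0^'+] --> l <->
  forall e, 0 < e -> exists2 d, 0 < d & forall s, 0 < s < d -> `|f s - l| < e.
Proof.
split=> [/cvgrPdist_lt cf e e0|H].
  have := cf e e0; rewrite near_withinE => -[d /= d0 hd]; exists d => // s /andP[s0 sd].
  by rewrite distrC; apply: hd => //=; rewrite sub0r normrN gtr0_norm.
apply/cvgrPdist_lt => e e0; have [d d0 hd] := H e e0.
rewrite near_withinE; exists d => //= s /= sd s0.
by rewrite distrC; apply: hd; rewrite s0/=; move: sd; rewrite sub0r normrN gtr0_norm.
Qed.

Lemma der_quotient_cvg f (a : R) : is_derive (0 : R) 1 f a -> f 0 = 0 -> f s / s @[s --> 0^'+] --> a.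
Proof.
move=> [df <-] f0; have : h^-1 *: (f (h *: 1 + 0) - f 0) @[h --> 0^'] --> 'D_1 f 0 by exact: df.
move=> /cvgrPdist_lt H; apply/cvg_at_right0P => e e0.
have := H e e0; rewrite near_withinE => -[d /= d0 hd]; exists d => // s /andP[s0 sd].
have := hd s; rewrite /= sub0r normrN gtr0_norm// => /(_ sd); rewrite gt_eqF// => /(_ isT).
rewrite distrC; congr (`|_ - _| < e).
by rewrite f0 addr0 subr0 /GRing.scale /= mulr1 mulrC.
Qed.

Lemma cvg_at_right_squeeze f (K : R) : 0 <= K -> (forall s, 0 < s -> `|f s| <= K * s) ->
  f s @[s --> 0^'+] --> (0 : R).
Proof.
move=> K0 H; apply/cvg_at_right0P => e e0; exists (e / (K + 1)); first by rewrite divr_gt0//; lra.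
move=> s /andP[s0]; rewrite ltr_pdivlMr; last lra.
by rewrite subr0; have := H s s0; nra.
Qed.

Lemma cvg_at_right_eq f g l : (forall s, 0 < s -> f s = g s) -> f s @[s --> 0^'+] --> l ->
  g s @[s --> 0^'+] --> l.
Proof.
move=> fg /cvg_at_right0P H; apply/cvg_at_right0P => e e0; have [d d0 hd] := H e e0.
by exists d => // s sd; rewrite -fg; [exact: hd | case/andP: sd].
Qed.

(* Extends f from s > 0 by its limit at 0, and by a constant to s < 0, where
   the values are irrelevant. *)
Definition prof l f s : R := if s <= 0 then l else f s.

Lemma prof_pos l f s : 0 < s -> prof l f s = f s.
Proof. by rewrite /prof leNgt => ->. Qed.

Lemma prof0 l f : prof l f 0 = l. Proof. by rewrite /prof lexx. Qed.

Lemma prof_cont0 l f : f s @[s --> 0^'+] --> l -> {for 0, continuous (prof l f)}.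
Proof.
move=> /cvg_at_right0P H; apply/cvgrPdist_lt => e e0; have [d d0 hd] := H e e0.
exists d => //= s; rewrite /= sub0r normrN prof0 /prof => sd.
have [s0|s0] /= := leP s 0; first by rewrite subrr normr0.
by rewrite distrC; apply: hd; rewrite s0/=; move: sd; rewrite gtr0_norm.
Qed.

Lemma prof_cont l f s : 0 < s -> {for s, continuous f} -> {for s, continuous (prof l f)}.
Proof.
move=> s0 cf; rewrite /prop_for /continuous_at prof_pos//.
apply: cvg_trans cf; apply: near_eq_cvg; near=> t.
by rewrite prof_pos//; near: t; exact: lt_nbhsr.
Unshelve. all: by end_near. Qed.

End RightLimits.

(** * The radial coefficients of the metric of a solution *)

Section ConifoldProfiles.
Context {R : realType}.
Variables (alpha kappa l0 p0 : R) (T : \bar R) (u phi : R -> R).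
Hypotheses (a0 : alpha != 0) (k0 : 0 < kappa).
Hypotheses (sol : solves alpha kappa T u phi) (zd : zero_data l0 p0 u phi).
Hypotheses (l00 : 0 < l0) (l0E : l0 ^+ 3 = 18 * kappa ^+ 2 * expR (4 * p0)).

Definition slope s := rhs_u alpha kappa s (u s) (phi s).
(** This is u tanh(3s/2), written without a singularity at 0. The five profiles below are found by
    matching the coefficients of [gform_polar] with those of [gmetric]. *)
Definition thu s := u s * sinh (3 * s) / (cosh (3 * s) + 1).
Definition prof1 s := thu s / (3 * s ^+ 2).
Definition prof3 s := 2 / 3 * (u s * cosh (3 * s) / sinh (3 * s) + u0 alpha s).
Definition prof2 s := slope s / 2 - prof1 s.
Definition prof4 s := 2 / 9 * slope s - prof3 s.
Definition prof5 s := - (2 / 3) * ((thu s + u0 alpha s) / s).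

Let u_cvg : u s / s @[s --> 0^'+] --> l0.
Proof.
apply/cvg_at_right0P => e e0; have [d d0 hd] := zd e0.
by exists d => // s sd; have [] := hd s sd.
Qed.

Let phi_cvg : phi s @[s --> 0^'+] --> p0.
Proof.
apply/cvg_at_right0P => e e0; have [d d0 hd] := zd e0.
by exists d => // s sd; have [] := hd s sd.
Qed.

Let id_cvg : (s : R) @[s --> 0^'+] --> (0 : R).
Proof. by apply: (@cvg_at_right_squeeze _ _ 1) => // s s0; rewrite mul1r gtr0_norm. Qed.

Let D3 (x : R) : is_derive x 1 (fun y : R => 3 * y) 3.
Proof. by derE ring. Qed.

Let sinh_cvg : sinh (3 * s) / s @[s --> 0^'+] --> (3 : R).
Proof.
have D := der_sinh (D3 0); have e : cosh (3 * 0) * 3 = 3 :> R by rewrite mulr0 cosh0 mul1r.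
have z : (fun y : R => sinh (3 * y)) 0 = 0 by rewrite /= mulr0 sinh0.
by rewrite e in D; exact: der_quotient_cvg D z.
Qed.

Let cosh_cvg : cosh (3 * s) @[s --> 0^'+] --> (1 : R).
Proof.
have D := der_cosh (D3 0); have := der_cont D; rewrite /prop_for /continuous_at mulr0 cosh0.
exact: cvg_at_right_filter.
Qed.

Let u0_quot_cvg : u0 alpha s / s @[s --> 0^'+] --> (0 : R).
Proof.
apply: (@cvg_at_right_squeeze _ _ (27 / 2 * `|alpha|)); first by rewrite mulr_ge0.
move=> s s0; have s3 : 0 < 3 * s by lra.
have h := langevin_le_sqr s3; have h0 := langevin_gt0 s3.
rewrite normrM normfV (gtr0_norm s0) ler_pdivrMr// u0E (normrM _ (langevin _)) (gtr0_norm h0) (normrM _ alpha) ger0_norm//.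
have := normr_ge0 alpha; move: (langevin _) h => x h; nra.
Qed.

Let u0_cvg : u0 alpha s @[s --> 0^'+] --> (0 : R).
Proof.
apply: (@cvg_at_right_eq _ (fun s => u0 alpha s / s * s)).
  by move=> s s0; rewrite divfK ?gt_eqF.
by rewrite -[X in _ --> X](mulr0 0); apply: cvgM.
Qed.

(** Dividing numerator and denominator by s^2 gives the limit 18 kappa^2 e^(4 p0) / l0^2, which is
    l0. The equality of the limits of u' and u/s makes [prof2] and [prof4] vanish at the
    zero-section. *)
Lemma slope_cvg : slope s @[s --> 0^'+] --> l0.
Proof.
apply: (@cvg_at_right_eq _ (fun s => 2 * kappa ^+ 2 * ((sinh (3 * s) / s) * (sinh (3 * s) / s))
   * expR (4 * phi s) / ((u s / s) * (u s / s) - (u0 alpha s / s) * (u0 alpha s / s)))).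
  move=> s s0; rewrite /slope /rhs_u /V.
  have -> : (u s / s) * (u s / s) - (u0 alpha s / s) * (u0 alpha s / s) =
    (u s ^+ 2 - u0 alpha s ^+ 2) / s ^+ 2 by field; rewrite gt_eqF.
  rewrite invfM invrK; move: (_ - _)^-1 => x; field; by rewrite gt_eqF.
rewrite [X in _ --> X](_ : l0 = 2 * kappa ^+ 2 * (3 * 3) * expR (4 * p0) / (l0 * l0 - 0 * 0)); last first.
  have -> : 2 * kappa ^+ 2 * (3 * 3) * expR (4 * p0) = l0 ^+ 3 by rewrite l0E; ring.
  by field; rewrite gt_eqF.
apply: cvgM; last first.
  apply: cvgV; first by rewrite mul0r subr0 mulf_neq0 ?gt_eqF.
  by apply: cvgB; apply: cvgM.
apply: cvgM.
  by apply: cvgM; [exact: cvg_cst | apply: cvgM].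
have e : {for 4 * p0, continuous (@expR R)} by exact: continuous_expR.
apply: (@cvg_comp _ _ _ (fun s => 4 * phi s) expR _ (nbhs (4 * p0))); last exact: e.
by apply: cvgM => //; exact: cvg_cst.
Qed.

Lemma prof1_cvg : prof1 s @[s --> 0^'+] --> l0 / 2.
Proof.
apply: (@cvg_at_right_eq _ (fun s => 3^-1 * ((u s / s) * (sinh (3 * s) / s)) / (cosh (3 * s) + 1))).
  move=> s s0; rewrite /prof1 /thu; have := cosh_gt0 (3 * s) => c.
  by field; rewrite !gt_eqF//; lra.
rewrite [X in _ --> X](_ : _ = 3^-1 * (l0 * 3) / (1 + 1)); last by field.
apply: cvgM; first by apply: cvgM; [exact: cvg_cst | apply: cvgM].
by apply: cvgV; [rewrite gt_eqF//; lra | apply: cvgD => //; exact: cvg_cst].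
Qed.

Lemma prof2_cvg : prof2 s @[s --> 0^'+] --> (0 : R).
Proof.
rewrite [X in _ --> X](_ : 0 = l0 / 2 - l0 / 2); last by rewrite subrr.
by apply: cvgB; [apply: cvgM; [exact: slope_cvg | exact: cvg_cst] | exact: prof1_cvg].
Qed.

Lemma prof3_cvg : prof3 s @[s --> 0^'+] --> 2 / 9 * l0.
Proof.
apply: (@cvg_at_right_eq _ (fun s => 2 / 3 * ((u s / s) * cosh (3 * s) / (sinh (3 * s) / s) + u0 alpha s))).
  move=> s s0; have h : 0 < sinh (3 * s) by pos.
  by rewrite /prof3; field; rewrite !gt_eqF.
rewrite [X in _ --> X](_ : _ = 2 / 3 * (l0 * 1 / 3 + 0)); last by field.
apply: cvgM; first exact: cvg_cst.
apply: cvgD => //; apply: cvgM; first by apply: cvgM.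
by apply: cvgV => //; rewrite gt_eqF//; lra.
Qed.

Lemma prof4_cvg : prof4 s @[s --> 0^'+] --> (0 : R).
Proof.
rewrite [X in _ --> X](_ : 0 = 2 / 9 * l0 - 2 / 9 * l0); last by rewrite subrr.
by apply: cvgB; [apply: cvgM; [exact: cvg_cst | exact: slope_cvg] | exact: prof3_cvg].
Qed.

Lemma prof5_cvg : prof5 s @[s --> 0^'+] --> (0 : R).
Proof.
apply: (@cvg_at_right_eq _ (fun s => - (2 / 3) * (3 * (prof1 s * s) + u0 alpha s / s))).
  move=> s s0; rewrite /prof5 /prof1; move: (thu s) => t.
  by field; rewrite gt_eqF.
rewrite [X in _ --> X](_ : 0 = - (2 / 3) * (3 * (l0 / 2 * 0) + 0)); last by field.
apply: cvgM; first exact: cvg_cst.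
apply: cvgD => //; apply: cvgM; first exact: cvg_cst.
by apply: cvgM => //; exact: prof1_cvg.
Qed.

Section Interior.
Variable s : R.
Hypotheses (s0 : 0 < s) (sT : (s%:E < T)%E).

Let Du : is_derive s 1 u (slope s).
Proof. by have [] := (solvesP _ _ _ _ k0).1 sol s s0 sT. Qed.

Let Dphi : is_derive s 1 phi (rhs_phi alpha s (u s)).
Proof. by have [] := (solvesP _ _ _ _ k0).1 sol s s0 sT. Qed.

Let gap : 0 < u s ^+ 2 - u0 alpha s ^+ 2.
Proof. by have [] := sol s0 sT. Qed.

Let us : 0 < u s. Proof. by have [] := sol s0 sT. Qed.

Lemma slope_cont : {for s, continuous slope}.
Proof.
have D0 := der_u0 alpha s0; have g := gap; have du := Du; have dp := Dphi.
by eapply der_cont; rewrite /slope /rhs_u /V; der; rewrite gt_eqF.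
Qed.

Lemma slope_gt0 : 0 < slope s.
Proof. by apply: rhs_u_gt0 => //; rewrite -subr_gt0. Qed.

Let thu_cont : {for s, continuous thu}.
Proof.
have du := Du; have := cosh_gt0 (3 * s) => c.
by eapply der_cont; rewrite /thu; der; rewrite gt_eqF//; lra.
Qed.

Lemma prof1_cont : {for s, continuous prof1}.
Proof.
have du := Du; have := cosh_gt0 (3 * s) => c.
by eapply der_cont; rewrite /prof1 /thu; der; rewrite gt_eqF//; [lra | pos].
Qed.

Lemma prof3_cont : {for s, continuous prof3}.
Proof.
have du := Du; have h : 0 < sinh (3 * s) by pos.
have D0 := der_u0 alpha s0.
by eapply der_cont; rewrite /prof3; der; rewrite gt_eqF.
Qed.

Lemma prof2_cont : {for s, continuous prof2}.
Proof.
by apply: cvgB; [apply: cvgM; [exact: slope_cont | exact: cvg_cst] | exact: prof1_cont].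
Qed.

Lemma prof4_cont : {for s, continuous prof4}.
Proof.
by apply: cvgB; [apply: cvgM; [exact: cvg_cst | exact: slope_cont] | exact: prof3_cont].
Qed.

Lemma prof5_cont : {for s, continuous prof5}.
Proof.
have du := Du; have := cosh_gt0 (3 * s) => c.
have D0 := der_u0 alpha s0.
by eapply der_cont; rewrite /prof5 /thu; der; rewrite gt_eqF//; lra.
Qed.

(** The determinant of the block orthogonal to n. Its positivity is exactly the condition u^2 >
    u0^2, which ties the definiteness of the metric to the domain of the system. *)
Lemma prof_det : prof1 s * prof3 s - prof5 s ^+ 2 / 4 =
  (u s ^+ 2 - u0 alpha s ^+ 2) / (9 * s ^+ 2).
Proof.
have := cosh_gt0 (3 * s) => c; have h : 0 < sinh (3 * s) by pos.
have e : sinh (3 * s) ^+ 2 = cosh (3 * s) ^+ 2 - 1 by rewrite cosh_sqr; ring.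
rewrite /prof1 /prof3 /prof5 /thu; move: (u0 alpha s) (sinh _) (cosh _) c h e => w S C c h e.
have -> : u s * S / (C + 1) / (3 * s ^+ 2) * (2 / 3 * (u s * C / S + w)) -
  (- (2 / 3) * ((u s * S / (C + 1) + w) / s)) ^+ 2 / 4 =
  (2 * u s ^+ 2 * C * (C + 1) - u s ^+ 2 * S ^+ 2 - w ^+ 2 * (C + 1) ^+ 2) / (9 * s ^+ 2 * (C + 1) ^+ 2).
  by field; rewrite !gt_eqF//; lra.
by rewrite e; field; rewrite !gt_eqF//; lra.
Qed.

Lemma prof1_gt0 : 0 < prof1 s.
Proof.
have := us; have := cosh_gt0 (3 * s) => c h.
by rewrite /prof1 /thu; pos.
Qed.

Lemma prof3_gt0 : 0 < prof3 s.
Proof.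
have : 0 < prof1 s * prof3 s.
  have -> : prof1 s * prof3 s = (u s ^+ 2 - u0 alpha s ^+ 2) / (9 * s ^+ 2) + prof5 s ^+ 2 / 4.
    by rewrite -prof_det; ring.
  by rewrite ltr_wpDr ?divr_ge0 ?sqr_ge0// divr_gt0// mulr_gt0// exprn_gt0.
by rewrite pmulr_rgt0// prof1_gt0.
Qed.

End Interior.

End ConifoldProfiles.

(** * The Riemannian metric over the zero-section *)

Section ConifoldMetric.
Context {R : realType}.
Variables (alpha kappa l0 p0 : R) (T : \bar R) (u phi : R -> R).
Hypotheses (a0 : alpha != 0) (k0 : 0 < kappa).
Hypotheses (sol : solves alpha kappa T u phi) (zd : zero_data l0 p0 u phi).
Hypotheses (l00 : 0 < l0) (l0E : l0 ^+ 3 = 18 * kappa ^+ 2 * expR (4 * p0)).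

Notation slope := (slope alpha kappa u phi).
Let F0 := prof l0 slope.
Let F1 := prof (l0 / 2) (prof1 u).
Let F2 := prof 0 (prof2 alpha kappa u phi).
Let F3 := prof (2 / 9 * l0) (prof3 alpha u).
Let F4 := prof 0 (prof4 alpha kappa u phi).
Let F5 := prof 0 (prof5 alpha u).

Definition conifold_mx : 'rV[R]_(4 + 3) -> 'M[R]_(4 + 3) := gmx F1 F2 F3 F4 F5.

Lemma conifoldE m : conifold T m ->
  [/\ sqnorm (lsubmx m) = 1, 0 <= nrm m & ((nrm m)%:E < T)%E].
Proof. by move=> [m1 mT]; split=> //; exact: nrm_ge0. Qed.

Section Pointwise.
Variable s : R.
Hypotheses (s0 : 0 <= s) (sT : (s%:E < T)%E).

Let cont_from f l : f s @[s --> 0^'+] --> l ->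
  (0 < s -> {for s, continuous f}) -> {for s, continuous (prof l f)}.
Proof.
move=> H0 H; move: s0; rewrite le_eqVlt => /predU1P[<-|h]; first exact: prof_cont0.
by apply: prof_cont => //; exact: H.
Qed.

Lemma profiles_continuous : [/\ {for s, continuous F0}, {for s, continuous F1},
  {for s, continuous F2}, {for s, continuous F3} &
  {for s, continuous F4} /\ {for s, continuous F5}].
Proof.
split; [| | | |split]; apply: cont_from.
- exact: (slope_cvg alpha zd l00 l0E).
- by move=> h; exact: (slope_cont k0 sol h sT).
- exact: (prof1_cvg zd).
- by move=> h; exact: (prof1_cont k0 sol h sT).
- exact: (prof2_cvg alpha zd l00 l0E).
- by move=> h; exact: (prof2_cont k0 sol h sT).
- exact: (prof3_cvg alpha zd).
- by move=> h; exact: (prof3_cont k0 sol h sT).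
- exact: (prof4_cvg alpha zd l00 l0E).
- by move=> h; exact: (prof4_cont k0 sol h sT).
- exact: (prof5_cvg alpha zd).
- by move=> h; exact: (prof5_cont k0 sol h sT).
Qed.

Lemma profiles_gt0 : [/\ 0 < F0 s, 0 < F1 s, 0 < F3 s & 0 < F1 s * F3 s - F5 s ^+ 2 / 4].
Proof.
move: s0; rewrite le_eqVlt => /predU1P[<-|h].
  rewrite /F0 /F1 /F3 /F5 !prof0; have h := l00; split; [exact: h|lra|lra|].
  have -> : l0 / 2 * (2 / 9 * l0) - 0 ^+ 2 / 4 = l0 ^+ 2 / 9 by field.
  by pos.
rewrite /F0 /F1 /F3 /F5 !prof_pos//; have [_ _ gap _ _] := sol h sT.
split; [exact: (slope_gt0 k0 sol h sT) | exact: (prof1_gt0 sol h sT) | exact: (prof3_gt0 sol h sT) |].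
by rewrite (prof_det alpha u h); pos.
Qed.

Lemma profiles_sum : F1 s + F2 s = F0 s / 2 /\ F3 s + F4 s = 2 / 9 * F0 s.
Proof.
move: s0; rewrite le_eqVlt => /predU1P[<-|h].
  by rewrite /F0 /F1 /F2 /F3 /F4 !prof0 !addr0; split; field.
by rewrite /F0 /F1 /F2 /F3 /F4 !prof_pos// /prof2 /prof4; split; ring.
Qed.

End Pointwise.

(** A lower bound for the metric relative to the Euclidean one: 1 for the normal term, 2/9 F0 for
    the two directions along n, and determinant over trace for the smaller eigenvalue of the 2 by 2
    block. *)
Definition profile_min s : R :=
  Num.min 1 (Num.min (2 / 9 * F0 s) ((F1 s * F3 s - F5 s ^+ 2 / 4) / (F1 s + F3 s))).

Lemma profile_min_gt0 s : 0 <= s -> (s%:E < T)%E -> 0 < profile_min s.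
Proof.
move=> s0 sT; have [h0 h1 h3 h5] := profiles_gt0 s0 sT.
by rewrite /profile_min !lt_min ltr01 /= mulr_gt0//= divr_gt0// addr_gt0.
Qed.

Lemma profile_min_form_ge delta s : 0 <= s -> (s%:E < T)%E -> delta <= profile_min s ->
  delta <= 1 /\ form_ge F1 F2 F3 F4 F5 delta s.
Proof.
move=> s0 sT; have [h0 h1 h3 h5] := profiles_gt0 s0 sT.
have [e12 e34] := profiles_sum s0.
rewrite /profile_min !le_min => /and3P[d1 d2 d3]; split=> //.
have h13 : 0 < F1 s + F3 s by lra.
rewrite ler_pdivlMr// in d3.
have q5 : 0 <= F5 s ^+ 2 by exact: sqr_ge0.
rewrite /form_ge e12 e34; move: (F0 s) (F1 s) (F3 s) (F5 s ^+ 2) h0 h1 h3 h5 d2 h13 d3 q5.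
move=> x a b q x0 a_0 b_0 ab d2 ab0 d3 q0.
have da : delta <= a by have [//|h] := lerP delta a; nra.
have db : delta <= b by have [//|h] := lerP delta b; nra.
by split=> //; [lra | have := sqr_ge0 delta; nra].
Qed.

Lemma profile_min_continuous s : 0 <= s -> (s%:E < T)%E -> {for s, continuous profile_min}.
Proof.
move=> s0 sT; have [c0 c1 _ c3 [_ c5]] := profiles_continuous s0 sT.
have [_ h1 h3 _] := profiles_gt0 s0 sT.
apply: continuous_min; first exact: cvg_cst.
apply: continuous_min.
  by apply: cvgM => //; exact: cvg_cst.
apply: cvgM; last by apply: cvgV; [rewrite gt_eqF// addr_gt0 | exact: cvgD].
by apply: cvgB; [exact: cvgM | apply: cvgM; [exact: cvgM | exact: cvg_cst]].
Qed.

Lemma profile_min_lower b : 0 <= b -> (b%:E < T)%E ->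
  exists2 delta, 0 < delta & forall s, 0 <= s <= b -> delta <= profile_min s.
Proof.
move=> b0 bT; have lt s : 0 <= s <= b -> 0 <= s /\ (s%:E < T)%E.
  by move=> /andP[s0 sb]; split=> //; apply: le_lt_trans bT; rewrite lee_fin.
apply: segment_lower_bound => // s /lt[s0 sT].
  exact: profile_min_continuous.
exact: profile_min_gt0.
Qed.

Lemma conifold_mx_ge m v delta : conifold T m -> delta <= profile_min (nrm m) ->
  delta * esq v <= bilin (conifold_mx m) v v.
Proof.
move=> /conifoldE[m1 s0 sT] /(profile_min_form_ge s0 sT)[d1 fg].
by rewrite bilin_gmx; exact: gform_ge.
Qed.

Lemma conifold_mx_le b : 0 <= b -> (b%:E < T)%E -> exists2 K, 0 < K &
  forall m v, conifold T m -> nrm m <= b -> bilin (conifold_mx m) v v <= K * esq v.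
Proof.
move=> b0 bT; have lt s : 0 <= s <= b -> 0 <= s /\ (s%:E < T)%E.
  by move=> /andP[s0 sb]; split=> //; apply: le_lt_trans bT; rewrite lee_fin.
have B (F : R -> R) : (forall s, 0 <= s -> (s%:E < T)%E -> {for s, continuous F}) ->
    exists2 K, 0 <= K & forall s, 0 <= s <= b -> `|F s| <= K.
  by move=> cF; apply: segment_bounded => // s /lt[]; exact: cF.
have [|K1 K10 B1] := B F1; first by move=> s s0 /(profiles_continuous s0)[].
have [|K2 K20 B2] := B F2; first by move=> s s0 /(profiles_continuous s0)[].
have [|K3 K30 B3] := B F3; first by move=> s s0 /(profiles_continuous s0)[].
have [|K4 K40 B4] := B F4; first by move=> s s0 /(profiles_continuous s0)[_ _ _ _ []].
have [|K5 K50 B5] := B F5; first by move=> s s0 /(profiles_continuous s0)[_ _ _ _ []].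
exists (3 * (1 + K1 + K2 + K3 + K4 + K5)); first lra.
move=> m v /conifoldE[m1 s0 sT] sb; rewrite bilin_gmx.
have sb' : 0 <= nrm m <= b by rewrite s0.
have h1 := B1 _ sb'; have h2 := B2 _ sb'; have h3 := B3 _ sb'.
have h4 := B4 _ sb'; have h5 := B5 _ sb'.
apply: gform_le => //; first lra.
by move=> f [->|[->|[->|[->|->]]]]; lra.
Qed.

Lemma esq_ge0 (v : 'rV[R]_(4 + 3)) : 0 <= esq v.
Proof. by rewrite addr_ge0// sumr_ge0// => i _; exact: sqr_ge0. Qed.

Lemma esq_gt0 (v : 'rV[R]_(4 + 3)) : v != 0 -> 0 < esq v.
Proof.
move=> v0; rewrite lt_def esq_ge0 andbT; apply: contra v0 => /eqP e.
have z n (x : 'rV[R]_n) : sqnorm x = 0 -> x = 0.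
  move=> /eqP; rewrite psumr_eq0 => [/allP h|i _]; last exact: sqr_ge0.
  apply/rowP => j; rewrite mxE; have := h j (mem_index_enum j).
  by rewrite /= sqrf_eq0 => /eqP.
have g n (x : 'rV[R]_n) : 0 <= sqnorm x by rewrite sumr_ge0// => i _; exact: sqr_ge0.
move: e; rewrite /esq => /eqP; rewrite paddr_eq0// => /andP[/eqP/z e1 /eqP/z e2].
by rewrite -[v]hsubmxK e1 e2 row_mx0.
Qed.

Lemma conifold_mx_continuous m : conifold T m -> {for m, continuous conifold_mx}.
Proof.
move=> /conifoldE[m1 s0 sT]; have [_ c1 c2 c3 [c4 c5]] := profiles_continuous s0 sT.
by apply: gmx_continuous => //; rewrite /F2 /F4 /F5 prof0.
Qed.

Lemma conifold_mx_riemannian : riemannian T conifold_mx.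
Proof.
split; first by apply: continuous_in_subspaceT => m; rewrite inE; exact: conifold_mx_continuous.
move=> m mT; split; first exact: gmx_sym.
move=> v _ v0; have [m1 s0 sT] := conifoldE mT.
apply: (@lt_le_trans _ _ (profile_min (nrm m) * esq v)); last exact: conifold_mx_ge.
by rewrite mulr_gt0 ?esq_gt0// profile_min_gt0.
Qed.

Lemma conifold_mx_polar s p q X Y : 0 < s -> (s%:E < T)%E -> sqnorm p = 1 -> sqnorm q = 1 ->
  bilin (conifold_mx (polar s p q)) (dpolar s p q X) (dpolar s p q Y) =
  metric alpha kappa u phi s X Y.
Proof.
move=> s0 sT p1 q1; rewrite bilin_gmx (gform_polar _ _ _ _ _ _ _ s0 p1 q1) metricE//.
have [us _ gap du _] := sol s0 sT; have [_ _ Du _] := (solvesP _ _ _ _ k0).1 sol s s0 sT.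
rewrite /F1 /F2 /F3 /F4 /F5 !prof_pos//.
have -> : derive1 u s = slope s by exact: derive1_der.
have h : 0 < sinh (3 * s) by pos.
have thE : thu u s = u s * ((cosh (3 * s) - 1) / sinh (3 * s)).
  rewrite /thu; have c := cosh_gt0 (3 * s).
  have e : sinh (3 * s) ^+ 2 = cosh (3 * s) ^+ 2 - 1 by rewrite cosh_sqr; ring.
  have -> : u s * sinh (3 * s) / (cosh (3 * s) + 1) =
     u s * (sinh (3 * s) ^+ 2 / (sinh (3 * s) * (cosh (3 * s) + 1))).
    by field; rewrite !gt_eqF//; lra.
  by rewrite e; field; rewrite !gt_eqF//; lra.
rewrite /prof2 /prof4 /prof1 /prof3 /prof5 thE /gmetric /nu0 /nu3 /=.
move: (slope s) (u s) (u0 alpha s) (cosh _) (sinh _) h => sl x w C S h.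
by field; rewrite !gt_eqF.
Qed.

Lemma conifold_mxP : conifold_metric alpha kappa T u phi conifold_mx.
Proof. by split; [exact: conifold_mx_riemannian | move=> *; exact: conifold_mx_polar]. Qed.

End ConifoldMetric.

(** * A uniform lower bound of the metric above the critical slope *)

Section UniformBound.
Context {R : realType}.
Variables (alpha kappa l0 p0 : R) (u phi : R -> R).
Hypotheses (a0 : alpha != 0) (k0 : 0 < kappa).
Hypotheses (sol : solves alpha kappa +oo%E u phi) (zd : zero_data l0 p0 u phi).
Hypotheses (l0E : l0 ^+ 3 = 18 * kappa ^+ 2 * expR (4 * p0)).
Hypothesis (cl : crit_slope alpha < l0).

Let l00 : 0 < l0 := lt_trans (crit_slope_gt0 a0) cl.

Notation profile_min := (profile_min alpha kappa l0 u phi).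

(** For large s, u' >= 1. The determinant is at least mu u^2 / (9 s^2) and the trace at most 3 u, so
    their quotient is at least mu u / (27 s^2); here u >= C e^s and s^2 <= 4 e^s, which gives the
    constant mu C / 108. *)
Lemma profile_min_lower_infty : exists s1 m, [/\ 0 < s1, 0 < m &
  forall s, s1 <= s -> m <= profile_min s].
Proof.
have [L phiL] := dilaton_cvg a0 k0 sol zd l0E cl.
have du := du_scale_cvg a0 k0 sol zd l0E cl phiL.
have [mu mu0 Hgap] := gap_ge a0 k0 sol zd l0E cl.
have [C [s1 [C0 s11 HC]]] := u_exp_growth a0 k0 sol zd l0E cl.
have [s2 Hs2] : exists s2, forall s, s2 <= s -> 1 <= derive1 u s.
  have : \forall s \near +oo, 2^-1 < derive1 u s / (2 * cone_radius kappa L s ^+ 2).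
    by apply: (cvgr_gt _ du); lra.
  move=> [A [_ HA]].
  have /cvgryPge/(_ 1)[B [_ HB]] : cone_radius kappa L s @[s --> +oo] --> +oo.
    by apply: cone_radius_cvg.
  exists (Num.max A B + 1) => s; rewrite -lerBrDr => hs.
  have [hA hB] : A < s /\ B < s by split; apply: le_lt_trans (_ : s - 1 < s);
    [apply: le_trans hs; rewrite le_max lexx | lra | apply: le_trans hs; rewrite le_max lexx orbT | lra].
  have := HA _ hA; have := HB _ hB => /= r1.
  rewrite ltr_pdivlMr; last by rewrite mulr_gt0 ?exprn_gt0//; lra.
  by move: (cone_radius _ _ _) r1 => r r1; nra.
exists (Num.max s1 (Num.max s2 1)); exists (Num.min 1 (Num.min (2 / 9) (mu * C / 108))).
split; first by rewrite lt_max; apply/orP; left; lra.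
  by rewrite !lt_min ltr01 /=; apply/andP; split; [lra | pos].
move=> s; rewrite !ge_max => /and3P[h1 h2 h3].
have s0 : 0 < s by lra.
have sT : (s%:E < +oo)%E by rewrite ltry.
rewrite /profile_min !prof_pos//.
have [us dus gap Du _] := sol s0 sT.
have D : derive1 u s = slope alpha kappa u phi s by exact: derive1_der.
have p1 := prof1_gt0 sol s0 sT; have p3 := prof3_gt0 sol s0 sT.
rewrite !le_min !ge_min lexx /=; apply/andP; split; apply/orP; right.
  by apply/orP; left; rewrite -D; have := Hs2 _ h2; lra.
apply/orP; right; rewrite ler_pdivlMr ?addr_gt0// (prof_det alpha u s0).
have s30 : 0 < 3 * s by lra.
have shs := sinh3_ge h3; have e1 : 4 <= expR (3 * s) by have := expR_ge1Dx (3 * s); lra.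
have S0 := sinh_gt0 s30; have C1 := cosh_gt0 (3 * s).
have CS : cosh (3 * s) <= 2 * sinh (3 * s).
  have := cosh_sub_sinh (3 * s).
  have : expR (- (3 * s)) <= 1 by rewrite -[leRHS]expR0 ler_expR; lra.
  by lra.
have b1 : prof1 u s <= u s / (3 * s ^+ 2).
  rewrite /prof1 ler_pM2r; last by rewrite invr_gt0; pos.
  rewrite /thu ler_pdivrMr; last lra.
  by have := sinh_lt_cosh (3 * s); nra.
have b3 : prof3 alpha u s <= 2 * u s.
  have : `|u0 alpha s| <= u s.
    rewrite -ler_sqr ?nnegrE//; last exact: ltW.
    by rewrite real_normK ?num_real//; lra.
  rewrite ler_norml => /andP[_ hu].
  have : u s * cosh (3 * s) / sinh (3 * s) <= u s * 2.
    by rewrite -mulrA ler_pM2l// ler_pdivrMr.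
  by rewrite /prof3; lra.
have b13 : prof1 u s + prof3 alpha u s <= 3 * u s.
  have : u s / (3 * s ^+ 2) <= u s.
    rewrite ler_pdivrMr; last by pos.
    by rewrite ler_peMr//; [exact: ltW | nra].
  by lra.
have q := sqr_le_expR (ltW s0); have g := Hgap _ s0; have hu := HC _ h1.
rewrite ler_pdivlMr; last by pos.
apply: (@le_trans _ _ (mu * C / 108 * (3 * u s) * (9 * (4 * expR s)))).
  have h : 0 < mu * C / 108 by pos.
  have m1 : mu * C / 108 * (prof1 u s + prof3 alpha u s) <= mu * C / 108 * (3 * u s).
    by rewrite ler_pM2l.
  apply: ler_pM => //; [|by pos|lra].
  by rewrite mulr_ge0// ?ltW// ?addr_gt0.
apply: le_trans g.
have -> : mu * C / 108 * (3 * u s) * (9 * (4 * expR s)) = mu * (u s * (C * expR s)) by field.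
by rewrite ler_pM2l// expr2 ler_pM2l.
Qed.

Lemma profile_min_lower_all : exists2 delta, 0 < delta & forall s, 0 <= s -> delta <= profile_min s.
Proof.
have [s1 [m [s10 m0 H]]] := profile_min_lower_infty.
have [|d d0 Hd] := profile_min_lower k0 sol zd l00 l0E (ltW s10); first by rewrite ltry.
exists (Num.min m d); first by rewrite lt_min m0.
move=> s s0; rewrite ge_min; have [h|h] := leP s s1.
  by rewrite Hd ?orbT// s0.
by rewrite H// ltW.
Qed.

End UniformBound.

(** * Bounds for integrals over the unit interval *)

Section UnitIntegral.
Context {R : realType}.
Notation mu := (@lebesgue_measure R).
Implicit Types (f g h F : R -> R).

(* Neither function is assumed measurable. *)
Lemma integral_monotone (D : set R) f g : (forall t, D t -> 0 <= f t <= g t) ->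
  (\int[mu]_(t in D) (f t)%:E <= \int[mu]_(t in D) (g t)%:E)%E.
Proof.
move=> fg.
rewrite !ge0_integralE; [|by move=> t /fg/andP[f0 /(le_trans f0)]; rewrite lee_fin
  |by move=> t /fg/andP[f0 _]; rewrite lee_fin].
apply: le_ereal_sup => _ /= [h hf <-]; exists h => // t.
apply: (le_trans (hf t)); rewrite /patch; case: ifP => //.
by rewrite inE => /fg/andP[_]; rewrite lee_fin.
Qed.

Lemma integral01_primitive g F : (forall t : R, 0 <= t <= 1 -> {for t, continuous g}) ->
  (forall t : R, 0 <= t <= 1 -> is_derive t 1 F (g t)) ->
  (\int[mu]_(t in `[0%R, 1%R]) (g t)%:E = (F 1 - F 0)%:E)%E.
Proof.
move=> cg dF; have cF (t : R) : 0 <= t <= 1 -> F x @[x --> t] --> F t by move=> /dF; exact: der_cont.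
rewrite (@continuous_FTC2 R g F 0 1)//.
- apply: continuous_in_subspaceT => t; rewrite inE/= in_itv/=; exact: cg.
- split; [|by apply: cvg_at_right_filter; apply: cF; lra |by apply: cvg_at_left_filter; apply: cF; lra].
  by move=> t; rewrite in_itv/= => /andP[t0 t1]; have [] := dF t _; rewrite ?ltW.
- by move=> t; rewrite in_itv/= => /andP[t0 t1]; apply: derive1_der; apply: dF; rewrite !ltW.
Qed.

Lemma integral01_le g F f : (forall t : R, 0 <= t <= 1 -> {for t, continuous g}) ->
  (forall t : R, 0 <= t <= 1 -> is_derive t 1 F (g t)) ->
  (forall t : R, 0 <= t <= 1 -> 0 <= f t <= g t) ->
  (\int[mu]_(t in `[0%R, 1%R]) (f t)%:E <= (F 1 - F 0)%:E)%E.
Proof.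
move=> cg dF fg; rewrite -(integral01_primitive cg dF).
by apply: integral_monotone => t /=; rewrite in_itv/=; exact: fg.
Qed.

Lemma integral01_ge h F f : continuous h ->
  (forall t : R, 0 <= t <= 1 -> is_derive t 1 F (h t)) ->
  (forall t : R, 0 <= t <= 1 -> 0 <= f t /\ h t <= f t) ->
  ((F 1 - F 0)%:E <= \int[mu]_(t in `[0%R, 1%R]) (f t)%:E)%E.
Proof.
(* The positive part is still continuous and below f, and its integral is monotone because both
   functions are nonnegative. *)
move=> ch dF hf; pose g t := Num.max (h t) 0.
have cg : continuous g by move=> t; apply: continuous_max; [exact: ch | exact: cvg_cst].
have [K _ dK] := antiderivative 0 cg.
apply: (@le_trans _ _ (K 1 - K 0)%:E).
  rewrite lee_fin; apply: (@deriv_le_sub _ F h K g 0 1 ler01 dF).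
    by move=> t /andP[t0 _]; exact: dK.
  by move=> t _; rewrite /g le_max lexx.
have cg' (t : R) : 0 <= t <= 1 -> {for t, continuous g} by move=> _; exact: cg.
have dK' (t : R) : 0 <= t <= 1 -> is_derive t 1 K (g t) by move=> /andP[t0 _]; exact: dK.
rewrite -(integral01_primitive cg' dK').
apply: integral_monotone => t /=; rewrite in_itv/= => /hf[f0 hft].
by rewrite /g le_max lexx orbT /= ge_max hft f0.
Qed.

End UnitIntegral.

(** * Riemannian distances from lengths of curves *)

Section Curves.
Context {R : realType}.
Notation E7 := 'rV[R]_(4 + 3).
Implicit Types (T : \bar R) (G : E7 -> 'M[R]_(4 + 3)) (c : R -> E7) (x y m v : E7).

Lemma esq_sum v : esq v = \sum_j v ord0 j ^+ 2.
Proof.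
rewrite /esq /sqnorm big_split_ord /=; congr (_ + _); apply: eq_bigr => j _; by rewrite mxE.
Qed.

Lemma coord_le_esq v j : v ord0 j ^+ 2 <= esq v.
Proof.
rewrite esq_sum (bigD1 j)//= lerDl sumr_ge0// => i _; exact: sqr_ge0.
Qed.

Lemma der_coord c (t : R) j : derivable c t 1 ->
  is_derive t 1 (fun r : R => c r ord0 j) (derive1 c t ord0 j).
Proof.
move=> dc; rewrite derive1E derive_mx// mxE; apply: DeriveDef => //.
by apply: (derivable_mxP _ _ _).1.
Qed.

(** The way to bound lengths from below: a function whose derivative along the curve is at most K
    times the speed cannot change by more than K times the length. *)
Lemma curve_length_ge T G x y c (F h : R -> R) (K : R) : curve_between T x y c ->
  0 < K -> continuous h -> (forall t : R, is_derive t 1 F (h t)) ->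
  (forall t : R, 0 <= t <= 1 -> h t <= K * Num.sqrt (bilin (G (c t)) (derive1 c t) (derive1 c t))) ->
  (((F 1 - F 0) / K)%:E <= curve_length G c)%E.
Proof.
move=> [_ _ _ _ cT] K0 ch dF hK.
have -> : (F 1 - F 0) / K = (fun t => F t / K) 1 - (fun t => F t / K) 0 by rewrite mulrBl.
apply: (@integral01_ge _ (fun t => h t / K) (fun t => F t / K)).
- by move=> t; apply: cvgM; [exact: ch | exact: cvg_cst].
- by move=> t _; have D := dF t; derE ring.
- by move=> t t01; rewrite sqrtr_ge0 ler_pdivrMr// mulrC hK.
Qed.

Lemma curve_length_le G c (M : R) : (forall t : R, 0 <= t <= 1 ->
  bilin (G (c t)) (derive1 c t) (derive1 c t) <= M ^+ 2) -> 0 <= M ->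
  (curve_length G c <= M%:E)%E.
Proof.
move=> H M0; have -> : M%:E = ((fun t => M * t) 1 - (fun t => M * t) 0)%:E by rewrite mulr1 mulr0 subr0.
apply: (@integral01_le _ (fun=> M) (fun t => M * t)).
- by move=> t _; exact: cvg_cst.
- by move=> t _; derE ring.
- move=> t t01; rewrite sqrtr_ge0 /= -[leRHS](ger0_norm M0) -sqrtr_sqr.
  by rewrite ler_wsqrtr// H.
Qed.

(** A coordinate, taken with either sign, varies at most at the Euclidean speed, which the lower
    bound on the metric controls. *)
Lemma coord_dist_le T G x y (delta : R) j : 0 < delta ->
  (forall m v, conifold T m -> delta * esq v <= bilin (G m) v v) ->
  ((`|x ord0 j - y ord0 j| * Num.sqrt delta)%:E <= riemannian_dist T G x y)%E.
Proof.
move=> d0 HG; apply: le_ereal_inf_tmp => _ [c cb <-].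
have sd0 : 0 < Num.sqrt delta by rewrite sqrtr_gt0.
have key (b : R) : `|b| <= 1 ->
    ((b * (y ord0 j - x ord0 j) * Num.sqrt delta)%:E <= curve_length G c)%E.
  move=> b1; have [dc cc c0 c1 cT] := cb.
  have -> : b * (y ord0 j - x ord0 j) * Num.sqrt delta =
    ((fun t => b * c t ord0 j) 1 - (fun t => b * c t ord0 j) 0) / (Num.sqrt delta)^-1.
    by rewrite c0 c1 invrK; ring.
  apply: (@curve_length_ge T G x y c (fun t => b * c t ord0 j) (fun t => b * derive1 c t ord0 j)) => //.
  - by rewrite invr_gt0.
  - move=> t; apply: cvgM; first exact: cvg_cst.
    exact: (@cvg_comp _ _ _ (derive1 c) (fun m : E7 => m ord0 j) _ (nbhs (derive1 c t)) _
      (cc t) (@coord_continuous _ _ _ _ _ _)).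
  - by move=> t; have D := der_coord j (dc t); derE ring.
  - move=> t t01; rewrite [leRHS]mulrC ler_pdivlMr//.
    apply: (le_trans (ler_norm _)); rewrite -sqrtr_sqr ler_wsqrtr// exprMn (sqr_sqrtr (ltW d0)).
    rewrite mulrC; apply: le_trans (HG _ (derive1 c t) (cT t t01)); rewrite ler_pM2l// exprMn.
    apply: le_trans (coord_le_esq _ j); rewrite ler_piMl ?sqr_ge0//.
    by rewrite -real_normK ?num_real// expr_le1.
case: (leP 0 (x ord0 j - y ord0 j)) => s.
  rewrite ger0_norm//; have := key (-1); rewrite normrN1 lexx => /(_ isT).
  by congr (_ <= _)%E; congr EFin; ring.
rewrite ltr0_norm//; have := key 1; rewrite normr1 lexx => /(_ isT).
by congr (_ <= _)%E; congr EFin; ring.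
Qed.

Lemma curve_dist_le T G x y c (M : R) : curve_between T x y c ->
  (forall t : R, 0 <= t <= 1 -> bilin (G (c t)) (derive1 c t) (derive1 c t) <= M ^+ 2) ->
  0 <= M -> (riemannian_dist T G x y <= M%:E)%E.
Proof.
move=> cb H M0; apply: le_trans (curve_length_le H M0).
by apply: ereal_inf_lbound; exists c.
Qed.

End Curves.

(** * Short curves between nearby points *)

Section Chords.
Context {R : realType}.
Notation E7 := 'rV[R]_(4 + 3).
Variables (T : \bar R) (x l : E7).
Hypotheses (xT : conifold T x) (lT : conifold T l) (xl : esq (l - x) <= 1).

Let P k : R := qc k (lsubmx x).
Let Q k : R := qc k (lsubmx l).
Let p k : R := vc k (rsubmx x).
Let q k : R := vc k (rsubmx l).

Let d : R := P 0%N * Q 0%N + P 1%N * Q 1%N + P 2 * Q 2 + P 3 * Q 3.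
Let D : 'rV[R]_4 := d^-1 *: lsubmx l - lsubmx x.
Let rho : R := d ^- 2 - 1.
Let e : R := esq (l - x).
Let N t : R := 1 + rho * t ^+ 2.
Let g t : R := expR (- (ln (N t) / 2)).
Let w : 'rV[R]_3 := rsubmx l - rsubmx x.
Let dc t : E7 := row_mx ((g t / N t) *: (D - (rho * t) *: lsubmx x)) w.
(** In R^3 a straight segment; in the sphere the radial projection of the segment from P to Q/d,
    where d is the cosine of the angle between P and Q. The difference [D] is orthogonal to P with
    squared length [rho], so [g] normalises the segment for every real t. *)
Let c t : E7 := row_mx (g t *: (lsubmx x + t *: D)) (rsubmx x + t *: w).

Let P1 : P 0%N ^+ 2 + P 1%N ^+ 2 + P 2 ^+ 2 + P 3 ^+ 2 = 1.
Proof. by have [m1 _ _] := conifoldE xT; move: m1; rewrite sqnorm4. Qed.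

Let Q1 : Q 0%N ^+ 2 + Q 1%N ^+ 2 + Q 2 ^+ 2 + Q 3 ^+ 2 = 1.
Proof. by have [m1 _ _] := conifoldE lT; move: m1; rewrite sqnorm4. Qed.

Let eE : e = 2 - 2 * d + sqnorm w.
Proof.
rewrite /e /esq.
have -> : lsubmx (l - x) = lsubmx l - lsubmx x by apply/rowP => j; rewrite !mxE.
have -> : rsubmx (l - x) = w by apply/rowP => j; rewrite !mxE.
have dk k : qc k (lsubmx l - lsubmx x) = Q k - P k by rewrite /Q /P /qc !mxE.
rewrite sqnorm4 !dk /d; congr (_ + _).
by have := P1; have := Q1; lra.
Qed.

Let w0 : 0 <= sqnorm w.
Proof. by rewrite sumr_ge0// => i _; exact: sqr_ge0. Qed.

Let d_ge : 1 - e / 2 <= d. Proof. by have := w0; rewrite eE; lra. Qed.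

Let d_le : d <= 1.
Proof.
have h : 0 <= 2 - 2 * d.
  have -> : 2 - 2 * d = (P 0%N - Q 0%N) ^+ 2 + (P 1%N - Q 1%N) ^+ 2 + (P 2 - Q 2) ^+ 2
    + (P 3 - Q 3) ^+ 2 by rewrite /d; have := P1; have := Q1; lra.
  by rewrite !addr_ge0 ?sqr_ge0.
lra.
Qed.

Let d_half : 2^-1 <= d. Proof. by have := d_ge; have := xl; rewrite -/e; lra. Qed.

Let rho_ge0 : 0 <= rho.
Proof.
have h := d_half; have h1 := d_le; rewrite /rho subr_ge0 -invr1 lef_pV2 ?posrE//; last by pos.
by rewrite expr_le1//; lra.
Qed.

Let rho_le : rho <= 4 * e.
Proof.
have h := d_half; have h1 := d_le; have h2 := d_ge.
have d2 : 0 < d ^+ 2 by pos.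
have -> : rho = (1 - d ^+ 2) / d ^+ 2 by rewrite /rho; field; rewrite gt_eqF//; lra.
have a1 : 1 - d ^+ 2 <= e by move: (e) h2 => r h2; nra.
have a2 : 1 / 4 <= d ^+ 2 by nra.
have e0 : 0 <= e by lra.
by rewrite ler_pdivrMr//; move: (d ^+ 2) (e) a1 a2 e0 => r1 r2 a1 a2 e0; nra.
Qed.

Let N_gt0 t : 0 < N t.
Proof. by rewrite ltr_wpDr// mulr_ge0 ?sqr_ge0. Qed.

Let g_sqr t : g t ^+ 2 = (N t)^-1.
Proof.
rewrite /g -expRM_natl.
have -> : 2 * - (ln (N t) / 2) = - ln (N t) by field.
by rewrite expRN lnK// posrE.
Qed.

Let DE k : qc k D = d^-1 * Q k - P k.
Proof. by rewrite /D -scaleN1r addrC qc_lin /P /Q /qc !mxE; ring. Qed.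

Let DP : P 0%N * qc 0 D + P 1%N * qc 1 D + P 2 * qc 2 D + P 3 * qc 3 D = 0.
Proof.
rewrite !DE; have h : d != 0 by rewrite gt_eqF//; have := d_half; lra.
have -> : P 0%N * (d^-1 * Q 0%N - P 0%N) + P 1%N * (d^-1 * Q 1%N - P 1%N) +
  P 2 * (d^-1 * Q 2 - P 2) + P 3 * (d^-1 * Q 3 - P 3) =
  d^-1 * d - (P 0%N ^+ 2 + P 1%N ^+ 2 + P 2 ^+ 2 + P 3 ^+ 2) by rewrite /d; ring.
by rewrite P1 mulVf// subrr.
Qed.

Let DD : qc 0 D ^+ 2 + qc 1 D ^+ 2 + qc 2 D ^+ 2 + qc 3 D ^+ 2 = rho.
Proof.
rewrite !DE; have h : d != 0 by rewrite gt_eqF//; have := d_half; lra.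
have -> : (d^-1 * Q 0%N - P 0%N) ^+ 2 + (d^-1 * Q 1%N - P 1%N) ^+ 2 +
  (d^-1 * Q 2 - P 2) ^+ 2 + (d^-1 * Q 3 - P 3) ^+ 2 =
  d ^- 2 * (Q 0%N ^+ 2 + Q 1%N ^+ 2 + Q 2 ^+ 2 + Q 3 ^+ 2) - 2 * (d^-1 * d)
  + (P 0%N ^+ 2 + P 1%N ^+ 2 + P 2 ^+ 2 + P 3 ^+ 2).
  by rewrite -exprVn {7}/d; ring.
by rewrite P1 Q1 mulVf// /rho; ring.
Qed.

Let D3 (t : R) : is_derive t 1 N (2 * rho * t).
Proof. by rewrite /N; derE ring. Qed.

Let dg (t : R) : is_derive t 1 g (g t * (- (rho * t / N t))).
Proof.
have h := N_gt0 t; have DN := D3 t; rewrite /g; derE idtac; first exact: h.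
by rewrite -/(g t); field; rewrite gt_eqF.
Qed.

Let der_c t : derivable c t 1 /\ derive1 c t = dc t.
Proof.
apply: derive1_row => j; case: (@split_ordP 4 3 j) => k ->.
  rewrite /dc row_mxEl.
  rewrite (_ : (fun t => _) = fun t => g t * (lsubmx x ord0 k + t * D ord0 k)); last first.
    by apply/funext => z; rewrite /c row_mxEl !mxE.
  have -> : ((g t / N t) *: (D - (rho * t) *: lsubmx x)) ord0 k =
    g t * (D ord0 k * N t - rho * t * (lsubmx x ord0 k + t * D ord0 k)) / N t.
    by rewrite !mxE /N; ring.
  have h := N_gt0 t; have Dg := dg t.
  by derE idtac; field; rewrite gt_eqF.
rewrite /dc row_mxEr.
rewrite (_ : (fun t => _) = fun t => rsubmx x ord0 k + t * w ord0 k).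
  by derE ring.
by apply/funext => z; rewrite /c row_mxEr !mxE.
Qed.

Let dc_continuous : continuous (derive1 c).
Proof.
have -> : derive1 c = dc by apply/funext => t; have [] := der_c t.
move=> t; apply: cvg_matrix => i j; rewrite ord1; case: (@split_ordP 4 3 j) => k ->.
  apply: (@cat_eq _ _ _ (fun z => g z / N z * (D ord0 k - rho * z * lsubmx x ord0 k))).
    by move=> z; apply: etrans (esym (row_mxEl _ _ _ _)); rewrite !mxE.
  have Dg := dg t; have DN := D3 t.
  by eapply der_cont; der; rewrite gt_eqF.
apply: (@cat_eq _ _ _ (fun z => w ord0 k)); last exact: cat_cst.
by move=> z; exact: (esym (row_mxEr _ _ _ _)).
Qed.

(** The sphere part contributes at most rho <= 4 e and the straight part at most e. *)
Let dc_esq t : esq (dc t) <= 5 * e.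
Proof.
rewrite /esq /dc row_mxKl row_mxKr.
have -> : sqnorm ((g t / N t) *: (D - (rho * t) *: lsubmx x)) = rho / N t ^+ 2.
  have Dk k : qc k (D - (rho * t) *: lsubmx x) = - (rho * t) * P k + qc k D.
    by rewrite /P /qc !mxE; ring.
  rewrite sqnorm4 !qc_scale !Dk !exprMn exprVn g_sqr.
  move: (DP) (DD) (P1); have := N_gt0 t; rewrite /N.
  move: (P 0%N) (P 1%N) (P 2) (P 3) (qc 0 D) (qc 1 D) (qc 2 D) (qc 3 D).
  move=> a0 a1 a2 a3 b0 b1 b2 b3 n0 h1 h2 h3.
  rewrite [LHS](_ : _ = (1 + rho * t ^+ 2)^-1 / (1 + rho * t ^+ 2) ^+ 2 *
    ((rho * t) ^+ 2 * (a0 ^+ 2 + a1 ^+ 2 + a2 ^+ 2 + a3 ^+ 2)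
     - 2 * (rho * t) * (a0 * b0 + a1 * b1 + a2 * b2 + a3 * b3)
     + (b0 ^+ 2 + b1 ^+ 2 + b2 ^+ 2 + b3 ^+ 2))); last by field; rewrite gt_eqF.
  by rewrite h1 h2 h3; field; rewrite gt_eqF.
have : rho / N t ^+ 2 <= rho.
  rewrite ler_pdivrMr ?exprn_gt0// ler_peMr// exprn_ege1// /N lerDl.
  by rewrite mulr_ge0 ?sqr_ge0.
have := rho_le; have := d_le; rewrite eE; lra.
Qed.

Let c_conifold t : 0 <= t <= 1 -> sqnorm (lsubmx (c t)) = 1 /\
  nrm (c t) <= Num.max (nrm x) (nrm l).
Proof.
move=> /andP[t0 t1]; split.
  have Dk k : qc k (lsubmx x + t *: D) = t * qc k D + P k by rewrite /P /qc !mxE; ring.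
  rewrite /c row_mxKl sqnorm4 !qc_scale !Dk !exprMn g_sqr.
  move: (DP) (DD) (P1); have := N_gt0 t; rewrite /N.
  move: (P 0%N) (P 1%N) (P 2) (P 3) (qc 0 D) (qc 1 D) (qc 2 D) (qc 3 D).
  move=> a0 a1 a2 a3 b0 b1 b2 b3 n0 h1 h2 h3.
  rewrite -!mulrDr; apply: (mulfI (x := 1 + rho * t ^+ 2)); first by rewrite gt_eqF.
  rewrite mulrA divff ?gt_eqF// mul1r mulr1.
  have -> : (t * b0 + a0) ^+ 2 + (t * b1 + a1) ^+ 2 + (t * b2 + a2) ^+ 2 + (t * b3 + a3) ^+ 2 =
    (a0 ^+ 2 + a1 ^+ 2 + a2 ^+ 2 + a3 ^+ 2) + 2 * t * (a0 * b0 + a1 * b1 + a2 * b2 + a3 * b3)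
    + t ^+ 2 * (b0 ^+ 2 + b1 ^+ 2 + b2 ^+ 2 + b3 ^+ 2) by ring.
  by rewrite h1 h2 h3; ring.
set M := Num.max _ _; have M0 : 0 <= M by rewrite le_max nrm_ge0.
have xM : nrm x ^+ 2 <= M ^+ 2 by rewrite ler_sqr ?nnegrE ?nrm_ge0// le_max lexx.
have lM : nrm l ^+ 2 <= M ^+ 2 by rewrite ler_sqr ?nnegrE ?nrm_ge0// le_max lexx orbT.
rewrite -ler_sqr ?nnegrE ?nrm_ge0// nrm_sqr /c row_mxKr.
have E k : vc k (rsubmx x + t *: w) = (1 - t) * p k + t * q k.
  by rewrite /w /p /q /vc !mxE; ring.
rewrite !E; move: xM lM; rewrite !nrm_sqr -!/(p _) -!/(q _).
have cx (a b : R) : ((1 - t) * a + t * b) ^+ 2 <= (1 - t) * a ^+ 2 + t * b ^+ 2.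
  rewrite -subr_ge0 [leRHS](_ : _ = t * (1 - t) * (a - b) ^+ 2); last by ring.
  by rewrite mulr_ge0 ?sqr_ge0// mulr_ge0// subr_ge0.
have := cx (p 0%N) (q 0%N); have := cx (p 1%N) (q 1%N); have := cx (p 2) (q 2).
move: (M ^+ 2) (p 0%N ^+ 2) (p 1%N ^+ 2) (p 2 ^+ 2) (q 0%N ^+ 2) (q 1%N ^+ 2) (q 2 ^+ 2) => *.
nra.
Qed.

Lemma chord_exists : exists c, curve_between T x l c /\ forall t : R, 0 <= t <= 1 ->
  esq (derive1 c t) <= 5 * esq (l - x) /\ nrm (c t) <= Num.max (nrm x) (nrm l).
Proof.
exists c; split; last first.
  by move=> t t01; have [_ ->] := der_c t; split; [exact: dc_esq | have [] := c_conifold t01].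
split.
- by move=> t; have [] := der_c t.
- exact: dc_continuous.
- rewrite /c /g /N expr0n mulr0 addr0 ln1 mul0r oppr0 expR0 scale1r !scale0r !addr0.
  exact: hsubmxK.
- have dd := d_half.
  have dp : 0 < d by lra.
  have gE : g 1 = d.
    apply: (pexpIrn (n := 2)) => //; rewrite ?nnegrE ?expR_ge0//; first exact: ltW.
    by rewrite g_sqr /N /rho expr1n mulr1 addrC subrK invrK.
  rewrite /c gE !scale1r /D /w !(addrC (lsubmx x)) !(addrC (rsubmx x)) !subrK.
  by rewrite scalerA mulfV ?gt_eqF// scale1r hsubmxK.
- move=> t /c_conifold[m1 mn]; split=> //.
  have [_ _ sx] := conifoldE xT; have [_ _ sl] := conifoldE lT.
  by apply: (@le_lt_trans _ _ (Num.max (nrm x) (nrm l))%:E); rewrite ?lee_fin// EFin_max gt_max sx.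
Qed.

End Chords.

(** * Completeness above the critical slope *)

Section Completeness.
Context {R : realType}.
Implicit Types (f : nat -> R).

Lemma real_cauchy_cvg f :
  (forall e, 0 < e -> exists N, forall m n, (N <= m)%N -> (N <= n)%N -> `|f m - f n| < e) ->
  exists l : R, f n @[n --> \oo] --> l.
Proof.
move=> H; apply/cvg_ex/cauchy_cvgP; apply: cauchy_exP => e e0.
have [N HN] := H e e0; exists (f N); exists N => // n Nn.
by apply: HN => //=.
Qed.

Lemma sum_seq_cvg n (f : 'I_n -> nat -> R) (l : 'I_n -> R) :
  (forall j, f j k @[k --> \oo] --> l j) ->
  (\sum_j f j k) @[k --> \oo] --> \sum_j l j.
Proof.
move=> H; have -> : (fun k => \sum_j f j k) = \sum_j f j.
  by apply/funext => k; rewrite fct_sumE.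
elim/big_ind2: _ => [|g a h b ga hb|j _]; [exact: cvg_cst | exact: cvgD | exact: H].
Qed.

Variables (alpha kappa l0 p0 : R) (u phi : R -> R).
Hypotheses (a0 : alpha != 0) (k0 : 0 < kappa).
Hypotheses (sol : solves alpha kappa +oo%E u phi) (zd : zero_data l0 p0 u phi).
Hypotheses (l0E : l0 ^+ 3 = 18 * kappa ^+ 2 * expR (4 * p0)).
Hypothesis (cl : crit_slope alpha < l0).

Let l00 : 0 < l0 := lt_trans (crit_slope_gt0 a0) cl.
Let G := conifold_mx alpha kappa l0 u phi.

(** The uniform lower bound makes a Cauchy sequence Euclidean Cauchy in every coordinate, and the
    conifold is closed in R^7. Near the limit the metric is bounded above, so the chords to the
    limit become short. *)
Lemma conifold_mx_complete : metrically_complete +oo%E G.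
Proof.
move=> x xT xC; have [delta d0 Hd] := profile_min_lower_all a0 k0 sol zd l0E cl.
have HG m v : conifold +oo%E m -> delta * esq v <= bilin (G m) v v.
  move=> mT; apply: (conifold_mx_ge k0 sol l00 v mT).
  by apply: Hd; exact: nrm_ge0.
have sd : 0 < Num.sqrt delta by rewrite sqrtr_gt0.
have /boolp.choice[L HL] : forall j : 'I_(4 + 3), exists L : R, x n ord0 j @[n --> \oo] --> L.
  move=> j; apply: real_cauchy_cvg => e e0.
  have [|N HN] := xC (e * Num.sqrt delta); first exact: mulr_gt0.
  exists N => m n hm hn; have := HN m n hm hn.
  move=> /(le_lt_trans (coord_dist_le (x m) (x n) j d0 HG)).
  by rewrite lte_fin ltr_pM2r.
pose l : 'rV[R]_(4 + 3) := \row_j L j.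
have lT : conifold +oo%E l.
  split; last exact: ltry.
  have c : sqnorm (lsubmx (x n)) @[n --> \oo] --> sqnorm (lsubmx l).
    apply: sum_seq_cvg => j; rewrite !mxE.
    apply: cvg_trans (cvgM (HL (lshift 3 j)) (HL (lshift 3 j))).
    by apply: near_eq_cvg; apply: nearW => n; rewrite !mxE expr2.
  have c1 : sqnorm (lsubmx (x n)) @[n --> \oo] --> (1 : R).
    rewrite (_ : (fun n => _) = fun=> 1); first exact: cvg_cst.
    by apply/funext => n; have [] := xT n.
  exact: (cvg_unique _ c c1).
have ecv : esq (l - x n) @[n --> \oo] --> (0 : R).
  rewrite [X in _ --> X](_ : 0 = \sum_(j < 4 + 3) (L j - L j) * (L j - L j)); last first.
    by rewrite big1// => j _; rewrite subrr mulr0.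
  rewrite (_ : (fun n => _) = fun n => \sum_(j < 4 + 3) (L j - x n ord0 j) * (L j - x n ord0 j)).
    apply: (@sum_seq_cvg _ (fun j n => (L j - x n ord0 j) * (L j - x n ord0 j))) => j.
    by apply: cvgM; (apply: cvgB; [exact: cvg_cst | exact: HL]).
  by apply/funext => n; rewrite esq_sum; apply: eq_bigr => j _; rewrite !mxE expr2.
have ecv' e : 0 < e -> exists N, forall n, (N <= n)%N -> esq (l - x n) < e.
  move=> e0; have : \forall n \near \oo, esq (l - x n) < e by exact: (cvgr_lt _ ecv).
  by move=> [N _ HN]; exists N.
have [N1 HN1] := ecv' 1 ltr01.
pose b := 2 * nrm l + 2; have b0 : 0 <= b by have := nrm_ge0 l; rewrite /b; lra.
have [|K K0 HK] := conifold_mx_le k0 sol zd l00 l0E b0; first exact: ltry.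
have xb n : (N1 <= n)%N -> nrm (x n) <= b.
  move=> /HN1 h; rewrite -ler_sqr ?nnegrE ?nrm_ge0//.
  have h2 : sqnorm (rsubmx (l - x n)) <= 1.
    have : 0 <= sqnorm (lsubmx (l - x n)) by rewrite sumr_ge0// => i _; exact: sqr_ge0.
    by move: h; rewrite /esq; lra.
  have dk k : vc k (rsubmx (l - x n)) = vc k (rsubmx l) - vc k (rsubmx (x n)) by rewrite /vc !mxE.
  move: h2; rewrite sqnorm3 !dk.
  have q (r s : R) : s ^+ 2 <= 2 * r ^+ 2 + 2 * (r - s) ^+ 2.
    by rewrite -subr_ge0 [leRHS](_ : _ = (2 * r - s) ^+ 2) ?sqr_ge0//; ring.
  have := q (vc 0 (rsubmx l)) (vc 0 (rsubmx (x n))).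
  have := q (vc 1 (rsubmx l)) (vc 1 (rsubmx (x n))).
  have := q (vc 2 (rsubmx l)) (vc 2 (rsubmx (x n))).
  have : b ^+ 2 = 4 * nrm l ^+ 2 + 8 * nrm l + 4 by rewrite /b; ring.
  by have := nrm_ge0 l; have := sqr_ge0 (nrm l); rewrite !nrm_sqr; lra.
exists l => // e e0.
(* K bounds the metric and 5 is the constant of the chord, so the squared speed stays below
   (e/2)^2. *)
have [|N2 HN2] := ecv' ((e / 2) ^+ 2 / (5 * K)); first by pos.
exists (maxn N1 N2) => n; rewrite geq_max => /andP[n1 n2].
have [c [cb Hc]] := chord_exists (xT n) lT (ltW (HN1 n n1)).
apply: (@le_lt_trans _ _ (e / 2)%:E); last by rewrite lte_fin; lra.
apply: (curve_dist_le cb); last lra.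
move=> t t01; have [h1 h2] := Hc t t01; have [_ _ _ _ cT] := cb.
have nb : nrm (c t) <= b.
  by apply: (le_trans h2); rewrite ge_max xb//= /b; have := nrm_ge0 l; lra.
apply: (le_trans (HK _ _ (cT t t01) nb)).
have := HN2 n n2; rewrite ltr_pdivlMr; last by pos.
have : K * esq (derive1 c t) <= K * (5 * esq (l - x n)) by rewrite ler_pM2l.
by lra.
Qed.

End Completeness.

(** * A cutoff function on the conifold *)

Section PositivePartSquare.
Context {R : realType}.

(** Squaring removes the corner of the positive part at 0, where both one-sided derivatives become
    0. *)
Lemma der_pos_sqr (x : R) :
  is_derive x 1 (fun y : R => Num.max y 0 ^+ 2) (2 * Num.max x 0).
Proof.
have Dsq (y : R) : is_derive y 1 (fun z : R => z ^+ 2) (2 * y) by derE ring.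
have [x0|x0|->] := ltgtP x 0.
- rewrite mulr0; apply: (der_near _ (der_cst 0 x)).
  near=> y; rewrite max_r ?expr0n// ltW//; near: y; exact: lt_nbhsl.
- apply: (der_near _ (Dsq x)).
  near=> y; rewrite max_l// ltW//; near: y; exact: lt_nbhsr.
- suff D : is_derive (0 : R) 1 (fun y : R => if y < 0 then 0 else y ^+ 2) (2 * 0).
    apply: (der_near _ D).
    near=> y; have [y0|y0] := ltP y 0; first by rewrite /= expr0n.
    by [].
  have D0 : is_derive (0 : R) 1 (fun y : R => y ^+ 2) 0 by have := Dsq 0; rewrite mulr0.
  by rewrite mulr0; apply: (der_glue (der_cst 0 0) D0); rewrite expr0n.
Unshelve. all: by end_near. Qed.

Lemma der_pos_sqr_comp (f : R -> R) (a x : R) : is_derive x 1 f a ->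
  is_derive x 1 (fun y => Num.max (f y) 0 ^+ 2) (2 * Num.max (f x) 0 * a).
Proof. by move=> D; exact: (is_derive1_comp (der_pos_sqr (f x))). Qed.

End PositivePartSquare.

Section Cutoff.
Context {R : realType}.
Notation E7 := 'rV[R]_(4 + 3).
Implicit Types (c : R -> E7) (m x y : E7).

(* A function that vanishes for |y| >= s, hence is Lipschitz for any metric
   that is bounded from below on |y| <= s. *)
Definition cutoff (s : R) m : R := Num.max (s ^+ 2 - nrm m ^+ 2) 0 ^+ 2.

(** Where the cutoff is nonzero, its gradient is at most 2 s^2 times 2 s, and the Euclidean speed is
    at most the Riemannian one divided by the square root of delta. Elsewhere the derivative
    vanishes, so no bound on the metric is needed there. *)
Lemma curve_length_cutoff (T : \bar R) (G : E7 -> 'M[R]_(4 + 3)) x y c (s delta : R) :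
  0 < s -> 0 < delta ->
  (forall m v, conifold T m -> nrm m <= s -> delta * esq v <= bilin (G m) v v) ->
  curve_between T x y c ->
  (((cutoff s y - cutoff s x) / (4 * s ^+ 3 / Num.sqrt delta))%:E <= curve_length G c)%E.
Proof.
move=> s0 d0 HG cb; have [dc cc c0 c1 cT] := cb.
pose Y (k : 'I_3) (t : R) := c t ord0 (rshift 4 k).
pose Y' (k : 'I_3) (t : R) := derive1 c t ord0 (rshift 4 k).
have DY k (t : R) : is_derive t 1 (Y k) (Y' k t) by exact: der_coord.
pose k0 : 'I_3 := inord 0; pose k1 : 'I_3 := inord 1; pose k2 : 'I_3 := inord 2.
have D0 := DY k0; have D1 := DY k1; have D2 := DY k2.
have nE t : nrm (c t) ^+ 2 = Y k0 t ^+ 2 + Y k1 t ^+ 2 + Y k2 t ^+ 2.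
  by rewrite nrm_sqr /vc !mxE.
pose w t := s ^+ 2 - (Y k0 t ^+ 2 + Y k1 t ^+ 2 + Y k2 t ^+ 2).
pose dw t := - (2 * (Y k0 t * Y' k0 t + Y k1 t * Y' k1 t + Y k2 t * Y' k2 t)).
have Dw (t : R) : is_derive t 1 w (dw t).
  by have d0t := D0 t; have d1t := D1 t; have d2t := D2 t; rewrite /w /dw; derE ring.
have sd : 0 < Num.sqrt delta by rewrite sqrtr_gt0.
have -> : cutoff s y - cutoff s x =
    (fun t => Num.max (w t) 0 ^+ 2) 1 - (fun t => Num.max (w t) 0 ^+ 2) 0.
  by rewrite /= /cutoff -c0 -c1 !nE.
apply: (@curve_length_ge _ T G x y c (fun t => Num.max (w t) 0 ^+ 2)
  (fun t => 2 * Num.max (w t) 0 * dw t)) => //.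
- by pos.
- have cY k (t : R) : cat t (Y k) by exact: der_cont (DY k t).
  have cY' k (t : R) : cat t (Y' k).
    exact: (@cvg_comp _ _ _ (derive1 c) (fun m : E7 => m ord0 (rshift 4 k)) _ (nbhs (derive1 c t)) _
      (cc t) (@coord_continuous _ _ _ _ _ _)).
  move=> t; apply: cvgM.
    apply: cvgM; first exact: cvg_cst.
    by apply: continuous_max; [exact: der_cont (Dw t) | exact: cvg_cst].
  have a0 := cY k0 t; have a1 := cY k1 t; have a2 := cY k2 t.
  have b0 := cY' k0 t; have b1 := cY' k1 t; have b2 := cY' k2 t.
  by rewrite -/(cat t dw) /dw; ctn.
- by move=> t; exact: der_pos_sqr_comp.
move=> t t01; have [w0|w0] := leP (w t) 0.
  by rewrite mulr0 mul0r mulr_ge0 ?sqrtr_ge0//; pos.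
have ns : nrm (c t) <= s.
  rewrite -ler_sqr ?nnegrE ?nrm_ge0//; last exact: ltW.
  by rewrite nE; move: w0; rewrite /w; lra.
have := HG _ (derive1 c t) (cT t t01) ns.
move: (bilin _ _ _) => B HB.
set Z := 4 * s ^+ 3 / Num.sqrt delta; have Z0 : 0 <= Z by rewrite /Z; pos.
apply: (le_trans (ler_norm _)); rewrite -[leLHS]sqrtr_sqr -[X in _ <= X * _](ger0_norm Z0) -[X in _ <= X * _]sqrtr_sqr.
rewrite -sqrtrM ?sqr_ge0//; apply: ler_wsqrtr.
have ZE : Z ^+ 2 = 16 * s ^+ 6 / delta.
  rewrite /Z -[in RHS](sqr_sqrtr (ltW d0)); field; by rewrite gt_eqF.
rewrite ZE.
have hw : w t <= s ^+ 2 by rewrite /w gerBl !addr_ge0 ?sqr_ge0.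
have he : Y' k0 t ^+ 2 + Y' k1 t ^+ 2 + Y' k2 t ^+ 2 <= esq (derive1 c t).
  rewrite /esq sqnorm3 /vc !mxE lerDr sumr_ge0// => i _; exact: sqr_ge0.
have hB : esq (derive1 c t) <= B / delta by rewrite ler_pdivlMr// mulrC.
have hY : Y k0 t ^+ 2 + Y k1 t ^+ 2 + Y k2 t ^+ 2 <= s ^+ 2 by move: w0; rewrite /w; lra.
have CS : (Y k0 t * Y' k0 t + Y k1 t * Y' k1 t + Y k2 t * Y' k2 t) ^+ 2 <=
    (Y k0 t ^+ 2 + Y k1 t ^+ 2 + Y k2 t ^+ 2) * (Y' k0 t ^+ 2 + Y' k1 t ^+ 2 + Y' k2 t ^+ 2).
  move: (Y k0 t) (Y k1 t) (Y k2 t) (Y' k0 t) (Y' k1 t) (Y' k2 t) => r1 r2 r3 q1 q2 q3.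
  rewrite -subr_ge0 [leRHS](_ : _ = (r1 * q2 - r2 * q1) ^+ 2 + (r1 * q3 - r3 * q1) ^+ 2
    + (r2 * q3 - r3 * q2) ^+ 2); last by ring.
  by rewrite !addr_ge0 ?sqr_ge0.
have -> : (2 * w t * dw t) ^+ 2 =
    16 * (w t ^+ 2 * (Y k0 t * Y' k0 t + Y k1 t * Y' k1 t + Y k2 t * Y' k2 t) ^+ 2).
  by rewrite /dw; ring.
have -> : 16 * s ^+ 6 / delta * B = 16 * ((s ^+ 2) ^+ 2 * (s ^+ 2 * (B / delta))) by ring.
rewrite ler_pM2l//; apply: ler_pM; rewrite ?sqr_ge0//.
  by rewrite ler_sqr ?nnegrE ?sqr_ge0//; exact: ltW.
apply: (le_trans CS); apply: ler_pM => //; rewrite ?addr_ge0 ?sqr_ge0//.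
exact: le_trans hB.
Qed.

End Cutoff.

(** * Incompleteness below the critical slope *)

Section Incompleteness.
Context {R : realType}.
Notation E7 := 'rV[R]_(4 + 3).
Variables (alpha kappa l0 p0 b : R) (u phi : R -> R).
Hypotheses (a0 : alpha != 0) (k0 : 0 < kappa) (b0 : 0 < b).
Hypotheses (sol : solves alpha kappa b%:E u phi) (zd : zero_data l0 p0 u phi).
Hypotheses (l00 : 0 < l0) (l0E : l0 ^+ 3 = 18 * kappa ^+ 2 * expR (4 * p0)).
Hypothesis (lc : l0 < crit_slope alpha).

Let G := conifold_mx alpha kappa l0 u phi.

Definition ray (s : R) : E7 := row_mx (delta_mx ord0 ord0) (s *: delta_mx ord0 ord0).

Lemma nrm_ray s : 0 <= s -> nrm (ray s) = s.
Proof.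
move=> s0; rewrite /nrm /ray row_mxKr sqnorm3 !e1E.
by rewrite expr0n /= !addr0 sqrtr_sqr ger0_norm.
Qed.

Lemma ray_conifold s : 0 <= s -> s < b -> conifold b%:E (ray s).
Proof.
move=> s0 sb; split; last by rewrite -/(nrm _) nrm_ray// lte_fin.
rewrite /ray row_mxKl /sqnorm (bigD1 ord0)//= big1 => [|j /negPf j0]; rewrite !mxE.
  by rewrite !eqxx expr1n addr0.
by rewrite eqxx j0 expr0n.
Qed.

Lemma ray_speed s (r : R) : 0 < s -> s < b ->
  bilin (G (ray s)) (row_mx 0 (r *: delta_mx ord0 ord0)) (row_mx 0 (r *: delta_mx ord0 ord0)) =
  r ^+ 2 * (slope alpha kappa u phi s / 2).
Proof.
move=> s0 sb; rewrite bilin_gmx /gform /zeta /nvec nrm_ray ?(ltW s0)// /ray.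
rewrite /Wq !row_mxKl !row_mxKr.
have w0 q : qmul q 0 = 0 :> 'rV[R]_4.
  by apply: row4P; rewrite !qmulE /qc !mxE; ring.
have := @e1E R 1; rewrite scale1r => dE.
rewrite w0 !prof_pos// /dot !(crossE, vc_scale, vec3E) !dE /prof2 /qc !mxE.
by field; rewrite gt_eqF.
Qed.

Let u_derive s : 0 < s -> s < b -> is_derive s 1 u (slope alpha kappa u phi s).
Proof.
by move=> s0 sb; have [_ _ D _] := (solvesP _ _ _ _ k0).1 sol s s0 sb.
Qed.

(** Along the ray the squared speed is u'/2 by [ray_speed], and the square root of u'/2 is at most 1
    + u', whose primitive is s + u. *)
Lemma ray_dist s1 s2 : 0 < s1 < b -> 0 < s2 < b ->
  (riemannian_dist b%:E G (ray s1) (ray s2) <= (`|s2 - s1| + `|u s2 - u s1|)%:E)%E.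
Proof.
move=> /andP[s10 s1b] /andP[s20 s2b].
pose r := s2 - s1; pose c (t : R) : E7 := ray (s1 + t * r).
pose v : E7 := row_mx 0 (r *: delta_mx ord0 ord0).
have sE (t : R) : 0 <= t <= 1 -> 0 < s1 + t * r < b.
  move=> /andP[t0 t1]; rewrite /r; apply/andP; split; [nra|].
  have h1 : (1 - t) * s1 <= (1 - t) * b by apply: ler_wpM2l; [lra | exact: ltW].
  have [->|tn] := eqVneq t 0; first by rewrite mul0r addr0.
  have : t * s2 < t * b by rewrite ltr_pM2l// lt_def tn.
  by lra.
have der_c (t : R) : derivable c t 1 /\ derive1 c t = v.
  apply: derive1_row => j; case: (@split_ordP 4 3 j) => k ->.
    have -> : (fun t => c t ord0 (lshift 3 k)) = fun=> (delta_mx ord0 ord0 : 'rV[R]_4) ord0 k.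
      by apply/funext => z; rewrite /c /ray row_mxEl.
    by rewrite /v row_mxEl [X in is_derive _ _ _ X]mxE; exact: der_cst.
  have -> : (fun t => c t ord0 (rshift 4 k)) =
      fun t => (s1 + t * r) * (delta_mx ord0 ord0 : 'rV[R]_3) ord0 k.
    by apply/funext => z; rewrite /c /ray row_mxEr [LHS]mxE.
  by rewrite /v row_mxEr [X in is_derive _ _ _ X]mxE; derE ring.
have cb : curve_between b%:E (ray s1) (ray s2) c.
  split.
  - by move=> t; have [] := der_c t.
  - have -> : derive1 c = fun=> v by apply/funext => t; have [] := der_c t.
    by move=> t; exact: cvg_cst.
  - by rewrite /c mul0r addr0.
  - by rewrite /c mul1r /r addrC subrK.
  - by move=> t /sE/andP[h1 h2]; apply: ray_conifold => //; exact: ltW.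
apply: (@le_trans _ _ (curve_length G c)); first by apply: ereal_inf_lbound; exists c.
(* The sign makes [F] increasing whichever of the two radii is larger. *)
pose e := Num.sg r.
pose F t := e * (s1 + t * r + u (s1 + t * r)).
have er : e * r = `|r| by rewrite /e normrEsg.
have DF (t : R) : 0 <= t <= 1 ->
    is_derive t 1 F (`|r| * (1 + slope alpha kappa u phi (s1 + t * r))).
  move=> /sE/andP[h1 h2]; have D := u_derive h1 h2.
  have Ds : is_derive t 1 (fun t => s1 + t * r) r by derE ring.
  have Du : is_derive t 1 (fun t => u (s1 + t * r)) (slope alpha kappa u phi (s1 + t * r) * r).
    exact: (@is_derive1_comp _ u (fun t => s1 + t * r) t _ _ D Ds).
  by rewrite -er /F; derE ring.
apply: (@le_trans _ _ (F 1 - F 0)%:E); last first.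
  rewrite lee_fin /F mul1r mul0r addr0 (addrC s1) subrK -mulrBr.
  apply: (le_trans (ler_norm _)); rewrite normrM.
  have e1 : `|e| <= 1 by rewrite /e normr_sg; case: (r != 0).
  have -> : s2 + u s2 - (s1 + u s1) = (s2 - s1) + (u s2 - u s1) by ring.
  apply: le_trans (ler_normD _ _); rewrite -[leRHS]mul1r.
  by apply: ler_wpM2r.
apply: (integral01_le _ DF).
  move=> t /sE/andP[h1 h2].
  apply: cvgM; first exact: cvg_cst.
  apply: cvgD; first exact: cvg_cst.
  have Ds : is_derive t 1 (fun t => s1 + t * r) r by derE ring.
  exact: (@cvg_comp _ _ _ (fun t => s1 + t * r) (slope alpha kappa u phi) _ (nbhs (s1 + t * r)) _
    (der_cont Ds) (slope_cont k0 sol h1 h2)).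
move=> t /sE/andP[h1 h2]; have [_ ->] := der_c t.
rewrite sqrtr_ge0 /= /v ray_speed// sqrtrM ?sqr_ge0// sqrtr_sqr ler_wpM2l//.
have sl := slope_gt0 k0 sol h1 h2.
have s0 : 0 <= 1 + slope alpha kappa u phi (s1 + t * r) by lra.
rewrite -[leRHS](ger0_norm s0) -sqrtr_sqr ler_wsqrtr//.
by move: (slope _ _ _ _ _) sl => q q0; have := sqr_ge0 q; nra.
Qed.

(** By [lt_ray] the increasing function u stays below c b, so points on a ray tending to its end are
    Cauchy. Points of the conifold have radius less than b, so a limit would be separated from the
    tail of the sequence by a cutoff, which bounds their distance from below. *)
Lemma conifold_mx_incomplete : ~ metrically_complete b%:E G.
Proof.
move=> H.
(* The shift by 2 keeps all radii strictly between 0 and b. *)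
pose s n : R := b - b / n.+2%:R.
have n2 n : (0 : R) < n.+2%:R by rewrite ltr0n.
have sb n : 0 < s n < b.
  rewrite /s subr_gt0 gtrBl divr_gt0// andbT ltr_pdivrMr// ltr_pMr//.
  by rewrite ltr1n.
pose v n := s n + u (s n).
have s_nd m n : (m <= n)%N -> s m <= s n.
  move=> mn; rewrite /s lerD2l lerN2 ler_pM2l// lef_pV2 ?posrE//.
  by rewrite ler_nat.
have u_nd x y : 0 < x -> x <= y -> y < b -> u x <= u y.
  move=> x0 xy yb; apply: (deriv_ge0_le xy).
    by move=> t /andP[h1 h2]; apply: u_derive; [exact: lt_le_trans h1 | exact: le_lt_trans yb].
  move=> t /andP[h1 h2]; apply: ltW.
  by apply: (slope_gt0 k0 sol); [exact: lt_trans h1 | rewrite lte_fin; exact: lt_trans yb].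
have us_nd m n : (m <= n)%N -> u (s m) <= u (s n).
  move=> mn; have /andP[h1 h2] := sb m; have /andP[h3 h4] := sb n.
  by apply: u_nd => //; exact: s_nd.
have cv : cvgn v.
  apply: nondecreasing_is_cvgn.
    by move=> m n mn; rewrite /v lerD ?s_nd ?us_nd.
  exists (b + crit_slope alpha * b) => _ [n _ <-]; have /andP[h1 h2] := sb n.
  have := lt_ray a0 k0 sol zd l00 l0E lc (lexx _) h1 h2.
  have : crit_slope alpha * s n <= crit_slope alpha * b.
    by rewrite ler_pM2l ?crit_slope_gt0// ltW.
  by rewrite /v; lra.
have vC e : 0 < e -> exists N, forall n, (N <= n)%N -> `|v n - limn v| < e.
  move=> e0; have [N _ HN] := (cvgrPdist_lt _ _).1 cv e e0.
  by exists N => n Nn; rewrite distrC; exact: HN.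
have rayT n : conifold b%:E (ray (s n)).
  by have /andP[h1 h2] := sb n; apply: ray_conifold => //; exact: ltW.
have [|l lT Hl] := H (fun n => ray (s n)) rayT.
  move=> e e0; have [|N HN] := vC (e / 2); first by rewrite divr_gt0.
  exists N => m n hm hn; apply: (le_lt_trans (ray_dist (sb m) (sb n))); rewrite lte_fin.
  have h1 := HN _ hm; have h2 := HN _ hn.
  have -> : `|s n - s m| + `|u (s n) - u (s m)| = `|v n - v m|.
    have add (x y z t : R) : x <= y -> z <= t -> `|y - x| + `|t - z| = `|y + t - (x + z)|.
      move=> xy zt; rewrite ger0_norm ?subr_ge0// ger0_norm ?subr_ge0//.
      by rewrite ger0_norm ?subr_ge0 ?lerD//; ring.
    have [mn|/ltnW nm] := leqP m n; first by apply: add; [exact: s_nd | exact: us_nd].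
    rewrite (distrC (s n)) (distrC (u (s n))) (distrC (v n)).
    by apply: add; [exact: s_nd | exact: us_nd].
  have -> : v n - v m = (v n - limn v) - (v m - limn v) by ring.
  by apply: (le_lt_trans (ler_normB _ _)); lra.
have [_ l0' lb] := conifoldE lT; rewrite lte_fin in lb.
(* A radius between that of the supposed limit and b: the cutoff at [r] is positive at the limit,
   and the metric is bounded below up to [r]. *)
pose r := (nrm l + b) / 2.
have r0 : 0 < r by rewrite /r; lra.
have rb : (r%:E < b%:E)%E by rewrite lte_fin /r; lra.
have [delta d0 Hd] := profile_min_lower k0 sol zd l00 l0E (ltW r0) rb.
have HG m w : conifold b%:E m -> nrm m <= r -> delta * esq w <= bilin (G m) w w.
  move=> mT mr; apply: (conifold_mx_ge k0 sol l00 w mT).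
  by apply: Hd; rewrite nrm_ge0.
have A0 : 0 < cutoff r l.
  have h : 0 < r ^+ 2 - nrm l ^+ 2.
    by rewrite subr_gt0 ltr_sqr ?nnegrE//; [rewrite /r; lra | exact: ltW].
  by rewrite /cutoff exprn_gt0// lt_max h.
have sd : 0 < Num.sqrt delta by rewrite sqrtr_gt0.
pose K := 4 * r ^+ 3 / Num.sqrt delta; have K0 : 0 < K by rewrite /K; pos.
have [|N HN] := Hl (cutoff r l / K); first exact: divr_gt0.
have [n Nn rs] : exists2 n, (N <= n)%N & r <= s n.
  have br : 0 < b - r by rewrite /r; lra.
  exists (maxn N (Num.trunc (b / (b - r)))); first exact: leq_maxl.
  have := truncnS_gt (b / (b - r)).
  rewrite ltr_pdivrMr// => h.
  have M : (Num.trunc (b / (b - r))).+1%:R <= (maxn N (Num.trunc (b / (b - r)))).+2%:R :> R.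
    by rewrite ler_nat ltnS ltnW// ltnS leq_maxr.
  rewrite /s lerBrDr addrC -lerBrDr ler_pdivrMr// mulrC.
  apply: ltW; apply: (lt_le_trans h); by rewrite ler_wpM2r// ltW.
have z : cutoff r (ray (s n)) = 0.
  have /andP[h1 h2] := sb n.
  rewrite /cutoff nrm_ray; last exact: ltW.
  rewrite max_r ?expr0n// subr_le0 ler_sqr ?nnegrE//; exact: ltW.
have := HN n Nn => /ereal_inf_lt[_ [c cb <-]].
apply/negP; rewrite -leNgt.
by have := curve_length_cutoff r0 d0 HG cb; rewrite z subr0.
Qed.

End Incompleteness.


Theorem theorem5p1 (R : realType) (alpha kappa : R)
    (halpha : alpha != 0) (hkappa : 0 < kappa) :
  [/\ (* (i) *)
      forall (phi0 : R) (T : \bar R) (u phi : R -> R),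
        critical_dilaton alpha kappa < phi0 ->
        zs_solution alpha kappa phi0 T u phi ->
        exists u' phi' : R -> R,
          [/\ extends T u phi +oo%E u' phi',
              solves alpha kappa +oo%E u' phi',
              complete_solution alpha kappa u' phi'
            & exists phi_infty : R,
                asymptotically_conical alpha kappa u' phi' phi_infty],
      (* (ii) *)
      forall (phi1 phi2 : R) (u1 psi1 u2 psi2 : R -> R) (l1 l2 : R),
        critical_dilaton alpha kappa < phi1 -> phi1 < phi2 ->
        zs_solution alpha kappa phi1 +oo%E u1 psi1 ->
        zs_solution alpha kappa phi2 +oo%E u2 psi2 ->
        asymptotically_conical alpha kappa u1 psi1 l1 ->
        asymptotically_conical alpha kappa u2 psi2 l2 ->
        l1 < l2,
      (* (iii) *)
      forall (T : \bar R) (u phi : R -> R),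
        zs_solution alpha kappa (critical_dilaton alpha kappa) T u phi ->
        exists u' phi' : R -> R,
          [/\ extends T u phi +oo%E u' phi',
              solves alpha kappa +oo%E u' phi'
            & forall s : R, 0 < s ->
                u' s = u_star alpha s /\
                expR (2 * phi' s) = exp_2phi_star alpha kappa s]
    & (* (iv) *)
      forall (phi0 : R) (T : \bar R) (u phi : R -> R),
        phi0 < critical_dilaton alpha kappa ->
        zs_solution alpha kappa phi0 T u phi ->
        incomplete_solution alpha kappa T u phi].
Proof.
split.
- move=> phi0 T u phi hc zs; have [T0 sol _] := zs; have zd := zs_zero_data zs.
  have l0E := zs_slope_cube phi0 hkappa.
  (* The condition on the dilaton becomes a comparison of slopes at the zero-section. *)
  have cl : crit_slope alpha < zs_slope kappa phi0.
    by rewrite -(zs_slope_critical halpha hkappa) zs_slope_lt.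
  have [u' [phi' [ext sol']]] := supercritical_global halpha hkappa T0 sol zd l0E cl.
  have zd' := zero_data_extends T0 ext zd.
  exists u', phi'; split=> //.
    exists (conifold_mx alpha kappa (zs_slope kappa phi0) u' phi').
      exact: (conifold_mxP hkappa sol' zd' (zs_slope_gt0 phi0 hkappa) l0E).
    exact: (conifold_mx_complete halpha hkappa sol' zd' l0E cl).
  exact: (supercritical_conical halpha hkappa sol' zd' l0E cl).
- move=> phi1 phi2 u1 psi1 u2 psi2 l1 l2 _ p12 zs1 zs2.
  have [_ sol1 _] := zs1; have [_ sol2 _] := zs2.
  move=> [_ [_ [_ _ _ [_ _ c1]]]] [_ [_ [_ _ _ [_ _ c2]]]].
  have sl : zs_slope kappa phi1 < zs_slope kappa phi2 by rewrite zs_slope_lt.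
  have [d d0 [r Hr]] := solution_mono halpha hkappa sol1 sol2 sl p12 (ltry 0)
    (zs_zero_data zs1) (zs_zero_data zs2).
  (* The uniform gap [d] survives the passage to the limit and keeps the inequality strict. *)
  rewrite -subr_gt0; apply: (lt_le_trans d0).
  have c : psi2 s - psi1 s @[s --> +oo] --> l2 - l1 by exact: cvgB.
  rewrite -(cvg_lim _ c)//; apply: limr_ge; first by apply/cvg_ex; exists (l2 - l1).
  near=> s; apply: Hr; last exact: ltry.
  by near: s; apply: nbhs_pinfty_ge; rewrite num_real.
- by move=> T u phi; exact: critical_solution.
- move=> phi0 T u phi hc zs; have [T0 sol _] := zs; have zd := zs_zero_data zs.
  have l0E := zs_slope_cube phi0 hkappa; have l00 := zs_slope_gt0 phi0 hkappa.
  have lc : zs_slope kappa phi0 < crit_slope alpha.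
    by rewrite -(zs_slope_critical halpha hkappa) zs_slope_lt.
  have [T' [u' [phi' M]]] := maximal_extension_exists halpha hkappa l00 T0 sol zd.
  have [ext sol' _] := M; have zd' := zero_data_extends T0 ext zd.
  exists T', u', phi'; split=> //.
  exists (conifold_mx alpha kappa (zs_slope kappa phi0) u' phi').
    exact: (conifold_mxP hkappa sol' zd' l00 l0E).
  have [B TB] := subcritical_bounded halpha hkappa sol' zd' l00 l0E lc.
  have T'0 : (0 < T')%E by case: ext => TT' _; exact: lt_le_trans TT'.
  (* The bound [B] and positivity leave only a finite end point. *)
  case: T' {M ext} sol' TB T'0 => [b| |] // sol' _ b0.
  exact: (conifold_mx_incomplete halpha hkappa b0 sol' zd' l00 l0E lc).
Unshelve. all: by end_near. Qed.
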